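(* Let $\mathcal A(\Gamma)$ be any of the modular Hecke algebras ($\Gamma\subset\mathrm{SL}(2,\mathbb Z)$ a congruence subgroup), with its action of $\mathcal H_1$, its quadratic differential $\omega=E_4/72$, and the associated Rankin-Cohen brackets $RC_n$, $n\ge0$. Then the brackets $RC_*$ yield an associative deformation of $\mathcal A(\Gamma)$; that is, the product $$a*_t b:=\sum_{n\ge0}t^n\,RC_n(a,b),\qquad a,b\in\mathcal A(\Gamma),$$ extended $\mathbb C[[t]]$-bilinearly to $\mathcal A(\Gamma)[[t]]$, is associative.
   Context: Modular forms: $\mathcal M=\bigoplus_{k\ge0}\mathcal M_{2k}$ is the algebra of holomorphic modular forms of all (principal congruence) levels, graded by weight, with the right slash action of $\mathrm{GL}^+(2,\mathbb Q)$: $f|\gamma(z)=\det(\gamma)^{k}(cz+d)^{-2k}f(\gamma z)$ for $f\in\mathcal M_{2k}$, $\gamma=\begin{pmatrix}a&b\\c&d\end{pmatrix}$. Modular Hecke algebra: $\mathcal A(\Gamma)$ is the space of maps $F:\mathrm{GL}^+(2,\mathbb Q)\to\mathcal M$, $\alpha\mapsto F_\alpha$, with $F_{\gamma\alpha}=F_\alpha$ and $F_{\alpha\gamma}=F_\alpha|\gamma$ for $\gamma\in\Gamma$, and with finite support in $\Gamma\backslash\mathrm{GL}^+(2,\mathbb Q)$, with product $(F^1*F^2)_\alpha=\sum_{\beta\in\Gamma\backslash\mathrm{GL}^+(2,\mathbb Q)}F^1_\beta\cdot F^2_{\alpha\beta^{-1}}|\beta$. Hopf algebra: $\mathcal H_1$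 is, as an algebra, the universal enveloping algebra of the Lie algebra with basis $\{X,Y,\delta_n;n\ge1\}$ and brackets $[Y,X]=X$, $[Y,\delta_n]=n\delta_n$, $[X,\delta_n]=\delta_{n+1}$, $[\delta_k,\delta_\ell]=0$; the coproduct is multiplicative with $\Delta Y=Y\otimes1+1\otimes Y$, $\Delta\delta_1=\delta_1\otimes1+1\otimes\delta_1$, $\Delta X=X\otimes1+1\otimes X+\delta_1\otimes Y$; $S(X)=-X+\delta_1Y$. It acts on $\mathcal A(\Gamma)$ by $X(F)_\alpha=X(F_\alpha)$, $Y(F)_\alpha=Y(F_\alpha)$, $\delta_1(F)_\alpha=\mu_\alpha F_\alpha$, where on $f\in\mathcal M$ of weight $\ell$: $Y(f)=\frac\ell2f$, $X(f)=\frac1{2\pi i}\big(\frac{df}{dz}-\frac{d}{dz}(\log\eta^4)\,Y(f)\big)$, and $\mu_\gamma=\frac1{2\pi i}\frac{d}{dz}\log\frac{\eta^4|\gamma}{\eta^4}$ ($\eta$ the Dedekind eta function, $\eta^4$ having weight 2). With $\delta_2'=\delta_2-\frac12\delta_1^2$ one has $\delta_2'(a)=[\omega,a]$, $\omega=E_4/72$ ($E_4$ the normalized Eisenstein series of level 1 and weight 4), regarded as the element of $\mathcal A(\Gamma)$ equal to $\omega$ on $\Gamma$ and $0$ elsewhere. Brackets: with $\Omega=\omega$ and $L_\Omega,R_\Omega$ left and right multiplication by $\Omega$, let $B_0=1$, $B_1=X$, $B_{n+1}=XB_n-n\,L_\Omega(Y-\frac{n-1}2)B_{n-1}$, and $A_0=1$,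 $A_1=S(X)$, $A_{n+1}=S(X)A_n-n\,R_\Omega(Y-\frac{n-1}2)A_{n-1}$; with $(\alpha)_k=\alpha(\alpha+1)\cdots(\alpha+k-1)$, $(\alpha)_0=1$, $$RC_n(a,b)=\sum_{k=0}^n\Big(\frac{A_k}{k!}(2Y+k)_{n-k}\Big)(a)\Big(\frac{B_{n-k}}{(n-k)!}(2Y+n-k)_k\Big)(b).$$ *)

(* Defs.v *)
From HB Require Import structures.
From mathcomp Require Import all_boot all_order all_algebra.
From mathcomp Require Import monoid.
From mathcomp Require Import all_classical all_reals all_analysis.
From mathcomp Require Import complex ring.

Set Implicit Arguments.
Unset Strict Implicit.
Unset Printing Implicit Defensive.

Import Order.TTheory GRing.Theory Num.Theory.
Import numFieldNormedType.Exports.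

Local Open Scope classical_set_scope.
Local Open Scope ring_scope.

(** ** The group GL+(2,Q) *)

Record GLQ : Type := MkGLQ { GLQval :> 'M[rat]_2; _ : 0 < \det GLQval }.

HB.instance Definition _ := [isSub for GLQval].
HB.instance Definition _ := [Choice of GLQ by <:].

Section GLQGroup.

Fact GLQ_mul_subproof (g h : GLQ) : 0 < \det (g *m h).
Proof. by rewrite det_mulmx mulr_gt0 // (valP g, valP h). Qed.

Fact GLQ_one_subproof : 0 < \det (1%:M : 'M[rat]_2).
Proof. by rewrite det1. Qed.

Fact GLQ_inv_subproof (g : GLQ) : 0 < \det (invmx g).
Proof. by rewrite det_inv invr_gt0 (valP g). Qed.

Definition GLQ_mul (g h : GLQ) : GLQ := MkGLQ (GLQ_mul_subproof g h).
Definition GLQ_one : GLQ := MkGLQ GLQ_one_subproof.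
Definition GLQ_inv (g : GLQ) : GLQ := MkGLQ (GLQ_inv_subproof g).

Fact GLQ_unit (g : GLQ) : (g : 'M[rat]_2) \in unitmx.
Proof. by rewrite unitmxE unitfE gt_eqF // (valP g). Qed.

Fact GLQ_mulA : associative GLQ_mul.
Proof. by move=> x y z; apply: val_inj; rewrite /= mulmxA. Qed.

Fact GLQ_mul1 : left_id GLQ_one GLQ_mul.
Proof. by move=> x; apply: val_inj; rewrite /= mul1mx. Qed.

Fact GLQ_mulr1 : right_id GLQ_one GLQ_mul.
Proof. by move=> x; apply: val_inj; rewrite /= mulmx1. Qed.

Fact GLQ_mulV : left_inverse GLQ_one GLQ_inv GLQ_mul.
Proof. by move=> x; apply: val_inj; rewrite /= mulVmx // GLQ_unit. Qed.

Fact GLQ_mulrV : right_inverse GLQ_one GLQ_inv GLQ_mul.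
Proof. by move=> x; apply: val_inj; rewrite /= mulmxV // GLQ_unit. Qed.

HB.instance Definition _ := isGroup.Build GLQ
  GLQ_mulA GLQ_mul1 GLQ_mulr1 GLQ_mulV GLQ_mulrV.

End GLQGroup.

Definition SL2Z : set GLQ :=
  [set g : GLQ | (forall i j, g i j \is a Num.int) /\ \det g = 1].

Definition principal_congruence (N : nat) : set GLQ :=
  [set g : GLQ | SL2Z g /\
     forall i j, (g i j - (i == j)%:R) / N%:R \is a Num.int].

Definition congruence_subgroup (Gamma : set GLQ) : Prop :=
  [/\ Gamma `<=` SL2Z,
      Gamma 1%g,
      forall g h, Gamma g -> Gamma h -> Gamma (g * h)%g,
      forall g, Gamma g -> Gamma (g^-1)%g
    & exists2 N, (0 < N)%N & principal_congruence N `<=` Gamma].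

(** ** The upper half-plane *)

Record uhp (R : realType) : Type :=
  MkUhp { uhpval :> R[i]; _ : 0 < complex.Im uhpval }.

HB.instance Definition _ (R : realType) := [isSub for @uhpval R].
HB.instance Definition _ (R : realType) := [Choice of uhp R by <:].

Fact uhp_i_subproof (R : realType) : 0 < complex.Im ('i%C : R[i]).
Proof. exact: ltr01. Qed.

HB.instance Definition _ (R : realType) :=
  isPointed.Build (uhp R) (MkUhp (uhp_i_subproof R)).

(* cz + d *)
Definition autj (R : realType) (g : GLQ) (z : uhp R) : R[i] :=
  ratr (g 1 0) * uhpval z + ratr (g 1 1).

Fact det_GLQ (g : GLQ) :
  \det g = g 0 0 * g 1 1 - g 0 1 * g 1 0.
Proof.
rewrite (expand_det_row _ ord0) big_ord_recl big_ord1 /cofactor !det_mx11 !mxE.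
rewrite /= expr0 mul1r expr1 mulN1r mulrN; congr (_ * GLQval g _ _ - GLQval g _ _ * GLQval g _ _);
  exact: val_inj.
Qed.

Fact ratrC (R : realType) (q : rat) : ratr q = (ratr q : R)%:C%C :> R[i].
Proof. by rewrite (fmorph_rat (real_complex R)). Qed.

Fact mobius_subproof (R : realType) (g : GLQ) (z : uhp R) :
  0 < complex.Im
    ((ratr (g 0 0) * uhpval z + ratr (g 0 1)) / autj g z).
Proof.
rewrite /autj !ratrC; case: z => -[x y] /= y0.
have := valP g; rewrite /= det_GLQ.
move: (g 0 0) (g 0 1) (g 1 0) (g 1 1) => a b c d.
rewrite -(ltr0q R) rmorphB !rmorphM /=.
move: (ratr a) (ratr b) (ratr c) (ratr d) => {g}{}a {}b {}c {}d D.
rewrite !mul0r !addr0 !subr0.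
set n2 := (c * x + d) ^+ 2 + (c * y) ^+ 2.
have n2_gt0 : 0 < n2.
  rewrite lt_def addr_ge0 ?sqr_ge0 // andbT paddr_eq0 ?sqr_ge0 // !sqrf_eq0.
  apply/negP => /andP[cxd]; rewrite mulf_eq0 (gt_eqF y0) orbF => /eqP c0.
  move: cxd; rewrite c0 mul0r add0r => /eqP d0.
  by move: D; rewrite c0 d0 !mulr0 subrr ltxx.
rewrite mulrN !mulrA addrC -mulrBl divr_gt0 //.
by rewrite (_ : _ - _ = (a * d - b * c) * y) ?mulr_gt0 //; ring.
Qed.

Definition mobius (R : realType) (g : GLQ) (z : uhp R) : uhp R :=
  MkUhp (mobius_subproof g z).

(** ** Complex analysis on the upper half-plane *)

Section Holomorphic.
Variable R : realType.
Implicit Types (f : uhp R -> R[i]) (z : uhp R).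

(* Derivatives only depend on values near points of the (open) half-plane, so
   the value chosen outside is irrelevant. R[i]^o is R[i] seen as a normed
   module over itself, so that the derivatives below are complex ones. *)
Definition extend f : R[i]^o -> R[i]^o := fun w => oapp f 0 (insub w).

Definition holomorphic f : Prop :=
  forall z, derivable (extend f) (uhpval z : R[i]^o) 1.

Definition cderiv f : uhp R -> R[i] := fun z => derive1 (extend f) (uhpval z).

(* f'/f, the derivative of any local determination of log f *)
Definition dlog f : uhp R -> R[i] := fun z => cderiv f z / f z.

Definition cexp (w : R[i]) : R[i] :=
  (expR (complex.Re w))%:C%C *
  (cos (complex.Im w) +i* sin (complex.Im w))%C.

Definition twopii : R[i] := (2 * pi)%:C%C * 'i%C.

(* q = exp(2 i pi z) *)
Definition nome z : R[i] := cexp (twopii * uhpval z).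

Definition dedekind_eta z : R[i] :=
  cexp (twopii * uhpval z / 24) *
  limn (fun N => \prod_(1 <= n < N.+1) (1 - nome z ^+ n) : R[i]^o).

Definition eta4 : uhp R -> R[i] := fun z => dedekind_eta z ^+ 4.

Definition sigma3 (n : nat) : nat := (\sum_(d <- divisors n) d ^ 3)%N.

Definition E4 z : R[i] :=
  1 + 240 *
  limn (fun N => \sum_(1 <= n < N.+1) (sigma3 n)%:R * nome z ^+ n : R[i]^o).

End Holomorphic.

(** ** Modular forms *)

Section ModularForms.
Variable R : realType.
Implicit Types (f : uhp R -> R[i]) (z : uhp R) (g : GLQ) (k : nat).

(* slash action in weight 2k *)
Definition slash k f g : uhp R -> R[i] :=
  fun z => ratr (\det g) ^+ k * autj g z ^- (2 * k) * f (mobius g z).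

Definition bounded_at_infinity f : Prop :=
  exists A B : R, forall z, A <= complex.Im (uhpval z) -> `|f z| <= B%:C%C.

(* f \in M_2k, the space of modular forms of weight 2k and level Gamma(N) for
   some N; holomorphy at the cusps is boundedness at i oo of all the
   SL(2,Z)-translates. *)
Definition modular_form k f : Prop :=
  [/\ holomorphic f,
      exists2 N, (0 < N)%N &
        forall g, principal_congruence N g -> slash k f g = f
    & forall g, SL2Z g -> bounded_at_infinity (slash k f g)].

End ModularForms.

(* The graded algebra of modular forms, as polynomials over the ring of
   functions on the half-plane: the coefficient of 'X^k is the component of
   weight 2k. *)
Notation graded R := {poly (uhp R -> R[i])} (only parsing).

Section GradedAlgebra.
Variable R : realType.
Implicit Types (p : graded R) (g : GLQ).

Definition modular p : Prop := forall k, modular_form k p`_k.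

Definition slashp p g : graded R := \poly_(k < size p) slash k p`_k g.

Definition Yf p : graded R := \poly_(k < size p) (k%:R * p`_k).

(* X on the component of weight 2k, where Y is multiplication by k; the result
   has weight 2k + 2. *)
Definition Xk (k : nat) (f : uhp R -> R[i]) : uhp R -> R[i] :=
  fun z => (twopii R)^-1 * (cderiv f z - dlog (@eta4 R) z * (k%:R * f z)).

Definition Xf p : graded R := 'X * \poly_(k < size p) Xk k p`_k.

Definition mu g : uhp R -> R[i] :=
  fun z => (twopii R)^-1 *
    dlog (fun w => slash 1 (@eta4 R) g w / @eta4 R w) z.

End GradedAlgebra.

(** ** The modular Hecke algebra *)

Notation hecke_map R := (GLQ -> {poly (uhp R -> R[i])}) (only parsing).

Section HeckeAlgebra.
Variables (R : realType) (Gamma : set GLQ).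
Implicit Types (F a b : hecke_map R).

Definition Gcoset (h : GLQ) : set GLQ := [set (g * h)%g | g in Gamma].

Definition hecke_algebra : set (hecke_map R) :=
  [set F | [/\ forall h, modular (F h),
               forall g h, Gamma g -> F (g * h)%g = F h,
               forall g h, Gamma g -> F (h * g)%g = slashp (F h) g
             & finite_set [set Gcoset h | h in [set h | F h != 0]]]].

(* The sum ranges over Gamma \ GL+(2,Q), with a chosen representative of each
   coset. *)
Definition hecke_mul a b : hecke_map R := fun h =>
  \sum_(c \in range Gcoset)
    let r := xget 1%g c in a r * slashp (b (h * r^-1)%g) r.

Definition hscale (x : R[i]) F : hecke_map R := fun h => cst x *: F h.

Definition hX F : hecke_map R := fun h => Xf (F h).
Definition hY F : hecke_map R := fun h => Yf (F h).
(* mu_h has weight 2, whence the factor 'X *)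
Definition hdelta1 F : hecke_map R := fun h => (mu h *: 'X) * F h.
(* the antipode of X *)
Definition hSX F : hecke_map R := - hX F + hdelta1 (hY F).

(* omega = E_4 / 72, in weight 4, extended by 0 outside Gamma *)
Definition Omega : hecke_map R := fun h =>
  if h \in Gamma then (fun z => E4 z / 72) *: 'X^2 else 0.

(** ** The Rankin-Cohen brackets *)

(* B_n and A_n as operators; the term with n = 0 in the recurrence vanishes, so
   that B_1 = X and A_1 = S(X). *)
Fixpoint opB (n : nat) F : hecke_map R :=
  if n is m.+1 then
    hX (opB m F) -
    (if m is p.+1 then
       hscale m%:R
         (hecke_mul Omega (hY (opB p F) - hscale (p%:R / 2) (opB p F)))
     else 0)
  else F.

Fixpoint opA (n : nat) F : hecke_map R :=
  if n is m.+1 then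
    hSX (opA m F) -
    (if m is p.+1 then
       hscale m%:R
         (hecke_mul (hY (opA p F) - hscale (p%:R / 2) (opA p F)) Omega)
     else 0)
  else F.

(* (2 Y + k)_m *)
Fixpoint poch (k m : nat) F : hecke_map R :=
  if m is j.+1 then
    let G := poch k j F in hscale 2 (hY G) + hscale (k + j)%:R G
  else F.

Definition RC (n : nat) a b : hecke_map R :=
  \sum_(k < n.+1)
    hecke_mul (hscale (k`!%:R)^-1 (opA k (poch k (n - k) a)))
              (hscale ((n - k)`!%:R)^-1 (opB (n - k) (poch (n - k) k b))).

(* The C[[t]]-bilinear extension of a *_t b = \sum_n t^n RC_n(a,b) to formal
   power series \sum_i t^i a_i, given by their sequences of coefficients. *)
Definition star (a b : nat -> hecke_map R) : nat -> hecke_map R := fun N =>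
  \sum_(n < N.+1) \sum_(i < (N - n).+1) RC n (a i) (b (N - n - i)%N).

End HeckeAlgebra.

(* Main.v *)
Require Import Defs.
From HB Require Import structures.
From mathcomp Require Import all_boot all_order all_algebra.
From mathcomp Require Import monoid.
From mathcomp Require Import all_classical all_reals all_analysis.
From mathcomp Require Import complex ring lra zify.

Set Implicit Arguments.
Unset Strict Implicit.
Unset Printing Implicit Defensive.

Import Order.TTheory GRing.Theory Num.Theory.
Import numFieldNormedType.Exports.

Local Open Scope classical_set_scope.
Local Open Scope ring_scope.

(* Let D = (2 i pi)^-1 d/dz and phi = (2 i pi)^-1 dlog eta^4 = E_2 / 6.
   Ramanujan's identity D E_2 = (E_2^2 - E_4) / 12 reads
   omega = phi^2 / 2 - D phi, and the transformation law of E_2 says that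
   phi_g = (2 i pi)^-1 dlog (eta^4 | g) equals phi for g in SL(2, Z). Replacing
   X by the operator X_g attached to phi_g, one gets S(X)(F)_g = - X_g F_g, so
   that RC_n(a, b)_h is the sum over the cosets of g of a classical bracket of
   a_g and b_(h g^-1) | g, whose two halves are written with phi_g.

   A classical bracket does not change if (phi, omega) is replaced by any other
   pair with omega = phi^2 / 2 - D phi: attaching to f of weight m
   the homogeneous function f(x / y) y^-m on pairs (x, y), n! times the n-th bracket becomes the n-th power of the Poisson tensor
   of the plane, and changing phi amounts to a unimodular change of the frame
   in which that tensor is written. Hence the brackets commute with the slash
   action, and their associativity is that of the Moyal product; both properties
   together give the associativity on the convolution algebra. *)

(** * Complex limits and derivatives *)

(** The left half of a bracket on A(Gamma) is written with the connection of its own coset, so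
    operators A_k, B_k from different terms cannot be compared directly; the freedom to change phi
    makes them comparable. The admissible pairs arise as follows. Put phi = -2 psi. With its value
    at a fixed base point taken as a constant, psi defines commuting fields on the plane: e2, which
    at that point multiplies a component of degree m by - m and raises its degree by 1, and e1 =
    d/dx - psi e2. The powers of e1 at the base point obey a recursion that is the one of B_n for
    omega = 2 (psi^2 + D psi). Powers of e2 act by rising factorials, and these are the factors (2 Y
    + k)_(n - k). The analytic input is the logarithmic derivative of eta as a Lambert series, the
    divisor identity behind Ramanujan's relation, and the behaviour of E_2 under z -> -1 / z.
    Function theory is developed from Goursat's lemma on, since D has to act on a ring of
    holomorphic functions and series have to be differentiated term by term. *)

Section ComplexModulus.
Variable R : realType.
Implicit Types x y z : R[i].

(** The norm of [R[i]] takes its values in [R[i]]; with a modulus in [R], estimates live in a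
    totally ordered field, within reach of [lra]. *)
Definition cabs z : R := ComplexField.Normc.normc z.

Lemma cabsE z : (cabs z)%:C%C = `|z|.
Proof. rewrite normc_def; case: z => a b; reflexivity. Qed.

Lemma cabs_ge0 z : 0 <= cabs z.
Proof. by rewrite -lecR cabsE; exact: normr_ge0. Qed.

Lemma cabs0 : cabs 0 = 0.
Proof. exact: ComplexField.Normc.normc0. Qed.

Lemma cabs1 : cabs 1 = 1.
Proof. exact: ComplexField.Normc.normc1. Qed.

Lemma cabsM x y : cabs (x * y) = cabs x * cabs y.
Proof. exact: ComplexField.Normc.normcM. Qed.

Lemma cabsV x : cabs x^-1 = (cabs x)^-1.
Proof. exact: ComplexField.Normc.normcV. Qed.

Lemma cabsN x : cabs (- x) = cabs x.
Proof. exact: normcN. Qed.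

Lemma cabsD x y : cabs (x + y) <= cabs x + cabs y.
Proof. exact: le_normcD. Qed.

Lemma cabsX x n : cabs (x ^+ n) = cabs x ^+ n.
Proof. by elim: n => [|n IH]; rewrite ?expr0 ?cabs1// !exprS cabsM IH. Qed.

Lemma cabs_eq0 x : (cabs x == 0) = (x == 0).
Proof.
apply/eqP/eqP => [/ComplexField.Normc.eq0_normc//|->]; exact: cabs0.
Qed.

Lemma cabs_gt0 x : (0 < cabs x) = (x != 0).
Proof. by rewrite lt_def cabs_eq0 cabs_ge0 andbT. Qed.

Lemma cabsB x y : cabs (x - y) = cabs (y - x).
Proof. by rewrite -cabsN opprB. Qed.

Lemma cabs_real (a : R) : cabs a%:C%C = `|a|.
Proof. by rewrite /cabs/= expr0n/= addr0 sqrtr_sqr. Qed.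

Lemma cabsi : cabs 'i%C = 1.
Proof. by rewrite /cabs/= expr0n/= add0r expr1n sqrtr1. Qed.

Lemma cabs_nat n : cabs n%:R = n%:R.
Proof. by rewrite -(rmorph_nat (real_complex R)) cabs_real ger0_norm. Qed.

Lemma cabs_triB x y : cabs x - cabs y <= cabs (x - y).
Proof. by rewrite lerBlDr -{1}(subrK y x) cabsD. Qed.

Lemma sqr_cabs x : cabs x ^+ 2 = complex.Re x ^+ 2 + complex.Im x ^+ 2.
Proof. by case: x => a b; rewrite sqr_sqrtr// addr_ge0// sqr_ge0. Qed.

Lemma absRe_le x : `|complex.Re x| <= cabs x.
Proof.
rewrite -(@ler_pXn2r _ 2)// ?nnegrE ?cabs_ge0// sqr_cabs real_normK ?num_real//.
by rewrite lerDl sqr_ge0.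
Qed.

Lemma absIm_le x : `|complex.Im x| <= cabs x.
Proof.
rewrite -(@ler_pXn2r _ 2)// ?nnegrE ?cabs_ge0// sqr_cabs real_normK ?num_real//.
by rewrite lerDr sqr_ge0.
Qed.

Lemma cabs_leReIm x : cabs x <= `|complex.Re x| + `|complex.Im x|.
Proof.
rewrite {1}[x]complexE (le_trans (cabsD _ _))// cabsM cabsi mul1r.
by rewrite !cabs_real.
Qed.

Lemma cabs_sum (I : Type) (r : seq I) (P : pred I) (F : I -> R[i]) :
  cabs (\sum_(i <- r | P i) F i) <= \sum_(i <- r | P i) cabs (F i).
Proof.
elim: r => [|i r IH]; first by rewrite !big_nil cabs0.
rewrite !big_cons; case: ifP => // _.
by rewrite (le_trans (cabsD _ _))// lerD2l.
Qed.

Lemma cabs_prod (I : Type) (r : seq I) (P : pred I) (F : I -> R[i]) :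
  cabs (\prod_(i <- r | P i) F i) = \prod_(i <- r | P i) cabs (F i).
Proof.
by apply: (big_morph cabs cabsM); exact: cabs1.
Qed.

Lemma ReD x y : complex.Re (x + y) = complex.Re x + complex.Re y.
Proof. by case: x y => [a b] [c d]. Qed.
Lemma ImD x y : complex.Im (x + y) = complex.Im x + complex.Im y.
Proof. by case: x y => [a b] [c d]. Qed.
Lemma ReN x : complex.Re (- x) = - complex.Re x.
Proof. by case: x. Qed.
Lemma ImN x : complex.Im (- x) = - complex.Im x.
Proof. by case: x. Qed.
Lemma ReM x y : complex.Re (x * y) = complex.Re x * complex.Re y - complex.Im x * complex.Im y.
Proof. by case: x y => [a b] [c d]. Qed.
Lemma ImM x y : complex.Im (x * y) = complex.Re x * complex.Im y + complex.Im x * complex.Re y.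
Proof. by case: x y => [a b] [c d]. Qed.

Lemma complex_ext x y :
  complex.Re x = complex.Re y -> complex.Im x = complex.Im y -> x = y.
Proof. by case: x y => [a b] [c d] /= -> ->. Qed.

End ComplexModulus.

(** * Convergence of complex-valued functions along a filter, with real tolerances *)

Section ComplexConvergence.
Variable R : realType.
Local Notation C := R[i].

Definition ccvg (T : Type) (F : set_system T) (f : T -> C) (l : C) : Prop :=
  forall e : R, 0 < e -> \forall x \near F, cabs (f x - l) < e.

Definition cnbhs (z : C) : set_system C :=
  [set A | exists2 d : R, 0 < d & forall w, cabs (w - z) < d -> A w].

Lemma cnbhs_self z A : cnbhs z A -> A z.
Proof. by case=> d d0; apply; rewrite subrr cabs0. Qed.

Global Instance cnbhs_filter z : ProperFilter (cnbhs z).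
Proof.
split; last split.
- by move/cnbhs_self.
- by exists 1.
- move=> A B [a a0 Aa] [b b0 Bb]; exists (Num.min a b) => [|w].
    by rewrite lt_min a0.
  by rewrite lt_min => /andP[/Aa ? /Bb ?].
- by move=> A B AB [a a0 Aa]; exists a => // w /Aa /AB.
Qed.

Section Theory.
Variables (T : Type) (F : set_system T).
Context {FF : Filter F}.
Implicit Types f g : T -> C.

Lemma ccvg_cst l : ccvg F (fun=> l) l.
Proof. by move=> e e0; near=> x; rewrite subrr cabs0. Unshelve. all: end_near. Qed.

Lemma ccvg_eq f g l : (forall x, f x = g x) -> ccvg F f l -> ccvg F g l.
Proof. by move=> fg; have -> : g = f by apply/funext => x; rewrite fg. Qed.

Lemma ccvg_near f g l :
  (\forall x \near F, f x = g x) -> ccvg F f l -> ccvg F g l.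
Proof.
move=> fg fl e e0; near=> x.
have <- : f x = g x by near: x.
by near: x; exact: fl.
Unshelve. all: end_near. Qed.

Lemma ccvgD f g a b : ccvg F f a -> ccvg F g b ->
  ccvg F (fun x => f x + g x) (a + b).
Proof.
move=> fa gb e e0.
have e2 : 0 < e / 2 by rewrite divr_gt0.
near=> x.
have h1 : cabs (f x - a) < e / 2 by near: x; exact: fa.
have h2 : cabs (g x - b) < e / 2 by near: x; exact: gb.
rewrite (_ : _ - _ = (f x - a) + (g x - b)); last by ring.
by rewrite (le_lt_trans (cabsD _ _))// (splitr e) ltrD.
Unshelve. all: end_near. Qed.

Lemma ccvgN f a : ccvg F f a -> ccvg F (fun x => - f x) (- a).
Proof.
move=> fa e e0; near=> x; rewrite -opprD cabsN; near: x; exact: fa.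
Unshelve. all: end_near. Qed.

Lemma ccvgB f g a b : ccvg F f a -> ccvg F g b ->
  ccvg F (fun x => f x - g x) (a - b).
Proof. by move=> fa /ccvgN; exact: ccvgD. Qed.

Lemma ccvg_bounded f a : ccvg F f a -> \forall x \near F, cabs (f x) < cabs a + 1.
Proof.
move=> fa; near=> x.
have : cabs (f x - a) < 1 by near: x; exact: fa.
have := cabs_triB (f x) a; lra.
Unshelve. all: end_near. Qed.

Lemma ccvgM0 f g M : (\forall x \near F, cabs (f x) <= M) -> ccvg F g 0 ->
  ccvg F (fun x => f x * g x) 0.
Proof.
move=> fM g0 e e0.
have M1 : 0 < `|M| + 1 by rewrite ltr_wpDl.
near=> x; rewrite subr0 cabsM.
have h1 : cabs (f x) <= M by near: x.
have : cabs (g x - 0) < e / (`|M| + 1).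
  by near: x; apply: g0; rewrite divr_gt0.
rewrite subr0 ltr_pdivlMr// mulrC; apply: le_lt_trans.
rewrite ler_wpM2r ?cabs_ge0// (le_trans h1)// (le_trans (ler_norm _))//.
by rewrite lerDl.
Unshelve. all: end_near. Qed.

Lemma ccvgM f g a b : ccvg F f a -> ccvg F g b ->
  ccvg F (fun x => f x * g x) (a * b).
Proof.
move=> fa gb.
apply: (@ccvg_eq (fun x => f x * (g x - b) + b * (f x - a) + a * b)) => [x|].
  by ring.
rewrite -[X in ccvg F _ X]add0r; apply: ccvgD; last exact: ccvg_cst.
rewrite -(addr0 0); apply: ccvgD.
  apply: (@ccvgM0 _ _ (cabs a + 1)).
    by apply: filterS (ccvg_bounded fa) => x /ltW.
  by rewrite -(subrr b); apply: ccvgB => //; exact: ccvg_cst.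
apply: (@ccvgM0 _ _ (cabs b)); first by near=> x.
by rewrite -(subrr a); apply: ccvgB => //; exact: ccvg_cst.
Unshelve. all: end_near. Qed.

Lemma ccvgV f a : a != 0 -> ccvg F f a -> ccvg F (fun x => (f x)^-1) a^-1.
Proof.
move=> a0 fa.
have a2 : 0 < cabs a / 2 by rewrite divr_gt0// cabs_gt0.
have nr : \forall x \near F, cabs a / 2 <= cabs (f x).
  near=> x.
  have : cabs (f x - a) < cabs a / 2 by near: x; exact: fa.
  by rewrite cabsB; have := cabs_triB a (f x); lra.
have nz : \forall x \near F, f x != 0.
  by apply: filterS nr => x; rewrite -cabs_gt0; exact: lt_le_trans.
(* [1 / f - 1 / a] is the bounded factor [1 / f] times [(a - f) / a], which tends to 0. *)
apply: (@ccvg_near (fun x => (f x)^-1 * (a^-1 * (a - f x)) + a^-1)).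
  near=> x; have fx : f x != 0 by near: x.
  by field; rewrite fx a0.
rewrite -[X in ccvg F _ X]add0r; apply: ccvgD; last exact: ccvg_cst.
apply: (@ccvgM0 _ _ (cabs a / 2)^-1).
  near=> x; rewrite cabsV lef_pV2 ?posrE//; first by near: x.
  by apply: lt_le_trans a2 _; near: x.
apply: (@ccvgM0 _ _ (cabs a^-1)); first by near=> x.
by rewrite -(subrr a); apply: ccvgB => //; exact: ccvg_cst.
Unshelve. all: end_near. Qed.

Lemma ccvgX f a n : ccvg F f a -> ccvg F (fun x => f x ^+ n) (a ^+ n).
Proof.
move=> fa; elim: n => [|n IH]; first exact: ccvg_cst.
by under eq_fun do rewrite exprS; rewrite exprS; exact: ccvgM.
Qed.

Lemma ccvg_le f l (g : T -> R) :
  (\forall x \near F, cabs (f x - l) <= g x) ->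
  (forall e : R, 0 < e -> \forall x \near F, g x < e) -> ccvg F f l.
Proof.
move=> fg g0 e e0; near=> x.
apply: (@le_lt_trans _ _ (g x)); first by near: x.
by near: x; exact: g0.
Unshelve. all: end_near. Qed.

Lemma ccvg_real (f : T -> R) (l : R) : f @ F --> l ->
  ccvg F (fun x => (f x)%:C%C) l%:C%C.
Proof.
move/cvgrPdist_lt => fl e e0; near=> x.
rewrite -rmorphB cabs_real distrC; near: x; exact: fl.
Unshelve. all: end_near. Qed.

Lemma ccvg_ReIm f l :
  (fun x => complex.Re (f x)) @ F --> complex.Re l ->
  (fun x => complex.Im (f x)) @ F --> complex.Im l -> ccvg F f l.
Proof.
move=> /ccvg_real h1 /ccvg_real h2.
rewrite [l]complexE; apply: ccvg_eq (ccvgD h1 (ccvgM (ccvg_cst 'i%C) h2)) => x.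
by rewrite -complexE.
Qed.

Lemma ccvg_Re f l : ccvg F f l ->
  (fun x => complex.Re (f x)) @ F --> complex.Re l.
Proof.
move=> fl; apply/cvgrPdist_lt => e e0; near=> x.
rewrite distrC -ReN -ReD (le_lt_trans (absRe_le _))//; near: x; exact: fl.
Unshelve. all: end_near. Qed.

Lemma ccvg_Im f l : ccvg F f l ->
  (fun x => complex.Im (f x)) @ F --> complex.Im l.
Proof.
move=> fl; apply/cvgrPdist_lt => e e0; near=> x.
rewrite distrC -ImN -ImD (le_lt_trans (absIm_le _))//; near: x; exact: fl.
Unshelve. all: end_near. Qed.

End Theory.

Lemma ccvg_unique (T : Type) (F : set_system T) {FF : ProperFilter F} f a b :
  ccvg F f a -> ccvg F f b -> a = b.
Proof.
move=> fa fb; apply/eqP; rewrite -subr_eq0 -cabs_eq0; apply/negPn/negP => ab.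
have e2 : 0 < cabs (a - b) / 2 by rewrite divr_gt0// lt_def ab cabs_ge0.
have [x [h1 h2]] := filter_ex (filterI (fa _ e2) (fb _ e2)).
move: h1; rewrite /= cabsB => h1.
have := cabsD (a - f x) (f x - b); rewrite addrA subrK.
by move: h1 h2 => /=; lra.
Qed.

Lemma ccvg_le_lim (T : Type) (F : set_system T) {FF : ProperFilter F}
    (f : T -> C) l M :
  ccvg F f l -> (\forall x \near F, cabs (f x) <= M) -> cabs l <= M.
Proof.
move=> fl fM; apply/ler_addgt0Pr => e e0.
have [x [/= h1 h2]] := filter_ex (filterI (fl _ e0) fM).
by move: h1; rewrite cabsB; have := cabs_triB l (f x); lra.
Qed.

Lemma nbhs_cnbhs (z : C) : nbhs (z : R[i]^o) = cnbhs z.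
Proof.
apply/seteqP; split=> A.
  move/nbhs_ballP => [e /= e0 eA].
  have eE : (complex.Re e)%:C%C = e.
    by rewrite RRe_real// realE ltW.
  exists (complex.Re e); first by rewrite -ltcR eE.
  move=> w wz; apply: eA; rewrite /ball/= -eE -cabsE ltcR cabsB; exact: wz.
move=> [d d0 dA]; apply/nbhs_ballP; exists (d%:C%C) => /=; first by rewrite ltcR.
move=> w; rewrite /ball/= -cabsE ltcR cabsB; exact: dA.
Qed.

Lemma ccvgP (T : Type) (F : set_system T) {FF : Filter F} (f : T -> C) l :
  (f : T -> R[i]^o) @ F --> (l : R[i]^o) <-> ccvg F f l.
Proof.
split=> [fl e e0|fl A].
  have := fl [set w | cabs (w - l) < e]; apply.
  by rewrite /= nbhs_cnbhs; exists e.
by rewrite /= nbhs_cnbhs => -[d d0 dA]; apply: filterS (fl _ d0) => x /dA.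
Qed.

(** Keeping the rate [r] in the conclusion turns Cauchy estimates that are uniform in a parameter
    into uniform convergence. *)
Lemma ccauchy_cvg (u : nat -> C) (r : nat -> R) :
  (forall m n, (m <= n)%N -> cabs (u n - u m) <= r m) ->
  (forall e : R, 0 < e -> \forall n \near \oo, r n < e) ->
  exists2 l, ccvg \oo u l & forall m, cabs (l - u m) <= r m.
Proof.
move=> ur r0.
have cvgc (v : nat -> R) : (forall m n, (m <= n)%N -> `|v n - v m| <= r m) ->
    cvg (v @ \oo).
  move=> vr; apply/cauchy_cvgP/cauchy_exP => e e0.
  have [n _ hn] := r0 _ e0.
  exists (v n); exists n => // m nm; rewrite /ball/= distrC.
  exact: le_lt_trans (vr _ _ nm) (hn n (leqnn n)).
have /cvg_ex[a va] : cvg ((fun n => complex.Re (u n)) @ \oo).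
  by apply: cvgc => m n mn; rewrite -ReN -ReD (le_trans (absRe_le _))// ur.
have /cvg_ex[b vb] : cvg ((fun n => complex.Im (u n)) @ \oo).
  by apply: cvgc => m n mn; rewrite -ImN -ImD (le_trans (absIm_le _))// ur.
have ul : ccvg \oo u (a +i* b)%C by exact: ccvg_ReIm.
exists (a +i* b)%C => // m.
apply: (@ccvg_le_lim _ \oo _ (fun n => u n - u m)).
  by apply: ccvgB => //; exact: ccvg_cst.
by exists m => // n /= mn; exact: ur.
Qed.

Lemma limnE (u : nat -> C) l : ccvg \oo u l -> limn (u : nat -> R[i]^o) = l.
Proof. by move=> /ccvgP ul; apply/cvg_lim => //; exact: norm_hausdorff. Qed.

End ComplexConvergence.

(** * Derivatives along an embedding: functions on C, on the half-plane and on R at once *)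

Section Derivative.
Variables (R : realType) (T : Type) (i : T -> R[i]).
Local Notation C := R[i].

Definition inbhs (t : T) : set_system T :=
  [set A | exists2 d : R, 0 < d & forall s, cabs (i s - i t) < d -> A s].

Lemma inbhs_self t A : inbhs t A -> A t.
Proof. by case=> d d0; apply; rewrite subrr cabs0. Qed.

Global Instance inbhs_filter t : ProperFilter (inbhs t).
Proof.
split; last split.
- by move/inbhs_self.
- by exists 1.
- move=> A B [a a0 Aa] [b b0 Bb]; exists (Num.min a b) => [|w].
    by rewrite lt_min a0.
  by rewrite lt_min => /andP[/Aa ? /Bb ?].
- by move=> A B AB [a a0 Aa]; exists a => // w /Aa /AB.
Qed.

(* Caratheodory's form of the derivative of f along the embedding i. *)
Definition der (f : T -> C) (t : T) (l : C) : Prop :=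
  exists phi : T -> C,
    [/\ ccvg (inbhs t) phi (phi t), phi t = l &
        forall s, f s = f t + phi s * (i s - i t)].

Lemma ccvg_emb t : ccvg (inbhs t) i (i t).
Proof. by move=> e e0; exists e. Qed.

Lemma ccvg_emb0 t : ccvg (inbhs t) (fun s => i s - i t) 0.
Proof. by rewrite -(subrr (i t)); apply: ccvgB; [exact: ccvg_emb|exact: ccvg_cst]. Qed.

Implicit Types (f g : T -> C) (t : T) (l a b : C).

Lemma der_cont f t l : der f t l -> ccvg (inbhs t) f (f t).
Proof.
case=> phi [phit _ fE]; apply: (@ccvg_eq _ _ _ (fun s => f t + phi s * (i s - i t))).
  by move=> s; rewrite -fE.
rewrite -[X in ccvg _ _ X]addr0; apply: ccvgD; first exact: ccvg_cst.
rewrite -(mulr0 (phi t)); exact: ccvgM phit (ccvg_emb0 t).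
Qed.

Lemma derP f t l : der f t l <->
  forall e : R, 0 < e -> \forall s \near inbhs t,
    cabs (f s - f t - l * (i s - i t)) <= e * cabs (i s - i t).
Proof.
split=> [[phi [phit <- fE]] e e0|h].
  apply: filterS (phit _ e0) => s hs.
  have -> : f s - f t - phi t * (i s - i t) = (phi s - phi t) * (i s - i t).
    by rewrite fE; ring.
  by rewrite cabsM ler_wpM2r ?cabs_ge0// ltW.
pose phi s := if i s == i t then l else (f s - f t) / (i s - i t).
have phil : phi t = l by rewrite /phi eqxx.
exists phi; split => //.
  move=> e e0; have e2 : 0 < e / 2 by rewrite divr_gt0.
  apply: filterS (h _ e2) => s; rewrite phil /phi.
  case: eqVneq => [_ _|]; first by rewrite subrr cabs0.
  rewrite -subr_eq0 => st hs.
  rewrite (_ : _ - l = (f s - f t - l * (i s - i t)) / (i s - i t)); last by field.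
  rewrite cabsM cabsV ltr_pdivrMr ?cabs_gt0//; apply: le_lt_trans hs _.
  by rewrite ltr_pM2r ?cabs_gt0//; lra.
(* [i] need not be injective: where [i s = i t], the estimate itself forces [f s = f t]. *)
move=> s; rewrite /phi; case: eqVneq => [st|].
  rewrite st subrr mulr0 addr0.
  have [d d0 hd] := h 1 ltr01; have := hd s; rewrite st subrr cabs0 => /(_ d0).
  rewrite mulr0 mulr0 subr0 => h0; apply/eqP; rewrite -subr_eq0 -cabs_eq0.
  by rewrite eq_le h0 cabs_ge0.
by rewrite -subr_eq0 => st; field.
Qed.

Lemma der_near f g t l : (\forall s \near inbhs t, f s = g s) ->
  der f t l -> der g t l.
Proof.
move=> fg /derP h; apply/derP => e e0.
have ft := inbhs_self fg.
apply: filterS2 fg (h _ e0) => s fgs; rewrite fgs ft; exact.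
Qed.

Lemma der_eq f g t l : (forall s, f s = g s) -> der f t l -> der g t l.
Proof. by move=> fg; apply: der_near; apply: filterE. Qed.

Lemma der_cst a t : der (fun=> a) t 0.
Proof.
exists (fun=> 0); split=> // [|s]; last by rewrite mul0r addr0.
exact: ccvg_cst.
Qed.

Lemma der_emb t : der i t 1.
Proof.
exists (fun=> 1); split=> // [|s]; last by rewrite mul1r; ring.
exact: ccvg_cst.
Qed.

Lemma derD f g t a b : der f t a -> der g t b ->
  der (fun s => f s + g s) t (a + b).
Proof.
move=> [p [pt <- pE]] [q [qt <- qE]]; exists (fun s => p s + q s); split=> //.
  exact: ccvgD.
by move=> s; rewrite pE qE; ring.
Qed.

Lemma derN f t a : der f t a -> der (fun s => - f s) t (- a).
Proof.
move=> [p [pt <- pE]]; exists (fun s => - p s); split=> //.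
  exact: ccvgN.
by move=> s; rewrite pE; ring.
Qed.

Lemma derB f g t a b : der f t a -> der g t b ->
  der (fun s => f s - g s) t (a - b).
Proof. by move=> fa /derN; exact: derD. Qed.

Lemma derM f g t a b : der f t a -> der g t b ->
  der (fun s => f s * g s) t (a * g t + f t * b).
Proof.
move=> fa gb; have gc := der_cont gb; move: fa gb.
move=> [p [pt <- pE]] [q [qt <- qE]].
exists (fun s => p s * g s + f t * q s); split=> //.
  apply: ccvgD; apply: ccvgM => //; exact: ccvg_cst.
move=> s; have -> : f t * g t = f t * (g s - q s * (i s - i t)) by rewrite (qE s); ring.
by rewrite (pE s); ring.
Qed.

Lemma derZ c f t a : der f t a -> der (fun s => c * f s) t (c * a).
Proof. by move=> fa; have := derM (der_cst c t) fa; rewrite mul0r add0r. Qed.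

Lemma derX f t a n : der f t a -> der (fun s => f s ^+ n) t (n%:R * f t ^+ n.-1 * a).
Proof.
move=> fa; elim: n => [|n IH]; first by rewrite !mul0r; exact: der_cst.
apply: (@der_eq (fun s => f s * f s ^+ n)) => [s|]; first by rewrite exprS.
have -> : n.+1%:R * f t ^+ n.+1.-1 * a = a * f t ^+ n + f t * (n%:R * f t ^+ n.-1 * a).
  by case: n IH => [|n] _; rewrite ?exprS -?natr1 /= ?expr0; ring.
exact: derM.
Qed.

Lemma derV f t a : f t != 0 -> der f t a -> der (fun s => (f s)^-1) t (- a / f t ^+ 2).
Proof.
move=> ft0 fa; have fc := der_cont fa; case: fa => p [pt <- pE].
have nz : \forall s \near inbhs t, f s != 0.
  have c0 : 0 < cabs (f t) by rewrite cabs_gt0.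
  apply: filterS (fc _ c0) => s; rewrite -cabs_gt0 cabsB.
  by have := cabs_triB (f t) (f s); lra.
apply/derP => e e0.
suff /derP/(_ _ e0) : der (fun s => if f s == 0 then (f t)^-1 - p s / (f t * f s) * (i s - i t) else (f s)^-1)
    t (- p t / f t ^+ 2).
  move=> hh; apply: filterS (filterI nz hh) => s [/negbTE fs0].
  by rewrite fs0 (negbTE ft0).
exists (fun s => - p s / (f t * f s)); split.
- apply: ccvgM; first exact: ccvgN.
  apply: ccvgV; first by rewrite mulf_neq0.
  by apply: ccvgM => //; exact: ccvg_cst.
- by rewrite expr2.
- move=> s; rewrite (negbTE ft0); case: eqVneq => [_|fs0]; first by ring.
  have h : p s * (i s - i t) = f s - f t by rewrite (pE s); ring.
  have -> : - p s / (f t * f s) * (i s - i t) = - (p s * (i s - i t)) / (f t * f s).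
    by ring.
  by rewrite h; field; rewrite fs0 ft0.
Qed.

Lemma der_div f g t a b : g t != 0 -> der f t a -> der g t b ->
  der (fun s => f s / g s) t ((a * g t - f t * b) / g t ^+ 2).
Proof.
move=> g0 fa gb; have := derM fa (derV g0 gb).
by congr der; field.
Qed.

Lemma der_sum (I : Type) (r : seq I) (f : I -> T -> C) t (l : I -> C) :
  (forall j, der (f j) t (l j)) ->
  der (fun s => \sum_(j <- r) f j s) t (\sum_(j <- r) l j).
Proof.
move=> fl; elim: r => [|j r IH].
  rewrite big_nil; apply: der_eq (der_cst 0 t) => s; by rewrite big_nil.
rewrite big_cons; apply: der_eq (derD (fl j) IH) => s; by rewrite big_cons.
Qed.

End Derivative.

Lemma der_comp (R : realType) (T T' : Type) (i : T -> R[i]) (j : T' -> R[i])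
    (f : T -> T') (g : T' -> R[i]) t a b :
  der i (fun s => j (f s)) t a -> der j g (f t) b -> der i (g \o f) t (b * a).
Proof.
move=> fa; have fc := der_cont fa; move: fa.
move=> [p [pt <- pE]] [q [qt <- qE]].
exists (fun s => q (f s) * p s); split=> //.
  apply: ccvgM => // e e0; have [d d0 hd] := qt _ e0.
  by apply: filterS (fc _ d0) => s; exact: hd.
by move=> s; rewrite /= qE pE; ring.
Qed.
Arguments der_comp {R T T' i} j {f g t a b}.

(** * Functions of a real variable and the mean value estimate *)

Section RealVariable.
Variable R : realType.
Local Notation rc := (real_complex R).

Lemma inbhs_real (t : R) : inbhs rc t = nbhs t.
Proof.
apply/seteqP; split=> A.
  move=> [d d0 dA]; apply/nbhs_ballP; exists d => //= s.
  by rewrite /ball/= distrC => st; apply: dA; rewrite -rmorphB cabs_real.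
move/nbhs_ballP=> [d /= d0 dA]; exists d => // s; rewrite -rmorphB cabs_real => st.
by apply: dA; rewrite /ball/= distrC.
Qed.

Lemma der_real (g : R -> R) (t l : R) : is_derive t 1 g l ->
  der rc (fun s => (g s)%:C%C) t l%:C%C.
Proof.
move/is_derive1_caratheodory => [p [pE pc pt]].
exists (fun s => (p s)%:C%C); split; last by move=> s; rewrite -rmorphB -rmorphM -rmorphD -pE subrKC.
  by rewrite inbhs_real; apply: ccvg_real.
by rewrite pt.
Qed.

Lemma der_Re (G : R -> R[i]) (t : R) (l : R[i]) : der rc G t l ->
  is_derive t 1 (fun s => complex.Re (G s)) (complex.Re l).
Proof.
move=> [p [pt <- pE]]; apply/is_derive1_caratheodory.
exists (fun s => complex.Re (p s)); split=> //.
  by move=> s; rewrite pE ReD -rmorphB ReM/= mulr0 subr0 addrAC subrr add0r.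
by move: pt; rewrite inbhs_real => /ccvg_Re.
Qed.

(** The real mean value theorem is applied to the real parts of [G] and of [- i G]; adding the two
    bounds costs the factor 2. *)
Lemma der_MVT (G G' : R -> R[i]) (a b M : R) : a <= b ->
  (forall t, a <= t <= b -> der rc G t (G' t)) ->
  (forall t, a <= t <= b -> cabs (G' t) <= M) ->
  cabs (G b - G a) <= 2 * M * (b - a).
Proof.
move=> ab dG GM.
have aux (u : R[i]) : cabs u = 1 -> `|complex.Re (u * (G b - G a))| <= M * (b - a).
  move=> u1; pose H s := u * G s.
  have dH t : a <= t <= b -> is_derive t 1 (fun s => complex.Re (H s)) (complex.Re (u * G' t)).
    by move=> tab; apply: der_Re; apply: derZ; exact: dG.
  have [||c cab] := @MVT_segment R (fun s => complex.Re (H s))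
      (fun s => complex.Re (u * G' s)) _ _ ab.
  - move=> t; rewrite in_itv/= => /andP[at_ tb]; apply: dH; by rewrite !ltW.
  - apply: derivable_within_continuous => t; rewrite in_itv/= => tab.
    by have := dH _ tab => -[].
  have -> : complex.Re (u * (G b - G a)) = complex.Re (H b) - complex.Re (H a).
    by rewrite -ReN -ReD mulrBr.
  move=> ->; rewrite normrM [`|b - a|]ger0_norm ?subr_ge0//.
  rewrite ler_wpM2r ?subr_ge0// (le_trans (absRe_le _))// cabsM u1 mul1r.
  by apply: GM; move: cab; rewrite in_itv.
have h1 := aux 1 (cabs1 _).
have h2 : `|complex.Im (G b - G a)| <= M * (b - a).
  have := aux (- 'i%C); rewrite cabsN => /(_ (cabsi _)).
  by rewrite mulNr ReN ReM/= mul0r mul1r sub0r opprK.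
rewrite mul1r in h1; have := cabs_leReIm (G b - G a); lra.
Qed.

Lemma der_segment (f f' : R[i] -> R[i]) (p q : R[i]) (M : R) :
  (forall t : R, 0 <= t <= 1 -> der id f (p + t%:C%C * (q - p)) (f' (p + t%:C%C * (q - p)))) ->
  (forall t : R, 0 <= t <= 1 -> cabs (f' (p + t%:C%C * (q - p))) <= M) ->
  cabs (f q - f p) <= 2 * M * cabs (q - p).
Proof.
move=> df fM; pose g (t : R) : R[i] := p + t%:C%C * (q - p).
have dg t : der rc g t (q - p).
  have h := derM (der_emb rc t) (der_cst rc (q - p) t).
  have := derD (der_cst rc p t) h; congr der; ring.
have := @der_MVT (f \o g) (fun t => f' (g t) * (q - p)) 0 1 (M * cabs (q - p)) ler01.
rewrite /= /g mul0r addr0 mul1r subrKC subr0 mulr1 mulrA; apply.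
  by move=> t /df h; exact: (der_comp id (dg t) h).
by move=> t /fM h; rewrite cabsM ler_wpM2r ?cabs_ge0.
Qed.

End RealVariable.

(** * Complex derivatives on the upper half-plane *)

Section UpperHalfPlane.
Variable R : realType.
Local Notation C := R[i].
Implicit Types (f g : uhp R -> C) (z : uhp R).

Lemma uhp_gt0 z : 0 < complex.Im (uhpval z).
Proof. exact: (valP z). Qed.

Lemma uhp_open z : \forall w \near inbhs id (uhpval z), 0 < complex.Im w.
Proof.
exists (complex.Im (uhpval z)) => [|w]; first exact: uhp_gt0.
have := absIm_le (w - uhpval z); rewrite ImD ImN ler_norml /=.
by move=> /andP[h _] h2; move: h h2; lra.
Qed.

Lemma extendE f z : extend f (uhpval z) = f z.
Proof. by rewrite /extend (valK z). Qed.

Lemma extend_in f (w : C) (h : 0 < complex.Im w) : extend f w = f (MkUhp h).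
Proof. by rewrite -(extendE f (MkUhp h)). Qed.

Lemma der_extend f z l : der (@uhpval R) f z l <-> der id (extend f) (uhpval z) l.
Proof.
split=> /derP h; apply/derP => e /h [d d0 hd].
  have nd : inbhs id (uhpval z) (fun w => cabs (w - uhpval z) < d) by exists d.
  apply: filterS (filterI (uhp_open z) nd).
  move=> w [w0 wz]; rewrite (extend_in f w0) extendE; exact: (hd (MkUhp w0)).
by exists d => // s /hd; rewrite !extendE.
Qed.

Lemma der_derivable (f : C -> C) (z l : C) : der id f z l <->
  ((fun h : R[i]^o => h^-1 *: ((f : R[i]^o -> R[i]^o) (h *: (1 : R[i]^o) + (z : R[i]^o)) - f z) : R[i]^o)
    @ (0 : R[i]^o)^' --> (l : R[i]^o)).
Proof.
rewrite ccvgP; split.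
  move=> /derP df e e0; have e2 : 0 < e / 2 by rewrite divr_gt0.
  have [d d0 hd] := df _ e2.
  suff : (0 : R[i]^o)^' [set h : C | h != 0 /\ cabs h < d].
    apply: filterS => h [h0 hd'].
    have := hd (h + z); rewrite addrK => /(_ hd') hh.
    have -> : h *: (1 : R[i]^o) + z = h + z by rewrite -[h *: _]/(h * 1) mulr1.
    rewrite -[X in cabs (X - l)]/(h^-1 * (f (h + z) - f z)).
    have -> : h^-1 * (f (h + z) - f z) - l = h^-1 * (f (h + z) - f z - l * h) by field.
    rewrite cabsM cabsV mulrC ltr_pdivrMr ?cabs_gt0//.
    by apply: le_lt_trans hh _; rewrite ltr_pM2r ?cabs_gt0//; lra.
  rewrite /dnbhs/= /within/=; have : nbhs (0 : R[i]^o) [set h : C | cabs h < d].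
    by rewrite nbhs_cnbhs; exists d => // w; rewrite subr0.
  by apply: filterS => h /= hd' h0.
move=> h; apply/derP => e e0.
have := h _ e0; rewrite /dnbhs/= /within/= /near_simpl/=.
rewrite nbhs_cnbhs => -[d d0 hd]; exists d => // s sz.
have [->|] := eqVneq s z; first by rewrite !subrr cabs0 mulr0 subr0 cabs0 mulr0.
rewrite -subr_eq0 => sz0; have := hd (s - z); rewrite subr0 => /(_ sz sz0).
have -> : (s - z) *: (1 : R[i]^o) + z = s by rewrite -[_ *: _]/((s - z) * 1) mulr1 subrK.
rewrite -[X in cabs (X - l)]/((s - z)^-1 * (f s - f z)) => hh.
have -> : f s - f z - l * (s - z) = (s - z) * ((s - z)^-1 * (f s - f z) - l) by field.
by rewrite cabsM mulrC ler_wpM2r ?cabs_ge0 ?ltW.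
Qed.

Lemma holomorphicP f : holomorphic f <-> forall z, exists l, der (@uhpval R) f z l.
Proof.
split=> [hf z|h z].
  have := hf z => /cvg_ex[l hl]; exists l; apply/der_extend; apply/der_derivable.
  exact: hl.
have [l /der_extend/der_derivable hl] := h z; apply/cvg_ex; exists l; exact: hl.
Qed.

Lemma cderivE f z l : der (@uhpval R) f z l -> cderiv f z = l.
Proof.
move=> /der_extend/der_derivable hl.
rewrite /cderiv /derive1.
refine (@cvg_lim _ (@norm_hausdorff _ (R[i]^o)) (R[i]) ((0 : R[i]^o)^') _ _ _ _).
by apply: cvg_trans hl; apply: near_eq_cvg; near=> h; rewrite -[h *: 1]/(h * 1) mulr1.
Unshelve. all: end_near. Qed.

Lemma cderivP f z : holomorphic f -> der (@uhpval R) f z (cderiv f z).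
Proof. by move=> /holomorphicP/(_ z)[l fl]; rewrite (cderivE fl). Qed.

Lemma uhp_segment (z w : uhp R) (t : R) : 0 <= t <= 1 ->
  0 < complex.Im (uhpval z + t%:C%C * (uhpval w - uhpval z)).
Proof.
move=> /andP[t0 t1]; rewrite ImD ImM/= mul0r addr0 ImD ImN.
have := uhp_gt0 z; have := uhp_gt0 w.
move: (complex.Im _) (complex.Im _) => a b a0 b0.
have [t0'|t0'] := eqVneq t 0; first by rewrite t0' mul0r addr0.
have -> : a + t * (b - a) = (1 - t) * a + t * b by ring.
apply: ltr_wpDl; first by apply: mulr_ge0; rewrite ?subr_ge0// ltW.
by apply: mulr_gt0 => //; rewrite lt_def t0' t0.
Qed.

(** The half-plane is convex, so the mean value estimate applies along the segment between any two
    points. *)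
Lemma uder0_cst f : (forall z, der (@uhpval R) f z 0) -> forall z w, f z = f w.
Proof.
move=> df z w.
have : cabs (extend f (uhpval w) - extend f (uhpval z)) <= 2 * 0 * cabs (uhpval w - uhpval z).
  apply: (@der_segment R _ (fun=> 0)) => [t t01|t _]; last by rewrite cabs0.
  by have := df (MkUhp (uhp_segment z w t01)) => /der_extend.
rewrite mulr0 mul0r !extendE => h; apply/esym/eqP.
by rewrite -subr_eq0 -cabs_eq0 eq_le h cabs_ge0.
Qed.

End UpperHalfPlane.

(** * The complex exponential *)

Section ComplexExp.
Variable R : realType.
Implicit Types z w : R[i].

Lemma cexpD z w : cexp (z + w) = cexp z * cexp w.
Proof.
case: z w => [a b] [c d]; rewrite /cexp /= expRD cosD sinD.
by apply: complex_ext => /=; ring.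
Qed.

Lemma cexp0 : cexp (0 : R[i]) = 1.
Proof. by rewrite /cexp/= expR0 cos0 sin0; apply: complex_ext; rewrite ?ReM ?ImM/=; ring. Qed.

Lemma cabs_cexp z : cabs (cexp z) = expR (complex.Re z).
Proof.
rewrite /cexp cabsM cabs_real ger0_norm ?expR_ge0//.
by rewrite [cabs (_ +i* _)%C]/cabs/= cos2Dsin2 sqrtr1 mulr1.
Qed.

Lemma cexp_neq0 z : cexp z != 0.
Proof. by rewrite -cabs_gt0 cabs_cexp expR_gt0. Qed.

Lemma cexpN z : cexp (- z) = (cexp z)^-1.
Proof.
apply: (mulIf (cexp_neq0 z)); rewrite mulVf ?cexp_neq0//.
by rewrite -cexpD addNr cexp0.
Qed.

Lemma cexpMn n z : cexp (n%:R * z) = cexp z ^+ n.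
Proof.
elim: n => [|n IH]; first by rewrite mul0r cexp0.
by rewrite -natr1 mulrDl mul1r cexpD IH exprSr.
Qed.

Lemma der_cexp z : der id (@cexp R) z (cexp z).
Proof.
(* The addition formula transports the derivative at 0 to any other point. *)
suff h0 : der id (@cexp R) 0 1.
  have hs : der id (fun w => w - z) z 1.
    by have := derB (der_emb id z) (der_cst id z z); rewrite subr0.
  have := @der_comp R _ _ id id (fun w => w - z) (@cexp R) z 1 1 hs.
  rewrite subrr => /(_ h0) hc; have := derZ (cexp z) hc; rewrite !mulr1.
  by apply: der_eq => s; rewrite /= -cexpD subrKC.
have de : der (real_complex R) (fun s => (expR s)%:C%C) 0 (expR (0 : R))%:C%C.
  by apply: der_real; exact: is_derive_expR.
have dc : der (real_complex R) (fun s => (cos s)%:C%C) 0 (- sin (0 : R))%:C%C.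
  by apply: der_real; exact: is_derive_cos.
have ds : der (real_complex R) (fun s => (sin s)%:C%C) 0 (cos (0 : R))%:C%C.
  by apply: der_real; exact: is_derive_sin.
rewrite expR0 in de; rewrite sin0 oppr0 in dc; rewrite cos0 in ds.
case: de => pe [pec pe0 peE]; case: dc => pc [pcc pc0 pcE]; case: ds => ps [psc ps0 psE].
apply/derP => e e0.
have e8 : 0 < e / 8 by rewrite divr_gt0.
have [d1 d10 h1] := pec _ e8; have [d2 d20 h2] := pcc _ e8.
have [d3 d30 h3] := psc _ e8.
exists (Num.min 1 (Num.min (e / 8) (Num.min d1 (Num.min d2 d3)))).
  by rewrite !lt_min d10 d20 d30 ltr01 e8.
move=> [x y]; rewrite !subr0 cexp0 mul1r !lt_min => /and5P[H0 He H1 H2 H3].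
set w := (x +i* y)%C in H0 He H1 H2 H3 *.
have xw : `|x| <= cabs w by have := absRe_le w.
have yw : `|y| <= cabs w by have := absIm_le w.
have sub0 (u : R) : u%:C%C - (0 : R)%:C%C = u%:C%C :> R[i] by rewrite subr0.
move: (h1 x) (h2 y) (h3 y).
rewrite !sub0 !cabs_real => /(_ (le_lt_trans xw H1)) {}h1.
move=> /(_ (le_lt_trans yw H2)) {}h2 /(_ (le_lt_trans yw H3)) {}h3.
move: (peE x) (pcE y) (psE y); rewrite !sub0 expR0 cos0 sin0 => {}peE {}pcE {}psE.
rewrite pe0 in h1; rewrite pc0 subr0 in h2; rewrite ps0 in h3.
have ce : (cos y +i* sin y)%C = (cos y)%:C%C + 'i%C * (sin y)%:C%C :> R[i].
  by rewrite [LHS]complexE.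
have wE : w = x%:C%C + 'i%C * y%:C%C by rewrite [LHS]complexE.
have cw : cexp w = (expR x)%:C%C * ((cos y)%:C%C + 'i%C * (sin y)%:C%C).
  by rewrite /cexp ce.
have mod1 : cabs ((cos y)%:C%C + 'i%C * (sin y)%:C%C) = 1 :> R.
  by rewrite -ce /cabs/= cos2Dsin2 sqrtr1.
set u := cabs w in xw yw H0 He H1 H2 H3 *.
set X := x%:C%C in peE wE; set Y := y%:C%C in pcE psE wE.
have cX : cabs X <= u by rewrite cabs_real.
have cY : cabs Y <= u by rewrite cabs_real.
have u0 : 0 <= u := cabs_ge0 _.
rewrite rmorph1 in h1 h3 peE pcE; rewrite rmorph0 add0r in psE.
set v := _ + _ in cw mod1.
(* [pe], [pc], [ps] are the slopes of exp, cos and sin from 0, within [e / 8] of 1, 0 and 1. The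
   remainder splits into four terms, bounded by 1, 2, 1 and 2 times [e / 8 * |w|]. *)
have -> : cexp w - 1 - w = (pe x - 1) * X * v +
  ((X + 1) * (pc y * Y) + ('i%C * ((ps y - 1) * Y) + X * ('i%C * ((ps y - 1) * Y + Y)))).
  by rewrite cw wE peE /v pcE psE; ring.
have b0 (p a : R[i]) : cabs p < e / 8 -> cabs a <= u -> cabs (p * a) <= e / 8 * u.
  by move=> pe8 au; rewrite cabsM ler_pM ?cabs_ge0// ltW.
have b1 := b0 _ _ h1 cX; have b2 := b0 _ _ h2 cY; have b3 := b0 _ _ h3 cY.
have t1 : cabs ((pe x - 1) * X * v) <= e / 8 * u by rewrite cabsM mod1 mulr1.
have t2 : cabs ((X + 1) * (pc y * Y)) <= 2 * (e / 8 * u).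
  rewrite cabsM ler_pM ?cabs_ge0// (le_trans (cabsD _ _))// cabs1; lra.
have t3 : cabs ('i%C * ((ps y - 1) * Y)) <= e / 8 * u by rewrite cabsM cabsi mul1r.
have t4 : cabs (X * ('i%C * ((ps y - 1) * Y + Y))) <= 2 * (e / 8 * u).
  rewrite !cabsM cabsi mul1r.
  apply: (@le_trans _ _ (u * (2 * (e / 8)))); last by lra.
  rewrite ler_pM ?cabs_ge0// (le_trans (cabsD _ _))//.
  have : e / 8 * u <= e / 8 by rewrite ler_piMr// ltW.
  lra.
have := cabsD ((pe x - 1) * X * v) ((X + 1) * (pc y * Y) + ('i%C * ((ps y - 1) * Y) + X * ('i%C * ((ps y - 1) *
    Y + Y)))).
have := cabsD ((X + 1) * (pc y * Y)) ('i%C * ((ps y - 1) * Y) + X * ('i%C * ((ps y - 1) * Y + Y))).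
have := cabsD ('i%C * ((ps y - 1) * Y)) (X * ('i%C * ((ps y - 1) * Y + Y))).
have : 0 <= e * u by rewrite mulr_ge0// ltW.
lra.
Qed.

Lemma cexp_twopii_nat n : cexp (n%:R * twopii R) = 1.
Proof.
suff e1 : cexp (twopii R) = 1 by rewrite cexpMn e1 expr1n.
rewrite /cexp /twopii ReM ImM /= !mul0r !mulr0 !subr0 !mulr1 addr0 expR0.
have -> : 2 * pi = pi *+ 2 :> R by rewrite mulr_natl.
by rewrite cos2pi sin2pi mul1r.
Qed.

End ComplexExp.

(** * Cauchy's theorem and Weierstrass' convergence theorem *)

Section PathIntegral.
Variable R : realType.
Local Notation C := R[i].
Local Notation rc := (real_complex R).
Implicit Types (g h : R -> C) (a b : R).

Definition rcont g a b := forall t, a <= t <= b -> ccvg (inbhs rc t) g (g t).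

(** Integrals are increments of primitives, so that linearity, additivity and bounds come from those
    of [der]; measure theory enters only through the existence of a primitive. *)
Definition pint g a b (I : C) :=
  exists2 G : R -> C, (forall t, a <= t <= b -> der rc G t (g t)) & I = G b - G a.

Lemma pint_unique g a b I J : a <= b -> pint g a b I -> pint g a b J -> I = J.
Proof.
move=> ab [G dG ->] [H dH ->].
have := @der_MVT R (fun t => G t - H t) (fun=> 0) a b 0 ab.
rewrite mulr0 mul0r => /(_ _ _)/wrap[t tab||h].
- by have := derB (dG t tab) (dH t tab); rewrite subrr.
- by move=> t _; rewrite cabs0.
apply/eqP; rewrite -subr_eq0 -cabs_eq0 eq_le cabs_ge0 andbT.
by rewrite (_ : _ - _ = G b - H b - (G a - H a)) //; ring.
Qed.

Lemma continuous_primitive (g : R -> R) a b : a <= b ->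
  (forall t, {for t, continuous g}) ->
  exists G : R -> R, forall t, a <= t <= b -> is_derive t 1 G (g t).
Proof.
move=> ab gc.
(* The interval is enlarged on both sides so that [a] and [b] become interior points. *)
have ab1 : a - 1 < b + 1 by lra.
exists (fun x => \int[lebesgue_measure]_(t in [set` Interval (BLeft (a - 1)) (BRight x)]) g t)%R.
move=> t /andP[at_ tb].
have tb1 : t < b + 1 by lra.
have [||d e] := @continuous_FTC1 R g (BLeft (a - 1)) t (b + 1) tb1 _ _ (gc t).
- apply: continuous_compact_integrable; first exact: segment_compact.
  by apply: continuous_subspaceT => x; exact: gc.
- by rewrite /= lte_fin; lra.
by apply: DeriveDef; [exact: d|rewrite -derive1E].
Qed.

(** The 1-Lipschitz retraction of R onto [a, b]: composition with it makes a function that is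
    continuous on [a, b] continuous everywhere. *)
Let clamp a b t : R := Num.max a (Num.min b t).

Let clamp_id a b t : a <= t <= b -> clamp a b t = t.
Proof. by move=> /andP[at_ tb]; rewrite /clamp min_r// max_r. Qed.

Let clamp_in a b t : a <= b -> a <= clamp a b t <= b.
Proof. by move=> ab; rewrite /clamp le_max lexx ge_max ab ge_min lexx. Qed.

Let max_lip a s t : `|Num.max a s - Num.max a t| <= `|s - t|.
Proof.
have h1 := ler_norm (s - t); have h2 := ler_norm (t - s); rewrite distrC in h2.
have h3 := normr_ge0 (s - t).
by rewrite !maxEle; case: (leP a s) => ?; case: (leP a t) => ?;
  rewrite ler_norml; apply/andP; split; lra.
Qed.

Let min_lip a s t : `|Num.min a s - Num.min a t| <= `|s - t|.
Proof.
have h1 := ler_norm (s - t); have h2 := ler_norm (t - s); rewrite distrC in h2.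
have h3 := normr_ge0 (s - t).
by rewrite !minEle; case: (leP a s) => ?; case: (leP a t) => ?;
  rewrite ler_norml; apply/andP; split; lra.
Qed.

Let clamp_lip a b s t : `|clamp a b s - clamp a b t| <= `|s - t|.
Proof. exact: le_trans (max_lip _ _ _) (min_lip _ _ _). Qed.

Lemma pint_exists g a b : a <= b -> rcont g a b -> exists I, pint g a b I.
Proof.
move=> ab gc; pose k t := g (clamp a b t).
have kc t : ccvg (nbhs t) k (k t).
  rewrite -inbhs_real => e e0.
  have [d d0 hd] := gc _ (clamp_in t ab) _ e0.
  exists d => // s; rewrite -rmorphB cabs_real => st; apply: hd.
  by rewrite -rmorphB cabs_real (le_lt_trans _ st)// clamp_lip.
have [G1 dG1] := @continuous_primitive (fun t => complex.Re (k t)) a b ab (fun t => ccvg_Re (kc t)).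
have [G2 dG2] := @continuous_primitive (fun t => complex.Im (k t)) a b ab (fun t => ccvg_Im (kc t)).
pose G t : C := (G1 t)%:C%C + 'i%C * (G2 t)%:C%C.
exists (G b - G a), G => // t tab.
have -> : g t = (complex.Re (k t))%:C%C + 'i%C * (complex.Im (k t))%:C%C.
  by rewrite -complexE /k clamp_id.
by apply: derD; [|apply: derZ]; apply: der_real; [exact: dG1|exact: dG2].
Qed.

Definition cint g a b : C := xget 0 [set I | pint g a b I].

Lemma cint_prim g (G : R -> C) a b : a <= b ->
  (forall t, a <= t <= b -> der rc G t (g t)) -> cint g a b = G b - G a.
Proof.
move=> ab dG; have p : pint g a b (G b - G a) by exists G.
rewrite /cint; case: xgetP => [I _ h|/(_ (G b - G a))//].
exact: pint_unique h p.
Qed.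

Lemma cintP g a b : a <= b -> rcont g a b ->
  exists2 G : R -> C, (forall t, a <= t <= b -> der rc G t (g t)) & cint g a b = G b - G a.
Proof.
move=> ab /(pint_exists ab)[I [G dG _]]; exists G => //; exact: cint_prim.
Qed.

Lemma cintD g h a b : a <= b -> rcont g a b -> rcont h a b ->
  cint (fun t => g t + h t) a b = cint g a b + cint h a b.
Proof.
move=> ab /(cintP ab)[G dG ->] /(cintP ab)[H dH ->].
rewrite (@cint_prim _ (fun t => G t + H t))//; first by ring.
by move=> t tab; apply: derD; [exact: dG|exact: dH].
Qed.

Lemma cintZ c g a b : a <= b -> rcont g a b ->
  cint (fun t => c * g t) a b = c * cint g a b.
Proof.
move=> ab /(cintP ab)[G dG ->].
rewrite (@cint_prim _ (fun t => c * G t))//; first by ring.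
by move=> t tab; apply: derZ; exact: dG.
Qed.

Lemma cint_split g a m b : a <= m -> m <= b -> rcont g a b ->
  cint g a b = cint g a m + cint g m b.
Proof.
move=> am mb /(cintP (le_trans am mb))[G dG ->].
rewrite (@cint_prim _ G a m)// ?(@cint_prim _ G m b)//; first by ring.
- by move=> t /andP[mt tb]; apply: dG; rewrite tb (le_trans am mt).
- by move=> t /andP[at_ tm]; apply: dG; rewrite at_ (le_trans tm mb).
Qed.

Lemma cint_bound g a b M : a <= b -> rcont g a b ->
  (forall t, a <= t <= b -> cabs (g t) <= M) -> cabs (cint g a b) <= 2 * M * (b - a).
Proof. by move=> ab /(cintP ab)[G dG ->] gM; exact: der_MVT gM. Qed.

Lemma cint_eq g h a b : a <= b -> rcont g a b -> (forall t, a <= t <= b -> h t = g t) ->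
  cint h a b = cint g a b.
Proof.
move=> ab /(cintP ab)[G dG ->] hg; apply: cint_prim => // t tab.
by rewrite hg//; exact: dG.
Qed.

End PathIntegral.

(** * Boundary integrals over rectangles and Goursat's lemma *)

Section Rectangle.
Variable R : realType.
Local Notation C := R[i].
Local Notation rc := (real_complex R).
Implicit Types (F G : C -> C) (a b c d x y : R) (z w : C).

Definition cont F w := ccvg (inbhs id w) F (F w).

Definition rect x0 x1 y0 y1 : set C :=
  [set w | x0 <= complex.Re w <= x1 /\ y0 <= complex.Im w <= y1].

Definition bdry x0 x1 y0 y1 : set C :=
  [set w | rect x0 x1 y0 y1 w /\
    [\/ complex.Re w = x0, complex.Re w = x1, complex.Im w = y0 | complex.Im w = y1]].

Definition hseg y (t : R) : C := (t +i* y)%C.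
Definition vseg x (t : R) : C := (x +i* t)%C.

Lemma hsegE y t : hseg y t = t%:C%C + 'i%C * y%:C%C.
Proof. by rewrite [LHS]complexE. Qed.

Lemma vsegE x t : vseg x t = x%:C%C + 'i%C * t%:C%C.
Proof. by rewrite [LHS]complexE. Qed.

Lemma der_hseg y t : der rc (hseg y) t 1.
Proof.
have := derD (der_emb rc t) (der_cst rc ('i%C * y%:C%C) t); rewrite addr0.
by apply: der_eq => s; rewrite hsegE.
Qed.

Lemma der_vseg x t : der rc (vseg x) t 'i%C.
Proof.
have := derD (der_cst rc x%:C%C t) (derZ 'i%C (der_emb rc t)); rewrite add0r mulr1.
by apply: der_eq => s; rewrite vsegE.
Qed.

Lemma ccvg_along (p : R -> C) l F t : der rc p t l -> cont F (p t) ->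
  ccvg (inbhs rc t) (fun s => F (p s)) (F (p t)).
Proof.
move=> dp Fc e e0; have [d d0 hd] := Fc _ e0.
by apply: filterS (der_cont dp d0) => s; exact: hd.
Qed.

(** The boundary is traversed counterclockwise; the factor ['i] is the velocity along the vertical
    edges. *)
Definition rint F x0 x1 y0 y1 : C :=
  cint (fun t => F (hseg y0 t)) x0 x1 - cint (fun t => F (hseg y1 t)) x0 x1 +
  'i%C * (cint (fun t => F (vseg x1 t)) y0 y1 - cint (fun t => F (vseg x0 t)) y0 y1).

Section Edges.
Variables (x0 x1 y0 y1 : R).
Hypotheses (hx : x0 <= x1) (hy : y0 <= y1).

Lemma bdry_h (y t : R) : y = y0 \/ y = y1 -> x0 <= t <= x1 ->
  bdry x0 x1 y0 y1 (hseg y t).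
Proof.
move=> yy tt; split; first by split=> //=; case: yy => ->; rewrite lexx ?hy.
by case: yy => ->; [apply: Or43|apply: Or44].
Qed.

Lemma bdry_v (x t : R) : x = x0 \/ x = x1 -> y0 <= t <= y1 ->
  bdry x0 x1 y0 y1 (vseg x t).
Proof.
move=> xx tt; split; first by split=> //=; case: xx => ->; rewrite lexx ?hx.
by case: xx => ->; [apply: Or41|apply: Or42].
Qed.

Definition bcont F := forall w, bdry x0 x1 y0 y1 w -> cont F w.

Lemma bcont_h F y : bcont F -> y = y0 \/ y = y1 -> rcont (fun t => F (hseg y t)) x0 x1.
Proof. by move=> Fc yy t tt; apply: ccvg_along (der_hseg y t) _; apply: Fc; exact: bdry_h. Qed.

Lemma bcont_v F x : bcont F -> x = x0 \/ x = x1 -> rcont (fun t => F (vseg x t)) y0 y1.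
Proof. by move=> Fc xx t tt; apply: ccvg_along (der_vseg x t) _; apply: Fc; exact: bdry_v. Qed.

Hint Resolve bcont_h bcont_v : core.

Lemma rintD F G : bcont F -> bcont G ->
  rint (fun w => F w + G w) x0 x1 y0 y1 = rint F x0 x1 y0 y1 + rint G x0 x1 y0 y1.
Proof.
move=> Fc Gc; rewrite /rint !cintD; try (by auto); by ring.
Qed.

Lemma rintZ (k : C) F : bcont F ->
  rint (fun w => k * F w) x0 x1 y0 y1 = k * rint F x0 x1 y0 y1.
Proof.
move=> Fc; rewrite /rint !cintZ; try (by auto); by ring.
Qed.

Lemma rint_eq F G : bcont F -> (forall w, bdry x0 x1 y0 y1 w -> G w = F w) ->
  rint G x0 x1 y0 y1 = rint F x0 x1 y0 y1.
Proof.
move=> Fc FG; rewrite /rint; congr (_ - _ + _ * (_ - _)); apply: cint_eq; auto;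
  by move=> t tt; apply: FG; (apply: bdry_h + apply: bdry_v); auto.
Qed.

(** Each side length occurs on two edges, and every edge contributes the 2 of the mean value
    estimate, whence the 4. *)
Lemma rint_bound F M : bcont F -> (forall w, bdry x0 x1 y0 y1 w -> cabs (F w) <= M) ->
  cabs (rint F x0 x1 y0 y1) <= 4 * M * ((x1 - x0) + (y1 - y0)).
Proof.
move=> Fc FM; rewrite /rint.
have b1 y : y = y0 \/ y = y1 -> cabs (cint (fun t => F (hseg y t)) x0 x1) <= 2 * M * (x1 - x0).
  by move=> yy; apply: cint_bound; auto => t tt; apply: FM; apply: bdry_h.
have b2 x : x = x0 \/ x = x1 -> cabs (cint (fun t => F (vseg x t)) y0 y1) <= 2 * M * (y1 - y0).
  by move=> xx; apply: cint_bound; auto => t tt; apply: FM; apply: bdry_v.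
apply: le_trans (cabsD _ _) _; rewrite cabsM cabsi mul1r.
move: (b1 y0 (or_introl erefl)) (b1 y1 (or_intror erefl)).
move: (b2 x0 (or_introl erefl)) (b2 x1 (or_intror erefl)).
set p := cint _ _ _; set q := cint _ _ _; set r := cint _ _ _; set s := cint _ _ _.
move=> h1 h2 h3 h4.
have := cabsD r (- s); have := cabsD q (- p); rewrite !cabsN; lra.
Qed.

Lemma rint_prim F (P : C -> C) :
  (forall w, bdry x0 x1 y0 y1 w -> der id P w (F w)) -> rint F x0 x1 y0 y1 = 0.
Proof.
move=> dP; rewrite /rint.
have e1 y : y = y0 \/ y = y1 ->
    cint (fun t => F (hseg y t)) x0 x1 = P (hseg y x1) - P (hseg y x0).
  move=> yy; apply: (@cint_prim _ _ (fun t => P (hseg y t))) => // t tt.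
  rewrite -[F _]mulr1; apply: (der_comp id (der_hseg y t)); apply: dP; exact: bdry_h.
have e2 x : x = x0 \/ x = x1 ->
    cint (fun t => F (vseg x t)) y0 y1 = P (vseg x y1) / 'i%C - P (vseg x y0) / 'i%C.
  move=> xx; apply: (@cint_prim _ _ (fun t => P (vseg x t) / 'i%C)) => // t tt.
  have i0 : 'i%C != 0 :> C by rewrite -cabs_eq0 cabsi oner_eq0.
  have h := der_comp id (der_vseg x t) (dP _ (bdry_v xx tt)).
  have := derZ ('i%C)^-1 h; rewrite [_ * 'i%C]mulrC mulKf//.
  by apply: der_eq => s; rewrite mulrC.
rewrite !e1 ?e2; try tauto.
have i0 : 'i%C != 0 :> C by rewrite -cabs_eq0 cabsi oner_eq0.
by rewrite /hseg /vseg; field.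
Qed.

End Edges.

Definition rectcont F x0 x1 y0 y1 := forall w, rect x0 x1 y0 y1 w -> cont F w.

Lemma rint_splitx F x0 m x1 y0 y1 : x0 <= m -> m <= x1 -> y0 <= y1 ->
  rectcont F x0 x1 y0 y1 ->
  rint F x0 x1 y0 y1 = rint F x0 m y0 y1 + rint F m x1 y0 y1.
Proof.
move=> h1 h2 h3 Fc; have h4 := le_trans h1 h2.
have bc : bcont x0 x1 y0 y1 F by move=> w [/Fc].
rewrite /rint (@cint_split _ (fun t => F (hseg y0 t)) x0 m x1)//; last first.
  by apply: (@bcont_h x0 x1 y0 y1); auto.
rewrite (@cint_split _ (fun t => F (hseg y1 t)) x0 m x1)//; last first.
  by apply: (@bcont_h x0 x1 y0 y1); auto.
by ring.
Qed.

Lemma rint_splity F x0 x1 y0 m y1 : y0 <= m -> m <= y1 -> x0 <= x1 ->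
  rectcont F x0 x1 y0 y1 ->
  rint F x0 x1 y0 y1 = rint F x0 x1 y0 m + rint F x0 x1 m y1.
Proof.
move=> h1 h2 h3 Fc; have h4 := le_trans h1 h2.
have bc : bcont x0 x1 y0 y1 F by move=> w [/Fc].
rewrite /rint (@cint_split _ (fun t => F (vseg x0 t)) y0 m y1)//; last first.
  by apply: (@bcont_v x0 x1 y0 y1); auto.
rewrite (@cint_split _ (fun t => F (vseg x1 t)) y0 m y1)//; last first.
  by apply: (@bcont_v x0 x1 y0 y1); auto.
by ring.
Qed.

Lemma rectcontS F x0 x1 y0 y1 a b c d : x0 <= a -> b <= x1 -> y0 <= c -> d <= y1 ->
  rectcont F x0 x1 y0 y1 -> rectcont F a b c d.
Proof.
move=> h1 h2 h3 h4 Fc w [/andP[k1 k2] /andP[k3 k4]]; apply: Fc; split; apply/andP; split; lra.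
Qed.

Lemma half_pow_small (x e : R) : 0 < e -> exists n, x / 2 ^+ n < e.
Proof.
move=> e0; have [n hn] : exists n, `|x| / e < n%:R.
  by exists (Num.bound (`|x| / e)); apply: archi_boundP; rewrite divr_ge0// ltW.
exists n; rewrite ltr_pdivrMr ?exprn_gt0//.
move: hn; rewrite ltr_pdivrMr// => hn.
apply: (le_lt_trans (ler_norm x)); apply: (lt_le_trans hn); rewrite mulrC ler_wpM2l ?(ltW e0)//.
by rewrite -natrX ler_nat ltnW// ltn_expl.
Qed.

(** If [P] failed, it would fail on nested rectangles with sides halved each time; they shrink to a
    point, where the local hypothesis refutes this. The property is arbitrary because Goursat's
    lemma and the boundedness of continuous functions both use the argument. *)
Lemma bisection (P : R -> R -> R -> R -> Prop) x0 x1 y0 y1 : x0 <= x1 -> y0 <= y1 ->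
  (forall a b c d, x0 <= a -> a <= b -> b <= x1 -> y0 <= c -> c <= d -> d <= y1 ->
    P a ((a + b) / 2) c ((c + d) / 2) -> P ((a + b) / 2) b c ((c + d) / 2) ->
    P a ((a + b) / 2) ((c + d) / 2) d -> P ((a + b) / 2) b ((c + d) / 2) d ->
    P a b c d) ->
  (forall p q, x0 <= p <= x1 -> y0 <= q <= y1 -> exists2 e : R, 0 < e &
    forall a b c d, x0 <= a -> a <= p <= b -> b <= x1 -> y0 <= c -> c <= q <= d -> d <= y1 ->
      b - a < e -> d - c < e -> P a b c d) ->
  P x0 x1 y0 y1.
Proof.
move=> hx hy hP hloc; apply: contrapT => nP.
pose ok (s : R * R * R * R) := let: (a, b, c, d) := s in
  [/\ x0 <= a, a <= b & b <= x1] /\ [/\ y0 <= c, c <= d & d <= y1] /\ ~ P a b c d.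
pose sub (s t : R * R * R * R) := let: (a, b, c, d) := s in let: (a', b', c', d') := t in
  [/\ a <= a', b' <= b, c <= c' & d' <= d] /\
  (b' - a' = (b - a) / 2 /\ d' - c' = (d - c) / 2).
have step s : ok s -> exists t, ok t /\ sub s t.
  case: s => [[[a b] c] d] /= [[h1 h2 h3] [[k1 k2 k3] nPs]].
  apply: contrapT => none; apply: nPs; apply: hP => //; apply: contrapT => n0; apply: none;
  [exists (a, (a + b) / 2, c, (c + d) / 2) | exists ((a + b) / 2, b, c, (c + d) / 2)
  |exists (a, (a + b) / 2, (c + d) / 2, d) | exists ((a + b) / 2, b, (c + d) / 2, d)];
  rewrite /ok /sub; (split; [split; [|split; [|exact: n0]]|]); clear -h1 h2 h3 k1 k2 k3;
  do ?split; lra.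
pose next s := xget s [set t | ok t /\ sub s t].
have nextP s : ok s -> ok (next s) /\ sub s (next s).
  by move=> /step[t ht]; rewrite /next; case: xgetP => [u _|/(_ t)].
pose u n := iter n next (x0, x1, y0, y1).
have uok n : ok (u n).
  elim: n => [|n IH]; last by rewrite /u iterS; exact: (nextP _ IH).1.
  by split; [split|split; [split|]].
have usub n : sub (u n) (u n.+1) by rewrite /u iterS; exact: (nextP _ (uok n)).2.
pose A n := (u n).1.1.1; pose B n := (u n).1.1.2; pose D n := (u n).1.2; pose E n := (u n).2.
have uE n : u n = (A n, B n, D n, E n) by rewrite /A /B /D /E; case: (u n) => [[[? ?] ?] ?].
have okn n : [/\ x0 <= A n, A n <= B n & B n <= x1] /\ [/\ y0 <= D n, D n <= E n & E n <= y1] /\ ~ P (A n) (B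
    n) (D n) (E n).
  by have := uok n; rewrite uE.
have subn n : [/\ A n <= A n.+1, B n.+1 <= B n, D n <= D n.+1 & E n.+1 <= E n] /\
  (B n.+1 - A n.+1 = (B n - A n) / 2 /\ E n.+1 - D n.+1 = (E n - D n) / 2).
  by have := usub n; rewrite !uE.
have size1 n : B n - A n = (x1 - x0) / 2 ^+ n.
  elim: n => [|n IH]; first by rewrite expr0 divr1.
  have [_ [-> _]] := subn n; rewrite IH exprSr invfM; ring.
have size2 n : E n - D n = (y1 - y0) / 2 ^+ n.
  elim: n => [|n IH]; first by rewrite expr0 divr1.
  have [_ [_ ->]] := subn n; rewrite IH exprSr invfM; ring.
have mono (v : nat -> R) : (forall n, v n <= v n.+1) -> forall m n, (m <= n)%N -> v m <= v n.
  by move=> hv m n; elim: n => [|n IH]; [rewrite leqn0 => /eqP -> | rewrite leq_eqVlt => /orP[/eqP->//|/IH h];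
      exact: le_trans h (hv n)].
have nest (v w : nat -> R) : (forall n, v n <= v n.+1) -> (forall n, w n.+1 <= w n) ->
    (forall n, v n <= w n) -> exists p, forall n, v n <= p <= w n.
  move=> hv hw vw.
  have vw' m n : v m <= w n.
    have hNw : forall n, (- w n) <= - w n.+1 by move=> k; rewrite lerN2.
    have [mn|nm] := leqP m n; first exact: le_trans (mono _ hv _ _ mn) (vw n).
    apply: le_trans (vw m) _; rewrite -lerN2; exact: mono hNw _ _ (ltnW nm).
  have hub m : ubound (range v) (w m) by move=> _ [n _ <-].
  exists (sup (range v)) => n; apply/andP; split.
    by apply: ub_le_sup; [exists (w 0%N); exact: hub | exists n].
  by apply: ge_sup; [exists (v 0%N), 0%N | exact: hub].
have [p hp] : exists p, forall n, A n <= p <= B n.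
  by apply: nest => n; [have [[]]:= subn n|have [[]]:= subn n|have [[]]:= okn n].
have [q hq] : exists q, forall n, D n <= q <= E n.
  by apply: nest => n; [have [[]]:= subn n|have [[]]:= subn n|have [_ [[]]]:= okn n].
have [e e0 he] := hloc p q (hp 0%N) (hq 0%N).
have [n1 hn1] := half_pow_small (x1 - x0) e0.
have [n2 hn2] := half_pow_small (y1 - y0) e0.
pose n := maxn n1 n2.
have small (x : R) m : 0 <= x -> x / 2 ^+ m < e -> (m <= n)%N -> x / 2 ^+ n < e.
  move=> x00 xm mn; apply: le_lt_trans xm; rewrite ler_wpM2l// lef_pV2 ?posrE ?exprn_gt0//.
  by rewrite ler_weXn2l// ler1n.
have [[h1 h2 h3] [[k1 k2 k3] npn]] := okn n.
apply: npn; apply: he => //.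
  by rewrite size1; apply: small hn1 _; rewrite ?subr_ge0 ?leq_maxl.
by rewrite size2; apply: small hn2 _; rewrite ?subr_ge0 ?leq_maxr.
Qed.

Lemma rect_dist a b c d p w : rect a b c d p -> rect a b c d w ->
  cabs (w - p) <= (b - a) + (d - c).
Proof.
move=> [/andP[h1 h2] /andP[h3 h4]] [/andP[k1 k2] /andP[k3 k4]].
apply: le_trans (cabs_leReIm _) _; rewrite ReD ImD ReN ImN; apply: lerD;
  rewrite ler_norml; apply/andP; split; lra.
Qed.

(** The bound [e * (width + height)^2] passes from the four quarters to the whole, because each
    quarter carries a quarter of it. Near a point, [F] differs from its affine part, which has a
    primitive, by an error that satisfies this bound. *)
Lemma goursat F x0 x1 y0 y1 : x0 <= x1 -> y0 <= y1 ->
  (forall w, rect x0 x1 y0 y1 w -> exists l, der id F w l) -> rint F x0 x1 y0 y1 = 0.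
Proof.
move=> hx hy dF.
have Fc : rectcont F x0 x1 y0 y1 by move=> w /dF[l]; exact: der_cont.
suff P e : 0 < e -> cabs (rint F x0 x1 y0 y1) <= e * ((x1 - x0) + (y1 - y0)) ^+ 2.
  apply/eqP; rewrite -cabs_eq0 eq_le cabs_ge0 andbT.
  set s := _ ^+ 2 in P; have s0 : 0 <= s by exact: sqr_ge0.
  apply/ler_addgt0Pr => e e0; rewrite add0r.
  have s1 : 0 < s + 1 by lra.
  apply: le_trans (P (e / (s + 1)) _) _; first by rewrite divr_gt0.
  by rewrite mulrAC ler_pdivrMr//; lra.
move=> e0; apply: (@bisection (fun a b c d => cabs (rint F a b c d) <= e * ((b - a) + (d - c)) ^+ 2)) => //.
  move=> a b c d h1 h2 h3 k1 k2 k3 q1 q2 q3 q4.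
  have Fc' : rectcont F a b c d by apply: rectcontS Fc.
  rewrite (@rint_splitx F a ((a + b) / 2) b c d)//; try lra.
  rewrite (@rint_splity F a ((a + b) / 2) c ((c + d) / 2) d)//; try lra; last first.
    by apply: rectcontS Fc'; lra.
  rewrite (@rint_splity F ((a + b) / 2) b c ((c + d) / 2) d)//; try lra; last first.
    by apply: rectcontS Fc'; lra.
  move: q1 q2 q3 q4.
  set r1 := rint _ _ _ _ _; set r2 := rint _ _ _ _ _; set r3 := rint _ _ _ _ _.
  set r4 := rint _ _ _ _ _ => q1 q2 q3 q4.
  have := cabsD (r1 + r3) (r2 + r4); have := cabsD r1 r3; have := cabsD r2 r4.
  have E1 : (a + b) / 2 - a = (b - a) / 2 by field.
  have E2 : b - (a + b) / 2 = (b - a) / 2 by field.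
  have E3 : (c + d) / 2 - c = (d - c) / 2 by field.
  have E4 : d - (c + d) / 2 = (d - c) / 2 by field.
  have E5 : e * ((b - a) / 2 + (d - c) / 2) ^+ 2 = e * (b - a + (d - c)) ^+ 2 / 4 by field.
  move: q1 q2 q3 q4; rewrite E1 E2 E3 E4 E5; clear; lra.
move=> p q hp hq; pose z : C := (p +i* q)%C.
have [l /derP dz] := dF z (conj hp hq).
(* The 1 / 4 absorbs the constant of [rint_bound]; one factor width + height comes from that lemma
   and the other from [|w - z|]. *)
have e4 : 0 < e / 4 by rewrite divr_gt0.
have [r r0 hr] := dz _ e4; exists (r / 2); first by rewrite divr_gt0.
move=> a b c d h1 h2 h3 k1 k2 k3 ba dc.
have ab : a <= b by move/andP: h2 => []; exact: le_trans.
have cd : c <= d by move/andP: k2 => []; exact: le_trans.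
pose L w := F z + l * (w - z).
have Lc w : cont L w.
  apply: ccvgD; first exact: ccvg_cst.
  apply: ccvgM; first exact: ccvg_cst.
  by apply: ccvgB; [exact: ccvg_emb|exact: ccvg_cst].
have Fb : bcont a b c d F.
  by move=> w [[/andP[? ?] /andP[? ?]] _]; apply: Fc; split; apply/andP; split; lra.
have L0 : rint L a b c d = 0.
  apply: (@rint_prim a b c d ab cd L (fun w => F z * w + l / 2 * (w - z) ^+ 2)) => w _.
  have := derD (derZ (F z) (der_emb id w)) (derZ (l / 2) (derX 2 (derB (der_emb id w) (der_cst id z w)))).
  by congr der; rewrite /L /= expr1; field.
have -> : rint F a b c d = rint (fun w => F w + -1 * L w) a b c d.
  rewrite rintD ?rintZ ?L0 ?mulr0 ?addr0//.
  by move=> w _; exact: (ccvgM (ccvg_cst (-1)) (Lc w)).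
apply: le_trans (@rint_bound a b c d ab cd _ (e / 4 * ((b - a) + (d - c))) _ _) _.
- move=> w bw; apply: ccvgD; first exact: Fb.
  exact: (ccvgM (ccvg_cst (-1)) (Lc w)).
- move=> w [rw _]; have zr : rect a b c d z by split.
  have wz := rect_dist zr rw.
  have -> : F w + -1 * L w = F w - F z - l * (w - z) by rewrite /L; ring.
  apply: le_trans (hr w _) _; first by rewrite /=; lra.
  by rewrite ler_wpM2l// ltW.
by rewrite expr2; lra.
Qed.

End Rectangle.

(** * Cauchy's formula on a square and the resulting estimates *)

Section CauchyFormula.
Variable R : realType.
Local Notation C := R[i].
Local Notation rc := (real_complex R).
Implicit Types (f F : C -> C) (z w : C).

Local Notation Q := (rect (-1 : R) 1 (-1) 1).
Local Notation dQ := (bdry (-1 : R) 1 (-1) 1).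
Local Notation int F := (rint F (-1) 1 (-1) 1).

Let h11 : (-1 : R) <= 1. Proof. lra. Qed.

Lemma contD F f w : cont F w -> cont f w -> cont (fun x => F x + f x) w.
Proof. exact: ccvgD. Qed.
Lemma contB F f w : cont F w -> cont f w -> cont (fun x => F x - f x) w.
Proof. exact: ccvgB. Qed.
Lemma contM F f w : cont F w -> cont f w -> cont (fun x => F x * f x) w.
Proof. exact: ccvgM. Qed.
Lemma cont_cst a w : cont (fun=> a) w.
Proof. exact: ccvg_cst. Qed.
Lemma contV F w : F w != 0 -> cont F w -> cont (fun x => (F x)^-1) w.
Proof. exact: ccvgV. Qed.
Lemma contX F n w : cont F w -> cont (fun x => F x ^+ n) w.
Proof. exact: ccvgX. Qed.
Lemma cont_shift z w : cont (fun x => x - z) w.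
Proof. by apply: ccvgB; [exact: ccvg_emb|exact: ccvg_cst]. Qed.

Lemma der_shift a w : der id (fun x => x - a) w 1.
Proof. by have := derB (der_emb id w) (der_cst id a w); rewrite subr0. Qed.

Lemma dQ_ge1 w : dQ w -> 1 <= cabs w.
Proof.
have h1 := absRe_le w; have h2 := absIm_le w.
by case=> _ [] e; rewrite e ?normrN normr1 in h1 h2.
Qed.

Lemma dQ_dist w z : dQ w -> cabs z < 1 / 2 -> 1 / 2 <= cabs (w - z).
Proof. by move=> /dQ_ge1 w1 z1; have := cabs_triB w z; lra. Qed.

Lemma dQ_neq w z : dQ w -> cabs z < 1 / 2 -> w - z != 0.
Proof. by move=> wQ zQ; rewrite -cabs_gt0; have := dQ_dist wQ zQ; lra. Qed.

(** The contour bounds [-1, 1]^2 and z is kept in |z| < 1 / 2, hence at distance at least 1 / 2 from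
    the contour; other discs are reached by rescaling. *)
Definition kern f k z : C := int (fun w => f w / (w - z) ^+ k).

Definition dQcont f := bcont (-1 : R) 1 (-1) 1 f.

Lemma kern_cont f k z : dQcont f -> cabs z < 1 / 2 ->
  dQcont (fun w => f w / (w - z) ^+ k).
Proof.
move=> fc z1 w wQ; apply: contM; first exact: fc.
by apply: contV; [rewrite expf_neq0// dQ_neq|apply/contX/cont_shift].
Qed.

Lemma kern_bound f k z M : dQcont f -> (forall w, dQ w -> cabs (f w) <= M) ->
  cabs z < 1 / 2 -> cabs (kern f k z) <= 16 * 2 ^+ k * M.
Proof.
move=> fc fM z1.
have -> : 16 * 2 ^+ k * M = 4 * (2 ^+ k * M) * ((1 - -1) + (1 - -1)) by ring.
apply: rint_bound => //; first exact: kern_cont.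
move=> w wQ; rewrite cabsM cabsV cabsX.
have d := dQ_dist wQ z1; have d0 : 0 < cabs (w - z) by lra.
have M0 : 0 <= M by apply: le_trans (cabs_ge0 _) (fM _ wQ).
rewrite ler_pdivrMr ?exprn_gt0// mulrAC -exprMn.
apply: le_trans (fM _ wQ) _; rewrite ler_peMl// exprn_ege1//; lra.
Qed.

(* The remainder of the first-order expansion of w -> f w / (w - z)^k in z. *)
Definition krem f k z h : C :=
  int (fun w => f w * (if k == 1%N then 1 else 3 * (w - z) - 2 * h) /
    ((w - z) ^+ k.+1 * (w - (z + h)) ^+ k)).

Lemma kern_expand f k z h : dQcont f -> cabs z < 1 / 2 -> cabs (z + h) < 1 / 2 ->
  k = 1%N \/ k = 2 ->
  kern f k (z + h) = kern f k z + k%:R * h * kern f k.+1 z + h ^+ 2 * krem f k z h.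
Proof.
move=> fc z1 z2 k12.
have cR : dQcont (fun w => f w * (if k == 1%N then 1 else 3 * (w - z) - 2 * h) /
    ((w - z) ^+ k.+1 * (w - (z + h)) ^+ k)).
  move=> w wQ; apply: contM.
    apply: contM; first exact: fc.
    case: (k == 1%N); first exact: cont_cst.
    apply: contB; last exact: cont_cst.
    by apply: contM; [exact: cont_cst|exact: cont_shift].
  apply: contV; first by rewrite mulf_neq0// expf_neq0// dQ_neq.
  by apply: contM; apply/contX/cont_shift.
have c1 := kern_cont k fc z1; have c2 := kern_cont k.+1 fc z1.
have c3 := kern_cont k fc z2.
have cZ a F : dQcont F -> dQcont (fun w => a * F w).
  by move=> Fc w wQ; apply: contM; [exact: cont_cst|exact: Fc].
have cD F G : dQcont F -> dQcont G -> dQcont (fun w => F w + G w).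
  by move=> Fc Gc w wQ; apply: contD; [exact: Fc|exact: Gc].
rewrite /kern /krem -(rintZ h11 h11 _ c2) -(rintZ h11 h11 _ cR).
have cc1 := cZ (k%:R * h) _ c2; have cc2 := cZ (h ^+ 2) _ cR.
have cc3 := cD _ _ c1 cc1.
rewrite -(rintD h11 h11 c1 cc1) -(rintD h11 h11 cc3 cc2).
apply: (rint_eq h11 h11 (cD _ _ cc3 cc2)).
move=> w wQ; have n1 := dQ_neq wQ z1; have n2 := dQ_neq wQ z2.
by case: k12 => -> /=; field; rewrite n1 n2.
Qed.

(** 5120 = 16 * 10 * 32: [rint_bound] on a square of side 2 gives 16, the numerator is at most 3 *
    (5 / 2) + 2 <= 10, and the denominator is at least 2^-5. *)
Lemma krem_bound f k z h M : dQcont f -> (forall w, dQ w -> cabs (f w) <= M) ->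
  cabs z < 1 / 2 -> cabs (z + h) < 1 / 2 -> k = 1%N \/ k = 2 ->
  cabs (krem f k z h) <= 5120 * M.
Proof.
move=> fc fM z1 z2 k12.
have -> : 5120 * M = 4 * (320 * M) * ((1 - -1) + (1 - -1)) by ring.
apply: rint_bound => //.
  move=> w wQ; apply: contM.
    apply: contM; first exact: fc.
    case: (k == 1%N); first exact: cont_cst.
    apply: contB; last exact: cont_cst.
    by apply: contM; [exact: cont_cst|exact: cont_shift].
  apply: contV; first by rewrite mulf_neq0// expf_neq0// dQ_neq.
  by apply: contM; apply/contX/cont_shift.
move=> w wQ; rewrite cabsM cabsV cabsM cabsM !cabsX.
have d1 := dQ_dist wQ z1; have d2 := dQ_dist wQ z2.
have M0 : 0 <= M by apply: le_trans (cabs_ge0 _) (fM _ wQ).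
have hb : cabs h <= 1.
  have -> : h = z + h - z by ring.
  by apply: le_trans (cabsD _ _) _; rewrite cabsN; lra.
have wb : cabs w <= 2.
  apply: le_trans (cabs_leReIm _) _; case: wQ => -[h1 h2] _.
  by rewrite -!ler_norml in h1 h2; lra.
have b1 : cabs (if k == 1%N then 1 else 3 * (w - z) - 2 * h) <= 10.
  case: ifP => _; first by rewrite cabs1; lra.
  apply: le_trans (cabsD _ _) _; rewrite cabsN !cabsM !cabs_nat.
  by have := cabsD w (- z); rewrite cabsN; lra.
rewrite ler_pdivrMr; last by apply: mulr_gt0; apply: exprn_gt0; lra.
apply: (@le_trans _ _ (M * 10)); first by rewrite ler_pM ?cabs_ge0 ?fM.
have p1 : (1 / 2) ^+ k.+1 <= cabs (w - z) ^+ k.+1.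
  by apply: lerXn2r; rewrite ?nnegrE ?cabs_ge0//; lra.
have p2 : (1 / 2) ^+ k <= cabs (w - (z + h)) ^+ k.
  by apply: lerXn2r; rewrite ?nnegrE ?cabs_ge0//; lra.
apply: (@le_trans _ _ (320 * M * ((1 / 2) ^+ k.+1 * (1 / 2) ^+ k))).
  have -> : M * 10 = 320 * M * (1 / 32) by field.
  apply: ler_wpM2l; first by lra.
  by clear -k12; case: k12 => ->; lra.
have h0 n : 0 <= (1 / 2 : R) ^+ n by apply: exprn_ge0; lra.
apply: ler_wpM2l; first by lra.
by apply: ler_pM.
Qed.

Lemma der_of_bound (g : C -> C) (z l : C) (K : R) :
  (exists2 d : R, 0 < d & forall h, cabs h < d -> cabs (g (z + h) - g z - l * h) <= K * cabs h ^+ 2) ->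
  der id g z l.
Proof.
move=> [d d0 hd]; apply/derP => e e0.
have K1 : 0 < `|K| + 1 by rewrite ltr_wpDl.
exists (Num.min d (e / (`|K| + 1))); first by rewrite lt_min d0 divr_gt0.
move=> s; rewrite lt_min => /andP[h1 h2].
have := hd (s - z) h1; rewrite subrKC => /le_trans; apply.
rewrite expr2 mulrA ler_wpM2r ?cabs_ge0//.
move: h2; rewrite ltr_pdivlMr// => h2.
have := ler_norm K; have := cabs_ge0 (s - z) => c0 kk.
apply: le_trans (ltW h2); rewrite mulrC ler_wpM2l//; lra.
Qed.

Lemma der_kern f k z M : dQcont f -> (forall w, dQ w -> cabs (f w) <= M) ->
  cabs z < 1 / 2 -> k = 1%N \/ k = 2 ->
  der id (kern f k) z (k%:R * kern f k.+1 z).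
Proof.
move=> fc fM z1 k12; apply: (@der_of_bound _ _ _ (5120 * M)).
exists (1 / 2 - cabs z); first by lra.
move=> h hz; have z2 : cabs (z + h) < 1 / 2 by have := cabsD z h; lra.
rewrite (kern_expand fc z1 z2 k12).
have -> : kern f k z + k%:R * h * kern f k.+1 z + h ^+ 2 * krem f k z h - kern f k z -
  k%:R * kern f k.+1 z * h = h ^+ 2 * krem f k z h by ring.
by rewrite cabsM cabsX mulrC ler_wpM2r ?exprn_ge0 ?cabs_ge0// krem_bound.
Qed.

(** The derivative in z is the integral of [(x - z)^-2], which has a primitive along the contour; so
    the value does not depend on z and is computed at 0. *)
Lemma kern1_const z : cabs z < 1 / 2 -> kern (fun=> 1) 1 z = twopii R.
Proof.
move=> z1.
have c1 : dQcont (fun=> 1) by move=> w _; exact: cont_cst.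
have k2 w : cabs w < 1 / 2 -> kern (fun=> 1) 2 w = 0.
  move=> w1; apply: (@rint_prim _ _ _ _ _ h11 h11 _ (fun x => - (x - w)^-1)) => x xQ.
  have nz := dQ_neq xQ w1.
  have := derN (derV (f := fun x => x - w) nz (der_shift w x)).
  by congr der; field.
have k0 : cabs (0 : C) < 1 / 2 by rewrite cabs0; lra.
have e0 : kern (fun=> 1) 1 z = kern (fun=> 1) 1 0.
  have := @der_segment R (kern (fun=> 1) 1) (fun=> 0) 0 z 0.
  rewrite mulr0 mul0r => h; apply/eqP; rewrite -subr_eq0 -cabs_eq0 eq_le cabs_ge0 andbT.
  apply: h => [t /andP[t0 t1]|t _]; last by rewrite cabs0.
  rewrite add0r subr0.
  have tz : cabs (t%:C%C * z) < 1 / 2.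
    rewrite cabsM cabs_real ger0_norm//; apply: le_lt_trans z1.
    by rewrite ler_piMl ?cabs_ge0.
  have := @der_kern (fun=> 1) 1 _ 1 c1 _ tz (or_introl erefl).
  by rewrite k2// mulr0; apply => w _; rewrite cabs1.
rewrite e0 /kern /rint.
pose A := fun t : R => ((1 + t ^+ 2)^-1)%:C%C : C.
have n0 (t : R) : (1 + t ^+ 2 : R) != 0 by rewrite gt_eqF// ltr_wpDr ?sqr_ge0.
have dA (t : R) : der rc (fun s => (atan s)%:C%C) t (A t).
  by apply: der_real; exact: is_derive1_atan.
have iA : cint A (-1) 1 = (pi / 2)%:C%C.
  rewrite (@cint_prim _ _ _ _ _ h11 (fun t _ => dA t)) -rmorphB atanN atan1.
  by congr (_ %:C%C); field.
have rA : rcont A (-1) 1.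
  move=> t _; rewrite inbhs_real; apply: ccvg_real.
  apply: (@cvg_comp _ _ _ (fun s : R => 1 + s ^+ 2)); last first.
    exact: inv_continuous (n0 t).
  by apply: cvgD; [exact: cvg_cst|exact: exprn_continuous].
have invE (a b : R) : a ^+ 2 + b ^+ 2 != 0 ->
    (a +i* b)%C^-1 = ((a ^+ 2 + b ^+ 2)^-1)%:C%C * (a -i* b)%C :> C.
  move=> ab; have abz : (a +i* b)%C != 0 :> C.
    by apply: contra ab; rewrite eq_complex /= => /andP[/eqP -> /eqP ->]; rewrite expr0n addr0.
  apply: (mulfI abz); rewrite mulfV// mulrCA.
  have -> : (a +i* b)%C * (a -i* b)%C = (a ^+ 2 + b ^+ 2)%:C%C :> C.
    by apply: complex_ext => /=; ring.
  by rewrite -rmorphM mulVf// rmorph1.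
have cst1 (a b : C) : cint (fun t => a * (t%:C%C * A t) + b * A t) (-1) 1 =
    a * cint (fun t => t%:C%C * A t) (-1) 1 + b * cint A (-1) 1.
  have rB : rcont (fun t => t%:C%C * A t) (-1) 1.
    by move=> t tt; apply: ccvgM; [exact: ccvg_emb|exact: rA].
  rewrite cintD ?cintZ//.
    by move=> t tt; apply: ccvgM; [exact: ccvg_cst|exact: rB].
  by move=> t tt; apply: ccvgM; [exact: ccvg_cst|exact: rA].
(* On each edge 1 / w is a combination of t / (1 + t^2) and 1 / (1 + t^2). The former cancel between
   opposite edges, so the value [T] is immaterial; the latter are arctangents and add up to 4 times
   [i pi / 2]. *)
set T := cint (fun t => t%:C%C * A t) (-1) 1 in cst1.
have E (g : R -> C) a b : (forall t, g t = a * (t%:C%C * A t) + b * A t) ->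
    cint g (-1) 1 = a * T + b * (pi / 2)%:C%C.
  by move=> gE; rewrite -iA -cst1; congr (cint _ _ _); apply/funext.
have n1 (t : R) : (t ^+ 2 + 1 : R) != 0 by rewrite addrC.
rewrite (E _ 1 'i%C); last first.
  move=> t; rewrite expr1 subr0 mul1r /hseg invE ?sqrrN ?expr1n ?n1// /A [1 + _]addrC.
  by apply: complex_ext => /=; rewrite !(mul0r, mul1r, mulr0, mulr1, subr0, addr0, add0r, opprK); ring.
rewrite (E _ 1 (- 'i%C)); last first.
  move=> t; rewrite expr1 subr0 mul1r /hseg invE ?sqrrN ?expr1n ?n1// /A [1 + _]addrC.
  by apply: complex_ext => /=; ring.
rewrite (E _ (- 'i%C) 1); last first.
  move=> t; rewrite expr1 subr0 mul1r /vseg invE ?sqrrN ?expr1n ?n0// /A.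
  by apply: complex_ext => /=; ring.
rewrite (E _ (- 'i%C) (-1)); last first.
  move=> t; rewrite expr1 subr0 mul1r /vseg invE ?sqrrN ?expr1n ?n0// /A.
  by apply: complex_ext => /=; ring.
rewrite /twopii.
have -> : (2 * pi)%:C%C = 4 * (pi / 2)%:C%C :> C.
  by rewrite -(rmorph_nat (real_complex R)) -rmorphM; congr (_ %:C%C); field.
ring.
Qed.

(** The slope [phi] of [f] at z is differentiable off z and continuous at z, so its integral
    vanishes. As [f w = f z + phi w * (w - z)], what is left is [f z] times the integral of 1 / (w -
    z). *)
Lemma cauchy_formula f z : (forall w, Q w -> exists l, der id f w l) ->
  cabs z < 1 / 2 -> kern f 1 z = twopii R * f z.
Proof.
move=> df z1.
have aRz := absRe_le z; have aIz := absIm_le z.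
rewrite ler_norml in aRz; rewrite ler_norml in aIz.
move/andP: aRz => [r1 r2]; move/andP: aIz => [i1 i2].
have zQ : Q z by split; apply/andP; split; lra.
have [l dz] := df z zQ.
case: (dz) => phi [phic phil fE].
have dphi w : Q w -> w != z -> exists l', der id phi w l'.
  move=> wQ wz; have [l' dw] := df w wQ.
  have wz0 : w - z != 0 by rewrite subr_eq0.
  eexists; apply: der_near (der_div (g := fun s => s - z) wz0 (derB dw (der_cst id (f z) w)) (der_shift z w)).
  exists (cabs (w - z)); first by rewrite cabs_gt0.
  move=> s sw; have sz : s - z != 0.
    apply/eqP => sz; move: sw.
    have -> : s - w = - (w - z) by rewrite -[s](subrK z) sz; ring.
    by rewrite cabsN ltxx.
  by rewrite fE; field.
have pc w : Q w -> cont phi w.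
  move=> wQ; have [->|wz] := eqVneq w z; first exact: phic.
  by have [l' h] := dphi w wQ wz; exact: der_cont h.
have I0 : int phi = 0.
  have [d d0 hd] := phic 1 ltr01.
  apply/eqP; rewrite -cabs_eq0 eq_le cabs_ge0 andbT; apply/ler_addgt0Pr => e e0.
  rewrite add0r.
  have M0 : 0 < cabs l + 1 by have := cabs_ge0 l; lra.
  (* Half the side of a square cut out around z: [1 / 4] keeps it inside [-1, 1]^2, [d / 8] keeps it
     where [|phi| <= |l| + 1], and the last entry makes the bound [16 * (|l| + 1) * s] at most
     [e]. *)
  pose s := Num.min (1 / 4) (Num.min (d / 8) (e / (16 * (cabs l + 1)))).
  have s0 : 0 < s by rewrite !lt_min !divr_gt0// mulr_gt0.
  have s1 : s <= 1 / 4 by rewrite /s ge_min lexx.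
  have s2 : s <= d / 8 by rewrite /s !ge_min lexx orbT.
  have s3 : s <= e / (16 * (cabs l + 1)) by rewrite /s !ge_min lexx !orbT.
  set x := complex.Re z in r1 r2; set y := complex.Im z in i1 i2.
  have G a b c' d' : -1 <= a -> a <= b -> b <= 1 -> -1 <= c' -> c' <= d' -> d' <= 1 ->
      [\/ x < a, b < x, y < c' | d' < y] -> rint phi a b c' d' = 0.
    move=> g1 g2 g3 g4 g5 g6 g7; apply: goursat => // w [/andP[k1 k2] /andP[k3 k4]].
    apply: dphi; first by split; apply/andP; split; lra.
    by apply/eqP => wz; move: k1 k2 k3 k4 g7; rewrite wz -/x -/y => k1 k2 k3 k4 []; lra.
  have Rc a b c' d' : -1 <= a -> b <= 1 -> -1 <= c' -> d' <= 1 -> rectcont phi a b c' d'.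
    move=> g1 g3 g4 g6 w [/andP[k1 k2] /andP[k3 k4]]; apply: pc; split; apply/andP; split; lra.
  have sx1 : int phi = rint phi (-1) (x - s) (-1) 1 + rint phi (x - s) 1 (-1) 1.
    by apply: rint_splitx; [lra|lra|lra|apply: Rc; lra].
  have sx2 : rint phi (x - s) 1 (-1) 1 = rint phi (x - s) (x + s) (-1) 1 + rint phi (x + s) 1 (-1) 1.
    by apply: rint_splitx; [lra|lra|lra|apply: Rc; lra].
  have sy1 : rint phi (x - s) (x + s) (-1) 1 =
      rint phi (x - s) (x + s) (-1) (y - s) + rint phi (x - s) (x + s) (y - s) 1.
    by apply: rint_splity; [lra|lra|lra|apply: Rc; lra].
  have sy2 : rint phi (x - s) (x + s) (y - s) 1 =
      rint phi (x - s) (x + s) (y - s) (y + s) + rint phi (x - s) (x + s) (y + s) 1.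
    by apply: rint_splity; [lra|lra|lra|apply: Rc; lra].
  have G1 : rint phi (-1) (x - s) (-1) 1 = 0 by apply: G; [lra|lra|lra|lra|lra|lra|apply: Or42; lra].
  have G2 : rint phi (x + s) 1 (-1) 1 = 0 by apply: G; [lra|lra|lra|lra|lra|lra|apply: Or41; lra].
  have G3 : rint phi (x - s) (x + s) (-1) (y - s) = 0.
    by apply: G; [lra|lra|lra|lra|lra|lra|apply: Or44; lra].
  have G4 : rint phi (x - s) (x + s) (y + s) 1 = 0.
    by apply: G; [lra|lra|lra|lra|lra|lra|apply: Or43; lra].
  rewrite sx1 sx2 sy1 sy2 G1 G2 G3 G4.
  rewrite !add0r !addr0.
  have b : cabs (rint phi (x - s) (x + s) (y - s) (y + s)) <=
      4 * (cabs l + 1) * ((x + s - (x - s)) + (y + s - (y - s))).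
    apply: rint_bound; try lra.
      by move=> w [rw _]; apply: (Rc (x - s) (x + s) (y - s) (y + s)) => //; lra.
    move=> w [rw _].
    have zr : rect (x - s) (x + s) (y - s) (y + s) z by split; apply/andP; split; lra.
    have wz : cabs (w - z) < d.
      apply: le_lt_trans (rect_dist zr rw) _;
      have -> : x + s - (x - s) + (y + s - (y - s)) = 4 * s by ring.
      lra.
    have := hd w wz; rewrite phil; have := cabs_triB (phi w) l; lra.
  apply: le_trans b _.
  have -> : 4 * (cabs l + 1) * (x + s - (x - s) + (y + s - (y - s))) = s * (16 * (cabs l + 1)) by ring.
  by rewrite -ler_pdivlMr// mulr_gt0.
have fc : dQcont f by move=> w [/df[l' h] _]; exact: der_cont h.
have c1 : dQcont (fun=> 1) by move=> w _; exact: cont_cst.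
rewrite -(kern1_const z1) mulrC /kern -(rintZ h11 h11 _ (kern_cont 1 c1 z1)).
have pd : dQcont phi by move=> w [/pc].
rewrite -[RHS]addr0 -I0 -rintD//.
  apply: rint_eq => //.
    move=> w wQ; apply: contD; last by apply: pd.
    by apply: contM; [exact: cont_cst|exact: kern_cont].
  by move=> w wQ; have nz := dQ_neq wQ z1; rewrite !expr1 fE; field.
by move=> w wQ; apply: contM; [exact: cont_cst|exact: kern_cont].
Qed.

(** Boundedness passes from the quarters to the whole and holds near every point of continuity, so
    bisection plays the part of compactness. *)
Lemma rect_bounded F x0 x1 y0 y1 : x0 <= x1 -> y0 <= y1 -> rectcont F x0 x1 y0 y1 ->
  exists M : R, forall w, rect x0 x1 y0 y1 w -> cabs (F w) <= M.
Proof.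
move=> hx hy Fc; apply: (@bisection _ (fun a b c d => exists M : R, forall w, rect a b c d w -> cabs (F w) <= M)) => //.
  move=> a b c d _ _ _ _ _ _ [M1 h1] [M2 h2] [M3 h3] [M4 h4].
  exists (`|M1| + `|M2| + `|M3| + `|M4|) => w [/andP[w1 w2] /andP[w3 w4]].
  have n1 := normr_ge0 M1; have n2 := normr_ge0 M2; have n3 := normr_ge0 M3; have n4 := normr_ge0 M4.
  have m1 := ler_norm M1; have m2 := ler_norm M2; have m3 := ler_norm M3; have m4 := ler_norm M4.
  have [u|u] := leP (complex.Re w) ((a + b) / 2); have [v|v] := leP (complex.Im w) ((c + d) / 2).
  - by have := h1 w (conj (introT andP (conj w1 u)) (introT andP (conj w3 v))); lra.
  - by have := h3 w (conj (introT andP (conj w1 u)) (introT andP (conj (ltW v) w4))); lra.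
  - by have := h2 w (conj (introT andP (conj (ltW u) w2)) (introT andP (conj w3 v))); lra.
  - by have := h4 w (conj (introT andP (conj (ltW u) w2)) (introT andP (conj (ltW v) w4))); lra.
move=> p q hp hq; have [d d0 hd] := Fc (p +i* q)%C (conj hp hq) 1 ltr01.
exists (d / 2); first by rewrite divr_gt0.
move=> a b c' d' _ ap _ _ cq _ ba dc; exists (cabs (F (p +i* q)%C) + 1) => w wr.
have wz := rect_dist (conj ap cq : rect a b c' d' (p +i* q)%C) wr.
have := hd w; have := cabs_triB (F w) (F (p +i* q)%C) => h1 /(_ _)/wrap[]; last by lra.
by apply: le_lt_trans wz _; lra.
Qed.

Let tp_le1 : cabs (twopii R)^-1 <= 1.
Proof.
rewrite cabsV /twopii cabsM cabsi mulr1 cabs_real invf_le1.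
  by rewrite ger0_norm; have := pi_ge2 R; lra.
by rewrite normr_gt0; have := pi_ge2 R; lra.
Qed.

Let tp0 : twopii R != 0.
Proof.
rewrite -cabs_gt0 /twopii cabsM cabsi mulr1 cabs_real normr_gt0.
by have := pi_ge2 R; lra.
Qed.

Lemma twopii_neq0 : twopii R != 0.
Proof. exact: tp0. Qed.

(** [f1] is Cauchy's integral for the derivative. The constants are those of [kern_bound] with k = 2
    and of [krem_bound], the factor 1 / |2 i pi| being bounded by 1. *)
Lemma cauchy_square f M : (forall w, Q w -> exists l, der id f w l) ->
  (forall w, Q w -> cabs (f w) <= M) ->
  exists f1 : C -> C,
    [/\ forall z, cabs z < 1 / 2 -> der id f z (f1 z),
        exists l, der id f1 0 l,
        cabs (f1 0) <= 64 * M &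
        forall h, cabs h < 1 / 2 -> cabs (f h - f 0 - f1 0 * h) <= 5120 * M * cabs h ^+ 2].
Proof.
move=> df fM.
have fc : dQcont f by move=> w [/df[l' h] _]; exact: der_cont h.
have fM' w : dQ w -> cabs (f w) <= M by case=> /fM.
have M0 : 0 <= M.
  by apply: le_trans (cabs_ge0 (f 0)) (fM 0 _); split; rewrite /= lerN10 ler01.
have fE z : cabs z < 1 / 2 -> f z = (twopii R)^-1 * kern f 1 z.
  by move=> z1; rewrite cauchy_formula// mulKf.
have k0 : cabs (0 : C) < 1 / 2 by rewrite cabs0; lra.
exists (fun z => (twopii R)^-1 * kern f 2 z); split.
- move=> z z1; apply: (@der_near _ _ _ (fun z => (twopii R)^-1 * kern f 1 z)).
    exists (1 / 2 - cabs z); first by lra.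
    by move=> s hs; rewrite fE//; have := cabs_triB s z; lra.
  by apply: derZ; have := der_kern fc fM' z1 (or_introl erefl); rewrite mul1r.
- eexists; apply: derZ; exact: der_kern fc fM' k0 (or_intror erefl).
- rewrite cabsM; apply: (@le_trans _ _ (1 * (64 * M))); last by lra.
  apply: ler_pM; rewrite ?cabs_ge0//.
  by apply: le_trans (kern_bound 2 fc fM' k0) _; lra.
- move=> h hh; rewrite !fE//.
  have z2 : cabs (0 + h) < 1 / 2 by rewrite add0r.
  have := kern_expand fc k0 z2 (or_introl erefl); rewrite add0r mul1r => ->.
  have -> : (twopii R)^-1 * (kern f 1 0 + h * kern f 2 0 + h ^+ 2 * krem f 1 0 h) -
     (twopii R)^-1 * kern f 1 0 - (twopii R)^-1 * kern f 2 0 * h =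
     (twopii R)^-1 * (krem f 1 0 h * h ^+ 2) by ring.
  rewrite cabsM cabsM cabsX; apply: (@le_trans _ _ (1 * (5120 * M * cabs h ^+ 2))); last by rewrite mul1r.
  apply: ler_pM; rewrite ?cabs_ge0 ?mulr_ge0 ?exprn_ge0 ?cabs_ge0//.
  by apply: ler_wpM2r; [rewrite exprn_ge0 ?cabs_ge0|exact: krem_bound fc fM' k0 z2 (or_introl erefl)].
Qed.

(** This is the square case after scaling by [r]: the square of half-side r around [z0] lies in the
    disc of radius 2 r, as |Re| + |Im| <= 2 on [-1, 1]^2. *)
Lemma cauchy_disc f z0 (r M : R) : 0 < r ->
  (forall w, cabs (w - z0) <= 2 * r -> exists l, der id f w l) ->
  (forall w, cabs (w - z0) <= 2 * r -> cabs (f w) <= M) ->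
  exists f1 : C -> C,
    [/\ forall z, cabs (z - z0) < r / 2 -> der id f z (f1 z),
        exists l, der id f1 z0 l,
        cabs (f1 z0) <= 64 / r * M &
        forall h, cabs h < r / 2 ->
          cabs (f (z0 + h) - f z0 - f1 z0 * h) <= 5120 / r ^+ 2 * M * cabs h ^+ 2].
Proof.
move=> r0 df fM; pose rr : C := r%:C%C.
have rr0 : rr != 0 by rewrite -cabs_gt0 cabs_real normr_gt0 gt_eqF.
have crr : cabs rr = r by rewrite cabs_real ger0_norm// ltW.
pose g w := f (z0 + rr * w).
have inQ w : Q w -> cabs (z0 + rr * w - z0) <= 2 * r.
  rewrite addrAC subrr add0r cabsM crr mulrC => -[h1 h2].
  rewrite ler_pM2r//; apply: le_trans (cabs_leReIm _) _.
  by rewrite -!ler_norml in h1 h2; lra.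
have daff w : der id (fun w => z0 + rr * w) w rr.
  by have := derD (der_cst id z0 w) (derZ rr (der_emb id w)); rewrite add0r mulr1.
have [||g1 [dg [l2 dg1] g1M gh]] := @cauchy_square g M.
- move=> w /inQ/df[l dl]; exists (l * rr); exact: (der_comp id (daff w) dl).
- by move=> w /inQ/fM.
have daff' w : der id (fun w => rr^-1 * (w - z0)) w rr^-1.
  by have := derZ rr^-1 (der_shift z0 w); rewrite mulr1.
have gE w : f w = g (rr^-1 * (w - z0)) by rewrite /g mulVKf// subrKC.
exists (fun z => rr^-1 * g1 (rr^-1 * (z - z0))); split.
- move=> z zz.
  have h1 : cabs (rr^-1 * (z - z0)) < 1 / 2.
    by rewrite cabsM cabsV crr mulrC ltr_pdivrMr//; lra.
  have := der_comp id (daff' z) (dg _ h1).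
  by rewrite mulrC; apply: der_eq => s; rewrite /= -gE.
- exists (rr^-1 * (l2 * rr^-1)); apply: derZ.
  apply: (der_comp id (daff' z0)); by rewrite subrr mulr0.
- rewrite subrr mulr0 cabsM cabsV crr.
  apply: (@le_trans _ _ (r^-1 * (64 * M))); first by rewrite ler_wpM2l// invr_ge0 ltW.
  by rewrite le_eqVlt; apply/orP; left; apply/eqP; ring.
- move=> h hh.
  have h1 : cabs (rr^-1 * h) < 1 / 2.
    by rewrite cabsM cabsV crr mulrC ltr_pdivrMr//; lra.
  have := gh _ h1; rewrite /g mulVKf// mulr0 addr0 subrr mulr0.
  rewrite cabsM cabsV crr.
  have -> : g1 0 * (rr^-1 * h) = rr^-1 * g1 0 * h by ring.
  move=> /le_trans; apply; rewrite le_eqVlt; apply/orP; left; apply/eqP.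
  by field; rewrite gt_eqF.
Qed.

End CauchyFormula.

(** * Cauchy's estimates on the half-plane; derivatives are holomorphic *)

Section Holomorphy.
Variable R : realType.
Local Notation C := R[i].
Implicit Types (f g : uhp R -> C) (z : uhp R).
Local Notation uder := (der (@uhpval R)).

Lemma disc_in_uhp z (r : R) (w : C) : 0 < r -> 4 * r <= complex.Im (uhpval z) ->
  cabs (w - uhpval z) <= 2 * r -> 0 < complex.Im w.
Proof.
move=> r0 rz wz; have := absIm_le (w - uhpval z); rewrite ImD ImN ler_norml.
by move=> /andP[h _]; lra.
Qed.

Lemma uhp_cauchy f z (r M : R) : 0 < r -> 4 * r <= complex.Im (uhpval z) -> holomorphic f ->
  (forall w : uhp R, cabs (uhpval w - uhpval z) <= 2 * r -> cabs (f w) <= M) ->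
  cabs (cderiv f z) <= 64 / r * M /\
  forall w : uhp R, cabs (uhpval w - uhpval z) < r / 2 ->
    cabs (f w - f z - cderiv f z * (uhpval w - uhpval z)) <=
      5120 / r ^+ 2 * M * cabs (uhpval w - uhpval z) ^+ 2.
Proof.
move=> r0 rz hf fM.
have [||f1 [df _ f1M fh]] := @cauchy_disc R (extend f) (uhpval z) r M r0.
- move=> w wz; have w0 := disc_in_uhp r0 rz wz.
  exists (cderiv f (MkUhp w0)).
  exact: (proj1 (der_extend f (MkUhp w0) _) (cderivP (MkUhp w0) hf)).
- move=> w wz; have w0 := disc_in_uhp r0 rz wz.
  by rewrite (extend_in f w0); exact: (fM (MkUhp w0)).
have e : cderiv f z = f1 (uhpval z).
  apply: cderivE; apply/der_extend; apply: df.
  by rewrite subrr cabs0 divr_gt0.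
rewrite e; split=> // w wz.
by have := fh _ wz; rewrite subrKC !extendE.
Qed.

Lemma holomorphic_cderiv f : holomorphic f -> holomorphic (cderiv f).
Proof.
move=> hf; apply/holomorphicP => z.
pose r := complex.Im (uhpval z) / 4.
have r0 : 0 < r by rewrite divr_gt0// uhp_gt0.
have rz : 4 * r <= complex.Im (uhpval z) by rewrite /r mulrCA divff// mulr1.
have df w : cabs (w - uhpval z) <= 2 * r -> exists l, der id (extend f) w l.
  move=> wz; have w0 := disc_in_uhp r0 rz wz.
  exists (cderiv f (MkUhp w0)).
  exact: (proj1 (der_extend f (MkUhp w0) _) (cderivP (MkUhp w0) hf)).
pose x := complex.Re (uhpval z); pose y := complex.Im (uhpval z).
have y0 : 0 < y by exact: uhp_gt0.
have [M hM] : exists M : R, forall w, rect (x - 2 * r) (x + 2 * r) (y - 2 * r) (y + 2 * r) w -> cabs (extend f w) <= M.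
  apply: rect_bounded; try lra.
  move=> w [/andP[h1 h2] /andP[h3 h4]].
  have w0 : 0 < complex.Im w by move: h3; rewrite /r -/y; lra.
  have := cderivP (MkUhp w0) hf => /der_extend; exact: der_cont.
have [|f1 [df1 [l dl] _ _]] := @cauchy_disc R (extend f) (uhpval z) r M r0 df.
  move=> w wz; apply: hM; have a1 := absRe_le (w - uhpval z); have a2 := absIm_le (w - uhpval z).
  rewrite ReD ReN -/x in a1; rewrite ImD ImN -/y in a2.
  move: (le_trans a1 wz) (le_trans a2 wz); rewrite !ler_norml => /andP[? ?] /andP[? ?].
  by split; apply/andP; split; lra.
exists l; apply/der_extend; apply: der_near dl.
have near : inbhs id (uhpval z) (fun w => cabs (w - uhpval z) < r / 2).
  by exists (r / 2); [rewrite divr_gt0|].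
apply: filterS (filterI (uhp_open z) near) => w [w0 wz].
rewrite (extend_in _ w0); apply/esym/cderivE/der_extend; exact: df1.
Qed.

End Holomorphy.

(** * Locally uniform limits of holomorphic functions *)

Section Weierstrass.
Variable R : realType.
Local Notation C := R[i].
Local Notation uder := (der (@uhpval R)).
Implicit Types (f g : uhp R -> C) (z : uhp R).

Lemma hol_cst (a : C) : holomorphic (fun _ : uhp R => a).
Proof. by apply/holomorphicP => z; exists 0; exact: der_cst. Qed.

Lemma hol_emb : holomorphic (@uhpval R).
Proof. by apply/holomorphicP => z; exists 1; exact: der_emb. Qed.

Lemma holD f g : holomorphic f -> holomorphic g -> holomorphic (fun z => f z + g z).
Proof.
move=> hf hg; apply/holomorphicP => z; eexists.
by apply: derD; exact: cderivP.
Qed.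

Lemma holN f : holomorphic f -> holomorphic (fun z => - f z).
Proof. by move=> hf; apply/holomorphicP => z; eexists; apply/derN/cderivP. Qed.

Lemma holB f g : holomorphic f -> holomorphic g -> holomorphic (fun z => f z - g z).
Proof. by move=> hf /holN; exact: holD. Qed.

Lemma holM f g : holomorphic f -> holomorphic g -> holomorphic (fun z => f z * g z).
Proof.
move=> hf hg; apply/holomorphicP => z; eexists.
by apply: derM; exact: cderivP.
Qed.

Lemma holV f : (forall z, f z != 0) -> holomorphic f -> holomorphic (fun z => (f z)^-1).
Proof.
move=> f0 hf; apply/holomorphicP => z; eexists; apply: derV => //; exact: cderivP.
Qed.

Lemma hol_sum (I : Type) (r : seq I) (F : I -> uhp R -> C) :
  (forall i, holomorphic (F i)) -> holomorphic (fun z => \sum_(i <- r) F i z).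
Proof.
move=> hF; apply/holomorphicP => z; eexists.
by apply: der_sum => i; exact: cderivP.
Qed.

Lemma cderiv_sum (I : Type) (r : seq I) (F : I -> uhp R -> C) z :
  (forall i, holomorphic (F i)) ->
  cderiv (fun z => \sum_(i <- r) F i z) z = \sum_(i <- r) cderiv (F i) z.
Proof. by move=> hF; apply/cderivE/der_sum => i; exact: cderivP. Qed.

Lemma cderivB f g z : holomorphic f -> holomorphic g ->
  cderiv (fun z => f z - g z) z = cderiv f z - cderiv g z.
Proof. by move=> hf hg; apply: cderivE; apply: derB; exact: cderivP. Qed.

Lemma hol_eq f g : (forall z, f z = g z) -> holomorphic f -> holomorphic g.
Proof. by move=> fg; have -> : g = f by apply/funext. Qed.

Definition lucvg (F : nat -> uhp R -> C) f :=
  forall z, exists2 d : R, 0 < d & forall e : R, 0 < e -> \forall n \near \oo,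
    forall w, cabs (uhpval w - uhpval z) < d -> cabs (F n w - f w) <= e.

Lemma lucvg_ccvg F f z : lucvg F f -> ccvg \oo (fun n => F n z) (f z).
Proof.
move=> /(_ z)[d d0 h] e e0; have e2 : 0 < e / 2 by rewrite divr_gt0.
apply: filterS (h _ e2) => n /(_ z); rewrite subrr cabs0 => /(_ d0); lra.
Qed.

(** Cauchy's estimate makes the derivatives a Cauchy sequence. The quadratic remainder bound for
    [F n - F N] is uniform in n, passes to the limit, and shows directly that [f] is differentiable
    with the limit as derivative. *)
Lemma weierstrass F f : (forall n, holomorphic (F n)) -> lucvg F f ->
  holomorphic f /\ forall z, ccvg \oo (fun n => cderiv (F n) z) (cderiv f z).
Proof.
move=> hF Ff.
suff H z : exists l, uder f z l /\ ccvg \oo (fun n => cderiv (F n) z) l.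
  split; first by apply/holomorphicP => z; have [l [dl _]] := H z; exists l.
  by move=> z; have [l [/cderivE -> dl]] := H z.
have [d d0 hd] := Ff z.
pose r := Num.min (complex.Im (uhpval z) / 4) (d / 4).
have r0 : 0 < r by rewrite lt_min !divr_gt0 ?uhp_gt0.
have rz : 4 * r <= complex.Im (uhpval z).
  have : r <= complex.Im (uhpval z) / 4 by rewrite /r ge_min lexx.
  lra.
have rd : 2 * r < d.
  have : r <= d / 4 by rewrite /r ge_min lexx orbT.
  lra.
have est m n (e : R) : (forall w : uhp R, cabs (uhpval w - uhpval z) <= 2 * r -> cabs (F m w - F n w) <= e) ->
   cabs (cderiv (F m) z - cderiv (F n) z) <= 64 / r * e /\
   forall w : uhp R, cabs (uhpval w - uhpval z) < r / 2 ->
    cabs ((F m w - F n w) - (F m z - F n z) - (cderiv (F m) z - cderiv (F n) z) * (uhpval w - uhpval z)) <=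
      5120 / r ^+ 2 * e * cabs (uhpval w - uhpval z) ^+ 2.
  move=> h; have := uhp_cauchy r0 rz (holB (hF m) (hF n)) h.
  by rewrite cderivB.
have unif (e : R) : 0 < e -> exists N, forall n m, (N <= n)%N -> (N <= m)%N -> forall w : uhp R,
    cabs (uhpval w - uhpval z) <= 2 * r -> cabs (F m w - F n w) <= e.
  move=> e0; have e2 : 0 < e / 2 by rewrite divr_gt0.
  have [N _ hN] := hd _ e2; exists N => n m Nn Nm w wz.
  have wd : cabs (uhpval w - uhpval z) < d by exact: le_lt_trans wz rd.
  have := cabsD (F m w - f w) (- (F n w - f w)); rewrite cabsN.
  have -> : F m w - f w - (F n w - f w) = F m w - F n w by ring.
  have := hN n Nn w wd; have := hN m Nm w wd; lra.
pose D n := cderiv (F n) z.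
have DC (e : R) : 0 < e -> exists N, forall n m, (N <= n)%N -> (N <= m)%N -> cabs (D m - D n) <= e.
  move=> e0; have e1 : 0 < e * r / 64 by rewrite divr_gt0// mulr_gt0.
  have [N hN] := unif _ e1; exists N => n m Nn Nm.
  have [h _] := est m n _ (hN n m Nn Nm); apply: le_trans h _.
  by rewrite le_eqVlt; apply/orP; left; apply/eqP; field; rewrite gt_eqF.
have [l Dl] : exists l, ccvg \oo D l.
  have cvgc (p : C -> R) : (forall a b, `|p a - p b| <= cabs (a - b)) -> cvg ((fun n => p (D n)) @ \oo).
    move=> hp; apply/cauchy_cvgP/cauchy_exP => e e0.
    have e2 : 0 < e / 2 by rewrite divr_gt0.
    have [N hN] := DC _ e2; exists (p (D N)); exists N => // m /= Nm.
    rewrite /ball/=; apply: le_lt_trans (hp _ _) _; rewrite cabsB.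
    have := hN N m (leqnn N) Nm; lra.
  have /cvg_ex[a ha] := cvgc (@complex.Re R) (fun a b => ltac:(rewrite -ReN -ReD; exact: absRe_le)).
  have /cvg_ex[b hb] := cvgc (@complex.Im R) (fun a b => ltac:(rewrite -ImN -ImD; exact: absIm_le)).
  by exists (a +i* b)%C; apply: ccvg_ReIm.
exists l; split=> //.
(* One fixed [N] is enough: [F N] is differentiable, and the remainder of [f - F N] is at most
   [K * |h|^2], which is small against |h| whatever [K] is. *)
have [N hN] := unif 1 ltr01.
have /derP dN := cderivP z (hF N).
apply/derP => e e0; have e2 : 0 < e / 2 by rewrite divr_gt0.
have [p p0 hp] := dN _ e2.
have [K K0 KE] : exists2 K : R, 0 < K & 5120 / r ^+ 2 * 1 = K.
  eexists; last reflexivity; rewrite mulr1; apply: divr_gt0; first lra.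
  exact: exprn_gt0.
exists (Num.min (r / 2) (Num.min p (e / 2 / K))).
  by rewrite !lt_min p0 !divr_gt0.
move=> w; rewrite !lt_min => /and3P[w1 w2 w3]; set h := uhpval w - uhpval z in w1 w2 w3 *.
have b1 := hp w w2; rewrite -/h in b1.
have lim : ccvg \oo (fun n => (F n w - F N w) - (F n z - F N z) - (D n - D N) * h)
    ((f w - F N w) - (f z - F N z) - (l - D N) * h).
  apply: ccvgB.
    by apply: ccvgB; (apply: ccvgB; [exact: lucvg_ccvg|exact: ccvg_cst]).
  by apply: ccvgM; [apply: ccvgB => //; exact: ccvg_cst|exact: ccvg_cst].
have b2 := @ccvg_le_lim R _ \oo _ _ _ (K * cabs h ^+ 2) lim.
have {}b2 : cabs ((f w - F N w) - (f z - F N z) - (l - D N) * h) <= K * cabs h ^+ 2.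
  apply: b2; exists N => // n /= Nn.
  by have [_] := est n N 1 (hN N n (leqnn N) Nn); rewrite KE; apply.
have -> : f w - f z - l * h = (F N w - F N z - cderiv (F N) z * h) +
   ((f w - F N w) - (f z - F N z) - (l - D N) * h) by rewrite /D; ring.
apply: le_trans (cabsD _ _) _.
have : K * cabs h ^+ 2 <= e / 2 * cabs h.
  rewrite expr2 mulrA ler_wpM2r ?cabs_ge0// mulrC -ler_pdivlMr//; exact: ltW.
lra.
Qed.

End Weierstrass.

(** * Absolutely summable families *)

Section UnorderedSums.
Variable R : realType.
Local Notation C := R[i].

(** A limit over finite subsets, listed without repetition: the index set carries no order, so
    rearrangements cost nothing. *)
Definition hsum (T : eqType) (c : T -> C) (s : C) : Prop :=
  forall e : R, 0 < e -> exists A : seq T, forall B, uniq B -> {subset A <= B} ->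
    cabs (\sum_(t <- B) c t - s) <= e.

Definition asum (T : eqType) (c : T -> C) (M : R) : Prop :=
  forall A, uniq A -> \sum_(t <- A) cabs (c t) <= M.

Lemma hsum_unique (T : eqType) (c : T -> C) s t : hsum c s -> hsum c t -> s = t.
Proof.
move=> hs ht; apply/eqP; rewrite -subr_eq0 -cabs_eq0 eq_le cabs_ge0 andbT.
apply/ler_addgt0Pr => e e0; rewrite add0r; have e2 : 0 < e / 2 by rewrite divr_gt0.
have [A hA] := hs _ e2; have [B hB] := ht _ e2.
pose D := undup (A ++ B).
have {}hA := hA D (undup_uniq _) (fun x xA => ltac:(by rewrite mem_undup mem_cat xA)).
have {}hB := hB D (undup_uniq _) (fun x xB => ltac:(by rewrite mem_undup mem_cat xB orbT)).
have := cabsD (s - \sum_(t <- D) c t) (\sum_(t <- D) c t - t).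
rewrite addrA subrK cabsB in hA *; lra.
Qed.

Lemma hsumD (T : eqType) (c d : T -> C) s t : hsum c s -> hsum d t ->
  hsum (fun x => c x + d x) (s + t).
Proof.
move=> hs ht e e0; have e2 : 0 < e / 2 by rewrite divr_gt0.
have [A hA] := hs _ e2; have [B hB] := ht _ e2.
exists (A ++ B) => D uD sD.
have {}hA := hA D uD (fun x xA => sD x ltac:(by rewrite mem_cat xA)).
have {}hB := hB D uD (fun x xB => sD x ltac:(by rewrite mem_cat xB orbT)).
rewrite big_split /=; set u := \sum_(_ <- _) _ in hA *; set v := \sum_(_ <- _) _ in hB *.
have -> : u + v - (s + t) = (u - s) + (v - t) by ring.
by apply: le_trans (cabsD _ _) _; lra.
Qed.

Lemma hsumZ (T : eqType) (c : T -> C) a s : hsum c s -> hsum (fun x => a * c x) (a * s).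
Proof.
move=> hs e e0; have a1 : 0 < cabs a + 1 by have := cabs_ge0 a; lra.
have [A hA] := hs (e / (cabs a + 1)) ltac:(by rewrite divr_gt0).
exists A => B uB sB; have := hA B uB sB.
rewrite -mulr_sumr -mulrBr cabsM ler_pdivlMr// mulrC; apply: le_trans.
by apply: ler_wpM2r; [exact: cabs_ge0|lra].
Qed.

Lemma hsumN (T : eqType) (c : T -> C) s : hsum c s -> hsum (fun x => - c x) (- s).
Proof.
move=> /(hsumZ (-1)); rewrite mulN1r; congr hsum.
by apply/funext => x; rewrite mulN1r.
Qed.

Lemma hsumB (T : eqType) (c d : T -> C) s t : hsum c s -> hsum d t ->
  hsum (fun x => c x - d x) (s - t).
Proof. by move=> hs /hsumN; exact: hsumD. Qed.

Lemma hsum_eq (T : eqType) (c d : T -> C) s : (forall x, c x = d x) -> hsum c s -> hsum d s.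
Proof. by move=> cd; have -> : d = c by apply/funext => x; rewrite cd. Qed.

Lemma big_sub_split (T : eqType) (V : nmodType) (d : T -> V) (A B : seq T) :
  uniq A -> uniq B -> {subset A <= B} ->
  \sum_(t <- B) d t = \sum_(t <- A) d t + \sum_(t <- B | t \notin A) d t.
Proof.
move=> uA uB sAB; rewrite (bigID (mem A)) /=; congr (_ + _).
rewrite -big_filter; apply: perm_big; apply: uniq_perm; rewrite ?filter_uniq// => t.
by rewrite mem_filter; case tA: (t \in A) => //=; exact: sAB.
Qed.

Lemma hsum_finite (T : eqType) (c : T -> C) (A : seq T) : uniq A ->
  (forall t, t \notin A -> c t = 0) -> hsum c (\sum_(t <- A) c t).
Proof.
move=> uA c0 e e0; exists A => B uB sB.
rewrite (big_sub_split _ uA uB sB) [X in _ + X - _]big1; last by move=> t /c0.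
by rewrite addr0 subrr cabs0 ltW.
Qed.

Lemma asum_ge0 (T : eqType) (c : T -> C) M : asum c M -> 0 <= M.
Proof. by move=> /(_ [::] erefl); rewrite big_nil. Qed.

Lemma sum_subset (T : eqType) (c : T -> R) (A B : seq T) : (forall t, 0 <= c t) ->
  uniq A -> uniq B -> {subset A <= B} -> \sum_(t <- A) c t <= \sum_(t <- B) c t.
Proof.
by move=> c0 uA uB sAB; rewrite [leRHS](big_sub_split _ uA uB sAB) lerDl sumr_ge0.
Qed.

(** The absolute sum over [A n] is within 2^-n of the supremum, so whatever is added to [A n]
    changes the sum by at most 2^-n. *)
Lemma asum_hsum (T : eqType) (c : T -> C) M : asum c M -> exists2 s, hsum c s & cabs s <= M.
Proof.
move=> cM.
pose S : set R := [set x | exists2 A : seq T, uniq A & x = \sum_(t <- A) cabs (c t)].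
have Sne : S !=set0 by exists 0, [::]; rewrite ?big_nil.
have Sub : ubound S M by move=> _ [A uA ->]; exact: cM.
have hS : has_sup S by split=> //; exists M.
have /choice[A hA] : forall n : nat, exists A : seq T, uniq A /\
    forall B, uniq B -> {subset A <= B} ->
      \sum_(t <- B) cabs (c t) - \sum_(t <- A) cabs (c t) <= 1 / 2 ^+ n.
  move=> n; have e2 : 0 < 1 / 2 ^+ n :> R by rewrite divr_gt0// exprn_gt0.
  have [x [A uA ->] hx] := sup_adherent e2 hS.
  exists A; split=> // B uB _.
  have : \sum_(t <- B) cabs (c t) <= sup S by apply: (sup_upper_bound hS); exists B.
  by move: hx; lra.
have dist n B : uniq B -> {subset A n <= B} ->
    cabs (\sum_(t <- B) c t - \sum_(t <- A n) c t) <= 1 / 2 ^+ n.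
  move=> uB sB; have [uA h] := hA n; apply: le_trans (h B uB sB).
  have split (V : zmodType) (d : T -> V) : \sum_(t <- B) d t - \sum_(t <- A n) d t =
      \sum_(t <- B | t \notin A n) d t.
    by rewrite (big_sub_split _ uA uB sB) addrAC subrr add0r.
  by rewrite !split; exact: cabs_sum.
pose u n := \sum_(t <- A n) c t.
have [l ul lu] : exists2 l, ccvg \oo u l & forall m, cabs (l - u m) <= 2 / 2 ^+ m.
  apply: (@ccauchy_cvg _ u (fun m => 2 / 2 ^+ m)) => [m n mn|e e0].
    pose B := undup (A m ++ A n).
    have h1 := dist m B (undup_uniq _) (fun x xA => ltac:(by rewrite mem_undup mem_cat xA)).
    have h2 := dist n B (undup_uniq _) (fun x xA => ltac:(by rewrite mem_undup mem_cat xA orbT)).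
    have h3 : 1 / 2 ^+ n <= 1 / 2 ^+ m :> R.
      by rewrite !mul1r lef_pV2 ?posrE ?exprn_gt0// ler_weXn2l// ler1n.
    have := cabsD (u n - \sum_(t <- B) c t) (\sum_(t <- B) c t - u m).
    rewrite addrA subrK; rewrite cabsB in h2; rewrite -!/(u _) in h1 h2 *.
    have e2m : 2 / 2 ^+ m = 1 / 2 ^+ m + 1 / 2 ^+ m :> R by rewrite -mulrDl; lra.
    lra.
  have [n hn] := half_pow_small 2 e0; exists n => // m /= nm.
  apply: le_lt_trans hn; rewrite ler_wpM2l// lef_pV2 ?posrE ?exprn_gt0//.
  by rewrite ler_weXn2l// ler1n.
exists l.
  move=> e e0; have [n hn] := half_pow_small 3 e0.
  exists (A n) => B uB sB; have h1 := dist n B uB sB; have h2 := lu n.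
  have := cabsD (\sum_(t <- B) c t - u n) (u n - l).
  rewrite addrA subrK cabsB in h2 *.
  have : 3 / 2 ^+ n = 1 / 2 ^+ n + 2 / 2 ^+ n :> R by rewrite -mulrDl; lra.
  by move: h1 h2 hn; rewrite -/u; lra.
apply: (ccvg_le_lim ul); apply: filterE => n.
by apply: le_trans (cabs_sum _ _ _) _; apply: cM; have [] := hA n.
Qed.

Lemma asum_le (T : eqType) (c d : T -> C) M : (forall t, cabs (d t) <= cabs (c t)) ->
  asum c M -> asum d M.
Proof. by move=> dc cM A uA; apply: le_trans (cM A uA); apply: ler_sum. Qed.

(** Summation by blocks; summing by rows, by columns and by the exponent of q are instances. *)
Lemma hsum_fiber (T U : eqType) (f : T -> U) (c : T -> C) (r : U -> C) s :
  hsum c s -> (forall u, hsum (fun t => if f t == u then c t else 0) (r u)) -> hsum r s.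
Proof.
move=> cs cr e e0; have e2 : 0 < e / 2 by rewrite divr_gt0.
have [A hA] := cs _ e2; exists (map f A) => B uB sB.
have n0 : 0 < (size B).+1%:R :> R by rewrite ltr0n.
have e3 : 0 < e / 2 / (size B).+1%:R by rewrite divr_gt0.
have /choice[D hD] : forall u, exists D : seq T, forall E, uniq E -> {subset D <= E} ->
    cabs (\sum_(t <- E) (if f t == u then c t else 0) - r u) <= e / 2 / (size B).+1%:R.
  by move=> u; have [D hD] := cr u _ e3; exists D.
(* [E0] approximates the total sum and every fibre over [B]. Dropping the indices that map outside
   [B] keeps [A] and turns the sum into one over fibres. *)
pose E0 := undup (A ++ flatten [seq D u | u <- B]).
pose E := [seq t <- E0 | f t \in B].
have uE : uniq E by rewrite filter_uniq// undup_uniq.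
have sAE : {subset A <= E}.
  move=> t tA; rewrite mem_filter sB ?map_f//= mem_undup mem_cat tA//.
have h1 := hA E uE sAE.
have sE : \sum_(t <- E) c t = \sum_(u <- B) \sum_(t <- E0) (if f t == u then c t else 0).
  rewrite exchange_big /= big_filter big_mkcond /=.
  apply: eq_bigr => t _; case: ifP => ft.
    rewrite -big_mkcond /= -big_filter.
    have -> : [seq u <- B | f t == u] = [:: f t].
      under eq_filter do rewrite eq_sym.
      rewrite filter_pred1_uniq//.
    by rewrite big_seq1.
  rewrite big_seq_cond big1// => u; rewrite andbT => uB'.
  by case: eqP => // fu; rewrite fu uB' in ft.
have h2 : cabs (\sum_(t <- E) c t - \sum_(u <- B) r u) <= e / 2.
  rewrite sE -sumrB; apply: le_trans (cabs_sum _ _ _) _.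
  apply: (@le_trans _ _ (\sum_(u <- B) (e / 2 / (size B).+1%:R))).
    rewrite !big_seq; apply: ler_sum => u uB'; apply: hD; first exact: undup_uniq.
    move=> t tD; rewrite mem_undup mem_cat; apply/orP; right.
    by apply/flattenP; exists (D u) => //; exact: map_f.
  rewrite big_const_seq count_predT iter_addr_0 -[X in X <= _]mulr_natr -mulrA.
  by rewrite ler_piMr ?(ltW e2)// mulrC ler_pdivrMr// mul1r ler_nat.
have := cabsD (\sum_(u <- B) r u - \sum_(t <- E) c t) (\sum_(t <- E) c t - s).
by rewrite addrA subrK; rewrite cabsB in h2; lra.
Qed.

Lemma hsum_nat (c : nat -> C) s : hsum c s -> ccvg \oo (fun n => \sum_(k < n) c k) s.
Proof.
move=> cs e e0; have [A hA] := cs (e / 2) ltac:(by rewrite divr_gt0).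
exists (\max_(k <- A) k.+1)%N => // n /= Nn.
have sA : {subset A <= iota 0 n}.
  move=> k kA; rewrite mem_iota add0n /=; apply: leq_trans Nn.
  by rewrite (big_rem k kA) /= leq_maxl.
have := hA _ (iota_uniq 0 n) sA; rewrite -(big_mkord xpredT) /index_iota subn0; lra.
Qed.

Lemma asum_nat (c : nat -> C) M :
  (forall n, \sum_(k < n) cabs (c k) <= M) -> asum c M.
Proof.
move=> h A uA; pose n := (\max_(k <- A) k.+1)%N; apply: le_trans (h n).
rewrite -(big_mkord xpredT (fun k => cabs (c k))) /index_iota subn0.
apply: sum_subset => //; [by move=> t; exact: cabs_ge0|exact: iota_uniq|].
by move=> k kA; rewrite mem_iota add0n /= /n (big_rem k kA) /= leq_maxl.
Qed.

Lemma hsum_nat_lim (c : nat -> C) M l : asum c M -> ccvg \oo (fun n => \sum_(k < n) c k) l ->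
  hsum c l.
Proof.
by move=> /asum_hsum[s cs _] /(ccvg_unique (hsum_nat cs)) <-.
Qed.

Lemma asum_prod (T U : eqType) (c : T * U -> C) (u : T -> C) (v : U -> C) M N :
  (forall t s, cabs (c (t, s)) <= cabs (u t) * cabs (v s)) -> asum u M -> asum v N ->
  asum c (M * N).
Proof.
move=> cuv uM vN A uA.
pose A1 := undup (map fst A); pose A2 := undup (map snd A).
apply: (@le_trans _ _ (\sum_(p <- [seq (t, s) | t <- A1, s <- A2]) cabs (c p))).
  apply: sum_subset => //; first by move=> p; exact: cabs_ge0.
    by apply: allpairs_uniq; rewrite ?undup_uniq// => -[a b] [a' b'] _ _ [-> ->].
  move=> [a b] abA; apply/allpairsP; exists (a, b); rewrite !mem_undup.
  by split=> //; apply/mapP; exists (a, b).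
rewrite big_allpairs /=.
apply: (@le_trans _ _ (\sum_(t <- A1) \sum_(s <- A2) cabs (u t) * cabs (v s))).
  by apply: ler_sum => t _; apply: ler_sum => s _; exact: cuv.
under eq_bigr do rewrite -mulr_sumr.
rewrite -mulr_suml; apply: ler_pM.
- by apply: sumr_ge0 => i _; exact: cabs_ge0.
- by apply: sumr_ge0 => i _; exact: cabs_ge0.
- by apply: uM; exact: undup_uniq.
- by apply: vN; exact: undup_uniq.
Qed.

Lemma asum_row (T U : eqType) (c : T * U -> C) M t :
  asum c M -> asum (fun s => c (t, s)) M.
Proof.
move=> cM A uA; have := cM [seq (t, s) | s <- A]; rewrite big_map; apply.
by rewrite map_inj_uniq// => x y [].
Qed.

Lemma hsum_inj (T U : eqType) (f : T -> U) (c : U -> C) s : injective f ->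
  (forall u, c u != 0 -> exists t, f t = u) ->
  hsum (fun t => c (f t)) s -> hsum c s.
Proof.
move=> fI cf hs; apply: (@hsum_fiber T U f (fun t => c (f t))) hs _ => u.
have [/cf[t ft]|] := boolP (c u != 0).
  have -> : c u = \sum_(x <- [:: t]) (if f x == u then c (f x) else 0).
    by rewrite big_seq1 ft eqxx.
  apply: hsum_finite => // x; rewrite inE => xt; case: eqP => // fx.
  by case/negP: xt; apply/eqP/fI; rewrite fx ft.
rewrite negbK => /eqP c0.
have -> : (fun t => if f t == u then c (f t) else 0) = (fun t => 0).
  by apply/funext => t; case: eqP => // ->.
by rewrite c0; have := @hsum_finite T (fun=> 0) [::] erefl (fun t _ => erefl); rewrite big_nil.
Qed.

Lemma hsum_row (T U : eqType) (c : T * U -> C) (r : T -> C) s :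
  hsum c s -> (forall t, hsum (fun u => c (t, u)) (r t)) -> hsum r s.
Proof.
move=> cs cr; apply: (@hsum_fiber _ _ fst c) cs _ => t.
apply: (@hsum_inj U _ (fun u => (t, u))) => [x y []//|[a b] /=|].
  by have [<- _|_] := eqVneq a t; [exists b|rewrite eqxx].
by apply: hsum_eq (cr t) => u /=; rewrite eqxx.
Qed.

Lemma hsum_col (T U : eqType) (c : T * U -> C) (r : U -> C) s :
  hsum c s -> (forall u, hsum (fun t => c (t, u)) (r u)) -> hsum r s.
Proof.
move=> cs cr; apply: (@hsum_fiber _ _ snd c) cs _ => u.
apply: (@hsum_inj T _ (fun t => (t, u))) => [x y []//|[a b] /=|].
  by have [<- _|_] := eqVneq b u; [exists a|rewrite eqxx].
by apply: hsum_eq (cr u) => t /=; rewrite eqxx.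
Qed.

Lemma hsumM (T U : eqType) (c : T -> C) (d : U -> C) s t M N :
  asum c M -> asum d N -> hsum c s -> hsum d t ->
  hsum (fun p : T * U => c p.1 * d p.2) (s * t).
Proof.
move=> cM dN cs dt.
have /asum_hsum[l hl _] : asum (fun p : T * U => c p.1 * d p.2) (M * N).
  by apply: (asum_prod _ cM dN) => x y /=; rewrite cabsM.
have := hsum_row hl (fun x => hsumZ (c x) dt) => /= hr.
have : hsum (fun x => c x * t) (s * t).
  by rewrite mulrC; apply: hsum_eq (hsumZ t cs) => x; rewrite mulrC.
by move=> /(hsum_unique hr) <-.
Qed.

Lemma asumZ (T : eqType) (c : T -> C) a M : asum c M -> asum (fun x => a * c x) (cabs a * M).
Proof.
move=> cM A uA; under eq_bigr do rewrite cabsM.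
by rewrite -mulr_sumr ler_wpM2l ?cabs_ge0 ?cM.
Qed.

(** By Pascal's rule, multiplication by [1 - r] lowers k by one, up to a boundary term that is not
    positive. *)
Lemma geometric_binomial (r : R) k N : 0 <= r < 1 ->
  \sum_(n < N) 'C(n + k, k)%:R * r ^+ n <= (1 - r) ^- k.+1.
Proof.
move=> /andP[r0 r1]; have d0 : 0 < 1 - r by rewrite subr_gt0.
elim: k => [|k IH].
  under eq_bigr do rewrite bin0 mul1r.
  rewrite expr1 -[X in _ <= X]mul1r ler_pdivlMr//.
  have -> : (\sum_(n < N) r ^+ n) * (1 - r) = 1 - r ^+ N.
    by rewrite -opprB mulrN mulrC -subrX1 opprB.
  by rewrite gerBl exprn_ge0.
have h : (1 - r) * (\sum_(n < N) 'C(n + k.+1, k.+1)%:R * r ^+ n) =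
    \sum_(n < N) 'C(n + k, k)%:R * r ^+ n - 'C(N + k, k.+1)%:R * r ^+ N.
  elim: N {IH} => [|N IHN]; first by rewrite !big_ord0 mulr0 add0n bin_small// mul0r subr0.
  rewrite !big_ord_recr /= mulrDr IHN addnS addSn binS natrD exprS.
  ring.
rewrite [X in _ <= X](_ : _ = (1 - r) ^- k.+1 / (1 - r)); last by rewrite -invfM -exprSr.
rewrite ler_pdivlMr// mulrC h; apply: le_trans IH.
by rewrite gerBl mulr_ge0// exprn_ge0.
Qed.

(** [n^k <= k! * 'C(n + k, k)]. This majorant dominates the q-series below, whose coefficients grow
    polynomially. *)
Lemma poly_geometric (r : R) k N : 0 <= r < 1 ->
  \sum_(n < N) (n ^ k)%:R * r ^+ n <= k`!%:R * (1 - r) ^- k.+1.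
Proof.
move=> r01; apply: le_trans (ler_wpM2l _ (geometric_binomial k N r01)) => //.
rewrite mulr_sumr; apply: ler_sum => n _; rewrite mulrA ler_wpM2r//.
  by rewrite exprn_ge0//; case/andP: r01.
rewrite -natrM ler_nat mulnC bin_ffact.
elim: k => // k IH; rewrite expnSr addnS ffactSS mulnC leq_mul//.
  by rewrite -addnS leq_addr.
Qed.

End UnorderedSums.

(** * The convolution sum of the divisor function *)

Section SigmaConvolution.

Lemma big_bij (V : nmodType) (T U : eqType) (A : seq T) (B : seq U) (g : T -> U) (h : U -> T) (F : U -> V) :
  uniq A -> uniq B ->
  (forall t, t \in A -> g t \in B /\ h (g t) = t) ->
  (forall u, u \in B -> h u \in A /\ g (h u) = u) ->
  \sum_(u <- B) F u = \sum_(t <- A) F (g t).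
Proof.
move=> uA uB gA hB; rewrite -(big_map g xpredT F); apply: perm_big.
apply: uniq_perm => //.
  rewrite map_inj_in_uniq// => x y /gA[_ gx] /gA[_ gy] xy.
  by rewrite -gx -gy xy.
move=> u; apply/idP/mapP => [/hB[hu <-]|[t /gA[gt _] ->//]].
by exists (h u) => //; have [] := gA _ hu.
Qed.

Definition quad := ((nat * nat) * (nat * nat))%type.

(** The solutions ((a, x), (b, y)) of a x + b y = n in positive integers. The sum of a b over them
    is the convolution of sigma_1 with itself, that is, the n-th coefficient of the square of its
    generating series. *)
Definition quads (n : nat) : seq quad :=
  let P := [seq (a, x) | a <- iota 1 n, x <- iota 1 n] in
  [seq q <- [seq (p, r) | p <- P, r <- P] | q.1.1 * q.1.2 + q.2.1 * q.2.2 == n]%N.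

Lemma quads_uniq n : uniq (quads n).
Proof.
by rewrite filter_uniq// !allpairs_uniq ?iota_uniq// => -[? ?] [? ?] _ _ [-> ->].
Qed.

Lemma mem_quads n a x b y : ((a, x), (b, y)) \in quads n =
  [&& 0 < a, 0 < x, 0 < b, 0 < y & a * x + b * y == n]%N.
Proof.
rewrite mem_filter /= andbC.
have pairE c d : ((c, d) \in [seq (a, x) | a <- iota 1 n, x <- iota 1 n]) =
   [&& 0 < c <= n & 0 < d <= n]%N.
  apply/allpairsP/idP => [[[u v] [/= ]]|].
    by rewrite !mem_iota => hu hv [-> ->]; apply/andP; split; lia.
  by move=> /andP[h1 h2]; exists (c, d); rewrite !mem_iota /=; split=> //; lia.
have -> : (((a, x), (b, y)) \in [seq (p, r) | p <- [seq (a, x) | a <- iota 1 n, x <- iota 1 n], r <- [seq (a,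
    x) | a <- iota 1 n, x <- iota 1 n]]) =
    [&& 0 < a <= n & 0 < x <= n]%N && [&& 0 < b <= n & 0 < y <= n]%N.
  rewrite -!pairE; apply/allpairsP/andP => [[[u v] [/= ? ? [-> ->]]]//|[h1 h2]].
  by exists ((a, x), (b, y)).
case: eqP => [e|]; last by rewrite !andbF.
rewrite !andbT; apply/idP/idP; first by lia.
move=> /and4P[a0 x0 b0 y0].
have := leq_pmulr a x0; have := leq_pmull x a0.
have := leq_pmulr b y0; have := leq_pmull y b0; lia.
Qed.

Variable n : nat.
Hypothesis n0 : (0 < n)%N.
Local Notation Q := (quads n).

Let S (P : pred quad) (F : quad -> int) : int := \sum_(q <- Q | P q) F q.

Let reindexQ (P P' : pred quad) (g h : quad -> quad) (F : quad -> int) :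
  (forall q, q \in Q -> P q -> [/\ g q \in Q, P' (g q) & h (g q) = q]) ->
  (forall q, q \in Q -> P' q -> [/\ h q \in Q, P (h q) & g (h q) = q]) ->
  S P' F = S P (fun q => F (g q)).
Proof.
move=> gP hP; rewrite /S -big_filter -[RHS]big_filter.
apply: (big_bij (g := g) (h := h)); rewrite ?(filter_uniq _ (quads_uniq n))// => q;
  rewrite mem_filter => /andP[Pq qQ].
- by have [? ? ?] := gP q qQ Pq; rewrite mem_filter; split=> //; apply/andP.
- by have [? ? ?] := hP q qQ Pq; rewrite mem_filter; split=> //; apply/andP.
Qed.

Let S_split (P : pred quad) (F : quad -> int) :
  \sum_(q <- Q) F q = S P F + S (fun q => ~~ P q) F.
Proof. by rewrite /S (bigID P). Qed.

Let sq (m : nat) : int := m%:Z ^+ 2.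

Let xlty := fun q : quad => (q.1.2 < q.2.2)%N.
Let yltx := fun q : quad => (q.2.2 < q.1.2)%N.
Let xeqy := fun q : quad => (q.1.2 == q.2.2)%N.
Let altb := fun q : quad => (q.1.1 < q.2.1)%N.
Let blta := fun q : quad => (q.2.1 < q.1.1)%N.
Let aeqb := fun q : quad => (q.1.1 == q.2.1)%N.

Let split3x F : \sum_(q <- Q) F q = S xlty F + S yltx F + S xeqy F.
Proof.
rewrite (S_split xlty) -addrA; congr (_ + _); rewrite /S (bigID yltx) /=.
by congr (_ + _); apply: eq_bigl => -[[a x] [b y]]; rewrite /xlty /yltx /xeqy /=; lia.
Qed.

Let split3a F : \sum_(q <- Q) F q = S altb F + S blta F + S aeqb F.
Proof.
rewrite (S_split altb) -addrA; congr (_ + _); rewrite /S (bigID blta) /=.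
by congr (_ + _); apply: eq_bigl => -[[a x] [b y]]; rewrite /altb /blta /aeqb /=; lia.
Qed.

Let swap (q : quad) : quad := (q.2, q.1).

Let fa (q : quad) := sq q.1.1.
Let fb (q : quad) := sq q.2.1.
Let fab (q : quad) := sq (q.1.1 + q.2.1).
Let fd (q : quad) := (q.1.1%:Z - q.2.1%:Z) ^+ 2.

(* Substitutions such as (a, x), (b, y) |-> (a, x - y), (a + b, y) preserve a x + b y; they relate the sums
   of a^2, b^2, (a + b)^2 and (a - b)^2 over the parts of quads n given by the order of x, y or a, b. *)
Let E1 : S yltx fab = S altb fb.
Proof.
symmetry; apply: (@reindexQ yltx altb
  (fun q => ((q.1.1, q.1.2 - q.2.2), (q.1.1 + q.2.1, q.2.2))%N)
  (fun q => ((q.1.1, q.1.2 + q.2.2), (q.2.1 - q.1.1, q.2.2))%N)) => -[[a x] [b y]];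
  rewrite /yltx /altb mem_quads /= => /and5P[a0 x0 b0 y0 /eqP e] h; split; rewrite ?mem_quads; try lia.
- by congr (_, _, (_, _)); lia.
- by congr (_, _, (_, _)); lia.
Qed.

Let E1' : S xlty fab = S yltx fab.
Proof.
rewrite (@reindexQ yltx xlty swap swap).
- by apply: eq_bigr => q _; rewrite /fab /swap /= addnC.
- by move=> [[a x] [b y]]; rewrite /swap /yltx /xlty !mem_quads /= => h1 h2; split => //; move: h1; lia.
- by move=> [[a x] [b y]]; rewrite /swap /yltx /xlty !mem_quads /= => h1 h2; split => //; move: h1; lia.
Qed.

Let E2 : S blta fd = S xlty fa.
Proof.
symmetry; rewrite (@reindexQ blta xlty
  (fun q => ((q.1.1 - q.2.1, q.1.2), (q.2.1, q.1.2 + q.2.2))%N)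
  (fun q => ((q.1.1 + q.2.1, q.1.2), (q.2.1, q.2.2 - q.1.2))%N)).
- apply: eq_bigr => -[[a x] [b y]]; rewrite /blta /fa /fd /sq /= => h.
  by rewrite subzn ?(ltnW h).
- move=> -[[a x] [b y]]; rewrite /xlty /blta mem_quads /= => /and5P[a0 x0 b0 y0 /eqP e] h; split; rewrite
    ?mem_quads; try lia.
  by congr (_, _, (_, _)); lia.
- move=> -[[a x] [b y]]; rewrite /xlty /blta mem_quads /= => /and5P[a0 x0 b0 y0 /eqP e] h; split; rewrite
    ?mem_quads; try lia.
  by congr (_, _, (_, _)); lia.
Qed.

Let E2' : S altb fd = S blta fd.
Proof.
rewrite (@reindexQ blta altb swap swap).
- by apply: eq_bigr => q _; rewrite /fd /swap /=; ring.
- by move=> [[a x] [b y]]; rewrite /swap /altb /blta !mem_quads /= => h1 h2; split => //; move: h1; lia.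
- by move=> [[a x] [b y]]; rewrite /swap /altb /blta !mem_quads /= => h1 h2; split => //; move: h1; lia.
Qed.

Let E3 : S xlty fa = S yltx fb.
Proof.
rewrite (@reindexQ yltx xlty swap swap) => //.
- by move=> [[a x] [b y]]; rewrite /swap /yltx /xlty !mem_quads /= => h1 h2; split => //; move: h1; lia.
- by move=> [[a x] [b y]]; rewrite /swap /yltx /xlty !mem_quads /= => h1 h2; split => //; move: h1; lia.
Qed.

Let E4 : S xlty fb = S blta fb.
Proof.
symmetry; apply: (@reindexQ xlty blta
  (fun q => ((q.1.1 + q.2.1, q.1.2), (q.2.1, q.2.2 - q.1.2))%N)
  (fun q => ((q.1.1 - q.2.1, q.1.2), (q.2.1, q.2.2 + q.1.2))%N)) => -[[a x] [b y]];
  rewrite /xlty /blta mem_quads /= => /and5P[a0 x0 b0 y0 /eqP e] h; split; rewrite ?mem_quads; try lia.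
- by congr (_, _, (_, _)); lia.
- by congr (_, _, (_, _)); lia.
Qed.

(** For x = y the equation reads (a + b) x = n, so d = a + b runs over the divisors and b over 1,
    ..., d - 1. *)
Let diag_x (F : nat -> nat -> int) :
  S xeqy (fun q => F (q.1.1 + q.2.1)%N q.2.1) =
  \sum_(d <- divisors n) \sum_(1 <= b < d) F d b.
Proof.
rewrite /S -big_filter.
have -> : \sum_(d <- divisors n) \sum_(1 <= b < d) F d b =
    \sum_(p <- [seq (d, b) | d <- divisors n, b <- index_iota 1 d]) F p.1 p.2.
  by rewrite big_allpairs_dep.
symmetry; apply: (@big_bij _ _ _ _ _ (fun q : quad => (q.1.1 + q.2.1, q.2.1)%N)
  (fun p : nat * nat => ((p.1 - p.2, n %/ p.1), (p.2, n %/ p.1))%N)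
  (fun p => F p.1 p.2)).
- by rewrite filter_uniq// quads_uniq.
- apply: allpairs_uniq_dep; rewrite ?divisors_uniq//; first by move=> d _; exact: iota_uniq.
  by move=> [u v] [u' v'] _ _ /= [-> ->].
- move=> [[a x] [b y]]; rewrite mem_filter mem_quads /xeqy /= => /andP[/eqP <- /and5P[a0 x0 b0 _ /eqP e]].
  have nE : n = ((a + b) * x)%N by rewrite mulnDl.
  split.
    apply/allpairsPdep; exists (a + b)%N, b; split=> //.
      by rewrite -dvdn_divisors// nE dvdn_mulr.
    by rewrite mem_index_iota; lia.
  have -> : (n %/ (a + b) = x)%N by rewrite nE mulKn//; lia.
  by congr (_, _, (_, _)); lia.
- move=> [d b] /allpairsPdep[u [v [hu hv [-> ->]]]] /=.
  rewrite -dvdn_divisors// in hu; rewrite mem_index_iota in hv.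
  have e : (u * (n %/ u) = n)%N by rewrite mulnC divnK.
  rewrite mem_filter mem_quads /xeqy /= eqxx /=; split; last by congr (_, _); lia.
  by apply/and5P; split; lia.
Qed.

(** For a = b the equation reads a (x + y) = n, so a is a divisor d and x takes n / d - 1 values. *)
Let diag_a : S aeqb fb = \sum_(d <- divisors n) sq d * ((n %/ d)%:Z - 1).
Proof.
rewrite /S -big_filter.
have -> : \sum_(d <- divisors n) sq d * ((n %/ d)%:Z - 1) =
    \sum_(p <- [seq (d, b) | d <- divisors n, b <- index_iota 1 (n %/ d)]) sq p.1.
  rewrite big_allpairs_dep /=; apply: eq_big_seq => d; rewrite -dvdn_divisors// => dn.
  rewrite big_const_seq count_predT size_iota iter_addr_0 -mulr_natr; congr (_ * _).
  have : (0 < n %/ d)%N.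
    by rewrite divn_gt0; [exact: dvdn_leq|exact: dvdn_gt0 n0 dn].
  by case: (n %/ d)%N => // k _; rewrite subn1 /= -natz -natr1 addrK natz.
symmetry; apply: (@big_bij _ _ _ _ _ (fun q : quad => (q.2.1, q.1.2)%N)
  (fun p : nat * nat => ((p.1, p.2), (p.1, n %/ p.1 - p.2))%N)
  (fun p => sq p.1)).
- by rewrite filter_uniq// quads_uniq.
- apply: allpairs_uniq_dep; rewrite ?divisors_uniq//; first by move=> d _; exact: iota_uniq.
  by move=> [u v] [u' v'] _ _ /= [-> ->].
- move=> [[a x] [b y]]; rewrite mem_filter mem_quads /aeqb /= => /andP[/eqP <- /and5P[a0 x0 _ y0 /eqP e]].
  have nE : n = (a * (x + y))%N by rewrite mulnDr.
  have nd : (n %/ a = x + y)%N by rewrite nE mulKn.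
  split.
    apply/allpairsPdep; exists a, x; split=> //.
      by rewrite -dvdn_divisors// nE dvdn_mulr.
    by rewrite mem_index_iota nd; lia.
  by rewrite nd; congr (_, _, (_, _)); lia.
- move=> [d b] /allpairsPdep[u [v [hu hv [-> ->]]]] /=.
  rewrite -dvdn_divisors// in hu; rewrite mem_index_iota in hv.
  have e : (u * (n %/ u) = n)%N by rewrite mulnC divnK.
  rewrite mem_filter mem_quads /aeqb /= eqxx /=; split=> //.
  by apply/and5P; split; lia.
Qed.

Let sum_squares d : 6 * \sum_(1 <= b < d) sq b = (d%:Z - 1) * d%:Z * (2 * d%:Z - 1).
Proof.
elim: d => [|d IH]; first by rewrite big_geq// mulr0 mulr0 mul0r.
case: d IH => [|d] IH; first by rewrite big_geq// subrr !mul0r mulr0.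
rewrite big_nat_recr//= mulrDr IH /sq -[d.+2%:Z]natz -[d.+1%:Z]natz -natr1; ring.
Qed.

(** Write 4 a b = (a + b)^2 - (a - b)^2. The substitutions make the off-diagonal parts of the two
    sums cancel, up to the diagonals x = y and a = b, which are sums over divisors. *)
Lemma sigma_convolution :
  12 * \sum_(q <- Q) (q.1.1%:Z * q.2.1%:Z) =
  \sum_(d <- divisors n) (5 * d%:Z ^+ 3 + d%:Z - 6 * n%:Z * d%:Z).
Proof.
have h1 : 4 * \sum_(q <- Q) (q.1.1%:Z * q.2.1%:Z) = \sum_(q <- Q) fab q - \sum_(q <- Q) fd q.
  rewrite mulr_sumr -sumrB; apply: eq_bigr => q _; rewrite /fab /fd /sq PoszD; ring.
have h2 : \sum_(q <- Q) fab q = 2 * S altb fb + S xeqy fab.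
  by rewrite split3x E1' E1; ring.
have h3 : \sum_(q <- Q) fd q = 2 * S yltx fb.
  rewrite split3a E2' E2 E3; have -> : S aeqb fd = 0.
    by apply: big1 => q /eqP; rewrite /fd => ->; rewrite subrr expr0n.
  by ring.
have h4 : S yltx fb + S xeqy fb = S altb fb + S aeqb fb.
  have := split3x fb; rewrite split3a E4 => h.
  have -> : S yltx fb = S altb fb + S blta fb + S aeqb fb - S blta fb - S xeqy fb by rewrite h; ring.
  ring.
have h5 : 12 * \sum_(q <- Q) (q.1.1%:Z * q.2.1%:Z) =
    6 * S xeqy fb - 6 * S aeqb fb + 3 * S xeqy fab.
  have -> : S xeqy fb = S altb fb + S aeqb fb - S yltx fb by rewrite -h4; ring.
  have -> : 12 * \sum_(q <- Q) (q.1.1%:Z * q.2.1%:Z) = 3 * (4 * \sum_(q <- Q) (q.1.1%:Z * q.2.1%:Z)) by ring.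
  by rewrite h1 h2 h3; ring.
rewrite h5 (diag_x (fun d b => sq b)) (diag_x (fun d b => sq d)) diag_a.
rewrite !mulr_sumr -sumrB -big_split /=; apply: eq_big_seq => d; rewrite -dvdn_divisors// => dn.
have d0 := dvdn_gt0 n0 dn.
have cst (x : int) : \sum_(1 <= b < d) x = x * (d%:Z - 1).
  by rewrite big_const_nat iter_addr_0 -mulr_natr natrB// natz.
rewrite sum_squares cst.
have -> : n%:Z = d%:Z * (n %/ d)%:Z by rewrite -PoszM mulnC divnK.
rewrite /sq; ring.
Qed.

End SigmaConvolution.

(** * Moyal products and Rankin-Cohen brackets *)

Section Pascal.
Variable V : zmodType.

(** Pascal's rule in the form used by an induction on powers of a sum of two commuting operators. *)
Lemma sum_pascal (g : nat -> nat -> V) N :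
  \sum_(i < N.+2) g i (N.+1 - i)%N *+ 'C(N.+1, i) =
  \sum_(i < N.+1) (g i.+1 (N - i)%N + g i (N - i).+1) *+ 'C(N, i).
Proof.
under [RHS]eq_bigr do rewrite mulrnDl.
rewrite big_split /= big_ord_recl bin0 subn0.
rewrite (eq_bigr (fun i : 'I_N.+1 => g i.+1 (N - i)%N *+ 'C(N, i.+1) + g i.+1 (N - i)%N *+ 'C(N, i))); last first.
  by move=> i _; rewrite /= /bump add1n subSS binS mulrnDr.
rewrite big_split /= [\sum_(i < N.+1) g i.+1 _ *+ 'C(N, i.+1)]big_ord_recr /= bin_small// mulr0n addr0.
rewrite addrA addrC; congr (_ + _).
rewrite [RHS]big_ord_recl bin0 subn0; congr (_ + _).
by apply: eq_bigr => i _; rewrite /= /bump add1n subnSK.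
Qed.

End Pascal.

Section Moyal.
Variable K : comNzRingType.

(** The tensor [d1 (x) d2 - d2 (x) d1] is applied n times before multiplying; the 1 / n! of the
    exponential is left out. *)
Fixpoint moyal (d1 d2 : K -> K) (n : nat) (F G : K) : K :=
  if n is m.+1 then moyal d1 d2 m (d1 F) (d2 G) - moyal d1 d2 m (d2 F) (d1 G)
  else F * G.

Record derivation (d : K -> K) : Prop := Derivation {
  derivation_add : forall x y, d (x + y) = d x + d y;
  derivation_mul : forall x y, d (x * y) = d x * y + x * d y }.

Lemma derivation0 d : derivation d -> d 0 = 0.
Proof. by case=> dD _; apply: (addrI (d 0)); rewrite -dD !addr0. Qed.

Lemma derivationN d x : derivation d -> d (- x) = - d x.
Proof.
move=> hd; apply: (addrI (d x)); rewrite -(derivation_add hd) !subrr.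
exact: derivation0.
Qed.

Lemma derivationB d x y : derivation d -> d (x - y) = d x - d y.
Proof. by move=> hd; rewrite (derivation_add hd) derivationN. Qed.

Section Assoc.
Variables d1 d2 : K -> K.
Hypotheses (h1 : derivation d1) (h2 : derivation d2).
Hypothesis d12 : forall x, d1 (d2 x) = d2 (d1 x).
Local Notation T := (moyal d1 d2).

Let d1D := derivation_add h1.
Let d2D := derivation_add h2.

Lemma moyalDl n F F' G : T n (F + F') G = T n F G + T n F' G.
Proof.
elim: n F F' G => [|n IH] F F' G /=; first by rewrite mulrDl.
by rewrite !(d1D, d2D) !IH; ring.
Qed.

Lemma moyalDr n F G G' : T n F (G + G') = T n F G + T n F G'.
Proof.
elim: n F G G' => [|n IH] F G G' /=; first by rewrite mulrDr.
by rewrite !(d1D, d2D) !IH; ring.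
Qed.

Lemma moyal0l n G : T n 0 G = 0.
Proof. by apply: (addrI (T n 0 G)); rewrite -moyalDl !addr0. Qed.

Lemma moyal0r n F : T n F 0 = 0.
Proof. by apply: (addrI (T n F 0)); rewrite -moyalDr !addr0. Qed.

Lemma moyalBl n F F' G : T n (F - F') G = T n F G - T n F' G.
Proof.
by apply: (addIr (T n F' G)); rewrite -moyalDl !subrK.
Qed.

Lemma moyalBr n F G G' : T n F (G - G') = T n F G - T n F G'.
Proof.
by apply: (addIr (T n F G')); rewrite -moyalDr !subrK.
Qed.

Lemma moyalZl c n F G : (forall x, d1 (c * x) = c * d1 x) -> (forall x, d2 (c * x) = c * d2 x) ->
  T n (c * F) G = c * T n F G.
Proof.
move=> c1 c2; elim: n F G => [|n IH] F G /=; first by rewrite mulrA.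
by rewrite c1 c2 !IH mulrBr.
Qed.

Lemma moyalZr c n F G : (forall x, d1 (c * x) = c * d1 x) -> (forall x, d2 (c * x) = c * d2 x) ->
  T n F (c * G) = c * T n F G.
Proof.
move=> c1 c2; elim: n F G => [|n IH] F G /=; first by rewrite mulrCA.
by rewrite c1 c2 !IH mulrBr.
Qed.

Lemma derivation_moyal d n F G : derivation d ->
  (forall x, d (d1 x) = d1 (d x)) -> (forall x, d (d2 x) = d2 (d x)) ->
  d (T n F G) = T n (d F) G + T n F (d G).
Proof.
move=> hd c1 c2; elim: n F G => [|n IH] F G /=; first exact: derivation_mul.
by rewrite derivationB// !IH !c1 !c2; ring.
Qed.

Let d1T n F G : d1 (T n F G) = T n (d1 F) G + T n F (d1 G).
Proof. exact: derivation_moyal. Qed.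

Let d2T n F G : d2 (T n F G) = T n (d2 F) G + T n F (d2 G).
Proof. by apply: derivation_moyal => // x; rewrite d12. Qed.

(** Multiplication after the n-th power of P12 + P13 + P23, where Pij is the tensor acting on the
    factors i and j. *)
Fixpoint moyal3 (n : nat) (F G H : K) : K :=
  if n is m.+1 then
    (moyal3 m (d1 F) (d2 G) H - moyal3 m (d2 F) (d1 G) H) +
    (moyal3 m (d1 F) G (d2 H) - moyal3 m (d2 F) G (d1 H)) +
    (moyal3 m F (d1 G) (d2 H) - moyal3 m F (d2 G) (d1 H))
  else F * G * H.

(** By Leibniz' rule, the tensor between a product of F and G on one side and H on the other is P13
    + P23; its powers and those of P12 assemble by the binomial theorem. *)
Lemma moyal_assocl N F G H :
  \sum_(i < N.+1) T (N - i) (T i F G) H *+ 'C(N, i) = moyal3 N F G H.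
Proof.
elim: N F G H => [|N IH] F G H; first by rewrite big_ord1 bin0 mulr1n.
rewrite (sum_pascal (fun i j => T j (T i F G) H)) /= -!IH -!sumrB -!big_split /=.
apply: eq_bigr => i _; rewrite moyalBl.
rewrite !(d1T, d2T) !moyalDl; rewrite -!mulrnBl -!mulrnDl; congr (_ *+ _).
ring.
Qed.

Lemma moyal_assocr N F G H :
  \sum_(i < N.+1) T (N - i) F (T i G H) *+ 'C(N, i) = moyal3 N F G H.
Proof.
elim: N F G H => [|N IH] F G H; first by rewrite big_ord1 bin0 mulr1n /= mulrA.
rewrite (sum_pascal (fun i j => T j F (T i G H))) /= -!IH -!sumrB -!big_split /=.
apply: eq_bigr => i _; rewrite moyalBr.
rewrite !(d1T, d2T) !moyalDr; rewrite -!mulrnBl -!mulrnDl; congr (_ *+ _).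
ring.
Qed.

Lemma iter_comm (d d' : K -> K) n x : (forall x, d (d' x) = d' (d x)) ->
  iter n d (d' x) = d' (iter n d x).
Proof. by move=> dd; elim: n => //= n ->. Qed.

Lemma moyal_expand n F G : T n F G =
  \sum_(j < n.+1) ((-1) ^+ j * iter (n - j) d1 (iter j d2 F) * iter j d1 (iter (n - j) d2 G)) *+ 'C(n, j).
Proof.
elim: n F G => [|n IH] F G; first by rewrite big_ord1 bin0 /= expr0 mul1r.
rewrite (sum_pascal (fun j k => (-1) ^+ j * iter k d1 (iter j d2 F) * iter j d1 (iter k d2 G))) /=.
rewrite !IH -sumrB; apply: eq_bigr => j _; rewrite -mulrnBl; congr (_ *+ _).
have e1 : iter j d2 (d1 F) = d1 (iter j d2 F) by apply: iter_comm => x; rewrite d12.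
have e2 x : iter (n - j) d1 (d1 x) = d1 (iter (n - j) d1 x) by exact: iter_comm.
have e3 : iter (n - j) d2 (d2 G) = d2 (iter (n - j) d2 G) by exact: iter_comm.
have e4 : iter j d2 (d2 F) = d2 (iter j d2 F) by exact: iter_comm.
have e5 : iter (n - j) d2 (d1 G) = d1 (iter (n - j) d2 G) by apply: iter_comm => x; rewrite d12.
have e6 x : iter j d1 (d1 x) = d1 (iter j d1 x) by exact: iter_comm.
by rewrite e1 e2 e3 e4 e5 e6 exprS; ring.
Qed.

(** The tensor is antisymmetric, so the added terms [c * d1 (x) d1] cancel. *)
Lemma moyal_shear2 c n F G : (forall x, d1 (c * x) = c * d1 x) -> (forall x, d2 (c * x) = c * d2 x) ->
  moyal d1 (fun x => d2 x + c * d1 x) n F G = T n F G.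
Proof.
move=> c1 c2; elim: n F G => //= n IH F G.
by rewrite !IH moyalDr moyalDl moyalZr// moyalZl//; ring.
Qed.

Lemma moyal_shear1 c n F G : (forall x, d1 (c * x) = c * d1 x) -> (forall x, d2 (c * x) = c * d2 x) ->
  moyal (fun x => d1 x + c * d2 x) d2 n F G = T n F G.
Proof.
move=> c1 c2; elim: n F G => //= n IH F G.
by rewrite !IH moyalDr moyalDl moyalZr// moyalZl//; ring.
Qed.

End Assoc.

End Moyal.

Definition rising (m i : nat) : nat := \prod_(j < i) (m + j).

Lemma rising0 m : rising m 0 = 1%N.
Proof. by rewrite /rising big_ord0. Qed.

Lemma risingS m i : rising m i.+1 = (rising m i * (m + i))%N.
Proof. by rewrite /rising big_ord_recr. Qed.

Lemma risingSl m i : rising m i.+1 = (m * rising m.+1 i)%N.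
Proof.
elim: i => [|i IH]; first by rewrite risingS !rising0 addn0 mulnC.
by rewrite risingS IH risingS addSnnS mulnA.
Qed.

(** * Jets: the closed form of the recursion for B_n *)

Section Jets.
Variables (A : comNzRingType) (D : A -> A).
Hypothesis hD : derivation D.
Variable psi : A.

Let DD := derivation_add hD.
Let DM := derivation_mul hD.

Lemma derivation_sum (I : Type) (r : seq I) (F : I -> A) :
  D (\sum_(i <- r) F i) = \sum_(i <- r) D (F i).
Proof.
by elim: r => [|i r IH]; rewrite ?big_nil ?derivation0// !big_cons DD IH.
Qed.

Lemma derivationMn x n : D (x *+ n) = D x *+ n.
Proof. by elim: n => [|n IH]; rewrite ?mulr0n ?derivation0// !mulrS DD IH. Qed.

Lemma derivationX n : D (psi ^+ n) = (psi ^+ n.-1 * D psi) *+ n.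
Proof.
elim: n => [|n IH].
  rewrite mulr0n expr0; apply: (addrI (D 1)).
  by rewrite addr0 -[X in _ = D X](mulr1 1) DM mulr1 mul1r.
rewrite exprS DM IH; case: n {IH} => [|n] /=; first by rewrite mulr0n mulr0 addr0 expr0 mulr1 mul1r mulr1n.
by rewrite mulrnAr mulrA -exprS [_ *+ n.+2]mulrS; congr (_ + _); rewrite mulrC.
Qed.

(** The coefficient of psi^i D^p in the (p + i)-th power of [dx - psi e2] on degree m: the binomial
    coefficient of that power times the effect of i applications of [e2] in degree m + p. *)
Definition jet_coef (m p i : nat) : nat := ('C(p + i, i) * rising (m + p) i)%N.

Lemma jet_coefS m p i :
  (i.+1 * jet_coef m p i.+1 = (p + i).+1 * (m + p + i) * jet_coef m p i)%N.
Proof.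
rewrite /jet_coef mulnA addnS -mul_bin_diag risingS.
by rewrite /= -!mulnA; congr (_ * _)%N; rewrite [RHS]mulnC -mulnA.
Qed.

Lemma jet_coefSS m p i :
  jet_coef m p.+1 i.+1 = (jet_coef m p i.+1 + (m + 2 * p.+1 + i) * jet_coef m p.+1 i)%N.
Proof.
apply/eqP; rewrite -(eqn_pmul2l (ltn0Sn i)); apply/eqP.
have h : (i.+1 * jet_coef m p i.+1 = p.+1 * (m + p) * jet_coef m p.+1 i)%N.
  rewrite /jet_coef risingSl mulnA addnS -(addnS m p) addSn.
  have := mul_bin_left (p + i).+1 i; rewrite subSn ?leq_addl// addnK => ->.
  by rewrite -!mulnA; congr (_ * _)%N; rewrite mulnCA.
rewrite mulnDr h jet_coefS; set t := jet_coef _ _ _; nia.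
Qed.

Lemma jet_coef0S m i : jet_coef m 0 i.+1 = ((m + i) * jet_coef m 0 i)%N.
Proof. by rewrite /jet_coef !add0n !binn !mul1n addn0 risingS mulnC. Qed.

Lemma jet_coefp0 m p : jet_coef m p 0 = 1%N.
Proof. by rewrite /jet_coef bin0 rising0. Qed.

(* Value at the base point of the n-th power of the frame field adapted to psi. *)
Definition jet (m n : nat) (f : A) : A :=
  \sum_(i < n.+1) (psi ^+ i * iter (n - i) D f) *+ jet_coef m (n - i) i.

Lemma jet0 m f : jet m 0 f = f.
Proof. by rewrite /jet big_ord1 jet_coefp0 expr0 mul1r mulr1n. Qed.

(** The recursion of the operators B_n. Differentiating the powers of psi yields exactly the term in
    [D psi], which cancels; the rest is the comparison of coefficients in [jet_coefSS]. *)
Lemma jetS m n f : jet m n.+1 f =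
  D (jet m n f) + (psi * jet m n f) *+ (m + 2 * n) -
  (if n is p.+1 then ((psi ^+ 2 + D psi) * jet m p f) *+ (n * (m + p)) else 0).
Proof.
have e1 : D (jet m n f) =
   (if n is p.+1 then (D psi * jet m p f) *+ (n * (m + p)) else 0) +
   \sum_(i < n.+1) (psi ^+ i * iter (n - i).+1 D f) *+ jet_coef m (n - i) i.
  rewrite /jet derivation_sum.
  rewrite (eq_bigr (fun i : 'I_n.+1 => (psi ^+ i.-1 * D psi * iter (n - i) D f) *+ (i * jet_coef m (n - i) i) +
    (psi ^+ i * iter (n - i).+1 D f) *+ jet_coef m (n - i) i)); last first.
    by move=> i _; rewrite derivationMn DM derivationX mulrnDl mulrnAl -mulrnA.
  rewrite big_split /=; congr (_ + _).
  rewrite big_ord_recl mul0n mulr0n add0r.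
  case: n => [|p]; first by rewrite big_ord0.
  rewrite /jet mulr_sumr -sumrMnl; apply: eq_bigr => i _.
  have ip : (p - i + i = p)%N by apply: subnK; rewrite -ltnS.
  rewrite /= /bump add1n subSS /= jet_coefS -(addnA m) ip.
  by rewrite mulrnAr -mulrnA mulnC; congr (_ *+ _); ring.
have e2 : (if n is p.+1 then (psi ^+ 2 * jet m p f) *+ (n * (m + p)) else 0) =
   \sum_(i < n.+1) (psi ^+ i.+1 * iter (n - i) D f) *+ (i * jet_coef m (n - i) i).
  rewrite big_ord_recl mul0n mulr0n add0r.
  case: n {e1} => [|p]; first by rewrite big_ord0.
  rewrite /jet mulr_sumr -sumrMnl; apply: eq_bigr => i _.
  have ip : (p - i + i = p)%N by apply: subnK; rewrite -ltnS.
  rewrite /= /bump add1n subSS /= jet_coefS -(addnA m) ip.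
  by rewrite mulrnAr -mulrnA mulnC; congr (_ *+ _); rewrite !exprS; ring.
have e3 : (psi * jet m n f) *+ (m + 2 * n) =
    \sum_(i < n.+1) (psi ^+ i.+1 * iter (n - i) D f) *+ ((m + 2 * n) * jet_coef m (n - i) i).
  rewrite /jet mulr_sumr -sumrMnl; apply: eq_bigr => i _.
  by rewrite mulrnAr -mulrnA mulnC mulrA -exprS.
have -> : (if n is p.+1 then ((psi ^+ 2 + D psi) * jet m p f) *+ (n * (m + p)) else 0) =
    (if n is p.+1 then (psi ^+ 2 * jet m p f) *+ (n * (m + p)) else 0) +
    (if n is p.+1 then (D psi * jet m p f) *+ (n * (m + p)) else 0).
  by case: n {e1 e2 e3} => [|p]; rewrite ?addr0// mulrDl mulrnDl.
rewrite e1 e2 e3; set X := (if n is _.+1 then _ else _).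
set S1 := \sum_(i < _) _; set S2 := \sum_(i < _) _; set S3 := \sum_(i < _) _.
have -> : X + S1 + S2 - (S3 + X) = S1 + (S2 - S3) by ring.
rewrite /S2 /S3 -sumrB.
rewrite (eq_bigr (fun i : 'I_n.+1 => (psi ^+ i.+1 * iter (n - i) D f) *+ ((m + 2 * (n - i) + i) * jet_coef m (n
    - i) i))); last first.
  move=> i _; have : (i <= n)%N by rewrite -ltnS.
  by move=> le_in; rewrite -mulrnBr ?leq_mul//; [congr (_ *+ _); rewrite -mulnBl; congr (_ * _)%N; lia|lia].
rewrite /jet big_ord_recl /S1 [in RHS]big_ord_recl !jet_coefp0 subn0 -addrA; congr (_ + _); first by rewrite /= subn0.
rewrite !big_ord_recr /=.
rewrite addrA -big_split /=; congr (_ + _).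
  apply: eq_bigr => i _; rewrite /bump add1n subSS.
  have [p hp] : exists p, (n - i = p.+1)%N by exists (n - i).-1; have := ltn_ord i; lia.
  have -> : (n - i.+1 = p)%N by lia.
  by rewrite hp jet_coefSS mulrnDr.
by rewrite /bump add1n subSS subnn jet_coef0S muln0 addn0.
Qed.

End Jets.

Lemma jetMn (A : comNzRingType) (D : A -> A) (hD : derivation D) psi m n (f : A) a :
  jet D psi m n (f *+ a) = jet D psi m n f *+ a.
Proof.
rewrite /jet -sumrMnl; apply: eq_bigr => i _; rewrite [RHS]mulrnAC; congr (_ *+ _).
rewrite -mulrnAr; congr (_ * _); elim: (n - i)%N => //= j ->.
exact: derivationMn.
Qed.

(** * Homogeneous functions of two variables and adapted frames *)

Section Symbols.
Variables (A : comNzRingType) (D : A -> A).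
Hypothesis hD : derivation D.
Variables (Z : A).
Hypothesis DZ : D Z = 1.
Local Notation K := {poly A}.

Let DD := derivation_add hD.
Let DM := derivation_mul hD.
Let D0 := derivation0 hD.

Definition mapD (p : K) : K := map_poly D p.

Lemma coef_mapD p i : (mapD p)`_i = D p`_i.
Proof. by rewrite /mapD coef_map_id0// D0. Qed.

Lemma mapD_derivation : derivation mapD.
Proof.
split=> p q; apply/polyP => i; first by rewrite coefD !coef_mapD coefD DD.
rewrite coefD coef_mapD !coefM (derivation_sum hD) -big_split /=.
by apply: eq_bigr => j _; rewrite !coef_mapD DM.
Qed.

Lemma mapD_deriv p : mapD p^`() = (mapD p)^`().
Proof.
by apply/polyP => i; rewrite coef_mapD !coef_deriv coef_mapD derivationMn.
Qed.

Lemma mapDX : mapD 'X = 0.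
Proof.
have D1 : D 1 = 0.
  by apply: (addrI (D 1)); rewrite addr0 -[X in _ = D X](mulr1 1) DM mulr1 mul1r.
by apply/polyP => i; rewrite coef_mapD coefX coef0; case: eqP; rewrite ?D1 ?D0.
Qed.

Lemma mapDC a : mapD a%:P = (D a)%:P.
Proof. by apply/polyP => i; rewrite coef_mapD !coefC; case: eqP; rewrite ?D0. Qed.

(* On functions F(x, y) = sum f_m(x / y) y^-m, written sum f_m 'X^m, these are
   the partial derivatives in x and y. *)
Definition dx (p : K) : K := 'X * mapD p.
Definition dy (p : K) : K := - ('X^2 * p^`() + Z%:P * dx p).

Let mD := mapD_derivation.

Lemma dx_derivation : derivation dx.
Proof.
split=> p q; rewrite /dx; first by rewrite (derivation_add mD) mulrDr.
by rewrite (derivation_mul mD); ring.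
Qed.

Lemma dy_derivation : derivation dy.
Proof.
split=> p q; rewrite /dy.
  by rewrite derivD (derivation_add dx_derivation); ring.
by rewrite derivM (derivation_mul dx_derivation); ring.
Qed.

Lemma dxdyC p : dx (dy p) = dy (dx p).
Proof.
rewrite /dy /dx (derivationN _ mD) (derivation_add mD) !(derivation_mul mD).
rewrite mapDX mapDC DZ polyC1 mapD_deriv derivM derivX.
ring.
Qed.

Section Frame.
Variables (k : comNzRingType) (cst : {rmorphism k -> A}) (ev : {rmorphism A -> k}).
Hypothesis Dcst : forall c, D (cst c) = 0.
Hypothesis evcst : forall c, ev (cst c) = c.
Variable psi : A.

Let cC (c : k) : K := (cst c)%:P.

Lemma dx_cst c p : dx (cC c * p) = cC c * dx p.
Proof. by rewrite /dx (derivation_mul mD) mapDC Dcst polyC0 mul0r add0r mulrCA. Qed.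

Lemma dy_cst c p : dy (cC c * p) = cC c * dy p.
Proof. by rewrite /dy dx_cst derivM derivC mul0r add0r; ring. Qed.

(** The coefficients are frozen at the base point where [ev] evaluates; being constants, they leave
    [dx], [e2] and [e1] commuting. The choice [ev Z] removes the part of [dy] along [dx] at the base
    point, where [e2] thus acts as [- 'X^2] times the derivative in 'X. *)
Definition e2 (p : K) : K := dy p + cC (ev Z) * dx p.
Definition e1 (p : K) : K := dx p + cC (- ev psi) * e2 p.

Lemma e2_derivation : derivation e2.
Proof.
split=> p q; rewrite /e2.
  by rewrite (derivation_add dx_derivation) (derivation_add dy_derivation); ring.
by rewrite (derivation_mul dx_derivation) (derivation_mul dy_derivation); ring.
Qed.

Lemma dxe2 p : dx (e2 p) = e2 (dx p).
Proof. by rewrite /e2 (derivation_add dx_derivation) dx_cst dxdyC. Qed.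

Lemma e2_cst c p : e2 (cC c * p) = cC c * e2 p.
Proof. by rewrite /e2 dx_cst dy_cst; ring. Qed.

Lemma e1e2 p : e1 (e2 p) = e2 (e1 p).
Proof. by rewrite /e1 [RHS](derivation_add e2_derivation (dx p)) e2_cst dxe2. Qed.

(* (e1, e2) is obtained from (dx, dy) by two shears with constant coefficients, so it defines the same
   Poisson tensor. *)
Lemma moyal_frame n F G : moyal e1 e2 n F G = moyal dx dy n F G.
Proof.
rewrite /e1 (moyal_shear1 dx_derivation e2_derivation) ?[in LHS]/e2.
- apply: (moyal_shear2 dx_derivation dy_derivation) => x; [exact: dx_cst|exact: dy_cst].
- by move=> x; exact: dx_cst.
- by move=> x; exact: e2_cst.
Qed.

Let evp (p : K) : {poly k} := map_poly ev p.
Let W (q : {poly k}) : {poly k} := - ('X^2 * q^`()).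

Let evp_e2 p : evp (e2 p) = W (evp p).
Proof.
rewrite /evp /e2 /W /dy rmorphD rmorphN rmorphD /= !rmorphM /= !map_polyC /= evcst.
by rewrite !map_polyX deriv_map; ring.
Qed.

Let evp_iter_e2 b p : evp (iter b e2 p) = iter b W (evp p).
Proof. by elim: b => //= b <-; exact: evp_e2. Qed.

Lemma iter_dx b f m : iter b dx (f *: 'X^m) = iter b D f *: 'X^(m + b).
Proof.
elim: b => [|b IH] /=; first by rewrite addn0.
rewrite IH /dx; apply/polyP => i; rewrite coefXM coefZ coefXn coef_mapD coefZ coefXn addnS.
case: i => [|i] /=; first by rewrite mulr0.
by rewrite eqSS; case: eqP; rewrite ?mulr1 ?mulr0.
Qed.

Lemma iter_W b (g : k) m : iter b W (g *: 'X^m) = ((-1) ^+ b * g *+ rising m b) *: 'X^(m + b).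
Proof.
elim: b => [|b IH] /=; first by rewrite addn0 rising0 mulr1n expr0 mul1r.
rewrite IH /W derivZ derivXn risingS addnS; case: (m + b)%N => [|j].
  by rewrite mulr0n scaler0 mulr0 oppr0 muln0 mulr0n scale0r.
rewrite /= -scalerAr mulrnAr -exprD add2n -scalerMnr scalerMnl -scaleNr; congr (_ *: _).
by rewrite exprS mulN1r mulNr mulNrn mulrnA.
Qed.

(** Expand (dx - psi e2)^a by the binomial theorem: [dx] differentiates the coefficient, and each
    [e2] multiplies by minus the degree, a sign that cancels against the one of - psi. *)
Lemma evp_e1 a f m :
  evp (iter a e1 (f *: 'X^m)) = ev (jet D psi m a f) *: 'X^(m + a).
Proof.
have -> : iter a e1 (f *: 'X^m) = \sum_(i < a.+1)
    (cC (- ev psi) ^+ i * iter i e2 (iter (a - i) dx (f *: 'X^m))) *+ 'C(a, i).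
  move: (f *: _) => F; elim: a F => [|a IH] F; first by rewrite big_ord1 bin0 mul1r.
  rewrite iterSr IH.
  rewrite (sum_pascal (fun i j => cC (- ev psi) ^+ i * iter i e2 (iter j dx F))).
  apply: eq_bigr => i _; congr (_ *+ _).
  have ie2D n x y : iter n e2 (x + y) = iter n e2 x + iter n e2 y.
    by elim: n => //= n ->; rewrite (derivation_add e2_derivation).
  have ie2Z n c x : iter n e2 (cC c * x) = cC c * iter n e2 x.
    by elim: n => //= n ->; rewrite e2_cst.
  have idxD n x y : iter n dx (x + y) = iter n dx x + iter n dx y.
    by elim: n => //= n ->; rewrite (derivation_add dx_derivation).
  have idxZ n c x : iter n dx (cC c * x) = cC c * iter n dx x.
    by elim: n => //= n ->; rewrite dx_cst.
  rewrite {1}/e1 idxD idxZ ie2D ie2Z.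
  have -> : iter (a - i) dx (e2 F) = e2 (iter (a - i) dx F).
    by elim: (a - i)%N => //= n ->; rewrite dxe2.
  by rewrite -!iterSr exprS; ring.
rewrite /evp rmorph_sum /jet rmorph_sum /= scaler_suml; apply: eq_bigr => i _.
have ia : (a - i + i = a)%N by apply: subnK; rewrite -ltnS.
have L (X : K) n : map_poly ev (cC (- ev psi) ^+ i * X *+ n) = ((- ev psi) ^+ i *: evp X) *+ n.
  by rewrite rmorphMn rmorphM rmorphXn /= map_polyC /= evcst -polyC_exp mul_polyC.
rewrite L evp_iter_e2 iter_dx /evp map_polyZ map_polyXn iter_W -addnA ia scalerA scalerMnl.
rewrite rmorphMn rmorphM rmorphXn /jet_coef; congr (_ *: _).
rewrite ia mulnC mulrnA; congr (_ *+ _).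
by rewrite -mulrnAr mulrA -exprMn mulrN1 opprK -mulrnAr.
Qed.

(** All the [e2] are moved outside, where at the base point they multiply by rising factorials of
    the degree: these become the Pochhammer factors in 2 Y. *)
Lemma ev_moyal n f g m l :
  evp (moyal dx dy n (f *: 'X^m) (g *: 'X^l)) =
  ev (\sum_(j < n.+1) ((-1) ^+ (n - j) * (jet D psi m (n - j) f *+ rising (m + (n - j)) j) *
    (jet D psi l j g *+ rising (l + j) (n - j))) *+ 'C(n, j)) *: 'X^(m + l + 2 * n).
Proof.
rewrite -moyal_frame (moyal_expand e1e2) rmorph_sum /evp rmorph_sum /= scaler_suml.
apply: eq_bigr => j _; rewrite !rmorphMn; rewrite -scalerMnl; congr (_ *+ _).
have nj : (n - j + j = n)%N by apply: subnK; rewrite -ltnS.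
rewrite !rmorphM /= -!/(evp _).
have comm a b x : iter a e1 (iter b e2 x) = iter b e2 (iter a e1 x).
  elim: b => //= b IH; rewrite -IH; elim: a {IH} => //= a ->; exact: e1e2.
rewrite !comm !evp_iter_e2 !evp_e1 !iter_W.
rewrite !rmorphMn /= !rmorphXn !rmorphN !rmorph1 -!addnA nj [(j + (n - j))%N]addnC nj.
have -> : evp ((-1) ^+ j) = ((-1) ^+ j)%:P.
  by rewrite /evp rmorphXn rmorphN rmorph1 polyC_exp polyCN polyC1.
rewrite mul_polyC -!scalerAl -!scalerAr -exprD !scalerA.
have -> : (m + n + (l + n) = m + (l + 2 * n))%N by lia.
congr (_ *: _).
have mn (x : k) r : x *+ r = r%:R * x by rewrite mulr_natl.
set s := (-1) ^+ j; have ss : s * s = 1 by rewrite -exprMn mulrNN mulr1 expr1n.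
set t := (-1) ^+ _; set u := ev _; set v := ev _; set a := rising _ _; set b := rising _ _.
rewrite (mn (s * u)) (mn (t * v)) (mn u) (mn v).
rewrite -[RHS]mul1r -ss; ring.
Qed.

End Frame.
Section Separated.
Variables (k : comNzRingType) (cst : {rmorphism k -> A}) (I : Type) (ev : I -> {rmorphism A -> k}).
Hypothesis Dcst : forall c, D (cst c) = 0.
Hypothesis evcst : forall i c, ev i (cst c) = c.
Hypothesis ev_sep : forall a b, (forall i, ev i a = ev i b) -> a = b.

(** The evaluations separate the elements of [A], and any of them may serve as base point. *)
Lemma moyal_monomials psi n f g m l :
  moyal dx dy n (f *: 'X^m) (g *: 'X^l) =
  (\sum_(j < n.+1) ((-1) ^+ (n - j) * (jet D psi m (n - j) f *+ rising (m + (n - j)) j) *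
    (jet D psi l j g *+ rising (l + j) (n - j))) *+ 'C(n, j)) *: 'X^(m + l + 2 * n).
Proof.
apply/polyP => i; apply: ev_sep => x.
have := ev_moyal Dcst (evcst x) psi n f g m l => /(congr1 (fun p : {poly k} => p`_i)).
by rewrite coef_map /= !coefZ !coefXn rmorphM rmorph_nat.
Qed.

End Separated.

End Symbols.

(** * Classical Rankin-Cohen brackets as powers of the Poisson tensor *)

Section RankinCohen.
Variables (A : comNzRingType) (D : A -> A).
Hypothesis hD : derivation D.
Variables (k : fieldType) (cst : {rmorphism k -> A}) (I : Type) (ev : I -> {rmorphism A -> k}).
Hypothesis Dcst : forall c, D (cst c) = 0.
Hypothesis evcst : forall i c, ev i (cst c) = c.
Hypothesis ev_sep : forall a b, (forall i, ev i a = ev i b) -> a = b.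
Hypothesis char0 : forall n, (n.+1%:R : k) != 0.
Variables (Z : A).
Hypothesis DZ : D Z = 1.
Local Notation P := {poly A}.
Implicit Types (p q r : P) (phi om f g : A).

Definition Yp p : P := 'X * p^`().
Definition Xp phi p : P := 'X * (mapD D p - phi *: Yp p).

Fixpoint opBp phi om (n : nat) p : P :=
  if n is m.+1 then
    Xp phi (opBp phi om m p) -
    (if m is j.+1 then
       cst m%:R *: ((om *: 'X^2) * (Yp (opBp phi om j p) - cst (j%:R / 2) *: opBp phi om j p))
     else 0)
  else p.

Fixpoint pochp (c m : nat) p : P :=
  if m is j.+1 then
    let q := pochp c j p in cst 2 *: Yp q + cst (c + j)%:R *: q
  else p.

(** Both halves use the same pair (phi, om), and (-1)^i B_i stands in for A_i. *)
Definition rcp phi om n p q : P :=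
  \sum_(i < n.+1)
    (cst (i`!%:R)^-1 *: ((-1) ^+ i *: opBp phi om i (pochp i (n - i) p))) *
    (cst ((n - i)`!%:R)^-1 *: opBp phi om (n - i) (pochp (n - i) i q)).

Let DD := derivation_add hD.
Let D0 := derivation0 hD.

Let cstn n : cst n%:R = n%:R.
Proof. exact: rmorph_nat. Qed.

Lemma Yp_monomial f m : Yp (f *: 'X^m) = (f *+ m) *: 'X^m.
Proof.
rewrite /Yp derivZ derivXn -scalerAr mulrnAr -exprS.
case: m => [|m]; first by rewrite !mulr0n scaler0 scale0r.
by rewrite /= -scalerMnr scalerMnl.
Qed.

Lemma mapD_monomial f m : mapD D (f *: 'X^m) = D f *: 'X^m.
Proof.
apply/polyP => i; rewrite (coef_mapD hD) !coefZ !coefXn.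
by case: eqP; rewrite ?mulr1// !mulr0 D0.
Qed.

Lemma Xp_monomial phi f m : Xp phi (f *: 'X^m) = (D f - phi * f *+ m) *: 'X^(m.+1).
Proof.
by rewrite /Xp mapD_monomial Yp_monomial scalerA -scalerBl -scalerAr -exprS mulrnAr.
Qed.

Lemma pochp_monomial c n f m : pochp c n (f *: 'X^m) = (f *+ rising (2 * m + c) n) *: 'X^m.
Proof.
elim: n => [|n IH] /=; first by rewrite rising0 mulr1n.
rewrite IH Yp_monomial !scalerA -scalerDl risingS !cstn; congr (_ *: _).
have mn (x : A) (j : nat) : x *+ j = j%:R * x by rewrite mulr_natl.
rewrite mulrnA; move: (f *+ _) => F; rewrite (mn F m) (mn F (2 * m + c + n)%N).
by rewrite (natrD _ (2 * m + c)) (natrD _ (2 * m)) (natrM _ 2) natrD; ring.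
Qed.

(** For phi = -2 psi the adapted omega is 2 (psi^2 + D psi), and 'X^m has weight 2 m; the recursion
    of [opBp] is then [jetS]. The recursion reaches back two steps, hence the paired induction. *)
Lemma opBp_monomial psi n f m :
  opBp (- 2%:R * psi) (2%:R * (psi ^+ 2 + D psi)) n (f *: 'X^m) = jet D psi (2 * m) n f *: 'X^(m + n).
Proof.
pose om := 2%:R * (psi ^+ 2 + D psi).
have mn (x : A) (j : nat) : x *+ j = j%:R * x by rewrite mulr_natl.
have H j : opBp (- 2%:R * psi) om j (f *: 'X^m) = jet D psi (2 * m) j f *: 'X^(m + j) /\
   opBp (- 2%:R * psi) om j.+1 (f *: 'X^m) = jet D psi (2 * m) j.+1 f *: 'X^(m + j.+1).
  elim: j => [|j [IH1 IH2]].
    split; first by rewrite jet0 addn0.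
    rewrite /= Xp_monomial subr0 jetS// jet0 addn1 subr0 muln0 addn0; congr (_ *: _).
    by rewrite (mn (- 2%:R * psi * f)) (mn (psi * f)) natrM; ring.
  split=> //; rewrite [LHS]/= -/(opBp _ _ j.+1 _) IH2 IH1 Xp_monomial Yp_monomial.
  rewrite scalerA -scalerBl -scalerAl -scalerAr !scalerA -exprD.
  have -> : (2 + (m + j) = m + j.+2)%N by lia.
  rewrite -addnS -scalerBl (jetS hD psi (2 * m) j.+1 f); congr (_ *: _).
  have half : cst (j%:R / 2) * 2%:R = j%:R.
    by rewrite -cstn -rmorphM mulfVK ?cstn// (char0 1).
  rewrite cstn /om; set a := jet D psi (2 * m) j.+1 f; set b := jet D psi (2 * m) j f.
  have -> : j.+1%:R * (2%:R * (psi ^+ 2 + D psi)) * (b *+ (m + j) - cst (j%:R / 2) * b) =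
     j.+1%:R * ((psi ^+ 2 + D psi) * (2%:R * (b *+ (m + j)) - (cst (j%:R / 2) * 2%:R) * b)) by ring.
  rewrite half (mn (- 2%:R * psi * a)) (mn (psi * a)) (mn (_ * b)) (mn b) !natrM !natrD !natrM -[j.+1%:R]natr1.
  ring.
by have [] := H n.
Qed.

Lemma mapD_D p q : mapD D (p + q) = mapD D p + mapD D q.
Proof. exact: (derivation_add (mapD_derivation hD)). Qed.

Lemma YpD p q : Yp (p + q) = Yp p + Yp q.
Proof. by rewrite /Yp derivD mulrDr. Qed.

Lemma XpD phi p q : Xp phi (p + q) = Xp phi p + Xp phi q.
Proof. by rewrite /Xp mapD_D YpD scalerDr; ring. Qed.

Lemma pochpD c n p q : pochp c n (p + q) = pochp c n p + pochp c n q.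
Proof. by elim: n => //= n ->; rewrite YpD !scalerDr addrACA. Qed.

Lemma opBpD phi om n p q : opBp phi om n (p + q) = opBp phi om n p + opBp phi om n q.
Proof.
suff [] : opBp phi om n (p + q) = opBp phi om n p + opBp phi om n q /\
  opBp phi om n.+1 (p + q) = opBp phi om n.+1 p + opBp phi om n.+1 q by [].
elim: n => [|n [IH1 IH2]]; first by rewrite /= !subr0 XpD.
split=> //; rewrite [LHS]/= -/(opBp _ _ n.+1 _) IH2 IH1 [in RHS]/= -!/(opBp _ _ n.+1 _).
rewrite XpD YpD !scalerDr; set u := cst _; set v := cst _.
set a := Xp _ _; set b := Xp _ _.
rewrite opprD addrACA mulrDr scalerDr; set x := opBp _ _ n p; set y := opBp _ _ n q.
by rewrite opprD addrACA.
Qed.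

Lemma rcpDl phi om n p p' q : rcp phi om n (p + p') q = rcp phi om n p q + rcp phi om n p' q.
Proof.
rewrite /rcp -big_split /=; apply: eq_bigr => i _.
by rewrite pochpD opBpD !scalerDr mulrDl.
Qed.

Lemma rcpDr phi om n p q q' : rcp phi om n p (q + q') = rcp phi om n p q + rcp phi om n p q'.
Proof.
rewrite /rcp -big_split /=; apply: eq_bigr => i _.
by rewrite pochpD opBpD !scalerDr mulrDr.
Qed.

Lemma polyn_ind (Q : P -> Prop) : (forall f m, Q (f *: 'X^m)) ->
  (forall p q, Q p -> Q q -> Q (p + q)) -> forall p, Q p.
Proof.
move=> Qm QD p; rewrite -[p]coefK poly_def.
elim/big_rec: _ => [|i q _ Qq]; last exact: QD.
by have := Qm 0 0%N; rewrite scale0r.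
Qed.

(** In the brackets 'X^m stands for weight 2 m, in the calculus of homogeneous functions for degree
    m; the substitution of 'X^2 reconciles the two. *)
Let u2 p : P := p \Po 'X^2.

Let u2_monomial f m : u2 (f *: 'X^m) = f *: 'X^(2 * m).
Proof. by rewrite /u2 comp_polyZ rmorphXn /= comp_polyX -exprM. Qed.

Let u2_inj : injective u2.
Proof.
move=> p q /(congr1 (fun r : P => r))-pq; apply/polyP => i.
have h r : r`_i = (u2 r)`_(2 * i) by rewrite /u2 coef_comp_poly_Xn// dvdn_mulr// mulKn.
by rewrite !h pq.
Qed.

Let fact_cst n : n`!%:R * cst n`!%:R^-1 = 1.
Proof.
have n0 : n`!%:R != 0 :> k by have := fact_gt0 n; case: (n`!) => // j _; exact: char0.
by rewrite -cstn -rmorphM mulfV// rmorph1.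
Qed.

Local Notation T := (moyal (dx D) (dy D Z)).
Let dxD := dx_derivation hD.
Let dyD := dy_derivation hD Z.

(** The right-hand side does not involve psi, and its powers obey the Moyal identities: independence
    and associativity both follow from here. *)
Lemma rcp_moyal psi n p q :
  u2 (rcp (- 2%:R * psi) (2%:R * (psi ^+ 2 + D psi)) n p q) *+ n`! = T n (u2 p) (u2 q).
Proof.
elim/polyn_ind: p => [f m|p p' IH IH']; last first.
  by rewrite rcpDl /u2 !comp_polyD mulrnDl IH IH' (moyalDl dxD dyD).
elim/polyn_ind: q => [g l|q q' IH IH']; last first.
  by rewrite rcpDr /u2 !comp_polyD mulrnDl IH IH' (moyalDr dxD dyD).
rewrite !u2_monomial (moyal_monomials hD DZ Dcst evcst ev_sep psi).
(* The expansion of the tensor is indexed by the order of the jet of the second factor, the bracket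
   by that of the first. *)
rewrite /rcp (reindex_inj rev_ord_inj) /= /u2 raddf_sum /= -/u2 scaler_suml -sumrMnl.
apply: eq_bigr => j _; rewrite subSS.
have nj : (n - (n - j) = j)%N by rewrite subKn// -ltnS.
rewrite nj !pochp_monomial !opBp_monomial.
rewrite !(jetMn hD); set x := _ *+ rising _ j; set y := _ *+ rising _ _; set t := (-1) ^+ _.
rewrite !scalerA -!scalerAl -!scalerAr -exprD !scalerA -/(u2 _) u2_monomial.
have -> : (2 * (m + (n - j) + (l + j)) = 2 * m + 2 * l + 2 * n)%N by have := ltn_ord j; lia.
rewrite scalerMnl; congr (_ *: _).
have mn (z : A) (i : nat) : z *+ i = i%:R * z by rewrite mulr_natl.
have jn : (j <= n)%N by rewrite -ltnS.
rewrite (mn _ n`!) -(bin_fact jn) !natrM (mn (t * x * y)); set c1 := cst _; set c2 := cst _.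
have -> : 'C(n, j)%:R * (j`!%:R * (n - j)`!%:R) * (c1 * t * x * (c2 * y)) =
  'C(n, j)%:R * ((n - j)`!%:R * c1) * (j`!%:R * c2) * (t * x * y) by ring.
by rewrite !fact_cst !mulr1.
Qed.

Definition adapted phi om := 2%:R * om = phi ^+ 2 - 2%:R * D phi.

Let half : 2%:R * cst 2%:R^-1 = 1.
Proof. by rewrite -cstn -rmorphM mulfV ?rmorph1// (char0 1). Qed.

Let Dhalf x : D (cst 2%:R^-1 * x) = cst 2%:R^-1 * D x.
Proof. by rewrite (derivation_mul hD) Dcst mul0r add0r. Qed.

Let rcp_moyal' phi om n p q : adapted phi om ->
  u2 (rcp phi om n p q) *+ n`! = T n (u2 p) (u2 q).
Proof.
move=> ok; rewrite -(rcp_moyal (- (cst 2%:R^-1 * phi))); congr (u2 (rcp _ _ _ _ _) *+ _).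
  by rewrite mulrNN mulrA half mul1r.
have hf := half; rewrite (derivationN _ hD) Dhalf; set h := cst _ in hf *.
have -> : om = h * (2%:R * om) by rewrite mulrA (mulrC h) hf mul1r.
rewrite ok.
have -> : h * (phi ^+ 2 - 2%:R * D phi) = h * phi ^+ 2 - (2%:R * h) * D phi by ring.
have -> : 2%:R * ((- (h * phi)) ^+ 2 - h * D phi) = (2%:R * h) * (h * phi ^+ 2) - (2%:R * h) * D phi by ring.
by rewrite hf !mul1r.
Qed.

Let fact_inj n p q : p *+ n`! = q *+ n`! -> p = q.
Proof.
have e r : r = cst n`!%:R^-1 *: (r *+ n`!).
  by rewrite -scaler_nat scalerA mulrC fact_cst scale1r.
by move=> pq; rewrite (e p) pq -e.
Qed.

Lemma rcp_indep phi om phi' om' n p q : adapted phi om -> adapted phi' om' ->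
  rcp phi om n p q = rcp phi' om' n p q.
Proof.
move=> ok ok'; apply: u2_inj; apply: (@fact_inj n).
by rewrite !rcp_moyal'.
Qed.

(** Multiplied by N! = (N - i)! i! 'C(N, i), the two sides become the binomial sums of
    [moyal_assocl] and [moyal_assocr]. *)
Lemma rcp_assoc phi om N p q r : adapted phi om ->
  \sum_(i < N.+1) rcp phi om (N - i) (rcp phi om i p q) r =
  \sum_(i < N.+1) rcp phi om (N - i) p (rcp phi om i q r).
Proof.
move=> ok; apply: u2_inj; apply: (@fact_inj N).
have TMl n F G a : T n (F *+ a) G = T n F G *+ a.
  by elim: a => [|a IH]; rewrite ?mulr0n ?(moyal0l dxD dyD)// !mulrS (moyalDl dxD dyD) IH.
have TMr n F G a : T n F (G *+ a) = T n F G *+ a.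
  by elim: a => [|a IH]; rewrite ?mulr0n ?(moyal0r dxD dyD)// !mulrS (moyalDr dxD dyD) IH.
rewrite /u2 !raddf_sum /= -/u2 -!sumrMnl.
have fE (i : 'I_N.+1) : N`! = ((N - i)`! * i`! * 'C(N, i))%N.
  have iN : (i <= N)%N by rewrite -ltnS.
  by rewrite -(bin_fact iN) mulnC [(i`! * _)%N]mulnC.
transitivity (moyal3 (dx D) (dy D Z) N (u2 p) (u2 q) (u2 r)).
  rewrite -(moyal_assocl dxD dyD (dxdyC hD DZ)); apply: eq_bigr => i _.
  rewrite (fE i) mulrnA mulrnA -/(u2 (rcp _ _ _ _ _)) (rcp_moyal' _ _ _ ok).
  by rewrite -(TMl _ _ _ i`!) (rcp_moyal' _ _ _ ok).
rewrite -(moyal_assocr dxD dyD (dxdyC hD DZ)); apply: eq_bigr => i _.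
rewrite (fE i) mulrnA mulrnA -/(u2 (rcp _ _ _ _ _)) (rcp_moyal' _ _ _ ok).
by rewrite -(TMr _ _ _ i`!) (rcp_moyal' _ _ _ ok).
Qed.

End RankinCohen.

(** * The eta function and Ramanujan's identity *)

Section MTest.
Variable R : realType.
Local Notation C := R[i].

Lemma partial_sums_tail (v : nat -> R) (B : R) : (forall k, 0 <= v k) ->
  (forall n, \sum_(k < n) v k <= B) ->
  exists r : nat -> R, (forall m n, (m <= n)%N -> \sum_(k < n) v k - \sum_(k < m) v k <= r m) /\
    forall e : R, 0 < e -> \forall n \near \oo, r n < e.
Proof.
move=> v0 vB; pose s n := \sum_(k < n) v k.
have ndS : nondecreasing_seq s.
  by apply/nondecreasing_seqP => n; rewrite /s big_ord_recr /= lerDl.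
have cv : cvgn s.
  by apply: nondecreasing_is_cvgn => //; exists B => _ [n _ <-]; exact: vB.
exists (fun m => limn s - s m); split=> [m n mn|e e0].
  by rewrite lerB// nondecreasing_cvgn_le.
have /cvgrPdist_lt /(_ e e0) := cv; apply: filterS => n.
by apply: le_lt_trans; exact: ler_norm.
Qed.

Lemma mtest (u : nat -> uhp R -> C) :
  (forall z, exists2 d : R, 0 < d & exists v : nat -> R, exists B : R,
     (forall n, \sum_(k < n) v k <= B) /\
     forall w k, cabs (uhpval w - uhpval z) < d -> cabs (u k w) <= v k) ->
  exists f, lucvg (fun n z => \sum_(k < n) u k z) f.
Proof.
move=> hu.
have H z : exists2 d : R, 0 < d & exists2 r : nat -> R,
    (forall e : R, 0 < e -> \forall n \near \oo, r n < e) &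
    forall w m n, cabs (uhpval w - uhpval z) < d -> (m <= n)%N ->
      cabs (\sum_(k < n) u k w - \sum_(k < m) u k w) <= r m.
  have [d d0 [v [B [vB uv]]]] := hu z; exists d => //.
  have v0 k : 0 <= v k.
    by apply: le_trans (cabs_ge0 (u k z)) (uv _ _ _); rewrite subrr cabs0.
  have [r [vr r0]] := partial_sums_tail v0 vB; exists r => // w m n wz mn.
  apply: le_trans (vr _ _ mn).
  rewrite -!(big_mkord xpredT (fun k => u k w)) -!(big_mkord xpredT v).
  rewrite !(big_cat_nat (leq0n m) mn) /= addrAC subrr add0r addrAC subrr add0r.
  by apply: le_trans (cabs_sum _ _ _) _; apply: ler_sum => k _; exact: uv.
have /choice[f hf] z : exists l, ccvg \oo (fun n => \sum_(k < n) u k z) l.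
  have [d d0 [r r0 hr]] := H z.
  have zz : cabs (uhpval z - uhpval z) < d by rewrite subrr cabs0.
  by have [l hl _] := ccauchy_cvg (fun m n => hr z m n zz) r0; exists l.
exists f => z; have [d d0 [r r0 hr]] := H z; exists d => // e e0.
apply: filterS (r0 e e0) => n rn w wz.
have [l hl lr] := ccauchy_cvg (fun m n => hr w m n wz) r0.
rewrite (ccvg_unique (hf w) hl) cabsB.
by apply: le_trans (lr n) _; exact: ltW.
Qed.

Lemma lucvg_eq (F G : nat -> uhp R -> C) f g :
  (forall n z, F n z = G n z) -> (forall z, f z = g z) -> lucvg F f -> lucvg G g.
Proof.
move=> FG fg h z; have [d d0 hd] := h z; exists d => // e e0.
by apply: filterS (hd e e0) => n hn w wz; rewrite -FG -fg; exact: hn.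
Qed.

Lemma sum_ord_recl (V : nmodType) (c : nat -> V) n :
  \sum_(k < n.+1) c k = c 0%N + \sum_(k < n) c k.+1.
Proof. by rewrite big_ord_recl. Qed.

Lemma hsum0 (T : eqType) (c : T -> C) : (forall x, c x = 0) -> hsum c 0.
Proof.
move=> c0; rewrite -(big_nil 0 +%R xpredT c).
by apply: hsum_finite.
Qed.

Lemma hsum_term (c : nat -> C) s : hsum c s -> ccvg \oo c 0.
Proof.
move=> /hsum_nat hs.
have h1 : ccvg \oo (fun n => \sum_(k < n.+1) c k) s.
  move=> e e0; have [N _ hN] := hs e e0; exists N => // n /= Nn.
  by apply: hN => /=; exact: leq_trans Nn _.
apply: ccvg_eq (_ : ccvg \oo (fun n => \sum_(k < n.+1) c k - \sum_(k < n) c k) 0).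
  by move=> n; rewrite big_ord_recr /= addrAC subrr add0r.
have h2 := ccvgB h1 hs.
rewrite subrr in h2.
exact: h2.
Qed.

Lemma asum_poly (y : C) j : cabs y < 1 ->
  asum (fun n => (n ^ j)%:R * y ^+ n) (j`!%:R * (1 - cabs y) ^- j.+1).
Proof.
move=> y1; apply: asum_nat => n.
under eq_bigr do rewrite cabsM cabsX cabs_nat.
by apply: poly_geometric; rewrite cabs_ge0.
Qed.

Lemma asum_nat_shift (c : nat -> C) M : asum c M ->
  asum (fun n => if n is m.+1 then c m else 0) M.
Proof.
move=> h; apply: asum_nat => -[|n]; first by rewrite big_ord0 (asum_ge0 h).
rewrite big_ord_recl [X in X + _]cabs0 add0r.
by rewrite -(big_mkord xpredT (fun m => cabs (c m))); apply: h; rewrite /index_iota iota_uniq.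
Qed.

Lemma pow_cvg0 (y : C) : cabs y < 1 -> ccvg \oo (fun n => y ^+ n) 0.
Proof.
move=> /(asum_poly 0)/asum_hsum[s hs _]; apply: ccvg_eq (hsum_term hs) => n.
by rewrite expn0 mul1r.
Qed.

Lemma npow_cvg0 (y : C) : cabs y < 1 -> ccvg \oo (fun n => n%:R * y ^+ n) 0.
Proof.
move=> /(asum_poly 1)/asum_hsum[s hs _]; apply: ccvg_eq (hsum_term hs) => n.
by rewrite expn1.
Qed.

Lemma cabs_lt1_neq1 (y : C) : cabs y < 1 -> 1 - y != 0.
Proof.
by move=> y1; apply/eqP => /eqP; rewrite subr_eq0 => /eqP e; move: y1; rewrite -e cabs1 ltxx.
Qed.

Lemma hsum_geometric (y : C) : cabs y < 1 ->
  hsum (fun n => if n is _.+1 then y ^+ n else 0) (y / (1 - y)).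
Proof.
move=> y1; have n0 := cabs_lt1_neq1 y1.
have h0 := asum_nat_shift (asumZ y (asum_poly 0 y1)).
apply: hsum_nat_lim (asum_le _ h0) _.
  by move=> [|n] //; rewrite expn0 mul1r exprS.
have hl : ccvg \oo (fun n => (y - y * y ^+ n) / (1 - y)) (y / (1 - y)).
  have -> : y / (1 - y) = (y - y * 0) * (1 - y)^-1 by rewrite mulr0 subr0.
  apply: ccvgM; last exact: ccvg_cst.
  by apply: ccvgB; [exact: ccvg_cst|apply: ccvgM; [exact: ccvg_cst|exact: pow_cvg0]].
have E n : (y - y * y ^+ n) / (1 - y) = \sum_(k < n.+1) (if k : nat is _.+1 then y ^+ k else 0).
  elim: n => [|n IH]; first by rewrite big_ord_recl big_ord0 /= expr0 mulr1 subrr mul0r addr0.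
  by rewrite big_ord_recr /= -IH !exprS; field.
move=> e e0; have [N _ hN] := hl e e0; exists N.+1 => // -[|n] //= Nn.
by rewrite -E; exact: hN.
Qed.

Lemma hsum_geometric2 (y : C) : cabs y < 1 ->
  hsum (fun n => n%:R * y ^+ n) (y / (1 - y) ^+ 2).
Proof.
move=> y1; have n0 := cabs_lt1_neq1 y1.
apply: hsum_nat_lim (asum_le _ (asum_poly 1 y1)) _; first by move=> n; rewrite expn1.
have hl : ccvg \oo (fun n => (y - n%:R * y ^+ n * (1 - y) - y * y ^+ n) / (1 - y) ^+ 2)
    ((y - 0 * (1 - y) - y * 0) * (1 - y) ^- 2).
  apply: ccvgM; last exact: ccvg_cst.
  apply: ccvgB; last by apply: ccvgM; [exact: ccvg_cst|exact: pow_cvg0].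
  apply: ccvgB; first exact: ccvg_cst.
  by apply: ccvgM; [exact: npow_cvg0|exact: ccvg_cst].
rewrite mul0r mulr0 !subr0 in hl; apply: ccvg_eq hl => n.
elim: n => [|n IH]; first by rewrite big_ord0 mul0r mul0r expr0 mulr1 subr0 subrr mul0r.
by rewrite big_ord_recr /= -IH !exprS; field.
Qed.

End MTest.

(** * The nome q and its powers *)

Section Nome.
Variable R : realType.
Local Notation C := R[i].
Local Notation uder := (der (@uhpval R)).
Local Notation t := (twopii R).
Implicit Types z : uhp R.

Lemma cabs_nome z : cabs (nome z) = expR (- (2 * pi * complex.Im (uhpval z))).
Proof.
rewrite /nome cabs_cexp /twopii; case: (uhpval z) => x y; congr expR => /=; ring.
Qed.

Lemma nome_lt1 z : cabs (nome z) < 1.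
Proof.
by rewrite cabs_nome expR_lt1 oppr_lt0 !mulr_gt0 ?pi_gt0 ?uhp_gt0.
Qed.

Lemma nome_near z : exists2 d : R, 0 < d & exists2 rho : R, 0 < rho < 1 &
  forall w, cabs (uhpval w - uhpval z) < d -> cabs (nome w) <= rho.
Proof.
have y0 := uhp_gt0 z; have p0 := pi_gt0 R.
exists (complex.Im (uhpval z) / 2); first by rewrite divr_gt0.
exists (expR (- (pi * complex.Im (uhpval z)))).
  by rewrite expR_gt0 expR_lt1 oppr_lt0 mulr_gt0.
move=> w wz; rewrite cabs_nome ler_expR lerN2 (mulrC 2) -mulrA ler_pM2l//.
have := absIm_le (uhpval w - uhpval z); rewrite ImD ImN => h.
have := ler_norm (- (complex.Im (uhpval w) - complex.Im (uhpval z))); rewrite normrN; lra.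
Qed.

Lemma der_cexp_lin (a : C) z : uder (fun w => cexp (a * uhpval w)) z (a * cexp (a * uhpval z)).
Proof.
rewrite mulrC; apply: (der_comp id (g := @cexp R) (f := fun w => a * uhpval w)); last exact: der_cexp.
by have := derZ a (der_emb (@uhpval R) z); rewrite mulr1.
Qed.

Lemma der_nomeX n z : uder (fun w => nome w ^+ n) z (t * (n%:R * nome z ^+ n)).
Proof.
have h := der_cexp_lin (n%:R * t) z.
have e w : cexp (n%:R * t * uhpval w) = nome w ^+ n by rewrite -mulrA cexpMn.
rewrite (_ : t * _ = n%:R * t * cexp (n%:R * t * uhpval z)).
  by apply: der_eq h => w; rewrite e.
by rewrite e; ring.
Qed.

Lemma hol_nomeX n : holomorphic (fun z => nome z ^+ n).
Proof. by apply/holomorphicP => z; exists (t * (n%:R * nome z ^+ n)); exact: der_nomeX. Qed.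

Lemma nomeX_lt1 n z : cabs (nome z ^+ n.+1) < 1.
Proof. by rewrite cabsX exprn_ilt1 ?cabs_ge0 ?nome_lt1. Qed.

Lemma nomeX_neq1 n z : 1 - nome z ^+ n.+1 != 0.
Proof. exact/cabs_lt1_neq1/nomeX_lt1. Qed.

End Nome.

(** * Convergence of the eta product and its logarithmic derivative *)

Section Eta.
Variable R : realType.
Local Notation C := R[i].
Local Notation uder := (der (@uhpval R)).
Local Notation t := (twopii R).
Implicit Types z : uhp R.

Definition eprod (N : nat) z : C := \prod_(k < N) (1 - nome z ^+ k.+1).

Lemma geometric_le (r : R) N : 0 <= r < 1 -> \sum_(k < N) r ^+ k.+1 <= (1 - r)^-1.
Proof.
move=> r01; have := poly_geometric 0 N r01; rewrite fact0 mul1r expr1; apply: le_trans.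
apply: ler_sum => k _; rewrite expn0 mul1r exprS; case/andP: r01 => r0 r1.
by rewrite ler_piMl ?exprn_ge0// ltW.
Qed.

Lemma prod_expR_le (a : nat -> R) N :
  (forall k, 0 <= a k) -> \prod_(k < N) (1 + a k) <= expR (\sum_(k < N) a k).
Proof.
move=> a0; elim: N => [|N IH]; first by rewrite !big_ord0 expR0.
rewrite !big_ord_recr /= expRD ler_pM// ?expR_ge1Dx//.
  by apply: prodr_ge0 => k _; rewrite addr_ge0.
by rewrite addr_ge0.
Qed.

Lemma eprod_bound (rho : R) z N : 0 < rho < 1 -> cabs (nome z) <= rho ->
  cabs (eprod N z) <= expR (1 - rho)^-1.
Proof.
case/andP=> r0 r1 h; have r01 : 0 <= rho < 1 by rewrite ltW.
have p0 k : 0 <= rho ^+ k.+1 by rewrite exprn_ge0 ?ltW.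
rewrite /eprod cabs_prod; apply: le_trans (_ : \prod_(k < N) (1 + rho ^+ k.+1) <= _).
  apply: ler_prod => k _; rewrite cabs_ge0 /=; apply: le_trans (cabsD _ _) _.
  by rewrite cabs1 cabsN cabsX lerD2l lerXn2r// ?nnegrE ?cabs_ge0// ltW.
apply: le_trans (prod_expR_le N p0) _.
by rewrite ler_expR; exact: geometric_le.
Qed.

(** With r = |q| and k >= 1, (1 - r^k) (1 + r^k / (1 - r)) >= 1; so the products are bounded below
    by the inverses of products that are bounded above. This is why the limit does not vanish. *)
Lemma eprod_lower z : exists2 c : R, 0 < c & forall N, c <= cabs (eprod N z).
Proof.
set rho := cabs (nome z); have r1 : rho < 1 := nome_lt1 z; have r0 : 0 <= rho := cabs_ge0 _.
have r01 : 0 <= rho < 1 by rewrite r0.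
have d0 : 0 < 1 - rho by rewrite subr_gt0.
pose a k := rho ^+ k.+1 / (1 - rho).
have a0 k : 0 <= a k by rewrite /a divr_ge0 ?exprn_ge0 // ltW.
have h N : \prod_(k < N) (1 + a k) <= expR ((1 - rho)^-1 / (1 - rho)).
  apply: le_trans (prod_expR_le N a0) _; rewrite ler_expR /a -mulr_suml.
  by rewrite ler_pM2r ?invr_gt0//; exact: geometric_le.
exists (expR ((1 - rho)^-1 / (1 - rho)))^-1; first by rewrite invr_gt0 expR_gt0.
move=> N; rewrite -[_^-1]mulr1 ler_pdivrMl ?expR_gt0//.
apply: le_trans (_ : 1 <= _) _ => //.
apply: le_trans (_ : cabs (eprod N z) * \prod_(k < N) (1 + a k) <= _); last first.
  by rewrite mulrC ler_pM2r ?h// /eprod cabs_prod prodr_gt0// => k _; rewrite cabs_gt0 nomeX_neq1.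
rewrite /eprod cabs_prod -big_split /=; apply: (big_ind (fun x => 1 <= x)) => //.
  by move=> x y x1 y1; rewrite -[1]mulr1 ler_pM.
move=> k _; have k1 : rho ^+ k.+1 <= rho by rewrite exprS ler_piMr// exprn_ile1// ltW.
have k0 : 0 <= rho ^+ k.+1 by rewrite exprn_ge0.
apply: le_trans (_ : (1 - rho ^+ k.+1) * (1 + a k) <= _); last first.
  rewrite ler_wpM2r ?addr_ge0//; have := cabs_triB 1 (nome z ^+ k.+1).
  by rewrite cabs1 cabsX.
have -> : (1 - rho ^+ k.+1) * (1 + a k) = 1 + rho ^+ k.+1 * (rho - rho ^+ k.+1) / (1 - rho).
  by rewrite /a; field; rewrite gt_eqF.
by rewrite lerDl divr_ge0 ?mulr_ge0 ?subr_ge0// ltW.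
Qed.

(** Telescoping writes the n-th product as 1 minus the sum of q^(k + 1) times the k-th product; as
    the products are locally bounded, the M-test applies with a geometric majorant. *)
Lemma eprod_cvg : exists P : uhp R -> C, lucvg eprod P.
Proof.
have [f hf] : exists f, lucvg (fun n z => \sum_(k < n) - (nome z ^+ k.+1 * eprod k z)) f.
  apply: (mtest (u := fun k z => - (nome z ^+ k.+1 * eprod k z))) => z; have [d d0 [rho r01 hr]] := nome_near z.
  exists d => //; exists (fun k => rho ^+ k.+1 * expR (1 - rho)^-1).
  have r01' : 0 <= rho < 1 by case/andP: r01 => /ltW -> ->.
  exists ((1 - rho)^-1 * expR (1 - rho)^-1); split=> [n|w k wz].
    by rewrite -mulr_suml ler_wpM2r ?expR_ge0//; exact: geometric_le.
  rewrite cabsN cabsM ler_pM ?cabs_ge0//; last exact: eprod_bound (hr w wz).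
  by rewrite cabsX lerXn2r// ?nnegrE ?cabs_ge0 ?hr//; case/andP: r01 => /ltW.
exists (fun z => 1 + f z) => z; have [d d0 hd] := hf z; exists d => // e e0.
apply: filterS (hd e e0) => n hn w wz.
suff -> : eprod n w = 1 + \sum_(k < n) - (nome w ^+ k.+1 * eprod k w).
  by have := hn w wz; rewrite [X in cabs X](_ : _ = 1 + \sum_(k < n) - (nome w ^+ k.+1 * eprod k w) - (1 + f
      w)) //; ring.
elim: n {hn} => [|n IH]; first by rewrite /eprod !big_ord0 addr0.
by rewrite /eprod big_ord_recr /= -/(eprod n w) big_ord_recr /= addrA -IH mulrBr mulr1 mulrC.
Qed.

Definition phi : uhp R -> C := fun z => t^-1 * dlog (@eta4 R) z.

Lemma hol_eprod N : holomorphic (eprod N).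
Proof.
elim: N => [|N IH].
  by apply: (@hol_eq R (fun=> 1)) (@hol_cst R 1) => z; rewrite /eprod big_ord0.
apply: hol_eq (holM IH (holB (@hol_cst R 1) (@hol_nomeX R N.+1))) => z.
by rewrite /eprod big_ord_recr.
Qed.

Lemma der_eprod N z :
  uder (eprod N) z (- t * (\sum_(k < N) k.+1%:R * (nome z ^+ k.+1 / (1 - nome z ^+ k.+1))) * eprod N z).
Proof.
elim: N => [|N IH].
  rewrite big_ord0 mulr0 mul0r; apply: der_eq (der_cst _ 1 z) => w.
  by rewrite /eprod big_ord0.
have h := derM IH (derB (der_cst _ 1 z) (der_nomeX N.+1 z)).
rewrite (_ : _ * eprod N.+1 z = - t * (\sum_(k < N) k.+1%:R * (nome z ^+ k.+1 / (1 - nome z ^+ k.+1))) * eprod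
    N z * (1 - nome z ^+ N.+1) + eprod N z * (0 - t * (N.+1%:R * nome z ^+ N.+1))).
  by apply: der_eq h => w; rewrite /eprod big_ord_recr.
rewrite /eprod !big_ord_recr /= -/(eprod N z); have := nomeX_neq1 N z.
by move: (\sum_(_ < _) _) (eprod N z) (nome z ^+ N.+1) => S P q q1; field.
Qed.

(** The product gives dlog eta = 2 i pi (1 / 24 - S) with S the limit of the Lambert sums, and phi
    is 4 / (2 i pi) times this; hence S = (1 - 6 phi) / 24. *)
Lemma eta_facts :
  [/\ holomorphic (@eta4 R), forall z, eta4 z != 0 &
    forall z, ccvg \oo (fun N => \sum_(k < N) k.+1%:R * (nome z ^+ k.+1 / (1 - nome z ^+ k.+1)))
      ((1 - 6 * phi z) / 24)].
Proof.
have [P hP] := eprod_cvg.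
have [holP dP] := weierstrass hol_eprod hP.
have P0 z : P z != 0.
  have [c c0 hc] := eprod_lower z; apply/eqP => P0.
  have := lucvg_ccvg z hP; rewrite P0 => /(_ c c0)[N _ /(_ N (leqnn N))] /=.
  by rewrite subr0 ltNge hc.
have etaE z : dedekind_eta z = cexp (t / 24 * uhpval z) * P z.
  have -> : t / 24 * uhpval z = t * uhpval z / 24 by rewrite mulrAC.
  rewrite /dedekind_eta; congr (_ * _).
  apply: (limnE (u := fun N => \prod_(1 <= n < N.+1) (1 - nome z ^+ n))).
  apply: ccvg_eq (lucvg_ccvg z hP) => N.
  by rewrite /eprod big_add1 /= big_mkord.
have dEta z : uder (@dedekind_eta R) z
    ((t / 24 + cderiv P z / P z) * dedekind_eta z).
  have h := derM (der_cexp_lin (t / 24) z) (cderivP z holP).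
  rewrite etaE (_ : (_ + _) * _ = t / 24 * cexp (t / 24 * uhpval z) * P z + cexp (t / 24 * uhpval z) * cderiv P z).
    by apply: der_eq h => w; rewrite etaE.
  by rewrite mulrDl mulrA; congr (_ + _); rewrite mulrCA divfK.
have eta0 z : dedekind_eta z != 0 by rewrite etaE mulf_neq0 ?cexp_neq0.
have dEta4 z := derX 4 (dEta z).
split=> [|z|z]; first by apply/holomorphicP => z; exists (4%:R * dedekind_eta z ^+ 3 * ((t / 24 + cderiv P z /
    P z) * dedekind_eta z)); exact: dEta4.
  by rewrite expf_neq0.
have -> : (1 - 6 * phi z) / 24 = - t^-1 * (cderiv P z / P z).
  rewrite /phi /dlog (cderivE (dEta4 z)) /eta4 /=.
  have := twopii_neq0 R; have := eta0 z; move: (dedekind_eta z) (_ / P z) t => e p x e0 x0.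
  by field; rewrite e0 x0.
have h := ccvgM (dP z) (ccvgV (P0 z) (lucvg_ccvg z hP)).
have {}h := ccvgM (ccvg_cst (- t^-1)) (h _ _).
apply: ccvg_eq (h _ _ _ _) => N; rewrite (cderivE (der_eprod N z)).
have E0 : eprod N z != 0 by have [c c0 hc] := eprod_lower z; rewrite -cabs_gt0 (lt_le_trans c0).
have t0 := twopii_neq0 R; move: (\sum_(_ < _) _) (eprod N z) E0 t t0 => S E E0 x x0.
by field; rewrite E0.
Qed.

Lemma hol_eta4 : holomorphic (@eta4 R). Proof. by case: eta_facts. Qed.
Lemma eta4_neq0 z : eta4 z != 0. Proof. by case: eta_facts. Qed.

Lemma hol_phi : holomorphic phi.
Proof.
exact: (holM (@hol_cst R t^-1) (holM (holomorphic_cderiv hol_eta4) (holV eta4_neq0 hol_eta4))).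
Qed.

End Eta.

(** * The q-series of E_2, of its derivative and of E_4 *)

Section Ramanujan.
Variable R : realType.
Local Notation C := R[i].
Local Notation uder := (der (@uhpval R)).
Local Notation t := (twopii R).
Implicit Types z : uhp R.

(** The value 0 at n = 0 allows q-series indexed by all of nat. *)
Definition divsum (j n : nat) : nat := if n is 0 then 0%N else (\sum_(d <- divisors n) d ^ j)%N.

Lemma divsum_le j n : (divsum j n <= n ^ j.+1)%N.
Proof.
case: n => [|n] //; rewrite /divsum; set m := n.+1.
have sd : {subset divisors m <= iota 1 m}.
  by move=> d; rewrite -dvdn_divisors// mem_iota => dm; rewrite (dvdn_gt0 _ dm)//= add1n ltnS dvdn_leq.
apply: leq_trans (_ : \sum_(d <- divisors m) m ^ j <= _)%N.
  rewrite big_seq [X in (_ <= X)%N]big_seq; apply: leq_sum => d /sd.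
  by rewrite mem_iota => /andP[_ dm]; case: (j) => // i; rewrite leq_exp2r//; move: dm; rewrite add1n ltnS.
rewrite big_const_seq count_predT iter_addn_0 expnSr leq_mul2l.
by rewrite -[X in (_ <= X)%N](size_iota 1 m) (uniq_leq_size (divisors_uniq m) sd) orbT.
Qed.

Lemma asum_divsum j i (y : C) : cabs y < 1 ->
  exists M : R, asum (fun n => (n ^ i * divsum j n)%:R * y ^+ n) M.
Proof.
move=> y1; eexists; apply: asum_le (asum_poly (i + j.+1) y1) => n.
rewrite !cabsM !cabs_nat ler_wpM2r ?cabs_ge0// ler_nat expnD leq_mul2l.
by rewrite divsum_le orbT.
Qed.

(** The double series of a q^(a x). Its rows give the logarithmic derivative of eta, its columns q^x
    / (1 - q^x)^2, that is, squared cosecants, and its hyperbolas a x = n the divisor sums. *)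
Definition lamb z (p : nat * nat) : C :=
  if (0 < p.1)%N && (0 < p.2)%N then p.1%:R * nome z ^+ (p.1 * p.2) else 0.

Lemma asum_lamb z : exists M : R, asum (lamb z) M.
Proof.
have q1 := nome_lt1 z.
have hu := asum_poly 1 q1; have hv := asum_nat_shift (asum_poly 0 q1).
eexists; apply: (asum_prod _ hu hv) => a x; rewrite /lamb /= expn1.
case: a => [|a]; first by rewrite cabs0 mul0r cabs0 mul0r.
case: x => [|x]; first by rewrite andbF cabs0 mulr0.
rewrite /= expn0 mul1r -cabsM -mulrA -exprD !cabsM ler_wpM2l ?cabs_ge0// !cabsX.
by apply: ler_wiXn2l; rewrite ?cabs_ge0 ?ltW//; nia.
Qed.

Lemma lamb_row z a :
  hsum (fun x => lamb z (a, x)) (a%:R * (nome z ^+ a / (1 - nome z ^+ a))).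
Proof.
case: a => [|a]; first by rewrite mul0r; apply: hsum0 => x; rewrite /lamb.
apply: hsum_eq (hsumZ a.+1%:R (hsum_geometric (nomeX_lt1 a z))) => x.
by rewrite /lamb /=; case: x => [|x] /=; rewrite ?mulr0// -exprM.
Qed.

Lemma lamb_col z x :
  hsum (fun a => lamb z (a, x)) (if x is _.+1 then nome z ^+ x / (1 - nome z ^+ x) ^+ 2 else 0).
Proof.
case: x => [|x]; first by apply: hsum0 => a; rewrite /lamb andbF.
apply: hsum_eq (hsum_geometric2 (nomeX_lt1 x z)) => a.
by rewrite /lamb /=; case: a => [|a] /=; rewrite ?mul0r// -exprM mulnC.
Qed.

Lemma phi_lamb z : hsum (lamb z) ((1 - 6 * phi z) / 24).
Proof.
have [M hM] := asum_lamb z; have [s hs _] := asum_hsum hM.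
have [_ _ /(_ z) h] := eta_facts R.
suff -> : (1 - 6 * phi z) / 24 = s by [].
apply: ccvg_unique h _; have := hsum_nat (hsum_row hs (lamb_row z)).
move=> h e e0; have [N _ hN] := h e e0; exists N => // n /= Nn.
have := hN n.+1 (leqW Nn).
by rewrite /= (sum_ord_recl (fun k => k%:R * (nome z ^+ k / (1 - nome z ^+ k)))) mul0r add0r.
Qed.

Lemma phi_col z : hsum (fun x => if x is _.+1 then nome z ^+ x / (1 - nome z ^+ x) ^+ 2 else 0)
  ((1 - 6 * phi z) / 24).
Proof. exact: hsum_col (phi_lamb z) (lamb_col z). Qed.

Lemma lamb_fiber z n :
  hsum (fun p => if (p.1 * p.2)%N == n then lamb z p else 0) ((divsum 1 n)%:R * nome z ^+ n).
Proof.
case: n => [|n].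
  rewrite mul0r; apply: hsum0 => -[[|a] [|x]]; rewrite /lamb ?andbF //=; by case: ifP.
have <- : \sum_(p <- [seq (d, n.+1 %/ d)%N | d <- divisors n.+1])
    (if (p.1 * p.2)%N == n.+1 then lamb z p else 0) = (divsum 1 n.+1)%:R * nome z ^+ n.+1.
  rewrite big_map /divsum natr_sum mulr_suml big_seq [RHS]big_seq; apply: eq_bigr => d.
  rewrite -dvdn_divisors// => dn /=; rewrite mulnC divnK// eqxx /lamb /=.
  by rewrite (dvdn_gt0 _ dn)// divn_gt0 ?(dvdn_gt0 _ dn)// dvdn_leq// mulnC divnK// expn1.
apply: hsum_finite; first by rewrite map_inj_uniq ?divisors_uniq// => a b [].
move=> [a x]; case: eqP => //= ax /mapP[]; exists a.
  by rewrite -dvdn_divisors// -ax dvdn_mulr.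
by rewrite -ax mulKn//; case: a ax.
Qed.

Lemma phi_qseries z : hsum (fun n => (divsum 1 n)%:R * nome z ^+ n) ((1 - 6 * phi z) / 24).
Proof. exact: hsum_fiber (phi_lamb z) (lamb_fiber z). Qed.

(** Locally uniform convergence, with majorant n^2 rho^n, permits termwise differentiation, which
    multiplies the n-th coefficient by n. *)
Lemma Dphi_qseries z :
  hsum (fun n => (n * divsum 1 n)%:R * nome z ^+ n) (- (t^-1 * cderiv (@phi R) z) / 4).
Proof.
have q1 := nome_lt1 z.
pose F (n : nat) w : C := \sum_(k < n) (divsum 1 k)%:R * nome w ^+ k.
have hol k : holomorphic (fun w => (divsum 1 k)%:R * nome w ^+ k : C).
  exact: holM (@hol_cst R _) (@hol_nomeX R k).
have hF : lucvg F (fun w => (1 - 6 * phi w) / 24).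
  have [f hf] : exists f, lucvg F f.
    apply: (mtest (u := fun k w => (divsum 1 k)%:R * nome w ^+ k)) => w.
    have [d d0 [rho /andP[r0 r1] hr]] := nome_near w; exists d => //.
    exists (fun k => (k ^ 2)%:R * rho ^+ k); exists (2`!%:R * (1 - rho) ^- 3); split.
      by move=> n; apply: poly_geometric; rewrite ltW.
    move=> v k vw; rewrite cabsM cabs_nat cabsX ler_pM ?ler0n ?exprn_ge0 ?cabs_ge0//.
      by rewrite ler_nat divsum_le.
    by rewrite lerXn2r// ?nnegrE ?cabs_ge0 ?hr// ltW.
  apply: (lucvg_eq (fun _ _ => erefl) _ hf) => w; apply: ccvg_unique (lucvg_ccvg w hf) _.
  exact: hsum_nat (phi_qseries w).
have hder k : cderiv (fun w => (divsum 1 k)%:R * nome w ^+ k) z = (divsum 1 k)%:R * (t * (k%:R * nome z ^+ k)).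
  by apply: cderivE; apply: derZ; exact: der_nomeX.
have holF n : holomorphic (F n).
  by apply: (@hol_sum R 'I_n (index_enum _) (fun (k : 'I_n) w => (divsum 1 k)%:R * nome w ^+ k)) => k; exact: hol.
have [_ /(_ z)] := weierstrass holF hF.
have -> : cderiv (fun w => (1 - 6 * phi w) / 24) z = - (6 / 24) * cderiv (@phi R) z.
  apply: cderivE; have h := derB (der_cst (@uhpval R) 1 z) (derZ 6 (cderivP z (@hol_phi R))).
  rewrite (_ : - (6 / 24) * _ = 24^-1 * (0 - 6 * cderiv (@phi R) z)); last by rewrite sub0r; ring.
  by apply: der_eq (derZ 24^-1 h) => w; rewrite mulrC.
move=> h; have [M hM] := asum_divsum 1 1 q1.
apply: hsum_nat_lim (asum_le _ hM) _; first by move=> n; rewrite expn1.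
have {}h := ccvgM (ccvg_cst t^-1) h.
have -> : - (t^-1 * cderiv (@phi R) z) / 4 = t^-1 * (- (6 / 24) * cderiv (@phi R) z).
  by have := twopii_neq0 R; move: t (cderiv _ z) => x y x0; field.
apply: ccvg_eq (h _ _) => n; rewrite cderiv_sum// mulr_sumr; apply: eq_bigr => k _.
by rewrite hder natrM; have := twopii_neq0 R; move: t => x x0; field.
Qed.

Lemma E4_qseries z : hsum (fun n => (divsum 3 n)%:R * nome z ^+ n) ((E4 z - 1) / 240).
Proof.
have [M hM] := asum_divsum 3 0 (nome_lt1 z).
have {}hM : asum (fun n => (divsum 3 n)%:R * nome z ^+ n) M.
  by apply: asum_le hM => n; rewrite expn0 mul1n.
have [s hs _] := asum_hsum hM; suff -> : (E4 z - 1) / 240 = s by [].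
suff -> : E4 z = 1 + 240 * s by field.
rewrite /E4; congr (_ + _ * _).
apply: (limnE (u := fun N => \sum_(1 <= n < N.+1) (sigma3 n)%:R * nome z ^+ n)).
move=> e e0; have [N _ hN] := hsum_nat hs e0; exists N => // n /= Nn.
have := hN n.+1 (leqW Nn).
by rewrite /= (sum_ord_recl (fun k => (divsum 3 k)%:R * nome z ^+ k)) mul0r add0r big_add1 /= big_mkord.
Qed.

(** The square of the absolutely summable double series is regrouped by a x + b y = n. *)
Lemma phi_sqr_qseries z : let s := (1 - 6 * phi z) / 24 in
  hsum (fun n => (\sum_(p <- quads n) p.1.1 * p.2.1)%N%:R * nome z ^+ n) (s * s).
Proof.
move=> s; have [M hM] := asum_lamb z; have hs := phi_lamb z.
apply: (hsum_fiber (f := fun p : (nat * nat) * (nat * nat) => (p.1.1 * p.1.2 + p.2.1 * p.2.2)%N)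
  (hsumM hM hM hs hs)) => n.
rewrite natr_sum mulr_suml.
have E p : p \in quads n -> (p.1.1 * p.2.1)%:R * nome z ^+ n =
    (if (p.1.1 * p.1.2 + p.2.1 * p.2.2)%N == n then lamb z p.1 * lamb z p.2 else 0).
  case: p => -[a x] [b y]; rewrite mem_quads => /and5P[a0 x0 b0 y0 /eqP e] /=.
  by rewrite -e eqxx /lamb /= a0 x0 b0 y0 /= exprD natrM mulrACA.
rewrite big_seq (eq_bigr _ E) -big_seq; apply: hsum_finite; first exact: quads_uniq.
move=> [[a x] [b y]]; rewrite mem_quads /lamb /=; case: (eqVneq (a * x + b * y)%N n) => // e.
by case: (0 < a)%N (0 < x)%N (0 < b)%N (0 < y)%N => [] [] [] [] //= _; rewrite ?mul0r ?mulr0.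
Qed.

(** With s the generating series of sigma_1 and s3 that of sigma_3, the divisor identity says 12 s^2
    = 5 s3 + s - 6 D s coefficient by coefficient; the rest is substitution. *)
Lemma ramanujan z :
  2 * (E4 z / 72) = phi z ^+ 2 - 2 * (t^-1 * cderiv (@phi R) z).
Proof.
have h1 := phi_qseries z; have h2 := Dphi_qseries z; have h3 := E4_qseries z.
have /(hsumZ 12) h4 := phi_sqr_qseries z.
have := hsumB (hsumD (hsumZ 5 h3) h1) (hsumZ 6 h2).
set s1 := (1 - _) / 24 in h1 h4 *; set s2 := - _ / 4; set s3 := (E4 z - 1) / 240 => h5.
have e : 12 * (s1 * s1) = 5 * s3 + s1 - 6 * s2.
  apply: hsum_unique h4 _; apply: hsum_eq h5 => -[|n]; first by rewrite /quads /= big_nil; ring.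
  have := sigma_convolution (ltn0Sn n) => /(congr1 (fun i : int => i%:~R : C)).
  rewrite rmorphM /= !rmorph_sum /= /divsum; set S := \sum_(_ <- quads _) _; set T := \sum_(_ <- _) _ => ST.
  have {}ST : 12 * S = T by rewrite -ST.
  rewrite [RHS]mulrA [X in _ = X * _](_ : _ = T); last exact: ST.
  rewrite /T; set q := nome z ^+ _.
  rewrite natrM rmorph_sum /= !mulrA -[X in X - _]mulrDl -mulrBl; congr (_ * _).
  rewrite !mulr_sumr -big_split /= -sumrB; apply: eq_bigr => d _.
  by rewrite expn1 natrX !(rmorphD, rmorphB, rmorphM, rmorphXn) /=; ring.
move: e; rewrite /s1 /s2 /s3; move: (E4 z) (phi z) (t^-1 * _) => E f D e.
have -> : E = 240 * ((E - 1) / 240) + 1 by field.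
have -> : (E - 1) / 240 = (12 * ((1 - 6 * f) / 24 * ((1 - 6 * f) / 24)) - (1 - 6 * f) / 24 + 6 * (- D / 4)) / 5.
  by rewrite e; field.
by field.
Qed.

End Ramanujan.

(** * The transformation law of E_2 *)

Section Sequences.
Variable R : realType.
Implicit Types (u v : nat -> R[i]) (a b : R[i]).

Lemma ncvgD u v a b : ccvg \oo u a -> ccvg \oo v b -> ccvg \oo (fun n => u n + v n) (a + b).
Proof. exact: ccvgD. Qed.

Lemma ncvgB u v a b : ccvg \oo u a -> ccvg \oo v b -> ccvg \oo (fun n => u n - v n) (a - b).
Proof. exact: ccvgB. Qed.

Lemma ncvgM u v a b : ccvg \oo u a -> ccvg \oo v b -> ccvg \oo (fun n => u n * v n) (a * b).
Proof. exact: ccvgM. Qed.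

Lemma ncvgZ u a b : ccvg \oo u b -> ccvg \oo (fun n => a * u n) (a * b).
Proof. by apply: ncvgM; exact: ccvg_cst. Qed.

Lemma ncvg_unique u a b : ccvg \oo u a -> ccvg \oo u b -> a = b.
Proof. exact: ccvg_unique. Qed.

Lemma ncvg_double u a : ccvg \oo u a -> ccvg \oo (fun n => u (2 * n)%N) a.
Proof.
move=> h e e0; have [N _ hN] := h e e0; exists N => // n /= Nn; apply: hN => /=.
by apply: leq_trans Nn _; rewrite leq_pmull.
Qed.

End Sequences.

(** * The sum of (w + n)^-2 over the integers *)

Section InverseSquares.
Variable R : realType.
Local Notation C := R[i].
Implicit Types w : C.

Lemma inv_sq_sum N : \sum_(k < N) (k.+1%:R ^- 2 : R) <= 2.
Proof.
case: N => [|N]; first by rewrite big_ord0.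
suff h : \sum_(k < N.+1) (k.+1%:R ^- 2 : R) <= 2 - N.+1%:R^-1.
  by apply: le_trans h _; rewrite gerBl invr_ge0 ler0n.
elim: N => [|N IH]; first by rewrite big_ord_recl big_ord0 expr1n invr1; lra.
rewrite big_ord_recr /=; apply: le_trans (lerD IH (lexx _)) _.
have -> : (N.+2%:R : R) = N.+1%:R + 1 by rewrite -natr1.
have : 0 < (N.+1%:R : R) by rewrite ltr0n.
move: (N.+1%:R : R) => x x0.
rewrite -subr_ge0 (_ : _ - _ = (x * (x + 1) ^+ 2)^-1); first by rewrite invr_ge0 mulr_ge0 ?sqr_ge0// ltW.
have x1 : x + 1 != 0 by rewrite gt_eqF// addr_gt0.
by field; rewrite ?x1 gt_eqF.
Qed.

Lemma asum_inv_sq (c : nat -> C) K :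
  (forall k, cabs (c k) <= K * k.+1%:R ^- 2) -> asum c (2 * K).
Proof.
move=> h; have K0 : 0 <= K.
  by have := h 0%N; rewrite expr1n invr1 mulr1; apply: le_trans; exact: cabs_ge0.
apply: asum_nat => n; apply: (@le_trans _ _ (\sum_(k < n) K * k.+1%:R ^- 2)).
  by apply: ler_sum.
by rewrite -mulr_sumr mulrC ler_wpM2r// inv_sq_sum.
Qed.

(** |w + k| is at least y and at least |k| - K; weighting the first bound by K and the second by y
    gives the claim. *)
Lemma far (w : C) (y K k : R) : 0 < y -> y <= complex.Im w -> cabs w <= K ->
  y * `|k| <= (y + K) * cabs (w + k%:C%C).
Proof.
move=> y0 yw wK; have h1 : y <= cabs (w + k%:C%C).
  apply: le_trans (absIm_le _); rewrite ImD /= addr0; apply: le_trans yw _; exact: ler_norm.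
have h2 : `|k| <= cabs (w + k%:C%C) + cabs w.
  by rewrite -(cabs_real k) -[X in cabs X <= _](addKr w) addrC -[cabs w]cabsN; exact: cabsD.
have K0 : 0 <= K := le_trans (cabs_ge0 _) wK.
have a0 := cabs_ge0 (w + k%:C%C).
have h3 : y * cabs w <= cabs (w + k%:C%C) * K by rewrite ler_pM ?cabs_ge0// ltW.
have : y * `|k| <= y * (cabs (w + k%:C%C) + cabs w) by rewrite ler_pM2l.
rewrite mulrDr mulrDl; lra.
Qed.

Definition away (c : R) w := forall m : nat,
  c * m%:R <= cabs (w + m%:R) /\ c * m%:R <= cabs (w - m%:R).

Lemma far_away w (y K : R) : 0 < y -> y <= complex.Im w -> cabs w <= K -> away (y / (y + K)) w.
Proof.
move=> y0 yw wK m; have yK : 0 < y + K.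
  by rewrite ltr_pwDl// (le_trans (cabs_ge0 _) wK).
have mE : m%:R = (m%:R : R)%:C%C :> C by rewrite rmorph_nat.
have E x : y / (y + K) * m%:R <= x = (y * m%:R <= (y + K) * x).
  by rewrite mulrAC ler_pdivrMr// [x * _]mulrC.
rewrite !E; split.
  by have := far m%:R y0 yw wK; rewrite normr_nat -mE.
by have := far (- m%:R) y0 yw wK; rewrite normrN normr_nat rmorphN /= -mE.
Qed.

Lemma away_gt0 (y K : R) : 0 < y -> 0 <= K -> 0 < y / (y + K).
Proof. by move=> y0 K0; rewrite divr_gt0// ltr_pwDl. Qed.

(** The terms of n + 1 and of - (n + 1) are paired, so that sums over the integers become sums over
    nat; [csum] adds the term of 0. *)
Definition pr w (n : nat) : C := (w + n.+1%:R) ^- 2 + (w - n.+1%:R) ^- 2.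

Lemma cabs_inv_sq (x : C) (c : R) n : 0 < c -> c * n.+1%:R <= cabs x ->
  cabs (x ^- 2) <= c ^- 2 * n.+1%:R ^- 2.
Proof.
move=> c0 h; have cn : 0 < c * n.+1%:R by rewrite mulr_gt0// ltr0n.
have x0 : 0 < cabs x := lt_le_trans cn h.
rewrite cabsV cabsX -invfM -exprMn lef_pV2 ?posrE ?exprn_gt0//.
by rewrite lerXn2r// ?nnegrE ltW.
Qed.

Lemma pr_bound (c : R) w n : 0 < c -> away c w ->
  cabs (pr w n) <= 2 * c ^- 2 * n.+1%:R ^- 2.
Proof.
move=> c0 /(_ n.+1)[h1 h2]; apply: le_trans (cabsD _ _) _.
have := cabs_inv_sq c0 h1; have := cabs_inv_sq c0 h2.
rewrite -mulrA; move: (c ^- 2 * _) => x; lra.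
Qed.

Lemma uhp_away w : 0 < complex.Im w -> exists2 c : R, 0 < c & away c w.
Proof.
move=> w0; exists (complex.Im w / (complex.Im w + cabs w)).
  by rewrite away_gt0// cabs_ge0.
exact: far_away.
Qed.

Lemma pr_hsum w (c : R) : 0 < c -> away c w ->
  exists2 s, hsum (pr w) s & cabs s <= 2 * (2 * c ^- 2).
Proof. by move=> c0 h; apply: asum_hsum; apply: asum_inv_sq => n; exact: pr_bound. Qed.

Definition prsum w : C := xget 0 [set s | hsum (pr w) s].

Lemma prsumP w (c : R) : 0 < c -> away c w -> hsum (pr w) (prsum w).
Proof. by move=> c0 h; have [s hs _] := pr_hsum c0 h; apply: (xgetPex 0); exists s. Qed.

Lemma prsum_bound w (c : R) : 0 < c -> away c w -> cabs (prsum w) <= 4 * c ^- 2.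
Proof.
move=> c0 h; have [s hs] := pr_hsum c0 h.
by rewrite (hsum_unique (prsumP c0 h) hs) mulrA (_ : 2 * 2 = 4) // -natrM.
Qed.

Definition csum w : C := w ^- 2 + prsum w.
Definition csumN (N : nat) w : C := w ^- 2 + \sum_(n < N) pr w n.

Lemma csumN_cvg w : 0 < complex.Im w -> ccvg \oo (fun N => csumN N w) (csum w).
Proof.
move=> /uhp_away[c c0 h]; apply: ncvgD; first exact: ccvg_cst.
exact: hsum_nat (prsumP c0 h).
Qed.

(** The two sums on the left run over the even and the odd integers added to w, up to the factor 4;
    the symmetric truncation leaves one odd term over. *)
Lemma csumN_double N w :
  csumN N (w / 2) + csumN N ((w + 1) / 2) =
  4 * (csumN (2 * N) w + (w + (2 * N).+1%:R) ^- 2).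
Proof.
have half (x : C) : (x / 2) ^- 2 = 4 * x ^- 2.
  by rewrite expr_div_n invf_div -natrX.
have n2 : (2 : C) != 0 by rewrite pnatr_eq0.
have E1 n : (w / 2 + n%:R) ^- 2 = 4 * (w + (2 * n)%:R) ^- 2.
  by rewrite -half; congr (_ ^- 2); rewrite natrM; field.
have E2 n : (w / 2 - n%:R) ^- 2 = 4 * (w - (2 * n)%:R) ^- 2.
  by rewrite -half; congr (_ ^- 2); rewrite natrM; field.
have E3 n : ((w + 1) / 2 + n%:R) ^- 2 = 4 * (w + (2 * n).+1%:R) ^- 2.
  by rewrite -half; congr (_ ^- 2); rewrite -[(2 * n).+1%:R]natr1 (natrM _ 2); field.
have E4 n : ((w + 1) / 2 - n.+1%:R) ^- 2 = 4 * (w - (2 * n).+1%:R) ^- 2.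
  by rewrite -half; congr (_ ^- 2); rewrite -[(2 * n).+1%:R]natr1 -[n.+1%:R]natr1 (natrM _ 2); field.
rewrite /csumN; elim: N => [|N IH].
  by rewrite muln0 !big_ord0 !addr0 !half mulrDr.
have D : (2 * N.+1)%N = (2 * N).+2 by rewrite mulnS.
rewrite D !big_ord_recr /=; move: IH.
move: (\sum_(_ < N) _) (\sum_(_ < N) _) (\sum_(_ < 2 * N) _) => S1 S2 S3.
rewrite /pr E1 E2 E3 E4 !D.
move: ((w / 2) ^- 2) (((w + 1) / 2) ^- 2) (w ^- 2) => a b c IH.
have -> : S1 = 4 * (c + S3 + (w + (2 * N).+1%:R) ^- 2) - (b + S2) - a by rewrite -IH; ring.
move: ((w + (2 * N).+1%:R) ^- 2) ((w - (2 * N).+1%:R) ^- 2) ((w + (2 * N).+2%:R) ^- 2) ((w - (2 * N).+2%:R) ^-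
    2) ((w + (2 * N).+3%:R) ^- 2) => x1 x2 x3 x4 x5.
ring.
Qed.

Lemma inv_sq_cvg0 w : ccvg \oo (fun N => (w + N%:R) ^- 2) 0.
Proof.
apply: (ccvg_le (g := fun N => (N%:R - cabs w)^-1)).
  exists (Num.bound (cabs w + 1)) => // N /= hN; rewrite subr0.
  have h : cabs w + 1 < N%:R.
    apply: lt_le_trans (archi_boundP _) _; first by rewrite addr_ge0 ?cabs_ge0.
    by rewrite ler_nat.
  have h2 := cabs_triB N%:R (- w); rewrite opprK cabsN cabs_nat addrC in h2.
  have [x1 h3] : 1 <= N%:R - cabs w /\ N%:R - cabs w <= cabs (w + N%:R).
    by split; [lra|move: h2; rewrite addrC; rewrite (addrC w)].
  rewrite cabsV cabsX lef_pV2 ?posrE; try lra.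
    by apply: (le_trans h3); rewrite expr2; exact: ler_peMl (cabs_ge0 _) (le_trans x1 h3).
  by rewrite exprn_gt0//; lra.
move=> e e0; exists (Num.bound (cabs w + e^-1)) => // N /= hN.
have h : cabs w + e^-1 < N%:R.
  apply: lt_le_trans (archi_boundP _) _; first by rewrite addr_ge0 ?cabs_ge0// invr_ge0 ltW.
  by rewrite ler_nat.
have e1 : 0 < e^-1 by rewrite invr_gt0.
by rewrite invf_plt ?posrE//; lra.
Qed.

Lemma csum_double w : 0 < complex.Im w ->
  csum w = 4^-1 * (csum (w / 2) + csum ((w + 1) / 2)).
Proof.
have n4 : (4 : C) != 0 by rewrite pnatr_eq0.
have half (x : C) : complex.Im (x / 2) = complex.Im x / 2.
  have -> : x / 2 = x * (2^-1 : R)%:C%C by rewrite fmorphV rmorph_nat.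
  by rewrite ImM /= mulr0 add0r.
move=> w0; have w1 : 0 < complex.Im (w / 2) by rewrite half divr_gt0.
have w2 : 0 < complex.Im ((w + 1) / 2) by rewrite half ImD /= addr0 divr_gt0.
have h1 := ncvgD (csumN_cvg w1) (csumN_cvg w2).
have h2 := ncvgD (ncvg_double (csumN_cvg w0)) (ncvg_double (inv_sq_cvg0 (w + 1))).
have h3 := ncvgZ 4 h2.
apply: (mulfI n4); rewrite mulVKf//; rewrite addr0 in h3.
apply/esym/(ncvg_unique h1); apply: ccvg_eq h3 => N.
by rewrite csumN_double -(addrA w 1) (addrC 1) natr1.
Qed.

Lemma csum_period w : 0 < complex.Im w -> csum (w + 1) = csum w.
Proof.
move=> w0; have w1 : 0 < complex.Im (w + 1) by rewrite ImD /= addr0.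
have h1 := ncvgB (csumN_cvg w1) (inv_sq_cvg0 (w + 1)); rewrite subr0 in h1.
have hm : ccvg \oo (fun N => (w - N%:R) ^- 2) 0.
  by apply: ccvg_eq (inv_sq_cvg0 (- w)) => N; rewrite -(sqrrN (w - _)) opprB addrC.
have h2 := ncvgB (csumN_cvg w0) hm; rewrite subr0 in h2.
apply: (ncvg_unique h1); apply: ccvg_eq h2 => N.
elim: N => [|N IH].
  by rewrite /csumN !big_ord0 !addr0 subr0 !subrr.
move: IH; rewrite /csumN !big_ord_recr /= /pr.
have -> : w + 1 + N%:R = w + N.+1%:R by rewrite -natr1; ring.
have -> : w + 1 - N.+1%:R = w - N%:R by rewrite -natr1; ring.
move: (\sum_(_ < N) _) (\sum_(_ < N) _) => S1 S2.
move: (w ^- 2) ((w + 1) ^- 2) ((w + N.+1%:R) ^- 2) ((w - N%:R) ^- 2) ((w - N.+1%:R) ^- 2) ((w + 1 + N.+1%:R) ^-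
    2) => a b x1 x2 x3 x4 IH.
have -> : S1 = (a + S2 - x2) - b + x1 by rewrite IH; ring.
ring.
Qed.

End InverseSquares.

(** * Expansions at 0 of the exponential, the squared cosecant and the cotangent *)

Section ExpTaylor.
Variable R : realType.
Local Notation C := R[i].
Local Notation t := (twopii R).
Implicit Types v w : C.

(** The derivative of the remainder of order n + 1 is the one of order n; each integration along the
    segment from 0 costs the factor 2 of [der_segment]. *)
Lemma cexp_taylor n w : cabs w <= 1 ->
  cabs (cexp w - \sum_(k < n) w ^+ k / k`!%:R) <= expR 1 * 2 ^+ n * cabs w ^+ n.
Proof.
elim: n w => [|n IH] w w1.
  rewrite big_ord0 subr0 !mulr1 cabs_cexp ler_expR.
  by apply: le_trans w1; apply: le_trans (absRe_le w); exact: ler_norm.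
pose f m v := cexp v - \sum_(k < m) v ^+ k / k`!%:R.
have df v : der id (f n.+1) v (f n v).
  have h k : der id (fun s : C => s ^+ k.+1 / k.+1`!%:R) v (v ^+ k / k`!%:R).
    have := derZ (k.+1`!%:R)^-1 (derX k.+1 (der_emb id v)).
    have k0 : k`!%:R != 0 :> C by rewrite pnatr_eq0 -lt0n fact_gt0.
    rewrite (_ : _ * (_ * 1) = v ^+ k / k`!%:R).
      by apply: der_eq => s; rewrite mulrC.
    have k1 : k.+1%:R != 0 :> C by rewrite pnatr_eq0.
    rewrite factS natrM /=; move: (k`!%:R) (k.+1%:R) k0 k1 => x y x0 y0.
    by field; rewrite x0 y0.
  have hs : der id (fun s : C => \sum_(k < n) s ^+ k.+1 / k.+1`!%:R) v (\sum_(k < n) v ^+ k / k`!%:R).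
    by apply: (@der_sum _ _ _ _ _ (fun (k : 'I_n) (s : C) => s ^+ k.+1 / k.+1`!%:R)) => k; exact: h.
  rewrite /f -[\sum_(k < n) _]add0r; apply: der_eq (derB (der_cexp v) (derD (der_cst id 1 v) hs)) => s.
  by rewrite (sum_ord_recl (fun k => s ^+ k / k`!%:R)) expr0 fact0 invr1 mulr1.
have f0 : f n.+1 0 = 0.
  rewrite /f cexp0 (sum_ord_recl (fun k => 0 ^+ k / k`!%:R)) expr0 fact0 invr1 mulr1.
  by rewrite big1 ?addr0 ?subrr// => k _; rewrite expr0n mul0r.
have seg (s : R) : 0 <= s <= 1 -> cabs (0 + s%:C%C * (w - 0)) <= cabs w.
  case/andP=> s0 s1; rewrite add0r subr0 cabsM cabs_real ger0_norm//.
  by rewrite ler_piMl ?cabs_ge0.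
have := der_segment (f := f n.+1) (f' := f n) (p := 0) (q := w) (M := expR 1 * 2 ^+ n * cabs w ^+ n).
rewrite f0 !subr0 -/(f n.+1 w) => /(_ (fun s _ => df _)) h.
apply: le_trans (h _) _; last by rewrite le_eqVlt; apply/orP; left; apply/eqP; rewrite !exprS; ring.
move=> s s01; have sw := seg s s01; rewrite subr0 in sw.
apply: le_trans (IH _ (le_trans sw w1)) _.
by rewrite ler_wpM2l ?mulr_ge0 ?expR_ge0 ?exprn_ge0// lerXn2r// ?nnegrE ?cabs_ge0.
Qed.

(** The trace on the half-plane of the neighbourhoods of its boundary point 0. *)
Definition near0 : set_system (uhp R) :=
  [set A | exists2 d : R, 0 < d & forall w : uhp R, cabs (uhpval w) < d -> A w].

Global Instance near0_filter : ProperFilter near0.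
Proof.
constructor=> [[d d0 hd]|]; last constructor.
- have h : 0 < complex.Im ((d / 2)%:C%C * 'i%C) by rewrite /= mul0r addr0 mulr1 divr_gt0.
  apply: (hd (MkUhp h)); change (cabs ((d / 2)%:C%C * 'i%C) < d).
  by rewrite cabsM cabsi mulr1 cabs_real ger0_norm; lra.
- by exists 1.
- move=> A B [d d0 hA] [e e0 hB]; exists (Num.min d e); first by rewrite lt_min d0.
  by move=> w; rewrite lt_min => /andP[wd we]; split; [exact: hA|exact: hB].
- by move=> A B AB [d d0 hA]; exists d => // w /hA /AB.
Qed.

Lemma near0_emb (a : C) : ccvg near0 (fun z => a * uhpval z) 0.
Proof.
have h : ccvg near0 (@uhpval R) 0 by move=> e e0; exists e => // w; rewrite subr0.
by rewrite -(mulr0 a); apply: ccvgM h; exact: ccvg_cst.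
Qed.

(** The expansion of q goes up to order 3: the double pole of [csc2] uses up the lower orders, and
    its constant term is wanted. *)
Lemma nome_expansion : exists s : uhp R -> C, ccvg near0 s 0 /\
  forall z, let v := t * uhpval z in
    nome z = 1 + v * (1 + v / 2 + v ^+ 2 * (6^-1 + s z)).
Proof.
pose s (w : uhp R) := let v := t * uhpval w in
  (nome w - \sum_(k < 4) v ^+ k / k`!%:R) / v ^+ 3.
have v0 (w : uhp R) : t * uhpval w != 0.
  rewrite mulf_neq0 ?twopii_neq0//; apply/eqP => w0.
  by have := uhp_gt0 w; rewrite w0 ltxx.
exists s; split=> [|w /=]; last first.
  have := v0 w; rewrite /s /= !big_ord_recl big_ord0 /= /bump /= !factS fact0.
  by move: (nome w) (t * uhpval w) => q v v00; field.
apply: (ccvg_le (g := fun z => expR 1 * 2 ^+ 4 * cabs (t * uhpval z))).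
  have [d d0 hd] := near0_emb t ltr01; exists d => // w /hd; rewrite subr0 => /ltW v1.
  rewrite subr0 /s cabsM cabsV cabsX ler_pdivrMr ?exprn_gt0 ?cabs_gt0//.
  by have := cexp_taylor 4 v1; rewrite [cabs _ ^+ 4]exprS mulrA.
move=> e e0; have e1 : 0 < e / (expR 1 * 2 ^+ 4) by rewrite divr_gt0// mulr_gt0 ?expR_gt0.
have [d d0 hd] := near0_emb t e1; exists d => // w /hd; rewrite subr0.
by rewrite ltr_pdivlMr ?mulr_gt0 ?expR_gt0// mulrC.
Qed.

(** This function and the next are pi^2 / sin^2 (pi w) and pi cot (pi w), written in q = exp (2 i pi
    w). *)
Definition csc2 w : C := t ^+ 2 * (cexp (t * w) / (1 - cexp (t * w)) ^+ 2).
Definition ctg w : C := t / 2 * ((cexp (t * w) + 1) / (cexp (t * w) - 1)).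

(** The limit is pi^2 / 3, later read as twice zeta(2). *)
Lemma csc2_near0 : ccvg near0 (fun z => csc2 (uhpval z) - (uhpval z) ^- 2) (- t ^+ 2 / 12).
Proof.
have [s [s0 hs]] := nome_expansion; have v0 := near0_emb t; have t0 := twopii_neq0 R.
pose p (w : uhp R) := let v := t * uhpval w in 1 + v / 2 + v ^+ 2 * (6^-1 + s w).
have p1 : ccvg near0 p 1.
  have -> : (1 : C) = 1 + 0 * 2^-1 + 0 ^+ 2 * (6^-1 + 0) by rewrite expr0n /= !mul0r !addr0.
  apply: ccvgD; last by apply: ccvgM; [exact: ccvgX|apply: ccvgD s0; exact: ccvg_cst].
  by apply: ccvgD; [exact: ccvg_cst|apply: ccvgM; [|exact: ccvg_cst]].
have h : ccvg near0 (fun z => t ^+ 2 * ((- 12^-1 - 2 * s z - (t * uhpval z) ^+ 2 * (6^-1 + s z) ^+ 2) * (p z ^+ 2)^-1))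
   (t ^+ 2 * ((- 12^-1 - 2 * 0 - 0 ^+ 2 * (6^-1 + 0) ^+ 2) * (1 ^+ 2)^-1)).
  apply: ccvgM; first exact: ccvg_cst.
  apply: ccvgM; last by apply: ccvgV; [rewrite expr1n oner_eq0|exact: ccvgX].
  apply: ccvgB; last by apply: ccvgM; [exact: ccvgX|apply: ccvgX; apply: ccvgD s0; exact: ccvg_cst].
  by apply: ccvgB; [exact: ccvg_cst|apply: ccvgM; [exact: ccvg_cst|]].
have -> : - t ^+ 2 / 12 = t ^+ 2 * ((- 12^-1 - 2 * 0 - 0 ^+ 2 * (6^-1 + 0) ^+ 2) * (1 ^+ 2)^-1).
  by rewrite expr0n expr1n /= mulr0 mul0r !subr0 invr1 mulr1 mulrN mulNr.
apply: ccvg_near h.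
have [d d0 hd] := p1 _ ltr01; exists d => // w /hd pw.
have p0 : p w != 0.
  by apply/eqP => pE; move: pw; rewrite pE sub0r cabsN cabs1 ltxx.
have w0 : uhpval w != 0 by apply/eqP => w0; have := uhp_gt0 w; rewrite w0 ltxx.
rewrite /csc2 -/(nome w) hs -/(p w).
set E := - 12^-1 - _ - _.
have e : t * uhpval w * p w = (t * uhpval w) ^+ 2 * E + p w ^+ 2 - 1.
  by rewrite /E /p; move: (t * uhpval w) (s w) => v x; field.
have -> : 1 - (1 + t * uhpval w * p w) = - (t * uhpval w * p w) by ring.
have -> : 1 + t * uhpval w * p w = (t * uhpval w) ^+ 2 * E + p w ^+ 2 by rewrite e; ring.
by move: (uhpval w) (p w) E t t0 w0 p0 {e} => z x y u u0 z0 x0; field; rewrite u0 z0 x0.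
Qed.

Lemma ctg_near0 : ccvg near0 (fun z => ctg (uhpval z) - (uhpval z)^-1) 0.
Proof.
have [s [s0 hs]] := nome_expansion; have v0 := near0_emb t; have t0 := twopii_neq0 R.
pose p (w : uhp R) := let v := t * uhpval w in 1 + v / 2 + v ^+ 2 * (6^-1 + s w).
have p1 : ccvg near0 p 1.
  have -> : (1 : C) = 1 + 0 * 2^-1 + 0 ^+ 2 * (6^-1 + 0) by rewrite expr0n /= !mul0r !addr0.
  apply: ccvgD; last by apply: ccvgM; [exact: ccvgX|apply: ccvgD s0; exact: ccvg_cst].
  by apply: ccvgD; [exact: ccvg_cst|apply: ccvgM; [|exact: ccvg_cst]].
have h : ccvg near0 (fun z => t * ((p z - 1 - (t * uhpval z) * (3^-1 + 2 * s z)) * (2 * p z)^-1))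
   (t * ((1 - 1 - 0 * (3^-1 + 2 * 0)) * (2 * 1)^-1)).
  apply: ccvgM; first exact: ccvg_cst.
  apply: ccvgM; last first.
    by apply: ccvgV; [rewrite mulr1 pnatr_eq0|apply: ccvgM; [exact: ccvg_cst|]].
  apply: ccvgB; first by apply: ccvgB; [|exact: ccvg_cst].
  apply: ccvgM => //; apply: ccvgD; first exact: ccvg_cst.
  by apply: ccvgM; [exact: ccvg_cst|].
have {1}-> : 0 = t * ((1 - 1 - 0 * (3^-1 + 2 * 0)) * (2 * 1)^-1).
  by rewrite subrr mul0r subrr mul0r mulr0.
apply: ccvg_near h.
have [d d0 hd] := p1 _ ltr01; exists d => // w /hd pw.
have p0 : p w != 0.
  by apply/eqP => pE; move: pw; rewrite pE sub0r cabsN cabs1 ltxx.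
have w0 : uhpval w != 0 by apply/eqP => w0; have := uhp_gt0 w; rewrite w0 ltxx.
rewrite /ctg -/(nome w) hs -/(p w).
have -> : 1 + t * uhpval w * p w - 1 = t * uhpval w * p w by ring.
set E := 3^-1 + _.
have e2 : (t * uhpval w) * (p w - 1 - (t * uhpval w) * E) = 1 + (t * uhpval w) * p w + 1 - 2 * p w.
  by rewrite /E /p; move: (t * uhpval w) (s w) => v x; field.
have -> : 1 + t * uhpval w * p w + 1 = (t * uhpval w) * (p w - 1 - (t * uhpval w) * E) + 2 * p w by rewrite e2; ring.
by move: (uhpval w) (p w) E t t0 w0 p0 {e2} => z x y u u0 z0 x0; field; rewrite u0 z0 x0.
Qed.

End ExpTaylor.

(** * The squared cosecant as a sum over the integers *)

Section Herglotz.
Variable R : realType.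
Local Notation C := R[i].
Local Notation t := (twopii R).
Local Notation Re := (@complex.Re R).
Local Notation Im := (@complex.Im R).
Implicit Types w : C.

Lemma Re_twopii w : Re (t * w) = - (2 * pi * Im w).
Proof. by rewrite /twopii; case: w => x y /=; ring. Qed.

Lemma Im_twopii w : Im (t * w) = 2 * pi * Re w.
Proof. by rewrite /twopii; case: w => x y /=; ring. Qed.

Lemma Im_half w : Im (w / 2) = Im w / 2.
Proof.
have -> : w / 2 = w * (2^-1 : R)%:C%C by rewrite fmorphV rmorph_nat.
by rewrite ImM /= mulr0 add0r.
Qed.

Lemma Re_half w : Re (w / 2) = Re w / 2.
Proof.
have -> : w / 2 = w * (2^-1 : R)%:C%C by rewrite fmorphV rmorph_nat.
by rewrite ReM /= mulr0 subr0.
Qed.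

Lemma cexp_neq1 w : 0 < Im w -> 1 - cexp (t * w) != 0.
Proof.
move=> w0; apply: cabs_lt1_neq1; rewrite cabs_cexp Re_twopii expR_lt1 oppr_lt0.
by rewrite !mulr_gt0 ?pi_gt0.
Qed.

Lemma csc2_period w : csc2 (w + 1) = csc2 w.
Proof.
have e : cexp t = 1 by have := cexp_twopii_nat R 1; rewrite mul1r.
by rewrite /csc2 mulrDr mulr1 cexpD e mulr1.
Qed.

(** As exp (i pi) = -1, the two half-arguments have the opposite square roots of q as
    exponentials. *)
Lemma csc2_double w : 0 < Im w -> csc2 w = 4^-1 * (csc2 (w / 2) + csc2 ((w + 1) / 2)).
Proof.
move=> w0; have w1 : 0 < Im (w / 2) by rewrite Im_half divr_gt0.
have w2 : 0 < Im ((w + 1) / 2) by rewrite Im_half ImD /= addr0 divr_gt0.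
have h1 := cexp_neq1 w1; have h2 := cexp_neq1 w2; have h0 := cexp_neq1 w0.
have n2 : (2 : C) != 0 by rewrite pnatr_eq0.
have e0 : cexp (t * w) = cexp (t * (w / 2)) ^+ 2.
  by rewrite -cexpMn; congr cexp; field.
have e1 : cexp (t / 2) = -1.
  have -> : t / 2 = (pi : R)%:C%C * 'i%C.
    by rewrite /twopii rmorphM /= rmorph_nat; field.
  have -> : (pi : R)%:C%C * 'i%C = (0 +i* pi)%C by apply: complex_ext => /=; ring.
  by rewrite /cexp /= expR0 cospi sinpi; apply: complex_ext => /=; ring.
have e2 : cexp (t * ((w + 1) / 2)) = - cexp (t * (w / 2)).
  by rewrite -mulN1r -e1 -cexpD; congr cexp; field.
rewrite /csc2 e2 in h2 *; rewrite e0 in h0 *.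
move: (cexp _) (t ^+ 2) h0 h1 h2 => x y h0 h1 h2; field.
by rewrite h0 h1 h2.
Qed.

Lemma strip_away w : `|Re w| <= 2^-1 -> away 2^-1 w.
Proof.
move=> w1 m; have mE : m%:R = (m%:R : R)%:C%C :> C by rewrite rmorph_nat.
case: m mE => [|m] mE; first by rewrite mulr0 !cabs_ge0.
have m1 : 1 <= (m.+1%:R : R) by rewrite ler1n.
have h (s : C) : m.+1%:R - `|Re w| <= `|Re s| -> 2^-1 * m.+1%:R <= cabs s.
  by have := absRe_le s; lra.
split; apply: h; rewrite ?ReD ?ReN mE /=; have := ler_norm (Re w); have := ler_norm (- Re w); rewrite normrN.
  by have := ler_norm (Re w + m.+1%:R); lra.
by have := ler_norm (- (Re w - m.+1%:R)); rewrite normrN; lra.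
Qed.

(* |1 - q| is bounded below on the part of the strip |Re w| <= 1/2 away from 0. *)
Lemma csc2_bound (Y d : R) : 0 < d -> d <= 1 -> exists K : R, forall w, `|Re w| <= 2^-1 ->
  0 < Im w -> Im w <= Y -> d <= cabs w -> cabs (csc2 w) <= K.
Proof.
move=> d0 d1; have p0 := pi_gt0 R.
pose c1 : R := 1 - expR (- (pi * d)).
pose c2 : R := 2 * expR (- (2 * pi * Y)) * (1 - cos (pi * d)).
have c10 : 0 < c1 by rewrite subr_gt0 expR_lt1 oppr_lt0 mulr_gt0.
have i1 : pi * d \in `[0, pi] by rewrite in_itv /= mulr_ge0 ?ler_piMr// ltW.
have cosd : cos (pi * d) < 1.
  have i0 : (0 : R) \in `[0, pi] by rewrite in_itv /= lexx ltW.
  by rewrite -[X in _ < X](cos0 R) (ltr_cos i0 i1) mulr_gt0.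
have c20 : 0 < c2 by rewrite !mulr_gt0 ?expR_gt0// subr_gt0.
pose m := Num.min (c1 ^+ 2) c2.
have m0 : 0 < m by rewrite lt_min exprn_gt0.
exists (cabs (t ^+ 2) * m^-1) => w wx wy wY wd.
set q := cexp (t * w); have q1 : cabs q < 1.
  by rewrite cabs_cexp Re_twopii expR_lt1 oppr_lt0 !mulr_gt0.
suff h : m <= cabs (1 - q) ^+ 2.
  rewrite cabsM ler_wpM2l ?cabs_ge0// cabsM cabsV cabsX -[m^-1]mul1r.
  by rewrite ler_pM ?cabs_ge0 ?invr_ge0 ?exprn_ge0 ?cabs_ge0 ?(ltW q1)// lef_pV2 ?posrE// (lt_le_trans m0).
have [yd|yd] := leP (d / 2) (Im w).
  apply: le_trans (_ : c1 ^+ 2 <= _); first by rewrite /m ge_min lexx.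
  rewrite lerXn2r ?nnegrE ?cabs_ge0 ?(ltW c10)//.
  have := cabs_triB 1 q; rewrite cabs1; apply: le_trans.
  rewrite lerB// /q cabs_cexp Re_twopii ler_expR lerN2.
  by have := ler_wpM2l (ltW p0) yd; lra.
apply: le_trans (_ : c2 <= _); first by rewrite /m ge_min lexx orbT.
have xd : d / 2 <= `|Re w|.
  by have := cabs_leReIm w; rewrite (gtr0_norm wy); lra.
set r := expR (- (2 * pi * Im w)).
have E : cabs (1 - q) ^+ 2 = (1 - r) ^+ 2 + 2 * r * (1 - cos (2 * pi * Re w)).
  have Rq : Re q = r * cos (2 * pi * Re w).
    by rewrite /q /cexp ReM /= mul0r subr0 Re_twopii Im_twopii.
  have Iq : Im q = r * sin (2 * pi * Re w).
    by rewrite /q /cexp ImM /= mul0r addr0 Re_twopii Im_twopii.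
  rewrite sqr_cabs ReD ImD ReN ImN Rq Iq /=.
  have := cos2Dsin2 (2 * pi * Re w); move: (cos _) (sin _) => c s cs.
  have -> : (1 - r) ^+ 2 + 2 * r * (1 - c) = 1 - 2 * r * c + r ^+ 2 * (c ^+ 2 + s ^+ 2) by rewrite cs; ring.
  ring.
rewrite E; apply: le_trans (_ : 2 * r * (1 - cos (2 * pi * Re w)) <= _); last by rewrite lerDr sqr_ge0.
rewrite /c2 ler_pM ?mulr_ge0 ?expR_ge0 ?subr_ge0 ?(ltW cosd)//.
  by rewrite ler_pM2l// ler_expR lerN2 ler_pM2l ?mulr_gt0.
rewrite lerB// -(cos_norm (2 * pi * Re w)) !normrM ger0_norm// (gtr0_norm p0).
have i2 : 2 * pi * `|Re w| \in `[0, pi].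
  rewrite in_itv /= !mulr_ge0 ?(ltW p0)//=.
  by have := ler_wpM2l (ltW p0) wx; lra.
rewrite leNgt (ltr_cos i2 i1).
by rewrite -leNgt; have := ler_wpM2l (ltW p0) xd; lra.
Qed.

Let d w := csum w - csc2 w.

Let d_double w : 0 < Im w -> d w = 4^-1 * (d (w / 2) + d ((w + 1) / 2)).
Proof.
by move=> w0; rewrite /d (csum_double w0) (csc2_double w0); move: (csum _) (csum _) (csc2 _) (csc2 _) => a b x y; ring.
Qed.

Let d_period w : 0 < Im w -> d (w + 1) = d w.
Proof. by move=> w0; rewrite /d csum_period// csc2_period. Qed.

(** Both functions are compared with w^-2. What remains of [csum] is [prsum], bounded on the strip;
    what remains of [csc2] is bounded near 0 by its limit there and elsewhere by [csc2_bound]. *)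
Let d_bounded (Y : R) : exists K : R, forall w, `|Re w| <= 2^-1 -> 0 < Im w -> Im w <= Y ->
  cabs (d w) <= K.
Proof.
have [r r0 hr] := @csc2_near0 R _ ltr01.
pose e := Num.min r 1.
have e0 : 0 < e by rewrite lt_min r0 ltr01.
have e1 : e <= 1 by rewrite ge_min lexx orbT.
have [K hK] := csc2_bound Y e0 e1.
pose K1 : R := 1 + cabs (- t ^+ 2 / 12).
exists (4 * 2^-1 ^- 2 + K1 + (`|K| + e ^- 2)) => w wx wy wY.
have h1 : cabs (csum w - w ^- 2) <= 4 * 2^-1 ^- 2.
  rewrite addrC addKr; apply: prsum_bound (strip_away wx).
  by rewrite invr_gt0.
have K10 : 0 <= K1 by rewrite addr_ge0 ?cabs_ge0.
have K0 : 0 <= `|K| + e ^- 2 by rewrite addr_ge0// invr_ge0 exprn_ge0// ltW.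
have h2 : cabs (csc2 w - w ^- 2) <= K1 + (`|K| + e ^- 2).
  have [we|we] := leP e (cabs w).
    apply: le_trans (_ : `|K| + e ^- 2 <= _); last by rewrite lerDr.
    apply: le_trans (cabsD _ _) _; rewrite cabsN lerD//.
      by apply: le_trans (hK _ wx wy wY we) _; exact: ler_norm.
    by rewrite cabsV cabsX lef_pV2 ?posrE ?exprn_gt0 ?(lt_le_trans e0)// lerXn2r// ?nnegrE ?cabs_ge0 ?(ltW e0).
  apply: le_trans (_ : K1 <= _); last by rewrite lerDl.
  have wr : cabs w < r by apply: lt_le_trans we _; rewrite ge_min lexx.
  have := hr (MkUhp wy) wr; rewrite /= => h.
  have := cabs_triB (csc2 w - w ^- 2) (- t ^+ 2 / 12); rewrite /K1; lra.
have -> : d w = (csum w - w ^- 2) - (csc2 w - w ^- 2) by rewrite /d; ring.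
apply: le_trans (cabsD _ _) _; rewrite cabsN -[leRHS]addrA.
exact: lerD.
Qed.

(* Herglotz' trick: a bounded d with d(w) = (d(w / 2) + d((w + 1) / 2)) / 4 vanishes. *)
Let d_strip w : `|Re w| <= 2^-1 -> 0 < Im w -> d w = 0.
Proof.
move=> wx wy; have [K hK] := d_bounded (Im w).
have h n v : `|Re v| <= 2^-1 -> 0 < Im v -> Im v <= Im w -> cabs (d v) <= K / 2 ^+ n.
  elim: n v => [|n IH] v vx vy vw; first by rewrite divr1; exact: hK.
  have v1 : cabs (d (v / 2)) <= K / 2 ^+ n.
    apply: IH; rewrite ?Re_half ?Im_half; try lra.
    by rewrite normrM [`|2^-1|]ger0_norm ?invr_ge0//; have := normr_ge0 (Re v); lra.
  have v2 : cabs (d ((v + 1) / 2)) <= K / 2 ^+ n.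
    have [x0|x0] := leP (Re v) 0.
      apply: IH; rewrite ?Re_half ?Im_half ?ReD ?ImD /= ?addr0; try lra.
      by move: vx; rewrite !ler_norml; lra.
    rewrite (_ : (v + 1) / 2 = (v - 1) / 2 + 1); last by field.
    rewrite d_period; last by rewrite Im_half ImD ImN /= subr0; lra.
    apply: IH; rewrite ?Re_half ?Im_half ?ReD ?ImD ?ReN ?ImN /= ?subr0; try lra.
    by move: vx; rewrite !ler_norml; lra.
  rewrite d_double// cabsM cabsV cabs_nat.
  apply: le_trans (ler_wpM2l _ (cabsD _ _)) _; first by rewrite invr_ge0.
  rewrite exprS invfM mulrCA; lra.
apply/eqP; rewrite -cabs_eq0 eq_le cabs_ge0 andbT; apply/ler_addgt0Pr => e e0.
have [n hn] := half_pow_small K e0; rewrite add0r.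
by apply: le_trans (ltW hn); exact: h.
Qed.

(** Both sides have period 1, and integer translations bring any point into the strip. *)
Lemma csum_csc2 w : 0 < Im w -> csum w = csc2 w.
Proof.
move=> wy; apply/eqP; rewrite -subr_eq0 -/(d w); apply/eqP.
have [n] : exists n : nat, `|Re w| <= n%:R + 2^-1.
  by exists (Num.bound `|Re w|); have := archi_boundP (normr_ge0 (Re w)); lra.
elim: n w wy => [|n IH] w wy; first by rewrite add0r => wx; exact: d_strip.
rewrite -natr1 => wx; have [h|h] := leP `|Re w| (n%:R + 2^-1); first exact: IH.
have n0 : 0 <= (n%:R : R) by [].
have [x0|x0] := leP (Re w) 0.
  rewrite -d_period//; apply: IH; first by rewrite ImD /= addr0.
  by move: wx h; rewrite ReD /= (ler0_norm x0) ler_norml; lra.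
rewrite -(subrK 1 w) d_period ?ImD ?ImN /= ?subr0//; apply: IH.
  by rewrite ImD ImN /= subr0.
by move: wx h; rewrite ReD ReN /= (gtr0_norm x0) ler_norml; lra.
Qed.

End Herglotz.

(** * Zeta(2) and the partial fractions of the cotangent *)

Section Cotangent.
Variable R : realType.
Local Notation C := R[i].
Local Notation t := (twopii R).
Local Notation uder := (der (@uhpval R)).
Implicit Types w : C.

Lemma uhp_neq0 (z : uhp R) : uhpval z != 0.
Proof. by apply/eqP => z0; have := uhp_gt0 z; rewrite z0 ltxx. Qed.

Lemma real_shift_neq0 w (k : R) : 0 < complex.Im w -> w + k%:C%C != 0.
Proof.
by move=> w0; apply/eqP => /(congr1 (@complex.Im R)); rewrite ImD /= addr0 => e; rewrite e ltxx in w0.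
Qed.

Lemma nat_shift_neq0 w n : 0 < complex.Im w -> w + n%:R != 0 /\ w - n%:R != 0.
Proof.
move=> w0; have e : n%:R = (n%:R : R)%:C%C :> C by rewrite rmorph_nat.
by rewrite e -[- _]rmorphN; split; exact: real_shift_neq0.
Qed.

Lemma near0_unique (f : uhp R -> C) a b :
  ccvg (@near0 R) f a -> ccvg (@near0 R) f b -> a = b.
Proof. exact: ccvg_unique. Qed.

Lemma ncvg_cst (a : C) : ccvg \oo (fun _ : nat => a) a.
Proof. exact: ccvg_cst. Qed.

Lemma ncvgN (u : nat -> C) a : ccvg \oo u a -> ccvg \oo (fun n => - u n) (- a).
Proof. exact: ccvgN. Qed.

Lemma hsum_sum (T : eqType) (c : nat -> T -> C) (r : nat -> C) N :
  (forall n, hsum (c n) (r n)) -> hsum (fun x => \sum_(n < N) c n x) (\sum_(n < N) r n).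
Proof.
move=> h; elim: N => [|N IH].
  by rewrite big_ord0; apply: hsum0 => x; rewrite big_ord0.
by rewrite big_ord_recr /=; apply: hsum_eq (hsumD IH (h N)) => x; rewrite big_ord_recr.
Qed.

Definition zeta2 : C := xget 0 [set s | hsum (fun n => (n.+1%:R : C) ^- 2) s].

Lemma asum_zeta2 : asum (fun n => (n.+1%:R : C) ^- 2) (2 * 1).
Proof. by apply: asum_inv_sq => n; rewrite cabsV cabsX cabs_nat mul1r. Qed.

Lemma zeta2_hsum : hsum (fun n => (n.+1%:R : C) ^- 2) zeta2.
Proof. by have [s hs _] := asum_hsum asum_zeta2; apply: (xgetPex 0); exists s. Qed.

Lemma pr_near0 w n : cabs w <= 2^-1 -> cabs (pr w n - 2 * n.+1%:R ^- 2) <= 20 * cabs w * n.+1%:R ^- 2.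
Proof.
move=> w1; have m1 : 1 <= (n.+1%:R : R) by rewrite ler1n.
have /strip_away /(_ n.+1)[h1 h2] : `|complex.Re w| <= 2^-1 := le_trans (absRe_le w) w1.
have m0 : n.+1%:R != 0 :> C by rewrite pnatr_eq0.
have half0 : 0 < (2^-1 : R) by rewrite invr_gt0.
(* With m = n + 1, each half costs 10 = (5 / 2) * 4, from |2 m + x| <= 5 m / 2 and |x + m|^-2 <= 4
   m^-2. *)
suff h (x : C) : cabs x = cabs w -> 2^-1 * n.+1%:R <= cabs (x + n.+1%:R) ->
    cabs ((x + n.+1%:R) ^- 2 - n.+1%:R ^- 2) <= 10 * cabs w * n.+1%:R ^- 2.
  have -> : pr w n - 2 * n.+1%:R ^- 2 = ((w + n.+1%:R) ^- 2 - n.+1%:R ^- 2) + ((- w + n.+1%:R) ^- 2 - n.+1%:R ^- 2).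
    by rewrite /pr -(sqrrN (w - _)) opprB [n.+1%:R - w]addrC; ring.
  apply: le_trans (cabsD _ _) _; have := h w erefl h1; have := h (- w) (cabsN w).
  have e : cabs (- w + n.+1%:R) = cabs (w - n.+1%:R) by rewrite addrC cabsB.
  rewrite e => /(_ h2) h4 h3; apply: le_trans (lerD h3 h4) _.
  by rewrite -!mulrDl -natrD.
move=> xw hx; have xn0 : x + n.+1%:R != 0.
  by rewrite -cabs_gt0; apply: lt_le_trans hx; rewrite mulr_gt0// ltr0n.
have -> : (x + n.+1%:R) ^- 2 - n.+1%:R ^- 2 = - x * (2 * n.+1%:R + x) * (x + n.+1%:R) ^- 2 * n.+1%:R ^- 2.
  by move: (n.+1%:R) m0 xn0 => y y0 xy; field; rewrite xy y0.
rewrite !cabsM cabsN xw !cabsV !cabsX cabs_nat.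
have i1 := cabs_inv_sq half0 hx; rewrite cabsV cabsX in i1.
rewrite ler_wpM2r ?invr_ge0 ?exprn_ge0 ?ler0n//.
rewrite -mulrA [10 * _]mulrC ler_wpM2l ?cabs_ge0//.
have j : cabs (2 * n.+1%:R + x) <= 5 / 2 * n.+1%:R.
  by apply: le_trans (cabsD _ _) _; rewrite cabsM !cabs_nat xw; lra.
apply: le_trans (ler_pM _ _ j i1) _; rewrite ?cabs_ge0 ?invr_ge0 ?exprn_ge0 ?cabs_ge0//.
have n0 : 0 < (n.+1%:R : R) by rewrite ltr0n.
have -> : 5 / 2 * n.+1%:R * (2^-1 ^- 2 * n.+1%:R ^- 2) = 10 * n.+1%:R^-1 :> R.
  by move: (n.+1%:R) n0 => y y0; field; rewrite gt_eqF.
by rewrite ler_pdivrMr//; lra.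
Qed.

(** [csum] and [csc2] agree; once w^-2 is subtracted, the limit at 0 of the one is twice zeta(2) and
    that of the other is [- t^2 / 12]. *)
Lemma zeta2E : zeta2 = - t ^+ 2 / 24.
Proof.
have n2 : (2 : C) != 0 by rewrite pnatr_eq0.
have n12 : (12 : C) != 0 by rewrite pnatr_eq0.
apply: (mulfI n2); have -> : 2 * (- t ^+ 2 / 24) = - t ^+ 2 / 12 by field.
refine (near0_unique _ (@csc2_near0 R)).
apply: (ccvg_le (g := fun z : uhp R => 40 * cabs (uhpval z))).
  have h0 : 0 < (2^-1 : R) by rewrite invr_gt0.
  exists 2^-1 => // z /ltW zh.
  rewrite -(csum_csc2 (uhp_gt0 z)) /csum [X in X - 2 * _](_ : _ = prsum (uhpval z)); last by ring.
  have h1 := prsumP h0 (strip_away (le_trans (absRe_le _) zh)).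
  have h2 := hsumB h1 (hsumZ 2 zeta2_hsum).
  have [s hs] := asum_hsum (asum_inv_sq (fun n => pr_near0 n zh)).
  by rewrite (hsum_unique h2 hs) mulrA -natrM.
move=> e e0; exists (e / 40); first by rewrite divr_gt0.
by move=> z; rewrite ltr_pdivlMr// mulrC.
Qed.

Definition ct w (n : nat) : C := (w + n.+1%:R)^-1 + (w - n.+1%:R)^-1.

Lemma ct_bound (c : R) w n : 0 < c -> away c w ->
  cabs (ct w n) <= 2 * cabs w * c ^- 2 * n.+1%:R ^- 2.
Proof.
move=> c0 /(_ n.+1)[h1 h2]; have n0 : 0 < (n.+1%:R : R) by rewrite ltr0n.
have cn : 0 < c * n.+1%:R by rewrite mulr_gt0.
have x1 : w + n.+1%:R != 0 by rewrite -cabs_gt0 (lt_le_trans cn).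
have x2 : w - n.+1%:R != 0 by rewrite -cabs_gt0 (lt_le_trans cn).
have -> : ct w n = 2 * w * ((w + n.+1%:R)^-1 * (w - n.+1%:R)^-1).
  by rewrite /ct; move: (n.+1%:R : C) x1 x2 => y y1 y2; field; rewrite y1 y2.
rewrite !cabsM cabs_nat !cabsV -[leRHS]mulrA ler_wpM2l ?mulr_ge0 ?cabs_ge0//.
have -> : c ^- 2 * n.+1%:R ^- 2 = (c * n.+1%:R)^-1 * (c * n.+1%:R)^-1.
  by rewrite -invfM -exprMn expr2 invfM.
by rewrite ler_pM ?invr_ge0 ?cabs_ge0// lef_pV2 ?posrE// (lt_le_trans cn).
Qed.

Lemma der_ct_term (z : uhp R) (a : C) : uhpval z + a != 0 ->
  uder (fun s => (uhpval s + a)^-1) z (- (uhpval z + a) ^- 2).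
Proof.
move=> h; have := @derV _ _ _ (fun s => uhpval s + a) z _ h (derD (der_emb (@uhpval R) z) (der_cst (@uhpval R) a z)).
by rewrite addr0 mulN1r.
Qed.

Lemma der_ct (z : uhp R) n : uder (fun s => ct (uhpval s) n) z (- pr (uhpval z) n).
Proof.
have [h1 h2] := nat_shift_neq0 n.+1 (uhp_gt0 z).
by have := derD (der_ct_term h1) (der_ct_term h2); rewrite -opprD.
Qed.

Lemma der_ctg (z : uhp R) : uder (fun s => ctg (uhpval s)) z (- csc2 (uhpval z)).
Proof.
have n1 := cexp_neq1 (uhp_gt0 z).
have n2 : cexp (t * uhpval z) - 1 != 0 by rewrite -oppr_eq0 opprB.
have hq := der_cexp_lin t z.
have h1 := derD hq (der_cst (@uhpval R) 1 z).
have h2 := derB hq (der_cst (@uhpval R) 1 z).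
have := derZ (t / 2) (@der_div _ _ _ _ (fun s => cexp (t * uhpval s) - 1) z _ _ n2 h1 h2).
rewrite (_ : t / 2 * _ = - csc2 (uhpval z)) //.
clear hq h1 h2; rewrite /csc2; move: (cexp (t * uhpval z)) n1 n2 => q q1 q2.
by move: t => x; field; rewrite q2 q1.
Qed.

(** By [csum_csc2] the two expansions have the same derivative, so they differ by a constant, which
    is 0 by the limits at 0. *)
Lemma ctg_hsum (z : uhp R) : hsum (ct (uhpval z)) (ctg (uhpval z) - (uhpval z)^-1).
Proof.
have hs (v : uhp R) : exists2 s, hsum (ct (uhpval v)) s &
    forall c : R, 0 < c -> away c (uhpval v) -> cabs s <= 2 * (2 * cabs (uhpval v) * c ^- 2).
  have [c c0 hc] := uhp_away (uhp_gt0 v).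
  have [s hs _] := asum_hsum (asum_inv_sq (fun n => ct_bound n c0 hc)).
  exists s => // c' c0' hc'; have [s' hs' b] := asum_hsum (asum_inv_sq (fun n => ct_bound n c0' hc')).
  by rewrite (hsum_unique hs hs').
have [f hf] : exists f, lucvg (fun n (v : uhp R) => \sum_(k < n) ct (uhpval v) k) f.
  apply: (mtest (u := fun k (v : uhp R) => ct (uhpval v) k)) => v.
  have y0 : 0 < complex.Im (uhpval v) / 2 by rewrite divr_gt0 ?uhp_gt0.
  set y := complex.Im (uhpval v) / 2 in y0; exists y => //.
  pose K := cabs (uhpval v) + y; pose c := y / (y + K).
  have K0 : 0 <= K by rewrite addr_ge0 ?cabs_ge0 ?ltW.
  have c0 : 0 < c by exact: away_gt0.
  exists (fun k => 2 * K * c ^- 2 * k.+1%:R ^- 2); exists (2 * K * c ^- 2 * 2); split=> [n|w k wv].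
    by rewrite -mulr_sumr ler_wpM2l ?inv_sq_sum// !mulr_ge0// invr_ge0 exprn_ge0// ltW.
  have wK : cabs (uhpval w) <= K by have := cabs_triB (uhpval w) (uhpval v); rewrite /K; lra.
  have wy : y <= complex.Im (uhpval w).
    have := absIm_le (uhpval w - uhpval v); rewrite ImD ImN => h.
    have := ler_norm (- (complex.Im (uhpval w) - complex.Im (uhpval v))); rewrite normrN /y; move: wv; rewrite /y; lra.
  apply: le_trans (ct_bound k c0 (far_away y0 wy wK)) _.
  by rewrite !ler_wpM2r ?invr_ge0 ?exprn_ge0 ?ler0n ?(ltW c0)// ler_wpM2l.
have fE v : hsum (ct (uhpval v)) (f v).
  have [s h _] := hs v; rewrite (_ : f v = s) //.
  exact: ncvg_unique (lucvg_ccvg v hf) (hsum_nat h).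
have hol n : holomorphic (fun v : uhp R => \sum_(k < n) ct (uhpval v) k).
  apply: (@hol_sum R 'I_n (index_enum _) (fun (k : 'I_n) v => ct (uhpval v) k)) => k.
  by apply/holomorphicP => v; eexists; exact: der_ct.
have [holf df] := weierstrass hol hf.
have dfE v : cderiv f v = - prsum (uhpval v).
  apply: ncvg_unique (df v) _; have [c c0 hc] := uhp_away (uhp_gt0 v).
  apply: ccvg_eq (hsum_nat (hsumN (prsumP c0 hc))) => n.
  apply/esym/cderivE.
  by apply: (@der_sum _ _ _ _ _ (fun (k : 'I_n) v => ct (uhpval v) k)) => k; exact: der_ct.
have d0 v : uder (fun v => (uhpval v)^-1 + f v - ctg (uhpval v)) v 0.
  have z0 := uhp_neq0 v; rewrite -[uhpval v]addr0 in z0.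
  have h1 := derD (der_ct_term z0) (cderivP v holf).
  have := derB h1 (der_ctg v); rewrite dfE -csum_csc2 ?uhp_gt0// addr0 opprK /csum.
  rewrite (_ : _ + _ = 0); last by ring.
  by apply: der_eq => s; rewrite addr0.
have [a ha] : exists a, forall v, (uhpval v)^-1 + f v - ctg (uhpval v) = a.
  by exists ((uhpval z)^-1 + f z - ctg (uhpval z)) => v; exact: (uder0_cst d0).
suff a0 : a = 0.
  have -> : ctg (uhpval z) - (uhpval z)^-1 = f z by have := ha z; rewrite a0 => /subr0_eq <-; ring.
  exact: fE.
have h1 : ccvg (@near0 R) f 0.
  apply: (ccvg_le (g := fun v : uhp R => 16 * cabs (uhpval v))).
    have h0 : 0 < (2^-1 : R) by rewrite invr_gt0.
    exists 2^-1 => // v /ltW vh; rewrite subr0; have [s h b] := hs v.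
    rewrite (hsum_unique (fE v) h).
    apply: le_trans (b _ h0 (strip_away (le_trans (absRe_le _) vh))) _.
    by rewrite expr2 invfM invrK; lra.
  move=> e e0; exists (e / 16); first by rewrite divr_gt0.
  by move=> v; rewrite ltr_pdivlMr// mulrC.
have h2 : ccvg (@near0 R) (fun v => f v - (ctg (uhpval v) - (uhpval v)^-1)) (0 - 0).
  exact: ccvgB h1 (@ctg_near0 R).
rewrite subr0 in h2; refine (near0_unique _ h2).
by apply: ccvg_eq (ccvg_cst a) => v; rewrite -(ha v); ring.
Qed.

End Cotangent.

(** The equality of the row and column sums of the lattice series, solved for the transformed value
    of phi. *)
Lemma quasi_eq (F : numFieldType) (f f' u v q : F) : u != 0 -> v != 0 ->
  u ^+ 2 * ((1 - 6 * f) / 24) - v ^- 2 * (- u ^+ 2 / 24) - q =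
  v ^- 2 * (u ^+ 2 * ((1 - 6 * f') / 24)) - - u ^+ 2 / 24 - (q - u / (2 * v)) ->
  f' = v ^+ 2 * f + 2 * v / u.
Proof.
move=> u0 v0 /eqP; rewrite -subr_eq0 => /eqP E; apply/eqP; rewrite -subr_eq0.
rewrite (_ : _ - _ = 4 * v ^+ 2 / u ^+ 2 * 0); first by rewrite mulr0.
by rewrite -E; field; rewrite u0 v0.
Qed.

(** * Quasi-modularity of E_2 under z -> -1 / z *)

Section QuasiModularity.
Variable R : realType.
Local Notation C := R[i].
Local Notation t := (twopii R).
Variables (z z' : uhp R).
Hypothesis zz' : uhpval z' = - (uhpval z)^-1.
Let x := uhpval z.
Let y := uhpval z'.
Let x0 : x != 0 := uhp_neq0 z.

Let Im_nat (n : nat) (w : C) : complex.Im (n%:R * w) = n%:R * complex.Im w.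
Proof.
have -> : n%:R = (n%:R : R)%:C%C :> C by rewrite rmorph_nat.
by rewrite ImM /= mul0r addr0.
Qed.

Let Im_pos n (v : uhp R) : 0 < complex.Im (n.+1%:R * uhpval v).
Proof. by rewrite Im_nat mulr_gt0 ?uhp_gt0// ltr0n. Qed.

(** The bound by m comes from the imaginary part; the bound by |k| is [far] scaled by m, which makes
    its constant independent of m. *)
Let lower : exists2 c : R, 0 < c & forall (m : nat) (k : R),
  c * m.+1%:R <= cabs (m.+1%:R * x + k%:C%C) /\ c * `|k| <= cabs (m.+1%:R * x + k%:C%C).
Proof.
have y0 : 0 < complex.Im x := uhp_gt0 z; set b := complex.Im x in y0.
have a0 := cabs_ge0 x; set a := cabs x in a0.
have ba : 0 < b + a by rewrite ltr_pwDl.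
exists (Num.min b (b / (b + a))); first by rewrite lt_min y0 divr_gt0.
move=> m k; have m0 : 0 < (m.+1%:R : R) by rewrite ltr0n.
split.
  apply: le_trans (_ : b * m.+1%:R <= _); first by rewrite ler_pM2r// ge_min lexx.
  apply: le_trans (absIm_le _); rewrite ImD Im_nat /= addr0 mulrC; exact: ler_norm.
apply: le_trans (_ : b / (b + a) * `|k| <= _).
  by rewrite ler_wpM2r// ge_min lexx orbT.
have bm : 0 < m.+1%:R * b by rewrite mulr_gt0.
have := far (w := m.+1%:R * x) (K := m.+1%:R * a) k bm.
rewrite Im_nat lexx cabsM cabs_nat lexx => /(_ isT isT).
rewrite -mulrDr -2!(mulrA m.+1%:R) ler_pM2l// => hh.
by rewrite mulrAC ler_pdivrMr// [leRHS]mulrC.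
Qed.

Let h : C := 2^-1.
Let hR : h = (2^-1 : R)%:C%C. Proof. by rewrite fmorphV rmorph_nat. Qed.
(** (w + n)^2 - 1 / 4 factors into neighbouring half-integer shifts, so the sum over n telescopes:
    [Q] is its limit for the row m and [TT] what a truncation adds. *)
Let ss (m n : nat) : C := let w := m.+1%:R * x in
  ((w + n.+1%:R) ^+ 2 - h ^+ 2)^-1 + ((w - n.+1%:R) ^+ 2 - h ^+ 2)^-1.
Let Q (m : nat) : C := let w := m.+1%:R * x in (w + h)^-1 - (w - h)^-1.
Let TT (A : C) (m : nat) : C := let w := m.+1%:R * x in (w - A)^-1 - (w + A)^-1.
Let rr (p : nat * nat) : C := pr (p.1.+1%:R * x) p.2 - ss p.1 p.2.

Let shift_neq0 m (k : R) : m.+1%:R * x + k%:C%C != 0.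
Proof. exact: real_shift_neq0 (Im_pos m z). Qed.

Let natC (n : nat) : n%:R = (n%:R : R)%:C%C :> C. Proof. by rewrite rmorph_nat. Qed.

Let telescope_inv (w : C) : w - h != 0 -> w + h != 0 -> (w ^+ 2 - h ^+ 2)^-1 = (w - h)^-1 - (w + h)^-1.
Proof.
have n2 : (2 : C) != 0 by rewrite pnatr_eq0.
move=> h1 h2; have e : h = 2^-1 by [].
have e2 : w + h - (w - h) = 1 by rewrite /h; field.
by rewrite subr_sqr; move: e2; move: (w - h) (w + h) h1 h2 => a b a0 b0 ba; rewrite -[LHS]mul1r -ba; field;
    rewrite a0 b0.
Qed.

Let ss_sum m N : \sum_(n < N) ss m n = Q m + TT (N%:R + h) m.
Proof.
have nz (k : R) : m.+1%:R * x + k%:C%C != 0 by exact: shift_neq0.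
rewrite /Q /TT; elim: N => [|N IH].
  by rewrite big_ord0 add0r; ring.
rewrite big_ord_recr /= IH /ss; set w := m.+1%:R * x in nz *.
have nzp (a b : R) : w + a%:C%C + b%:C%C != 0 by rewrite -addrA -rmorphD; exact: nz.
have negC (a : R) : - a%:C%C = (- a)%:C%C :> C by rewrite rmorphN.
rewrite !telescope_inv; last first.
- by rewrite hR natC ?negC ?negC; exact: nzp.
- by rewrite hR natC ?negC ?negC; exact: nzp.
- by rewrite hR natC ?negC ?negC; exact: nzp.
- by rewrite hR natC ?negC ?negC; exact: nzp.
have e1 : w + N.+1%:R - h = w + (N%:R + h) by rewrite -natr1 /h; field.
have e2 : w - N.+1%:R + h = w - (N%:R + h) by rewrite -natr1 /h; field.
have e3 : w + N.+1%:R + h = w + (N.+1%:R + h) by ring.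
have e4 : w - N.+1%:R - h = w - (N.+1%:R + h) by ring.
by rewrite e1 e2 e3 e4; ring.
Qed.

(* The double series of (m z + n)^-2 is only conditionally summable; subtracting the telescoping terms ss
   makes it absolutely summable, and the two iterated sums of ss account for the anomaly of E_2. *)
Let rr_asum : exists M : R, asum rr M.
Proof.
have [c c0 hc] := lower.
pose K : R := c ^- 4.
have KC : cabs (K%:C%C) = K by rewrite cabs_real ger0_norm// invr_ge0 exprn_ge0// ltW.
have hu : asum (fun m => K%:C%C * (m.+1%:R : C) ^- 2) (K * (2 * 1)).
  by rewrite -[X in asum _ (X * _)]KC; apply: asumZ; exact: asum_zeta2.
exists (K * (2 * 1) * (2 * 1)); apply: (asum_prod _ hu (@asum_zeta2 R)) => m n.
have m0 : 0 < (m.+1%:R : R) by rewrite ltr0n.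
have n1 : 1 <= (n.+1%:R : R) by rewrite ler1n.
rewrite cabsM KC !cabsV !cabsX !cabs_nat /rr /=.
have est (k : R) : `|k| = n.+1%:R ->
   cabs ((m.+1%:R * x + k%:C%C) ^- 2 - ((m.+1%:R * x + k%:C%C) ^+ 2 - h ^+ 2)^-1) <=
   2^-1 * (K * m.+1%:R ^- 2 * n.+1%:R ^- 2).
  move=> kn; have [a1 a2] := hc m k; have [b1 b2] := hc m (k - 2^-1); have [d1 d2] := hc m (k + 2^-1).
  have b2' : c * (n.+1%:R / 2) <= cabs (m.+1%:R * x + (k - 2^-1)%:C%C).
    apply: le_trans b2; rewrite ler_pM2l// -kn; have := ler_norm k; have := ler_norm (- k).
    rewrite normrN; have := ler_norm (k - 2^-1); have := ler_norm (- (k - 2^-1)); rewrite normrN.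
    by move: n1; rewrite -kn; case: (ler0P k); lra.
  have d2' : c * (n.+1%:R / 2) <= cabs (m.+1%:R * x + (k + 2^-1)%:C%C).
    apply: le_trans d2; rewrite ler_pM2l// -kn.
    have := ler_norm (k + 2^-1); have := ler_norm (- (k + 2^-1)); rewrite normrN.
    by move: n1; rewrite -kn; case: (ler0P k); lra.
  move: (shift_neq0 m k) (shift_neq0 m (k - 2^-1)) (shift_neq0 m (k + 2^-1)) a1 a2 b1 b2' d1 d2'.
  rewrite rmorphB rmorphD /= -hR !addrA; set w := _ * x + k%:C%C => w0 w1 w2 a1 a2 b1 b2' d1 d2'.
  have -> : w ^- 2 - (w ^+ 2 - h ^+ 2)^-1 = - h ^+ 2 * ((w * w) * ((w - h) * (w + h)))^-1.
    rewrite subr_sqr; have e : h ^+ 2 = w * w - (w - h) * (w + h) by ring.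
    by rewrite e; move: (w - h) (w + h) w1 w2 => p q p0 q0; field; rewrite w0 p0 q0.
  have h4 : cabs (- h ^+ 2) = 4^-1.
    by rewrite cabsN cabsX hR cabs_real ger0_norm ?invr_ge0// exprVn -natrX.
  rewrite cabsM h4 cabsV !cabsM.
  have lo : c ^+ 4 * m.+1%:R ^+ 2 * n.+1%:R ^+ 2 / 2 <= cabs w * cabs w * (cabs (w - h) * cabs (w + h)).
    have -> : c ^+ 4 * m.+1%:R ^+ 2 * n.+1%:R ^+ 2 / 2 = ((c * m.+1%:R) * (c * n.+1%:R)) * ((c * m.+1%:R) * (c
        * (n.+1%:R / 2))) by ring.
    have c0' := ltW c0.
    by rewrite !ler_pM ?mulr_ge0 ?divr_ge0 ?ler0n// -kn.
  have pos : 0 < c ^+ 4 * m.+1%:R ^+ 2 * n.+1%:R ^+ 2 / 2.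
    by rewrite divr_gt0// !mulr_gt0 ?exprn_gt0// ltr0n.
  apply: le_trans (_ : 4^-1 * (c ^+ 4 * m.+1%:R ^+ 2 * n.+1%:R ^+ 2 / 2)^-1 <= _).
    by rewrite ler_wpM2l ?invr_ge0// lef_pV2 ?posrE// (lt_le_trans pos).
  rewrite le_eqVlt; apply/orP; left; apply/eqP; rewrite /K.
  have cn : c != 0 by rewrite gt_eqF.
  have mn : (m.+1%:R : R) != 0 by rewrite pnatr_eq0.
  have nn : (n.+1%:R : R) != 0 by rewrite pnatr_eq0.
  by move: (m.+1%:R) (n.+1%:R) mn nn => p q p0 q0; field; rewrite p0 q0 cn.
have := lerD (est n.+1%:R (normr_nat _ _)) (est (- n.+1%:R) _).
rewrite normrN normr_nat => /(_ erefl); rewrite rmorphN /= -natC => e.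
rewrite [X in cabs X](_ : _ =
   ((m.+1%:R * x + n.+1%:R) ^- 2 - ((m.+1%:R * x + n.+1%:R) ^+ 2 - h ^+ 2)^-1) +
   ((m.+1%:R * x - n.+1%:R) ^- 2 - ((m.+1%:R * x - n.+1%:R) ^+ 2 - h ^+ 2)^-1)); last by rewrite /pr /ss; ring.
apply: le_trans (cabsD _ _) _; apply: le_trans e _.
by move: (K / _ / _) => u; lra.
Qed.

Let inv_cvg0 (v : C) (c : R) : 0 < c -> (forall k : R, 0 <= k -> c * k <= cabs (v + k%:C%C)) ->
  ccvg \oo (fun N => (v + (N%:R + h))^-1) 0.
Proof.
move=> c0 hv; apply: (ccvg_le (g := fun N => (c * (N%:R + 2^-1))^-1)).
  apply: nearW => N; rewrite subr0 cabsV.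
  have k0 : 0 < (N%:R + 2^-1 : R) by rewrite ltr_wpDl ?invr_gt0.
  have e : N%:R + h = (N%:R + 2^-1 : R)%:C%C by rewrite hR natC rmorphD.
  have := hv _ (ltW k0); rewrite e => hk.
  by rewrite lef_pV2 ?posrE ?mulr_gt0// (lt_le_trans _ hk)// mulr_gt0.
move=> e e0; exists (Num.bound ((c * e)^-1)) => // N /= hN.
have ce : 0 < c * e by rewrite mulr_gt0.
have i : (c * e)^-1 < N%:R.
  apply: lt_le_trans (archi_boundP _) _; first by rewrite invr_ge0 ltW.
  by rewrite ler_nat.
have k0 : 0 < c * (N%:R + 2^-1 : R) by rewrite mulr_gt0// ltr_wpDl ?invr_gt0.
rewrite invf_plt ?posrE//; have -> : e^-1 = c * (c * e)^-1 by field; rewrite !gt_eqF.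
by rewrite ltr_pM2l//; lra.
Qed.

Let Q_hsum : exists q, hsum Q q.
Proof.
have [c c0 hc] := lower.
suff [q hq _] : exists2 q, hsum Q q & cabs q <= 2 * c ^- 2 by exists q.
apply: asum_hsum; apply: asum_inv_sq => m; rewrite /Q.
have e : - h = (- 2^-1 : R)%:C%C by rewrite hR rmorphN.
have m0 : 0 < (m.+1%:R : R) by rewrite ltr0n.
have [h1 _] := hc m 2^-1; have [h2 _] := hc m (- 2^-1).
move: (shift_neq0 m 2^-1) (shift_neq0 m (- 2^-1)) h1 h2; rewrite -e -hR; set w := _ * x => w1 w2 h1 h2.
have n2 : (2 : C) != 0 by rewrite pnatr_eq0.
have e2 : w + h - (w - h) = 1 by rewrite /h; field.
have -> : (w + h)^-1 - (w - h)^-1 = - ((w + h)^-1 * (w - h)^-1).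
  by rewrite -[RHS]mulr1 -e2; move: (w + h) (w - h) w1 w2 => a b a0 b0; field; rewrite a0 b0.
have cm : 0 < c * m.+1%:R by rewrite mulr_gt0.
rewrite cabsN cabsM !cabsV -invfM -[leRHS]invfM -exprMn lef_pV2 ?posrE ?exprn_gt0 ?mulr_gt0//; last first.
- exact: lt_le_trans h2.
- exact: lt_le_trans h1.
by rewrite expr2 ler_pM// ltW.
Qed.

(** The columns q^x / (1 - q^x)^2 of the Lambert series are squared cosecants at the multiples of
    v. *)
Let csc2_sum (v : uhp R) :
  ccvg \oo (fun N => \sum_(m < N) csc2 (m.+1%:R * uhpval v)) (t ^+ 2 * ((1 - 6 * phi v) / 24)).
Proof.
have H := ncvgZ (t ^+ 2) (hsum_nat (phi_col v)).
move=> e e0; have [N _ hN] := H e e0; exists N => // n /= Nn.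
have := hN n.+1 (leqW Nn).
rewrite /= (sum_ord_recl (fun k => if k is _.+1 then nome v ^+ k / (1 - nome v ^+ k) ^+ 2 else 0)) add0r.
have E m : t ^+ 2 * (nome v ^+ m.+1 / (1 - nome v ^+ m.+1) ^+ 2) = csc2 (m.+1%:R * uhpval v).
  by rewrite /csc2 [t * (_ * _)]mulrCA cexpMn.
by rewrite mulr_sumr (eq_bigr _ (fun (m : 'I_n) _ => E m)).
Qed.

Let rr_row m : hsum (fun n => rr (m, n)) (csc2 (m.+1%:R * x) - (m.+1%:R * x) ^- 2 - Q m).
Proof.
have [M hM] := rr_asum; have [s hs _] := asum_hsum (asum_row m hM).
suff -> : csc2 (m.+1%:R * x) - (m.+1%:R * x) ^- 2 - Q m = s by [].
have w0 := Im_pos m z; have [c c0 hc] := uhp_away w0.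
have [c' c0' hc'] := lower.
have h1 := hsum_nat (prsumP c0 hc).
have TT0 : ccvg \oo (fun N => TT (N%:R + h) m) 0.
  have t1 : ccvg \oo (fun N => (m.+1%:R * x + (N%:R + h))^-1) 0.
    by apply: (inv_cvg0 c0') => k k0; have [_] := hc' m k; rewrite ger0_norm.
  have t2 : ccvg \oo (fun N => (- (m.+1%:R * x) + (N%:R + h))^-1) 0.
    apply: (inv_cvg0 c0') => k k0; have [_] := hc' m (- k); rewrite normrN ger0_norm//.
    by rewrite rmorphN cabsB addrC.
  have := ncvgN (ncvgD t1 t2); rewrite addr0 oppr0; apply: ccvg_eq => N.
  rewrite /TT (_ : - _ + _ = - (m.+1%:R * x - (N%:R + h))); last by ring.
  by rewrite invrN; ring.
have h2 : ccvg \oo (fun N => \sum_(n < N) ss m n) (Q m + 0).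
  by apply: ccvg_eq (ncvgD (ncvg_cst (Q m)) TT0) => N; rewrite ss_sum.
apply: ncvg_unique (hsum_nat hs).
have := ncvgB h1 h2; rewrite addr0.
have -> : prsum (m.+1%:R * x) = csc2 (m.+1%:R * x) - (m.+1%:R * x) ^- 2.
  by rewrite -csum_csc2// /csum addrAC subrr add0r.
by apply: ccvg_eq => N; rewrite -sumrB.
Qed.

Let xy : x * y = -1.
Proof. by rewrite /y zz' mulrN mulfV. Qed.

Let pr_col n : hsum (fun m => pr (m.+1%:R * x) n) (x ^- 2 * csc2 (n.+1%:R * y) - n.+1%:R ^- 2).
Proof.
have w0 := Im_pos n z'; have [c c0 hc] := uhp_away w0.
have y0 : y != 0 := uhp_neq0 z'.
have n0 : n.+1%:R != 0 :> C by rewrite pnatr_eq0.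
have -> : x ^- 2 * csc2 (n.+1%:R * y) - n.+1%:R ^- 2 = x ^- 2 * prsum (n.+1%:R * y).
  have -> : n.+1%:R ^- 2 = x ^- 2 * (n.+1%:R * y) ^- 2 :> C.
    by rewrite -invfM -exprMn mulrCA xy mulrN1 sqrrN.
  by rewrite -mulrBr -csum_csc2// /csum addrAC subrr add0r.
apply: hsum_eq (hsumZ _ (prsumP c0 hc)) => m.
have e1 : m.+1%:R * x + n.+1%:R = - (x * (n.+1%:R * y - m.+1%:R)).
  by rewrite mulrBr mulrCA xy; ring.
have e2 : m.+1%:R * x - n.+1%:R = x * (n.+1%:R * y + m.+1%:R).
  by rewrite mulrDr mulrCA xy; ring.
by rewrite /pr e1 e2 sqrrN !exprMn !invfM mulrDr addrC.
Qed.

Let TT_col N : hsum (TT (N%:R + h)) (x^-1 * (ctg ((N%:R + h) * y) - ((N%:R + h) * y)^-1)).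
Proof.
have e : N%:R + h = (N%:R + 2^-1 : R)%:C%C by rewrite hR natC rmorphD.
have W0 : 0 < complex.Im ((N%:R + h) * y).
  by rewrite e ImM /= mul0r addr0 mulr_gt0 ?uhp_gt0// ltr_wpDl ?invr_gt0.
apply: hsum_eq (hsumZ x^-1 (ctg_hsum (MkUhp W0))) => m /=; rewrite /ct /TT /=.
have e1 : m.+1%:R * x - (N%:R + h) = x * ((N%:R + h) * y + m.+1%:R).
  by rewrite mulrDr [x * (_ * y)]mulrCA xy; ring.
have e2 : m.+1%:R * x + (N%:R + h) = - (x * ((N%:R + h) * y - m.+1%:R)).
  by rewrite mulrBr [x * (_ * y)]mulrCA xy; ring.
by rewrite e1 e2 invrN opprK !invfM mulrDr.
Qed.

(** Along (N + 1 / 2) y the exponential tends to 0, and [ctg] to - t / 2. In each single row the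
    truncation terms vanish in the limit, but their sum over the rows does not: this is where the
    two orders of summation part. *)
Let ctg_lim : ccvg \oo (fun N => x^-1 * (ctg ((N%:R + h) * y) - ((N%:R + h) * y)^-1)) (- (t / (2 * x))).
Proof.
have h1 : ccvg \oo (fun N => cexp (t * ((N%:R + h) * y))) 0.
  have := ncvgZ (cexp (t * (h * y))) (pow_cvg0 (nome_lt1 z')); rewrite mulr0.
  apply: ccvg_eq => N; rewrite -cexpMn -cexpD; congr cexp.
  by rewrite -/y; ring.
have h2 : ccvg \oo (fun N => ((N%:R + h) * y)^-1) 0.
  have h3 : ccvg \oo (fun N => (0 + (N%:R + h))^-1) 0.
    by apply: (inv_cvg0 ltr01) => k k0; rewrite add0r mul1r cabs_real ger0_norm.
  have := ncvgZ y^-1 h3; rewrite mulr0; apply: ccvg_eq => N.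
  by rewrite add0r mulrC -invfM.
have n1 : (0 - 1 : C) != 0 by rewrite sub0r oppr_eq0 oner_eq0.
have h3 : ccvg \oo (fun N => ctg ((N%:R + h) * y)) (t / 2 * ((0 + 1) / (0 - 1))).
  apply: ncvgZ; apply: ncvgM; first by apply: ncvgD h1 _; exact: ccvg_cst.
  by apply: ccvgV n1 _; apply: ncvgB h1 _; exact: ccvg_cst.
have := ncvgZ x^-1 (ncvgB h3 h2).
rewrite (_ : x^-1 * _ = - (t / (2 * x))) //.
rewrite add0r sub0r invrN1 mul1r; have n2 : (2 : C) != 0 by rewrite pnatr_eq0.
by field; rewrite x0.
Qed.

(** As x y = -1, m x + n = x (m - n y), so the columns of [rr] are rows of the series for z'.
    Absolute summability of [rr] equates the two iterated sums. *)
Lemma phi_S : phi z' = x ^+ 2 * phi z + 2 * x / t.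
Proof.
have [M hM] := rr_asum; have [s hs _] := asum_hsum hM; have [q hq] := Q_hsum.
have /choice[r' hr'] n : exists l, hsum (fun m => rr (m, n)) l.
  have hsw : asum (fun p => rr (p.2, p.1)) M.
    move=> A uA; rewrite -(big_map (fun p => (p.2, p.1)) xpredT (fun p => cabs (rr p))).
    by apply: hM; rewrite map_inj_uniq// => -[a b] [c d] [-> ->].
  by have [l hl _] := asum_hsum (asum_row n hsw); exists l.
have c1 := hsum_nat (hsum_col hs hr').
have r'E N : \sum_(n < N) r' n = x ^- 2 * (\sum_(n < N) csc2 (n.+1%:R * y)) - \sum_(n < N) (n.+1%:R ^- 2) -
    (q + x^-1 * (ctg ((N%:R + h) * y) - ((N%:R + h) * y)^-1)).
  apply: hsum_unique (hsum_sum N hr') _.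
  rewrite mulr_sumr -sumrB.
  apply: hsum_eq (hsumB (hsum_sum N pr_col) (hsumD hq (TT_col N))) => m.
  by rewrite -ss_sum -sumrB.
have c2 := hsum_nat (hsum_row hs rr_row).
have rE N : \sum_(m < N) (csc2 (m.+1%:R * x) - (m.+1%:R * x) ^- 2 - Q m) =
    \sum_(m < N) csc2 (m.+1%:R * x) - x ^- 2 * (\sum_(m < N) (m.+1%:R ^- 2)) - \sum_(m < N) Q m.
  rewrite !sumrB mulr_sumr; congr (_ - _ - _); apply: eq_bigr => m _.
  by rewrite exprMn invfM mulrC.
have l1 : ccvg \oo (fun N => \sum_(n < N) r' n)
   (x ^- 2 * (t ^+ 2 * ((1 - 6 * phi z') / 24)) - zeta2 R - (q - (t / (2 * x)))).
  have := ncvgB (ncvgB (ncvgZ (x ^- 2) (csc2_sum z')) (hsum_nat (@zeta2_hsum R))) (ncvgD (ncvg_cst q) ctg_lim).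
  by apply: ccvg_eq => N; rewrite r'E.
have l2 : ccvg \oo (fun N => \sum_(m < N) (csc2 (m.+1%:R * x) - (m.+1%:R * x) ^- 2 - Q m))
    (t ^+ 2 * ((1 - 6 * phi z) / 24) - x ^- 2 * zeta2 R - q).
  have := ncvgB (ncvgB (csc2_sum z) (ncvgZ (x ^- 2) (hsum_nat (@zeta2_hsum R)))) (hsum_nat hq).
  by apply: ccvg_eq => N; rewrite rE.
have := ncvg_unique c1 l1; rewrite (ncvg_unique c2 l2) zeta2E.
exact: quasi_eq (twopii_neq0 R) x0.
Qed.

End QuasiModularity.

(** * The slash action on holomorphic functions *)

Section HolomorphicRing.
Variable R : realType.
Local Notation C := R[i].
Local Notation t := (twopii R).
Implicit Types (f g : uhp R -> C) (z : uhp R).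

Definition hol : {pred (uhp R -> C)} := fun f => `[< holomorphic f >].

Lemma holE f : (f \in hol) = `[< holomorphic f >]. Proof. by []. Qed.

Fact hol_subring : subring_closed hol.
Proof.
split=> [|f g|f g]; rewrite ?holE; first exact/asboolP/(@hol_cst R 1).
  by move=> /asboolP hf /asboolP hg; apply/asboolP; exact: (holB hf hg).
by move=> /asboolP hf /asboolP hg; apply/asboolP; exact: (holM hf hg).
Qed.

HB.instance Definition _ := GRing.isSubringClosed.Build (uhp R -> C) hol hol_subring.

(** A commutative ring on which d/dz is total and internal, as the abstract calculus requires of the
    pair (A, D). *)
Record holfun := HolFun { holval :> uhp R -> C; _ : holval \in hol }.
HB.instance Definition _ := [isSub for holval].
HB.instance Definition _ := [Choice of holfun by <:].
HB.instance Definition _ := [SubChoice_isSubComNzRing of holfun by <:].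

Implicit Types (a b : holfun).

Lemma holfunP a : holomorphic a.
Proof. by case: a => f /= /asboolP. Qed.
Arguments holfunP : clear implicits.

Definition mkhol f (h : holomorphic f) : holfun := HolFun (introT (asboolP _) h : f \in hol).

Lemma holfun_ext a b : (forall z, a z = b z) -> a = b.
Proof. by move=> h; apply: val_inj; apply/funext. Qed.

Lemma hfD a b z : (a + b) z = a z + b z. Proof. by []. Qed.
Lemma hfN a z : (- a) z = - a z. Proof. by []. Qed.
Lemma hfM a b z : (a * b) z = a z * b z. Proof. by []. Qed.

Definition hcst (c : C) : holfun := mkhol (@hol_cst R c).

Fact hcst_zmod : zmod_morphism hcst.
Proof. by move=> x y; apply: holfun_ext. Qed.
Fact hcst_monoid : monoid_morphism hcst.
Proof. by split=> [|x y]; apply: holfun_ext. Qed.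
HB.instance Definition _ := GRing.isZmodMorphism.Build C holfun hcst hcst_zmod.
HB.instance Definition _ := GRing.isMonoidMorphism.Build C holfun hcst hcst_monoid.

Definition hev z a : C := a z.
Fact hev_zmod z : zmod_morphism (hev z). Proof. by []. Qed.
Fact hev_monoid z : monoid_morphism (hev z). Proof. by []. Qed.
HB.instance Definition _ z := GRing.isZmodMorphism.Build holfun C (hev z) (hev_zmod z).
HB.instance Definition _ z := GRing.isMonoidMorphism.Build holfun C (hev z) (hev_monoid z).

Definition hD a : holfun := mkhol (holM (@hol_cst R t^-1) (holomorphic_cderiv (holfunP a))).

Lemma hDE a z l : der (@uhpval R) a z l -> hD a z = t^-1 * l.
Proof. by move=> /cderivE <-. Qed.

Lemma hD_der a z : der (@uhpval R) a z (t * hD a z).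
Proof. by rewrite /= mulVKf ?twopii_neq0//; apply: cderivP; exact: holfunP. Qed.

Lemma hD_derivation : derivation hD.
Proof.
split=> a b; apply: holfun_ext => z.
  by rewrite (hDE (a := a + b) (derD (hD_der a z) (hD_der b z))) -mulrDr mulKf ?twopii_neq0.
rewrite (hDE (a := a * b) (derM (hD_der a z) (hD_der b z))).
have t0 := twopii_neq0 R; rewrite hfD !hfM.
by move: (hD a z) (hD b z) (a z) (b z) => x y u v; field.
Qed.

Lemma hD_cst c : hD (hcst c) = 0.
Proof. by apply: holfun_ext => z; rewrite (hDE (a := hcst c) (der_cst _ c z)) mulr0. Qed.

Definition hZ : holfun := mkhol (holM (@hol_cst R t) (@hol_emb R)).

Lemma hD_Z : hD hZ = 1.
Proof.
apply: holfun_ext => z; rewrite (hDE (a := hZ) (derZ t (der_emb (@uhpval R) z))) mulr1.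
by rewrite mulVf ?twopii_neq0.
Qed.

Definition hphi : holfun := mkhol (@hol_phi R).

(** Ramanujan's identity writes omega as a polynomial in phi and D phi, whose holomorphy is
    known. *)
Fact hol_omega : holomorphic (fun z : uhp R => E4 z / 72).
Proof.
have h := holfunP (hcst 2^-1 * (hphi ^+ 2 - 2 * hD hphi)).
apply: hol_eq h => z; have n2 : (2 : C) != 0 by rewrite pnatr_eq0.
by apply: (mulfI n2); rewrite ramanujan /= mulVKf.
Qed.

Definition homega : holfun := mkhol hol_omega.

Lemma hphi_adapted : adapted hD hphi homega.
Proof. by apply: holfun_ext => z; exact: ramanujan. Qed.

End HolomorphicRing.

(** * Moebius transformations and the derivative of a slashed function *)

Section Mobius.
Variable R : realType.
Local Notation C := R[i].
Local Notation t := (twopii R).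
Implicit Types (f : uhp R -> C) (z : uhp R) (g h : GLQ) (k : nat).

Lemma GLQ_mulE g h i j : (g * h)%g i j = g i 0 * h 0 j + g i 1 * h 1 j.
Proof.
rewrite /= mxE !big_ord_recl big_ord0 addr0.
by congr (_ + GLQval g _ _ * GLQval h _ _); apply: val_inj.
Qed.

Lemma autj_neq0 g z : autj g z != 0.
Proof.
apply/eqP; rewrite /autj !ratrC => e.
have := congr1 (@complex.Im R) e; rewrite ImD ImM /= mul0r !addr0 => /eqP.
rewrite mulf_eq0 (gt_eqF (uhp_gt0 z)) orbF fmorph_eq0 => /eqP c0.
move: e; rewrite c0 rmorph0 mul0r add0r => /(congr1 (@complex.Re R)) /= /eqP.
rewrite fmorph_eq0 => /eqP d0; have := valP g.
by rewrite /= det_GLQ c0 d0 !mulr0 subrr ltxx.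
Qed.

Lemma ratr_det_neq0 g : (ratr (\det g) : C) != 0.
Proof. by rewrite fmorph_eq0 gt_eqF// (valP g). Qed.

Lemma mobiusE g z : uhpval (mobius g z) = (ratr (g 0 0) * uhpval z + ratr (g 0 1)) / autj g z.
Proof. by []. Qed.

Lemma autjM g h z : autj (g * h)%g z = autj g (mobius h z) * autj h z.
Proof.
rewrite {1 2}/autj mobiusE !GLQ_mulE !rmorphD !rmorphM /=; have := autj_neq0 h z.
move=> j0; rewrite [RHS]mulrDl -[X in _ = X + _]mulrA divfK// /autj.
move: (ratr (g 1 0)) (ratr (g 1 1)) (ratr (h 0 0)) (ratr (h 1 0)) (ratr (h 0 1)) (ratr (h 1 1)) (uhpval z).
by move=> a b c d e f w; ring.
Qed.

Lemma mobiusM g h z : mobius (g * h)%g z = mobius g (mobius h z).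
Proof.
apply: val_inj; rewrite /= autjM !GLQ_mulE !rmorphD !rmorphM /=.
have u0 := autj_neq0 g (mobius h z); have v0 := autj_neq0 h z.
have E (u v a b N : C) : u != 0 -> v != 0 -> (a * (N / v) + b) / u = (a * N + b * v) / (u * v).
  by move=> u1 v1; field; rewrite u1 v1.
rewrite E//; congr (_ / _); rewrite [autj h z]/autj.
move: (ratr (g 0 0)) (ratr (g 0 1)) (ratr (h 0 0)) (ratr (h 1 0)) (ratr (h 0 1)) (ratr (h 1 1)) (uhpval z).
by move=> a b c d e f w; ring.
Qed.

Lemma autj1 z : autj 1%g z = 1.
Proof. by rewrite /autj /= !mxE /= rmorph0 rmorph1 mul0r add0r. Qed.

Lemma mobius1 z : mobius 1%g z = z.
Proof.
by apply: val_inj; rewrite /= autj1 !mxE /= rmorph0 rmorph1 mul1r addr0 divr1.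
Qed.

Lemma det_GLQM g h : \det (g * h)%g = \det g * \det h.
Proof. exact: det_mulmx. Qed.

Lemma slashM k f g h : slash k (slash k f g) h = slash k f (g * h)%g.
Proof.
apply/funext => z; rewrite /slash det_GLQM autjM mobiusM rmorphM /=.
move: (ratr (\det g)) (ratr (\det h)) (autj g _) (autj h z) (f _) => a b u v x.
by rewrite !exprMn invfM; ring.
Qed.

Lemma slash1 k f : slash k f 1%g = f.
Proof.
apply/funext => z; rewrite /slash autj1 mobius1 /=.
by rewrite det1 rmorph1 !expr1n invr1 !mul1r.
Qed.

(** (2 i pi)^-1 times the logarithmic derivative of c z + d; it measures the failure of D to commute
    with the slash action. *)
Definition hcj g z : C := ratr (g 1 0) / (t * autj g z).

Lemma der_autj g z : der (@uhpval R) (autj g) z (ratr (g 1 0)).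
Proof.
have := derD (derZ (ratr (g 1 0)) (der_emb (@uhpval R) z)) (der_cst _ (ratr (g 1 1)) z).
by rewrite mulr1 addr0.
Qed.

Lemma der_mobius g z :
  der (@uhpval R) (fun w => uhpval (mobius g w)) z (ratr (\det g) / autj g z ^+ 2).
Proof.
have h := derD (derZ (ratr (g 0 0)) (der_emb (@uhpval R) z)) (der_cst _ (ratr (g 0 1)) z).
have := der_div (autj_neq0 g z) h (der_autj g z).
rewrite (_ : (_ * autj g z - _) = ratr (\det g)) //.
rewrite det_GLQ rmorphB !rmorphM /= /autj.
by move: (ratr (g 0 0)) (ratr (g 0 1)) (ratr (g 1 0)) (ratr (g 1 1)) (uhpval z) => a b c d w; ring.
Qed.

Lemma der_slash k f g z l : der (@uhpval R) f (mobius g z) l ->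
  der (@uhpval R) (slash k f g) z
    (t * (ratr (\det g) ^+ k.+1 * autj g z ^- (2 * k.+1) * (t^-1 * l) -
      (2 * k)%:R * hcj g z * slash k f g z)).
Proof.
move=> hf; have j0 := autj_neq0 g z; have t0 := twopii_neq0 R.
have h1 := @derV _ _ _ (fun s => autj g s ^+ (2 * k)) z _ (expf_neq0 (2 * k) j0) (derX (2 * k) (der_autj g z)).
have h2 := derM (derZ (ratr (\det g) ^+ k) h1) (der_comp (@uhpval R) (der_mobius g z) hf).
rewrite (_ : t * _ = ratr (\det g) ^+ k *
    (- ((2 * k)%:R * autj g z ^+ (2 * k).-1 * ratr (g 1 0)) / (autj g z ^+ (2 * k)) ^+ 2) *
    (f \o mobius g) z + ratr (\det g) ^+ k * (autj g z ^+ (2 * k))^-1 *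
    (l * (ratr (\det g) / autj g z ^+ 2))) //.
rewrite /slash /hcj mulnS exprD (exprS (ratr _) k) /=.
have -> : (2 * k)%:R * autj g z ^+ (2 * k).-1 = (2 * k)%:R * autj g z ^+ (2 * k) / autj g z.
  case: k {h1 h2} => [|k]; first by rewrite muln0 !mul0r.
  have -> : (2 * k.+1)%N = (2 * k).+2 by rewrite mulnS.
  by rewrite [in RHS]exprS; field.
move: (expf_neq0 (2 * k) j0) => {h1 h2}; move: (autj g z ^+ (2 * k)) => J J0.
move: (autj g z) t (f _) (ratr (g 1 0)) (ratr (\det g)) j0 t0 => j u x c d j0 u0.
by move: (d ^+ k) => e; field; rewrite J0 j0 u0.
Qed.

Lemma hol_slash k f g : holomorphic f -> holomorphic (slash k f g).
Proof.
move=> /holomorphicP hf; apply/holomorphicP => z; have [l hl] := hf (mobius g z).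
by eexists; exact: der_slash hl.
Qed.

Lemma hol_hcj g : holomorphic (hcj g).
Proof.
have hj : holomorphic (@autj R g).
  by apply: (proj2 (holomorphicP (@autj R g))) => z; eexists; exact: der_autj.
have h0 z : t * autj g z != 0 by rewrite mulf_neq0 ?twopii_neq0 ?autj_neq0.
exact: (holM (@hol_cst R _) (holV h0 (holM (@hol_cst R t) hj))).
Qed.

End Mobius.

(** * The slash action on graded elements and on connections *)

Section SlashRing.
Variable R : realType.
Local Notation C := R[i].
Local Notation t := (twopii R).
Local Notation A := (holfun R).
Local Notation D := (@hD R).
Implicit Types (a b phi om : A) (z : uhp R) (g h : GLQ) (k : nat) (p q : {poly A}).

Definition sl k a g : A := mkhol (@hol_slash R k a g (@holfunP R a)).
Definition cj g : A := mkhol (@hol_hcj R g).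
(* phi_g = phi | g - 2 c / (2 i pi (c z + d)), the action on connections *)
Definition con phi g : A := sl 1 phi g - 2 * cj g.

Lemma slE k a g z : sl k a g z = slash k a g z. Proof. by []. Qed.

Lemma sl_mul k a g h : sl k (sl k a g) h = sl k a (g * h)%g.
Proof. by apply: val_inj => /=; exact: slashM. Qed.

Lemma sl_one k a : sl k a 1%g = a.
Proof. by apply: val_inj => /=; exact: slash1. Qed.

Lemma slD k a b g : sl k (a + b) g = sl k a g + sl k b g.
Proof. by apply: holfun_ext => z; rewrite /= /slash mulrDr. Qed.

Lemma slN k a g : sl k (- a) g = - sl k a g.
Proof. by apply: holfun_ext => z; rewrite /= /slash mulrN. Qed.

Lemma slB k a b g : sl k (a - b) g = sl k a g - sl k b g.
Proof. by rewrite slD slN. Qed.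

Lemma sl0 k g : sl k 0 g = 0.
Proof. by apply: holfun_ext => z; rewrite /= /slash mulr0. Qed.

Lemma sl_cst k (c : C) a g : sl k (hcst c * a) g = hcst c * sl k a g.
Proof. by apply: holfun_ext => z; rewrite /= /slash mulrCA. Qed.

Lemma sl_nat k n a g : sl k (n%:R * a) g = n%:R * sl k a g.
Proof. by rewrite -(rmorph_nat (@hcst R)) sl_cst. Qed.

Lemma slM k l a b g : sl (k + l) (a * b) g = sl k a g * sl l b g.
Proof.
apply: holfun_ext => z; rewrite hfM !slE /slash hfM mulnDr (exprD (ratr _)) (exprD (autj g z)) invfM.
by move: (ratr _ ^+ k) (ratr _ ^+ l) ((autj g z ^+ _)^-1) ((autj g z ^+ _)^-1) => u v x y; ring.
Qed.

Lemma hD_sl k a g : D (sl k a g) = sl k.+1 (D a) g - (2 * k)%:R * cj g * sl k a g.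
Proof.
apply: holfun_ext => z; rewrite (hDE (a := sl k a g) (der_slash k (cderivP (mobius g z) (@holfunP R a)))).
rewrite mulKf ?twopii_neq0// hfD hfN !hfM !slE; congr (_ - _ * _ * _).
by rewrite -(rmorph_nat (@hcst R)).
Qed.

Lemma hD_cj g : D (cj g) = - cj g ^+ 2.
Proof.
apply: holfun_ext => z; have j0 := autj_neq0 g z; have t0 := twopii_neq0 R.
have tj : t * autj g z != 0 by rewrite mulf_neq0.
have := derM (der_cst (@uhpval R) (ratr (g 1 0)) z) (@derV _ _ _ (fun w => t * autj g w) z _ tj (derZ t
    (der_autj g z))).
move=> /(hDE (a := cj g)) ->; rewrite expr2 hfN hfM /= /hcj; move: (autj g z) t (ratr _) j0 t0 {tj} => j u c j0 u0.
by field; rewrite j0 u0.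
Qed.

(** The logarithmic derivative of the cocycle relation [autjM]. *)
Lemma cjM g h : sl 1 (cj g) h + cj h = cj (g * h)%g.
Proof.
apply: holfun_ext => z; rewrite hfD slE /slash /= /hcj autjM expr1 det_GLQ GLQ_mulE rmorphB rmorphD !rmorphM /=.
have j0 := autj_neq0 g (mobius h z); have i0 := autj_neq0 h z; have t0 := twopii_neq0 R.
have := autjM g h z; rewrite {1}/autj !GLQ_mulE !rmorphD !rmorphM /=.
have : autj h z = ratr (h 1 0) * uhpval z + ratr (h 1 1) by [].
move: (ratr (g 1 0)) (ratr (g 1 1)) (ratr (h 0 0)) (ratr (h 1 0)) (ratr (h 0 1)) (ratr (h 1 1)).
move: (uhpval z) (autj g _) (autj h z) t j0 i0 t0 => w j i u j0 i0 u0 a b c d e f ei eji.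
transitivity (((c * f - e * d) * a + d * (j * i)) / (u * j * i ^+ 2)).
  by field; rewrite j0 i0 u0.
have -> : (c * f - e * d) * a + d * (j * i) = (a * c + b * d) * i by rewrite -eji ei; ring.
by field; rewrite j0 i0 u0.
Qed.

Lemma conM phi g h : con (con phi g) h = con phi (g * h)%g.
Proof. by rewrite /con slB sl_mul sl_nat -cjM; ring. Qed.

Lemma con1 phi : con phi 1%g = phi.
Proof.
rewrite /con sl_one (_ : cj 1%g = 0) ?mulr0 ?subr0//; apply: holfun_ext => z.
by rewrite /= /hcj /= mxE /= rmorph0 mul0r.
Qed.

(** The terms in [cj g] produced by the square and by the derivative cancel, because D sends [cj g]
    to minus its square. *)
Lemma adapted_con phi om g : adapted D phi om -> adapted D (con phi g) (sl 2 om g).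
Proof.
rewrite /adapted => e; rewrite -sl_nat e slB sl_nat expr2 (slM 1 1).
rewrite /con (derivation_add (@hD_derivation R)) (derivationN _ (@hD_derivation R)) (derivation_mul (@hD_derivation R)).
rewrite hD_cj hD_sl (_ : D 2 = 0) ?mul0r ?add0r; first by ring.
by rewrite -(rmorph_nat (@hcst R)) hD_cst.
Qed.

Definition slA p g : {poly A} := \poly_(k < size p) sl k p`_k g.

Lemma coef_slA p g k : (slA p g)`_k = sl k p`_k g.
Proof.
by rewrite coef_poly; case: ltnP => // h; rewrite nth_default// sl0.
Qed.

Lemma slA_mul p g h : slA (slA p g) h = slA p (g * h)%g.
Proof. by apply/polyP => k; rewrite !coef_slA sl_mul. Qed.

Lemma slA_one p : slA p 1%g = p.
Proof. by apply/polyP => k; rewrite coef_slA sl_one. Qed.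

Lemma slAD p q g : slA (p + q) g = slA p g + slA q g.
Proof. by apply/polyP => k; rewrite coefD !coef_slA coefD slD. Qed.

Lemma slA0 g : slA 0 g = 0.
Proof. by apply/polyP => k; rewrite coef_slA !coef0 sl0. Qed.

Lemma slAN p g : slA (- p) g = - slA p g.
Proof. by apply/polyP => k; rewrite coefN !coef_slA coefN slN. Qed.

Lemma slA_sum (I : Type) (r : seq I) (F : I -> {poly A}) g :
  slA (\sum_(i <- r) F i) g = \sum_(i <- r) slA (F i) g.
Proof. exact: (big_morph (fun p => slA p g) (fun p q => slAD p q g) (slA0 g)). Qed.

Lemma slAM p q g : slA (p * q) g = slA p g * slA q g.
Proof.
apply/polyP => k; rewrite coef_slA !coefM.
have -> : sl k (\sum_(j < k.+1) p`_j * q`_(k - j)) g = \sum_(j < k.+1) sl k (p`_j * q`_(k - j)) g.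
  exact: (big_morph (fun a => sl k a g) (fun a b => slD k a b g) (sl0 k g)).
apply: eq_bigr => j _; rewrite !coef_slA -slM subnKC//.
by rewrite -ltnS.
Qed.

Lemma slAZ (c : C) p g : slA (hcst c *: p) g = hcst c *: slA p g.
Proof. by apply/polyP => k; rewrite coefZ !coef_slA coefZ sl_cst. Qed.

Lemma slA_sign n p g : slA ((-1) ^+ n *: p) g = (-1) ^+ n *: slA p g.
Proof. by rewrite -signr_odd; case: odd; rewrite ?expr1 ?expr0 ?scaleN1r ?scale1r ?slAN. Qed.

Lemma slA_monomial a k g : slA (a *: 'X^k) g = sl k a g *: 'X^k.
Proof.
apply/polyP => i; rewrite coefZ coef_slA coefZ coefXn.
by case: eqP => [->|]; rewrite ?mulr1// !mulr0 sl0.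
Qed.

Lemma coef_Yp p k : (Yp p)`_k = k%:R * p`_k.
Proof.
rewrite /Yp coefXM; case: k => [|k]; first by rewrite mul0r.
by rewrite coef_deriv mulr_natl.
Qed.

Lemma slA_Yp p g : slA (Yp p) g = Yp (slA p g).
Proof. by apply/polyP => k; rewrite coef_slA !coef_Yp coef_slA sl_nat. Qed.

Lemma coef_Xp phi p k : (Xp D phi p)`_k.+1 = D p`_k - phi * (k%:R * p`_k).
Proof. by rewrite /Xp coefXM /= coefB (coef_mapD (@hD_derivation R)) coefZ coef_Yp. Qed.

(** In weight 2 k, slashing the derivative differs from deriving the slash by [2 k * cj g], exactly
    what passing from phi to [con phi g] absorbs. *)
Lemma slA_Xp phi p g : slA (Xp D phi p) g = Xp D (con phi g) (slA p g).
Proof.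
apply/polyP => -[|k].
  by rewrite coef_slA /Xp !coefXM sl0.
rewrite coef_slA !coef_Xp coef_slA slB hD_sl (slM 1 k) sl_nat /con natrM.
ring.
Qed.

Lemma slA_pochp c m p g : slA (pochp (@hcst R) c m p) g = pochp (@hcst R) c m (slA p g).
Proof. by elim: m => [|m IH] //=; rewrite slAD !slAZ slA_Yp IH. Qed.

Lemma slA_opBp phi om n p g :
  slA (opBp D (@hcst R) phi om n p) g = opBp D (@hcst R) (con phi g) (sl 2 om g) n (slA p g).
Proof.
suff [] : slA (opBp D (@hcst R) phi om n p) g = opBp D (@hcst R) (con phi g) (sl 2 om g) n (slA p g) /\
  slA (opBp D (@hcst R) phi om n.+1 p) g = opBp D (@hcst R) (con phi g) (sl 2 om g) n.+1 (slA p g) by [].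
elim: n => [|n [IH1 IH2]]; first by rewrite /= !subr0 slA_Xp.
split=> //; rewrite -[LHS]/(slA (Xp D phi (opBp D (@hcst R) phi om n.+1 p) - hcst n.+1%:R *: ((om *: 'X^2) *
    (Yp (opBp D (@hcst R) phi om n p) - hcst (n%:R / 2) *: opBp D (@hcst R) phi om n p))) g).
by rewrite slAD slAN slA_Xp IH2 slAZ slAM slA_monomial slAD slAN slAZ slA_Yp IH1.
Qed.

Definition rc phi om n p q := rcp D (@hcst R) phi om n p q.

Lemma slA_rc phi om n p q g :
  slA (rc phi om n p q) g = rc (con phi g) (sl 2 om g) n (slA p g) (slA q g).
Proof.
rewrite /rc /rcp slA_sum; apply: eq_bigr => i _.
by rewrite slAM !slAZ slA_sign !slA_opBp !slA_pochp.
Qed.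

Lemma hev_sep a b : (forall z, hev z a = hev z b) -> a = b.
Proof. exact: holfun_ext. Qed.

Lemma complex_char0 n : (n.+1%:R : C) != 0.
Proof. by rewrite pnatr_eq0. Qed.

Lemma rc_indep phi om phi' om' n p q : adapted D phi om -> adapted D phi' om' ->
  rc phi om n p q = rc phi' om' n p q.
Proof.
exact: (rcp_indep (@hD_derivation R) (ev := @hev R) (@hD_cst R) (fun _ _ => erefl) hev_sep complex_char0 (@hD_Z R)).
Qed.

Lemma rc_assoc phi om N p q r : adapted D phi om ->
  \sum_(i < N.+1) rc phi om (N - i) (rc phi om i p q) r =
  \sum_(i < N.+1) rc phi om (N - i) p (rc phi om i q r).
Proof.
exact: (rcp_assoc (@hD_derivation R) (ev := @hev R) (@hD_cst R) (fun _ _ => erefl) hev_sep complex_char0 (@hD_Z R)).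
Qed.

Lemma rc_slash phi om n p q g : adapted D phi om ->
  slA (rc phi om n p q) g = rc phi om n (slA p g) (slA q g).
Proof.
by move=> h; rewrite slA_rc; apply: rc_indep => //; exact: adapted_con.
Qed.

End SlashRing.

(** * Invariance of phi and omega under SL(2, Z) *)

Section SL2.
Variable R : realType.
Local Notation C := R[i].
Local Notation t := (twopii R).
Implicit Types (g h : GLQ) (z : uhp R).

Lemma hfnat n z : (n%:R : holfun R) z = n%:R.
Proof. by rewrite -(rmorph_nat (@hcst R)). Qed.

Definition mx2 (a b c d : rat) : 'M[rat]_2 :=
  \matrix_(i, j) if i == 0 then if j == 0 then a else b else if j == 0 then c else d.

Lemma det_mx2 a b c d : \det (mx2 a b c d) = a * d - b * c.
Proof.
rewrite (expand_det_row _ ord0) big_ord_recl big_ord1 /cofactor !det_mx11 !mxE.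
by rewrite /= expr0 mul1r expr1 mulN1r mulrN.
Qed.

Lemma GLQ_ext g h : g 0 0 = h 0 0 -> g 0 1 = h 0 1 -> g 1 0 = h 1 0 -> g 1 1 = h 1 1 -> g = h.
Proof.
move=> e1 e2 e3 e4; apply: val_inj; apply/matrixP => i j.
have ordE (k : 'I_2) : k = 0 \/ k = 1.
  by case: k => -[|[|//]] ?; [left|right]; apply: val_inj.
by case: (ordE i) => ->; case: (ordE j) => ->.
Qed.

Definition gl2 a b c d (h : 0 < \det (mx2 a b c d)) : GLQ := MkGLQ h.

Fact shift_det (q : rat) : 0 < \det (mx2 1 q 0 1).
Proof. by rewrite det_mx2 mulr0 subr0 mulr1. Qed.
Definition shiftg q : GLQ := gl2 (shift_det q).

Fact inversion_det : 0 < \det (mx2 0 (-1) 1 0).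
Proof. by rewrite det_mx2 mulr0 sub0r mulr1 opprK. Qed.
Definition inversion : GLQ := gl2 inversion_det.

Fact adj_det g : 0 < \det (mx2 (g 1 1) (- g 0 1) (- g 1 0) (g 0 0)).
Proof.
by rewrite det_mx2 mulrNN mulrC -det_GLQ (valP g).
Qed.
Definition adjg g : GLQ := gl2 (adj_det g).

Lemma SL2Z_inv g : SL2Z g -> (g^-1)%g = adjg g.
Proof.
move=> [_ dg]; apply: (mulgI g); rewrite mulgV; rewrite det_GLQ in dg.
apply: GLQ_ext; rewrite GLQ_mulE !mxE /=.
- by rewrite -dg; ring.
- by ring.
- by ring.
- by rewrite -dg; ring.
Qed.

Lemma SL2Z_mulg g h : SL2Z g -> SL2Z h -> SL2Z (g * h)%g.
Proof.
move=> [ig dg] [ih dh]; split=> [i j|]; last by rewrite det_GLQM dg dh mulr1.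
by rewrite GLQ_mulE rpredD// rpredM.
Qed.

Lemma SL2Z_invg g : SL2Z g -> SL2Z (g^-1)%g.
Proof.
move=> sg; rewrite SL2Z_inv//; case: sg => ig dg; split.
  by move=> i j; rewrite mxE; case: ifP; case: ifP => _ _; rewrite ?rpredN ?ig.
by rewrite /= det_mx2 mulrNN mulrC -det_GLQ.
Qed.

Lemma SL2Z_shift (q : int) : SL2Z (shiftg q%:~R).
Proof.
split=> [i j|]; last by rewrite /= det_mx2; ring.
by rewrite mxE; case: ifP; case: ifP => _ _ //; rewrite ?rpred0 ?rpred1 ?intr_int.
Qed.

Lemma SL2Z_inversion : SL2Z inversion.
Proof.
split=> [i j|]; last by rewrite /= det_mx2; ring.
by rewrite mxE; case: ifP; case: ifP => _ _ //; rewrite ?rpred0 ?rpred1 ?rpredN1.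
Qed.

Lemma phi_nome (z w : uhp R) : nome z = nome w -> phi z = phi w.
Proof.
move=> e; have h := phi_qseries z.
have n24 : (24 : C) != 0 by rewrite pnatr_eq0.
have n6 : (6 : C) != 0 by rewrite pnatr_eq0.
have : (1 - 6 * phi z) / 24 = (1 - 6 * phi w) / 24.
  by apply: hsum_unique h _; rewrite e; exact: phi_qseries.
by move=> /(mulIf (invr_neq0 n24)) /addrI /oppr_inj /(mulfI n6).
Qed.

Lemma cexp_twopii_int (n : int) : cexp (n%:~R * t) = 1.
Proof.
case: n => n; first exact: cexp_twopii_nat.
by rewrite NegzE rmorphN mulNr cexpN cexp_twopii_nat invr1.
Qed.

Lemma phi_shift (z w : uhp R) (n : int) : uhpval w = uhpval z + n%:~R -> phi w = phi z.
Proof.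
move=> e; apply: phi_nome; rewrite /nome e mulrDr cexpD.
by rewrite [t * n%:~R]mulrC cexp_twopii_int mulr1.
Qed.

Lemma con_inversion : con (@hphi R) inversion = @hphi R.
Proof.
apply: holfun_ext => z; rewrite /con hfD hfN hfM (hfnat 2) slE /slash /=.
rewrite /hcj det_mx2 /autj !mxE /= (_ : 0 * 0 - -1 * 1 = 1 :> rat); last by ring.
have x0 := uhp_neq0 z; have t0 := twopii_neq0 R.
have zz : uhpval (mobius inversion z) = - (uhpval z)^-1.
  by rewrite mobiusE /autj !mxE /= rmorph0 rmorph1 rmorphN1 mul0r add0r mul1r addr0 mulN1r.
rewrite (phi_S zz) muln1 !(rmorph0, rmorph1, mul1r, addr0, expr1n).
by move: (uhpval z) t (phi z) x0 t0 => x u f x0 u0; field; rewrite x0 u0.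
Qed.

Lemma con_mul g h : con (@hphi R) g = @hphi R -> con (@hphi R) h = @hphi R ->
  con (@hphi R) (g * h)%g = @hphi R.
Proof. by move=> hg hh; rewrite -conM hg. Qed.

Lemma con_inv g : con (@hphi R) g = @hphi R -> con (@hphi R) (g^-1)%g = @hphi R.
Proof. by move=> hg; rewrite -{1}hg conM mulgV con1. Qed.

(** Both diagonal entries are 1 or both are -1, so g acts as the translation by the integer b d,
    which leaves q unchanged. *)
Lemma con_triangular g : SL2Z g -> g 1 0 = 0 -> con (@hphi R) g = @hphi R.
Proof.
move=> [ig dg] c0; apply: holfun_ext => z; rewrite /con hfD hfN hfM (hfnat 2) slE /slash /=.
rewrite dg rmorph1 expr1n mul1r /hcj c0 rmorph0 mul0r mulr0 subr0.
have /intrP[a ea] := ig 0 0; have /intrP[b eb] := ig 0 1; have /intrP[d ed] := ig 1 1.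
move: dg; rewrite det_GLQ c0 mulr0 subr0 ea ed -intrM => /eqP; rewrite -[1]/(1%:~R) eqr_int => /eqP ad.
have d1 : d = a /\ d * d = 1.
  have /eqP : (`|a| * `|d| = 1)%N by rewrite -abszM ad.
  rewrite muln_eq1 => /andP[/eqP a1 /eqP d1];
  have [ae|ae] : a = 1 \/ a = -1 by lia.
    by move: ad; rewrite ae mul1r => ->.
  by move: ad; rewrite ae mulN1r => /(canRL (@opprK _)) ->.
have dR : ratr (g 1 1) = d%:~R :> C by rewrite ed ratr_int.
have dd : (d%:~R : C) * d%:~R = 1 by rewrite -intrM d1.2.
have jE : autj g z = d%:~R by rewrite /autj c0 rmorph0 mul0r add0r.
rewrite jE muln1 expr2 dd invr1 mul1r; apply: (@phi_shift _ _ (b * d)).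
rewrite mobiusE jE ea eb !ratr_int -d1.1.
have d0 : (d%:~R : C) != 0 by apply/eqP => d0; move: dd; rewrite d0 mul0r => /esym/eqP; rewrite oner_eq0.
have dV : (d%:~R : C)^-1 = d%:~R by apply: (mulIf d0); rewrite mulVf.
by rewrite dV intrM mulrDl mulrAC dd mul1r.
Qed.

(** Euclid's algorithm on the lower row (c, d): a translation followed by the inversion replaces the
    lower left entry by d mod c, until the matrix is triangular. *)
Lemma con_SL2Z g : SL2Z g -> con (@hphi R) g = @hphi R.
Proof.
move=> sg; have /intrP[c ec] := sg.1 1 0.
have [n] := ubnP `|c|%N; elim: n => // n IH in g sg c ec *; rewrite ltnS => cn.
have [c0|c0] := eqVneq c 0; first by apply: con_triangular; rewrite // ec c0.
have /intrP[d ed] := sg.1 1 1.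
pose q : int := (d %/ c)%Z; pose T := shiftg (- q)%:~R.
have sT : SL2Z T := SL2Z_shift _.
have sS := SL2Z_inversion; have sgTS := SL2Z_mulg (SL2Z_mulg sg sT) sS.
have e1 : (g * T * inversion)%g 1 0 = (d %% c)%Z%:~R.
  rewrite !GLQ_mulE !mxE /= ec ed /modz -/q rmorphB rmorphM rmorphN /=; ring.
have hP : con (@hphi R) (g * T * inversion)%g = @hphi R.
  apply: (IH _ sgTS _ e1); apply: leq_trans cn.
  by rewrite -ltz_nat gez0_abs ?modz_ge0//; exact: ltz_mod.
have hT : con (@hphi R) T = @hphi R by apply: con_triangular => //; rewrite mxE.
have -> : g = (g * T * inversion * inversion^-1 * T^-1)%g by rewrite !mulgK.
by apply: con_mul; [apply: con_mul => //; apply: con_inv; exact: con_inversion|exact: con_inv].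
Qed.

(** An adapted omega is determined by phi, and phi is invariant. *)
Lemma omega_SL2Z g : SL2Z g -> sl 2 (@homega R) g = @homega R.
Proof.
move=> sg; have h := adapted_con g (@hphi_adapted R); rewrite con_SL2Z// in h.
move: (@hphi_adapted R); rewrite /adapted -h => e.
have n2 : (2 : C) != 0 by rewrite pnatr_eq0.
apply: holfun_ext => z; have := congr1 (fun f : holfun R => f z) e.
rewrite !hfM (hfnat 2).
by move/(mulfI n2).
Qed.

End SL2.

(** * Modular forms *)

Section Growth.
Variable R : realType.
Local Notation C := R[i].
Local Notation t := (twopii R).
Local Notation A := (holfun R).
Local Notation D := (@hD R).
Implicit Types (a b : A) (g h : GLQ) (z : uhp R) (k : nat) (f : uhp R -> C).

Definition bd f := exists M B : R, forall z, M <= complex.Im (uhpval z) -> cabs (f z) <= B.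

Lemma bdP f : bounded_at_infinity f <-> bd f.
Proof.
by split=> -[M [B h]]; exists M, B => z /h; rewrite -cabsE lecR.
Qed.

Lemma bd_eq f (g : uhp R -> C) : (forall z, f z = g z) -> bd f -> bd g.
Proof. by move=> fg [M [B h]]; exists M, B => z; rewrite -fg; exact: h. Qed.

Lemma bd_cst (c : C) : bd (fun=> c).
Proof. by exists 0, (cabs c). Qed.

Lemma bd_add f (g : uhp R -> C) : bd f -> bd g -> bd (fun z => f z + g z).
Proof.
move=> [M [B h]] [M' [B' h']]; exists (Num.max M M'), (B + B') => z.
by rewrite ge_max => /andP[/h u /h' v]; apply: le_trans (cabsD _ _) _; exact: lerD.
Qed.

Lemma bd_mul f (g : uhp R -> C) : bd f -> bd g -> bd (fun z => f z * g z).
Proof.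
move=> [M [B h]] [M' [B' h']]; exists (Num.max M M'), (B * B') => z.
by rewrite ge_max => /andP[/h u /h' v]; rewrite cabsM ler_pM ?cabs_ge0.
Qed.

Lemma bd_hN a : bd a -> bd (- a).
Proof. by move=> /(bd_mul (bd_cst (- 1))); apply: bd_eq => z; rewrite hfN mulN1r. Qed.

Lemma bd_hM a b : bd a -> bd b -> bd (a * b).
Proof. exact: bd_mul. Qed.

(** Cauchy's estimate with radius 1; above height [|M| + 4] the disc of radius 2 stays in the
    half-plane and above height M. *)
Lemma bd_hD a : bd a -> bd (D a).
Proof.
move=> [M [B h]]; apply: bd_mul (bd_cst t^-1) _.
exists (`|M| + 4), (64 * B) => z hz; have M0 := ler_norm M; have M1 := normr_ge0 M.
have [] := @uhp_cauchy R a z 1 B ltr01 _ (@holfunP R a) _; rewrite ?divr1//; first lra.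
move=> w wz; apply: h; have := absIm_le (uhpval w - uhpval z); rewrite ImD ImN => e.
have := ler_norm (- (complex.Im (uhpval w) - complex.Im (uhpval z))); rewrite normrN; lra.
Qed.

(** For Im z >= 1 one has |q| <= exp (- pi), and the q-series is bounded by its majorant n^2
    rho^n. *)
Lemma bd_phi : bd (@hphi R).
Proof.
have p0 := pi_gt0 R; have n24 : (24 : C) != 0 by rewrite pnatr_eq0.
have n6 : (6 : C) != 0 by rewrite pnatr_eq0.
pose rho : R := expR (- pi); have r1 : rho < 1 by rewrite expR_lt1 oppr_lt0.
have r0 : 0 < rho := expR_gt0 _.
pose B : R := 2`!%:R * (1 - rho) ^- 3.
suff [M [B' h]] : bd (fun z => (1 - 6 * phi z) / 24).
  have := bd_mul (bd_cst 6^-1) (bd_add (bd_cst 1) (bd_mul (bd_cst (- 24)) (ex_intro _ M (ex_intro _ B' h)))).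
  by apply: bd_eq => z; rewrite /=; field.
exists 1, B => z hz; have h := phi_qseries z.
have q1 : cabs (nome z) <= rho.
  by rewrite cabs_nome ler_expR lerN2 mulrAC; have := ler_wpM2l (ltW p0) hz; lra.
have as1 : asum (fun n => (divsum 1 n)%:R * nome z ^+ n) B.
  apply: asum_nat => n; apply: le_trans (poly_geometric 2 n (_ : 0 <= rho < 1)); last by rewrite ltW.
  apply: ler_sum => k _; rewrite cabsM cabs_nat cabsX ler_pM ?exprn_ge0 ?cabs_ge0//.
    by rewrite ler_nat divsum_le.
  by rewrite lerXn2r// nnegrE ?cabs_ge0 ?(ltW r0).
by have [s hs sB] := asum_hsum as1; rewrite (hsum_unique h hs).
Qed.

(** For an upper triangular matrix c z + d is constant, and Im z is multiplied by the positive
    constant a / d. *)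
Lemma bd_triangular k f g : g 1 0 = 0 -> bd f -> bd (slash k f g).
Proof.
move=> c0 [M [B h]]; apply: (bd_mul (f := fun z => ratr (\det g) ^+ k * autj g z ^- (2 * k))).
  apply: bd_eq (bd_cst (ratr (\det g) ^+ k * ratr (g 1 1) ^- (2 * k))) => z.
  by rewrite /autj c0 rmorph0 mul0r add0r.
have ad : 0 < g 0 0 * g 1 1 by have := valP g; rewrite /= det_GLQ c0 mulr0 subr0.
have d0 : g 1 1 != 0 by apply/eqP => d0; move: ad; rewrite d0 mulr0 ltxx.
have ad' : 0 < g 0 0 / g 1 1.
  rewrite (_ : _ / _ = g 0 0 * g 1 1 / g 1 1 ^+ 2); last by field.
  by rewrite divr_gt0// exprn_even_gt0.
have r0 : 0 < ratr (g 0 0 / g 1 1) :> R by rewrite ltr0q.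
exists (M / ratr (g 0 0 / g 1 1)), B => z; rewrite ler_pdivrMr// => hz; apply: h.
rewrite mobiusE /autj c0 rmorph0 mul0r add0r mulrDl mulrAC -!fmorph_div /=.
by rewrite !ratrC ImD ImM /= mul0r !addr0 mulrC.
Qed.

End Growth.

(** * Congruence subgroups and rational matrices *)

Section RationalMatrices.
Implicit Types (g h : GLQ).

Lemma rat_denominator (x : rat) : exists2 d : nat, (0 < d)%N & d%:R * x \is a Num.int.
Proof.
exists `|denq x|%N; first by rewrite absz_gt0 denq_neq0.
by rewrite natr_absz gtr0_norm ?denq_gt0// mulrC -numqE intr_int.
Qed.

Lemma GLQ_denominator g : exists2 d : nat, (0 < d)%N & forall i j, d%:R * g i j \is a Num.int.
Proof.
have [d hd] : exists d : 'I_2 -> 'I_2 -> nat, forall i j, (0 < d i j)%N /\ (d i j)%:R * g i j \is a Num.int.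
  have /choice[d hd] (p : 'I_2 * 'I_2) : exists d : nat, (0 < d)%N /\ d%:R * g p.1 p.2 \is a Num.int.
    by have [d d0 hd] := rat_denominator (g p.1 p.2); exists d.
  by exists (fun i j => d (i, j)) => i j; exact: (hd (i, j)).
exists (\prod_i \prod_j d i j)%N => [|i j].
  by apply: prodn_gt0 => i; apply: prodn_gt0 => j; case: (hd i j).
rewrite (bigD1 i)//= (bigD1 j)//= -mulnA mulnC natrM -mulrA.
by rewrite rpredM ?rpred_nat//; case: (hd i j).
Qed.

Lemma principal_mul N M g : (0 < N)%N -> (0 < M)%N ->
  principal_congruence (N * M) g -> principal_congruence N g.
Proof.
move=> N0 M0 [sg h]; split=> // i j.
have m0 : (M%:R : rat) != 0 by rewrite pnatr_eq0 -lt0n.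
have n0 : (N%:R : rat) != 0 by rewrite pnatr_eq0 -lt0n.
rewrite (_ : _ / _ = (g i j - (i == j)%:R) / (N * M)%:R * M%:R).
  by rewrite rpredM ?rpred_nat.
by rewrite natrM; field; rewrite ?n0 ?m0.
Qed.

(** h g h^-1 - 1 = h (g - 1) h^-1; divisibility of g - 1 by N d e absorbs the denominators d of h
    and e of h^-1. *)
Lemma principal_conj h N : (0 < N)%N -> exists2 M, (0 < M)%N &
  forall g, principal_congruence M g -> principal_congruence N (h * g * h^-1)%g.
Proof.
move=> N0; have [d d0 hd] := GLQ_denominator h; have [e e0 he] := GLQ_denominator (h^-1)%g.
exists (N * d * e)%N; first by rewrite !muln_gt0 N0 d0.
move=> g [[ig dg] hg].
have n0 : (N%:R : rat) != 0 by rewrite pnatr_eq0 -lt0n.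
have d1 : (d%:R : rat) != 0 by rewrite pnatr_eq0 -lt0n.
have e1 : (e%:R : rat) != 0 by rewrite pnatr_eq0 -lt0n.
have H i j : ((h * g * h^-1)%g i j - (i == j)%:R) / N%:R \is a Num.int.
  have -> : (h * g * h^-1)%g i j - (i == j)%:R = ((h : 'M[rat]_2) *m ((g : 'M[rat]_2) - 1%:M) *m ((h^-1)%g : GLQ)) i j.
    rewrite mulmxBr mulmxBl mulmx1.
    have -> : (h : 'M[rat]_2) *m ((h^-1)%g : GLQ) = 1%:M by rewrite -[LHS]/(GLQval (h * h^-1)%g) mulgV.
    by rewrite [RHS]mxE [X in _ = _ + X]mxE [X in _ = _ - X]mxE.
  rewrite mxE mulr_suml; apply: rpred_sum => l _; rewrite [X in X * _ / _]mxE !mulr_suml.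
  apply: rpred_sum => k _; rewrite (mxE _ _ k l) (mxE _ _ k l).
  have -> : h i k * (g k l - (1%:M : 'M[rat]_2) k l) * (h^-1)%g l j / N%:R =
      (d%:R * h i k) * ((g k l - (1%:M : 'M[rat]_2) k l) / (N * d * e)%:R) * (e%:R * (h^-1)%g l j).
    by rewrite !natrM; field; rewrite n0 d1 e1.
  have hkl : (g k l - (1%:M : 'M[rat]_2) k l) / (N * d * e)%:R \is a Num.int by rewrite mxE; exact: hg.
  exact: rpredM (rpredM (hd _ _) hkl) (he _ _).
split=> //; split=> [i j|].
  have -> : (h * g * h^-1)%g i j = ((h * g * h^-1)%g i j - (i == j)%:R) / N%:R * N%:R + (i == j)%:R.
    by rewrite divfK// subrK.
  exact: rpredD (rpredM (H i j) (rpred_nat _ N)) (rpred_nat _ _).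
by rewrite !det_GLQM dg mulr1 -det_GLQM mulgV det1.
Qed.

(** By Bezout, the primitive integral vector on the line of the first column of g is sent to the
    first basis vector by a matrix of SL(2, Z). *)
Lemma triangular_decomposition g : exists c u : GLQ, [/\ SL2Z c, u 1 0 = 0 & g = (c * u)%g].
Proof.
pose a := g 0 0; pose c := g 1 0.
pose x := numq a * denq c; pose y := numq c * denq a.
pose e : rat := (denq a * denq c)%:~R.
have e0 : e != 0 by rewrite intr_eq0 mulf_neq0 ?denq_neq0.
have xE : x%:~R = a * e by rewrite rmorphM /= numqE /e rmorphM /=; ring.
have yE : y%:~R = c * e by rewrite rmorphM /= numqE /e rmorphM /=; ring.
have G0 : gcdz x y != 0.
  rewrite gcdz_eq0; apply/negP => /andP[/eqP x0 /eqP y0].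
  have a0 : a = 0 by apply: (mulIf e0); rewrite -xE x0 mul0r.
  have c0 : c = 0 by apply: (mulIf e0); rewrite -yE y0 mul0r.
  by have := valP g; rewrite /= det_GLQ -/a -/c a0 c0 mul0r mulr0 subrr ltxx.
have [p [q pq]] := Bezoutz x y.
have /dvdzP[x' xx] := dvdz_gcdl x y; have /dvdzP[y' yy] := dvdz_gcdr x y.
have pq1 : p * x' + q * y' = 1.
  by apply: (mulIf G0); rewrite mulrDl -!mulrA -xx -yy pq mul1r.
have dv : \det (mx2 p%:~R q%:~R (- y')%:~R x'%:~R) = 1.
  by rewrite det_mx2 -!rmorphM -rmorphB mulrN opprK pq1.
have dv0 : 0 < \det (mx2 p%:~R q%:~R (- y')%:~R x'%:~R) by rewrite dv.
pose v := gl2 dv0.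
have sv : SL2Z v by split=> // i j; rewrite mxE; case: ifP; case: ifP => _ _; exact: intr_int.
exists (v^-1)%g, (v * g)%g; split; first exact: SL2Z_invg.
  rewrite GLQ_mulE !mxE /= -/a -/c; apply: (mulIf e0).
  have z0 : - y' * x + x' * y = 0 by rewrite [X in - y' * X]xx [X in _ + x' * X]yy; ring.
  by rewrite mul0r mulrDl -!mulrA -xE -yE -!rmorphM -rmorphD z0.
by rewrite mulKg.
Qed.

End RationalMatrices.

(** * Stability of modular forms under products, X and the slash action *)

Section ModularClosure.
Variable R : realType.
Local Notation C := R[i].
Local Notation A := (holfun R).
Local Notation D := (@hD R).
Implicit Types (a b : A) (g h : GLQ) (k l : nat).

Definition mf k a : Prop :=
  (exists2 N, (0 < N)%N & forall g, principal_congruence N g -> sl k a g = a) /\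
  (forall g, SL2Z g -> bd (sl k a g)).

Lemma mfP k a : modular_form k a <-> mf k a.
Proof.
split=> [[_ [N N0 hN] hb]|[[N N0 hN] hb]].
  split; last by move=> g /hb/bdP.
  by exists N => // g /hN h; apply: val_inj.
split; first exact: holfunP.
  by exists N => // g /hN/(congr1 (@holval R)).
by move=> g /hb/bdP.
Qed.

Lemma principal_SL2Z N g : principal_congruence N g -> SL2Z g.
Proof. by case. Qed.

Lemma mf_level2 k a l b : mf k a -> mf l b -> exists2 N, (0 < N)%N &
  forall g, principal_congruence N g -> sl k a g = a /\ sl l b g = b.
Proof.
move=> [[N N0 hN] _] [[M M0 hM] _]; exists (N * M)%N; first by rewrite muln_gt0 N0.
move=> g hg; split; first by apply: hN; exact: principal_mul hg.
by apply: hM; rewrite mulnC in hg; exact: principal_mul hg.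
Qed.

Lemma mf_add k a b : mf k a -> mf k b -> mf k (a + b).
Proof.
move=> ha hb; split; last first.
  by move=> g sg; rewrite slD; apply: bd_add; [exact: ha.2|exact: hb.2].
have [N N0 hN] := mf_level2 ha hb; exists N => // g /hN[e1 e2].
by rewrite slD e1 e2.
Qed.

Lemma mf_mul k l a b : mf k a -> mf l b -> mf (k + l) (a * b).
Proof.
move=> ha hb; split; last first.
  by move=> g sg; rewrite slM; apply: bd_mul; [exact: ha.2|exact: hb.2].
have [N N0 hN] := mf_level2 ha hb; exists N => // g /hN[e1 e2].
by rewrite slM e1 e2.
Qed.

Lemma mf_cst k (c : C) a : mf k a -> mf k (hcst c * a).
Proof.
move=> [[N N0 hN] hb]; split; first by exists N => // g /hN e; rewrite sl_cst e.
by move=> g sg; rewrite sl_cst; apply: bd_mul (bd_cst c) _; exact: hb.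
Qed.

Lemma mf_zero k : mf k 0.
Proof.
split; first by exists 1%N => // g _; rewrite sl0.
by move=> g _; rewrite sl0; exact: bd_cst.
Qed.

Lemma mf_nat k n a : mf k a -> mf k (n%:R * a).
Proof. by rewrite -(rmorph_nat (@hcst R)); exact: mf_cst. Qed.

Lemma mf_opp k a : mf k a -> mf k (- a).
Proof. by move=> /(mf_cst (-1)); rewrite rmorphN1 mulN1r. Qed.

(** Invariance of phi under SL(2, Z) makes X commute with its slash action; boundedness at the cusps
    then follows from that of phi and of derivatives. *)
Lemma mf_X k a : mf k a -> mf k.+1 (D a - @hphi R * (k%:R * a)).
Proof.
have H g : SL2Z g -> sl k.+1 (D a - @hphi R * (k%:R * a)) g = D (sl k a g) - @hphi R * (k%:R * sl k a g).
  move=> sg; rewrite slB hD_sl (slM 1 k) sl_nat.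
  have e := con_SL2Z R sg; rewrite -{2}e /con natrM; ring.
move=> [[N N0 hN] hb]; split.
  by exists N => // g hg; rewrite (H _ (principal_SL2Z hg)) hN.
move=> g sg; rewrite H//; apply: bd_add; first by apply: bd_hD; exact: hb.
apply: bd_hN; apply: bd_hM (@bd_phi R) _; apply: bd_hM; last exact: hb.
by apply: bd_eq (bd_cst k%:R) => z; rewrite hfnat.
Qed.

(** For the level, a conjugate of a deeper principal subgroup lies in the given one. For the cusps,
    g h is an element of SL(2, Z) times a triangular matrix, which preserves boundedness. *)
Lemma mf_sl k a g : mf k a -> mf k (sl k a g).
Proof.
move=> [[N N0 hN] hb]; split.
  have [M M0 hM] := principal_conj g N0; exists M => // h /hM/hN e.
  by rewrite sl_mul -{2}e sl_mul mulgVK.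
move=> h sh; rewrite sl_mul; have [c [u [sc u0 ->]]] := triangular_decomposition (g * h)%g.
by rewrite -sl_mul; apply: bd_triangular => //; exact: hb.
Qed.

(** The form mu_g, seen as the variation of the connection phi under g. *)
Definition hmu g : A := con (@hphi R) g - @hphi R.

Lemma adapted_at (phi om : A) : adapted D phi om ->
  forall z, 2 * om z = phi z * phi z - 2 * D phi z.
Proof.
move=> h z; have := congr1 (fun f : A => f z) h.
by rewrite expr2 hfD hfN !hfM (hfnat 2).
Qed.

Lemma mf_omega : mf 2 (@homega R).
Proof.
split; first by exists 1%N => // g /principal_SL2Z; exact: omega_SL2Z.
move=> g sg; rewrite omega_SL2Z//.
have := bd_mul (bd_cst 2^-1) (bd_add (bd_mul (@bd_phi R) (@bd_phi R)) (bd_mul (bd_cst (-2)) (bd_hD (@bd_phi R)))).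
apply: bd_eq => z; have n2 : (2 : C) != 0 by rewrite pnatr_eq0.
have e := adapted_at (@hphi_adapted R) z.
by apply: (mulfI n2); rewrite e mulVKf// mulNr.
Qed.

End ModularClosure.

(** * The modular Hecke algebra *)

Section Cosets.
Variable Gamma : set GLQ.
Hypothesis hG : congruence_subgroup Gamma.
Implicit Types (g h k s : GLQ) (P Q : set GLQ).
Local Notation co := (Gcoset Gamma).

Let G1 : Gamma 1%g. Proof. by case: hG. Qed.
Let GM g h : Gamma g -> Gamma h -> Gamma (g * h)%g. Proof. by case: hG => _ _ + _ _; apply. Qed.
Let GV g : Gamma g -> Gamma (g^-1)%g. Proof. by case: hG => _ _ _ + _; apply. Qed.

Definition rep (c : set GLQ) : GLQ := xget 1%g c.
Definition finsupp P := finite_set (co @` P).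
Definition cosets P : seq (set GLQ) := finmap.enum_fset (fset_set (co @` P)).
Definition linv (T : Type) (F : GLQ -> T) := forall g h, Gamma g -> F (g * h)%g = F h.

Lemma coset_mul g h : Gamma g -> co (g * h)%g = co h.
Proof.
move=> Gg; apply/seteqP; split=> x [k Gk <-].
  by exists (k * g)%g; [exact: GM|rewrite mulgA].
by exists (k * g^-1)%g; [apply: GM => //; exact: GV|rewrite mulgA mulgVK].
Qed.

Lemma coset_self h : co h h.
Proof. by exists 1%g => //; rewrite mul1g. Qed.

Lemma coset_eq g h : co g = co h -> exists2 k, Gamma k & g = (k * h)%g.
Proof.
move=> e; have : co h g by rewrite -e; exact: coset_self.
by case=> k Gk <-; exists k.
Qed.

Lemma rep_coset h : exists2 g, Gamma g & rep (co h) = (g * h)%g.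
Proof.
have : co h (rep (co h)) by apply: xgetPex; exists h; exact: coset_self.
by case=> g Gg <-; exists g.
Qed.

Lemma coset_rep h : co (rep (co h)) = co h.
Proof. by have [g Gg ->] := rep_coset h; exact: coset_mul. Qed.

Lemma finsuppS P Q : Q `<=` P -> finsupp P -> finsupp Q.
Proof. by move=> QP; apply: sub_finite_set; exact: image_subset. Qed.

Section Sums.
Variable V : nmodType.
Implicit Types F : GLQ -> V.

Definition cosum F : V := \sum_(c \in range co) F (rep c).

(** Any finite set of cosets that carries the support may be used, so several sums can share one
    list of indices. *)
Lemma cosumE P F : finsupp P -> (forall h, F h != 0 -> P h) ->
  cosum F = \sum_(c <- cosets P) F (rep c).
Proof.
move=> fP FP; rewrite -fsbig_finite//; apply/esym/fsbig_widen => [c [h _ <-]|c [[h _ <-] nP]].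
  by exists h.
apply/eqP; apply: contra_notT nP => /FP hP; exists (rep (co h)) => //.
exact: coset_rep.
Qed.

Lemma cosum_ext F F' : (forall h, F h = F' h) -> cosum F = cosum F'.
Proof. by move=> FF'; apply: eq_fsbigr => c _; exact: FF'. Qed.

(** Right translation permutes the cosets, and left invariance makes the choice of representatives
    irrelevant. *)
Lemma cosum_reindex F s : linv F -> cosum (fun r => F (r * s)%g) = cosum F.
Proof.
move=> lF; rewrite [RHS](reindex_fsbig (fun c => co (rep c * s)%g) (range co)); last first.
  split=> [c _|c c' /set_mem[h _ <-] /set_mem[h' _ <-] /coset_eq[k Gk e]|c [h _ <-]].
  - by exists (rep c * s)%g.
  - move: e; rewrite mulgA => /mulIg e.
    by rewrite -(coset_rep h) e coset_mul// coset_rep.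
  exists (co (h * s^-1)%g); first by exists (h * s^-1)%g.
  have [g Gg ->] := rep_coset (h * s^-1)%g.
  by rewrite -mulgA mulgVK coset_mul.
apply: eq_fsbigr => c _; have [g Gg ->] := rep_coset (rep c * s)%g.
by rewrite (lF g).
Qed.

Lemma cosum_exchange P Q (K : GLQ -> GLQ -> V) : finsupp P -> finsupp Q ->
  (forall s r, K s r != 0 -> P s /\ Q r) ->
  cosum (fun s => cosum (K s)) = cosum (fun r => cosum (fun s => K s r)).
Proof.
move=> fP fQ KPQ.
have E1 s : cosum (K s) = \sum_(c <- cosets Q) K s (rep c).
  by apply: cosumE => // r /KPQ[].
have E2 r : cosum (fun s => K s r) = \sum_(c <- cosets P) K (rep c) r.
  by apply: cosumE => // s /KPQ[].
have nz (I : eqType) (l : seq I) (f : I -> V) : \sum_(i <- l) f i != 0 -> exists i, f i != 0.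
  move=> h; apply: contrapT => /forallNP nf; move/negP: h; apply; apply/eqP.
  by apply: big1 => i _; apply/eqP; apply: contra_notT (nf i).
rewrite (@cosumE P); [|by []|by move=> s; rewrite E1 => /nz[c /KPQ[]]].
rewrite (@cosumE Q _ fQ); last by move=> r; rewrite E2 => /nz[c /KPQ[]].
under eq_bigr do rewrite E1; under [RHS]eq_bigr do rewrite E2.
exact: exchange_big.
Qed.

Lemma cosum_sum (n : nat) P (F : 'I_n -> GLQ -> V) : finsupp P ->
  (forall i h, F i h != 0 -> P h) ->
  cosum (fun h => \sum_(i < n) F i h) = \sum_(i < n) cosum (F i).
Proof.
move=> fP FP; rewrite (@cosumE P _ fP).
  by rewrite exchange_big /=; apply: eq_bigr => i _; rewrite (@cosumE P _ fP)// => h; exact: FP.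
move=> h nz; apply: contrapT => nP; move/negP: nz; apply; apply/eqP.
by apply: big1 => i _; apply/eqP; apply: contra_notT nP; exact: FP.
Qed.

End Sums.

Lemma cosum_morph (V W : nmodType) (f : V -> W) P (F : GLQ -> V) : f 0 = 0 ->
  (forall x y, f (x + y) = f x + f y) -> finsupp P -> (forall h, F h != 0 -> P h) ->
  f (cosum F) = cosum (fun h => f (F h)).
Proof.
move=> f0 fD fP FP; rewrite !(@cosumE _ P)//; last first.
  by move=> h nz; apply: FP; apply: contra_neq nz => ->.
exact: (big_morph f fD f0).
Qed.

Lemma cosum_neq0 (V : nmodType) (F : GLQ -> V) : cosum F != 0 -> exists h, F h != 0.
Proof.
move=> h; apply: contrapT => /forallNP nf; move/negP: h; apply; apply/eqP.
by apply: fsbig1 => c _; apply/eqP; apply: contra_notT (nf (rep c)).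
Qed.

End Cosets.

(** * Convolution built on a slash-equivariant bilinear product *)

Section Convolution.
Variables (R : realType) (Gamma : set GLQ).
Hypothesis hG : congruence_subgroup Gamma.
Local Notation A := (holfun R).
Local Notation P := {poly A}.
Local Notation co := (Gcoset Gamma).
Implicit Types (a b c : GLQ -> P) (p q : P) (g h : GLQ) (M : P -> P -> P).

Let GSL g : Gamma g -> SL2Z g. Proof. by case: hG => + _ _ _ _; apply. Qed.
Let G1 : Gamma 1%g. Proof. by case: hG. Qed.
Let GV g : Gamma g -> Gamma (g^-1)%g. Proof. by case: hG => _ _ _ + _; apply. Qed.

Definition modp p := forall k, mf k p`_k.

(* hecke_algebra, with holomorphic functions as coefficients so that D is defined on them *)
Record heckep a : Prop := Heckep {
  hk_mod : forall h, modp (a h);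
  hk_left : forall g h, Gamma g -> a (g * h)%g = a h;
  hk_right : forall g h, Gamma g -> a (h * g)%g = slA (a h) g;
  hk_supp : finsupp Gamma [set h | a h != 0] }.

(** What makes [conv] preserve the Hecke algebra; the pointwise product and all the brackets are
    instances. *)
Record bilinear_slash M : Prop := BilinearSlash {
  bs_Dl : forall p p' q, M (p + p') q = M p q + M p' q;
  bs_Dr : forall p q q', M p (q + q') = M p q + M p q';
  bs_slash : forall p q g, slA (M p q) g = M (slA p g) (slA q g);
  bs_mod : forall p q, modp p -> modp q -> modp (M p q) }.

Lemma bs_0l M q : bilinear_slash M -> M 0 q = 0.
Proof. by case=> Dl _ _ _; apply: (addrI (M 0 q)); rewrite -Dl !addr0. Qed.

Lemma bs_0r M p : bilinear_slash M -> M p 0 = 0.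
Proof. by case=> _ Dr _ _; apply: (addrI (M p 0)); rewrite -Dr !addr0. Qed.

Lemma modp0 : modp 0. Proof. by move=> k; rewrite coef0; exact: mf_zero. Qed.

Lemma modpD p q : modp p -> modp q -> modp (p + q).
Proof. by move=> hp hq k; rewrite coefD; exact: mf_add. Qed.

Lemma modp_sum (I : Type) (r : seq I) (F : I -> P) :
  (forall i, modp (F i)) -> modp (\sum_(i <- r) F i).
Proof. by move=> h; apply: big_ind => //; [exact: modp0|exact: modpD]. Qed.

Lemma modpN p : modp p -> modp (- p).
Proof. by move=> hp k; rewrite coefN; exact: mf_opp. Qed.

Lemma modpZ (x : R[i]) p : modp p -> modp (hcst x *: p).
Proof. by move=> hp k; rewrite coefZ; exact: mf_cst. Qed.

Lemma modpM p q : modp p -> modp q -> modp (p * q).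
Proof.
move=> hp hq k; rewrite coefM; apply: big_ind => [|x y|j _].
- exact: mf_zero.
- exact: mf_add.
by have := mf_mul (hp j) (hq (k - j)%N); rewrite subnKC// -ltnS.
Qed.

Lemma modp_monomial f k : mf k f -> modp (f *: 'X^k).
Proof.
move=> hf i; rewrite coefZ coefXn; case: eqP => [->|_]; first by rewrite mulr1.
by rewrite mulr0; exact: mf_zero.
Qed.

Lemma modp_slA p g : modp p -> modp (slA p g).
Proof. by move=> hp k; rewrite coef_slA; exact: mf_sl. Qed.

Lemma modp_Yp p : modp p -> modp (Yp p).
Proof. by move=> hp k; rewrite coef_Yp; exact: mf_nat. Qed.

Lemma modp_Xp p : modp p -> modp (Xp (@hD R) (@hphi R) p).
Proof.
move=> hp [|k]; first by rewrite /Xp coefXM; exact: mf_zero.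
by rewrite coef_Xp; exact: mf_X.
Qed.

Local Notation opb := (opBp (@hD R) (@hcst R)).

Lemma modp_opBp n p : modp p -> modp (opb (@hphi R) (@homega R) n p).
Proof.
move=> hp; suff [] : modp (opb (@hphi R) (@homega R) n p) /\ modp (opb (@hphi R) (@homega R) n.+1 p) by [].
elim: n => [|n [IH1 IH2]]; first by split=> //=; rewrite subr0; exact: modp_Xp.
split=> //; rewrite -[X in modp X]/(Xp (@hD R) (@hphi R) (opb (@hphi R) (@homega R) n.+1 p) - hcst n.+1%:R *:
    ((@homega R *: 'X^2) * (Yp (opb (@hphi R) (@homega R) n p) - hcst (n%:R / 2) *: opb (@hphi R) (@homega R) n p))).
apply: modpD; first exact: modp_Xp.
apply: modpN; apply: modpZ; apply: modpM; first exact: modp_monomial (@mf_omega R).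
by apply: modpD; [exact: modp_Yp|apply: modpN; exact: modpZ].
Qed.

Lemma modp_pochp (d m : nat) p : modp p -> modp (pochp (@hcst R) d m p).
Proof.
by move=> hp; elim: m => [|m IH] //=; apply: modpD; apply: modpZ => //; exact: modp_Yp.
Qed.

Lemma modp_sign n p : modp p -> modp ((-1) ^+ n *: p).
Proof. by rewrite -signr_odd; case: odd; rewrite ?expr1 ?expr0 ?scaleN1r ?scale1r //; exact: modpN. Qed.

Lemma rc_bilinear n : bilinear_slash (rc (@hphi R) (@homega R) n).
Proof.
split=> [p p' q|p q q'|p q g|p q hp hq].
- exact: (rcpDl (@hD_derivation R)).
- exact: (rcpDr (@hD_derivation R)).
- exact: rc_slash (@hphi_adapted R).
apply: modp_sum => i; apply: modpM.
  by apply: modpZ; apply: modp_sign; apply: modp_opBp; exact: modp_pochp.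
by apply: modpZ; apply: modp_opBp; exact: modp_pochp.
Qed.

Definition conv M a b h : P := cosum Gamma (fun r => M (a r) (slA (b (h * r^-1)%g) r)).

Lemma slA_eq0 p g : (slA p g == 0) = (p == 0).
Proof.
apply/eqP/eqP => [h|->]; last exact: slA0.
by rewrite -[p](slA_one) -(mulgV g) -slA_mul h slA0.
Qed.

(** Every coset in question is that of [rep d * rep c] with c and d in the two finite supports;
    right equivariance of [b] absorbs the change of representative of s. *)
Lemma finsupp_prod a b : heckep a -> heckep b ->
  finsupp Gamma [set u | exists2 s, a s != 0 & b (u * s^-1)%g != 0].
Proof.
move=> ha hb; have fa := hk_supp ha; have fb := hk_supp hb.
pose f (c d : set GLQ) := co (rep d * rep c)%g.
apply: (@sub_finite_set _ _ (\bigcup_(c in co @` [set h | a h != 0])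
   (f c @` (co @` [set h | b h != 0])))); last first.
  by apply: bigcup_finite => // c _; exact: finite_image.
move=> _ [u [s as0 bu0] <-]; exists (co s); first by exists s.
have [g Gg eg] := rep_coset hG s.
have bug : b (u * s^-1 * g^-1)%g != 0.
  by rewrite (hk_right hb) ?slA_eq0//; exact: GV.
exists (co (u * s^-1 * g^-1)%g); first by exists (u * s^-1 * g^-1)%g.
have [k Gk ek] := rep_coset hG (u * s^-1 * g^-1)%g.
by rewrite /f eg ek -!mulgA mulKg mulVg mulg1 coset_mul.
Qed.

(** Passing from r to g r translates the argument of [b] by g^-1 on the right, which the slash by g
    r undoes. *)
Lemma conv_linv M a b h : heckep a -> heckep b ->
  linv Gamma (fun r => M (a r) (slA (b (h * r^-1)%g) r)).
Proof.
move=> ha hb g r Gg; rewrite (hk_left ha)//; congr (M _ _).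
by rewrite invgM mulgA (hk_right hb _ (GV Gg)) slA_mul mulKg.
Qed.

Lemma conv_supp M a b h r : bilinear_slash M ->
  M (a r) (slA (b (h * r^-1)%g) r) != 0 -> a r != 0 /\ b (h * r^-1)%g != 0.
Proof.
move=> hM nz; split; apply: contra_neq nz => ->; first exact: bs_0l.
by rewrite slA0; exact: bs_0r.
Qed.

Lemma heckep_conv M a b : bilinear_slash M -> heckep a -> heckep b -> heckep (conv M a b).
Proof.
move=> hM ha hb.
have sup h r : M (a r) (slA (b (h * r^-1)%g) r) != 0 -> [set h | a h != 0] r.
  by move=> /(conv_supp hM)[].
split=> [h|g h Gg|g h Gg|].
- rewrite /conv (cosumE hG (hk_supp ha) (sup h)); apply: modp_sum => d.
  by apply: (bs_mod hM); [exact: hk_mod ha _|apply: modp_slA; exact: hk_mod hb _].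
- by apply: cosum_ext => r; rewrite -mulgA (hk_left hb _ Gg).
(* Substituting r g for r makes g act on both arguments, from where equivariance takes it out of the
   sum. *)
- rewrite /conv -(cosum_reindex hG g (conv_linv M (h * g)%g ha hb)).
  rewrite (cosum_morph hG (f := fun p => slA p g) (slA0 _ g) (fun p q => slAD p q g) (hk_supp ha) (sup h)).
  apply: cosum_ext => r; rewrite (bs_slash hM) (hk_right ha)// slA_mul; congr (M _ (slA (b _) _)).
  by rewrite invgM mulgA mulgK.
apply: finsuppS (finsupp_prod ha hb) => h /= /cosum_neq0[r] /(conv_supp hM)[ar br].
by exists r.
Qed.

Definition arc n a b := conv (rc (@hphi R) (@homega R) n) a b.

Lemma heckep_arc n a b : heckep a -> heckep b -> heckep (arc n a b).
Proof. exact: heckep_conv (rc_bilinear n). Qed.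

(** Both sides become sums over pairs (s, r) with the same three arguments a_s, b_(r s^-1) | s and
    c_(h r^-1) | r, to which the classical associativity applies. On the right this takes the
    substitution r = u s and the equivariance of the inner bracket, which is slashed by s. *)
Lemma arc_assoc N a b c h : heckep a -> heckep b -> heckep c ->
  \sum_(i < N.+1) arc (N - i) (arc i a b) c h = \sum_(i < N.+1) arc (N - i) a (arc i b c) h.
Proof.
move=> ha hb hc.
pose B n := rc (@hphi R) (@homega R) n.
have hB n : bilinear_slash (B n) := rc_bilinear n.
pose Pa : set GLQ := [set s | a s != 0].
pose Q : set GLQ := [set u | exists2 s, a s != 0 & b (u * s^-1)%g != 0].
have fP : finsupp Gamma Pa := hk_supp ha; have fQ : finsupp Gamma Q := finsupp_prod ha hb.
pose K (i : nat) s r := B (N - i)%N (B i (a s) (slA (b (r * s^-1)%g) s)) (slA (c (h * r^-1)%g) r).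
pose K' (i : nat) s r := B (N - i)%N (a s) (B i (slA (b (r * s^-1)%g) s) (slA (c (h * r^-1)%g) r)).
have K0 i s r : K i s r != 0 -> Pa s /\ Q r.
  move=> nz; have as0 : a s != 0.
    by apply: contra_neq nz => e; rewrite /K e (bs_0l _ (hB _)) (bs_0l _ (hB _)).
  split=> //; exists s => //; apply: contra_neq nz => e.
  by rewrite /K e slA0 (bs_0r _ (hB _)) (bs_0l _ (hB _)).
have K0' i s r : K' i s r != 0 -> Pa s /\ Q r.
  move=> nz; have as0 : a s != 0.
    by apply: contra_neq nz => e; rewrite /K' e (bs_0l _ (hB _)).
  split=> //; exists s => //; apply: contra_neq nz => e.
  by rewrite /K' e slA0 (bs_0l _ (hB _)) (bs_0r _ (hB _)).
have KK s r : \sum_(i < N.+1) K i s r = \sum_(i < N.+1) K' i s r.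
  exact: rc_assoc (@hphi_adapted R).
have L (i : 'I_N.+1) : arc (N - i) (arc i a b) c h = cosum Gamma (fun r => cosum Gamma (fun s => K i s r)).
  apply: cosum_ext => r; rewrite [arc i a b r]/arc /conv -!/(B _).
  rewrite (cosum_morph hG (f := fun p => B (N - i)%N p (slA (c (h * r^-1)%g) r)) (P := Pa)) //.
  - exact: bs_0l (hB _).
  - by move=> x y; exact: (bs_Dl (hB _)).
  by move=> s /(conv_supp (hB i))[].
have Rr (i : 'I_N.+1) : arc (N - i) a (arc i b c) h = cosum Gamma (fun s => cosum Gamma (K' i s)).
  apply: cosum_ext => s; rewrite [arc i b c _]/arc /conv -!/(B _).
  rewrite (cosum_morph hG (f := fun p => B (N - i)%N (a s) (slA p s)) (P := [set u | b u != 0])) //.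
  - have lin : linv Gamma (K' i s).
      move=> g r Gg; rewrite /K' -mulgA (hk_left hb)//; congr (B _ _ (B _ _ _)).
      by rewrite invgM mulgA (hk_right hc _ (GV Gg)) slA_mul mulKg.
    rewrite -(cosum_reindex hG s lin); apply: cosum_ext => u.
    by rewrite /K' mulgK (bs_slash (hB _)) slA_mul invgM mulgA.
  - by rewrite slA0; exact: bs_0r (hB _).
  - by move=> x y; rewrite slAD; exact: (bs_Dr (hB _)).
  - exact: hk_supp hb.
  by move=> u /(conv_supp (hB i))[].
rewrite (eq_bigr _ (fun i _ => L i)) (eq_bigr _ (fun i _ => Rr i)).
have ex (i : 'I_N.+1) : cosum Gamma (fun r => cosum Gamma (fun s => K i s r)) = cosum Gamma (fun s => cosum
    Gamma (K i s)).
  by apply/esym; apply: (cosum_exchange hG fP fQ) => s r; exact: K0.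
rewrite (eq_bigr _ (fun i _ => ex i)).
have cs (T : nat -> GLQ -> GLQ -> P) : (forall i s r, T i s r != 0 -> Pa s /\ Q r) ->
    \sum_(i < N.+1) cosum Gamma (fun s => cosum Gamma (T i s)) =
    cosum Gamma (fun s => cosum Gamma (fun r => \sum_(i < N.+1) T i s r)).
  move=> hT; rewrite -(cosum_sum hG (F := fun (i : 'I_N.+1) s => cosum Gamma (T i s)) fP).
    by apply: cosum_ext => s; rewrite (cosum_sum hG (F := fun (i : 'I_N.+1) r => T i s r) fQ)// => i r /hT[].
  by move=> i s /cosum_neq0[r /hT[]].
rewrite !cs//; apply: cosum_ext => s; apply: cosum_ext => r; exact: KK.
Qed.

End Convolution.

(** * Iterated Cauchy products *)

Section CauchySums.
Variable V : nmodType.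

(* the coefficient of t^N in the product of two power series *)
Definition cs (N : nat) (u : nat -> nat -> V) : V := \sum_(i < N.+1) u i (N - i)%N.

Lemma cs_ext N u v : (forall i j, u i j = v i j) -> cs N u = cs N v.
Proof. by move=> uv; apply: eq_bigr => i _. Qed.

Lemma csC N u : cs N u = cs N (fun i j => u j i).
Proof.
rewrite /cs (reindex_inj rev_ord_inj) /=; apply: eq_bigr => i _.
by rewrite subSS subKn// -ltnS.
Qed.

Lemma csS N u : cs N.+1 u = u 0%N N.+1 + cs N (fun i j => u i.+1 j).
Proof. by rewrite /cs big_ord_recl /= subn0. Qed.

Lemma csA N (f : nat -> nat -> nat -> V) :
  cs N (fun n s => cs s (f n)) = cs N (fun s j => cs s (fun n i => f n i j)).
Proof.
elim: N f => [|N IH] f; first by rewrite /cs !big_ord_recl !big_ord0 !addr0.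
rewrite csS (IH (fun n i j => f n.+1 i j)) [RHS]csS.
rewrite [X in _ = _ + X](_ : _ = cs N (fun s j => f 0%N s.+1 j) + cs N (fun s j => cs s (fun n i => f n.+1 i
    j))); last first.
  rewrite [RHS](_ : _ = cs N (fun s j => f 0%N s.+1 j + cs s (fun n i => f n.+1 i j))); last by rewrite /cs -big_split.
  by apply: cs_ext => i j; exact: csS.
by rewrite csS addrA; congr (_ + _ + _); rewrite /cs big_ord1.
Qed.

Lemma cs_exchange N M (f : nat -> nat -> nat -> nat -> V) :
  cs N (fun i j => cs M (f i j)) = cs M (fun k l => cs N (fun i j => f i j k l)).
Proof. exact: exchange_big. Qed.

(** The left side has the index pattern of (a * b) * c. On the right the orders m, n of the two
    brackets are summed innermost with fixed total M and fixed i, j, k, the form in which bracket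
    associativity is stated. *)
Lemma cs_five N (T : nat -> nat -> nat -> nat -> nat -> V) :
  cs N (fun m r => cs r (fun s k => cs s (fun n x => cs x (fun i j => T m n i j k)))) =
  cs N (fun M s => cs s (fun i y => cs y (fun j k => cs M (fun m n => T m n i j k)))).
Proof.
transitivity (cs N (fun m r => cs r (fun n s => cs s (fun i y => cs y (fun j k => T m n i j k))))).
  apply: cs_ext => m r; rewrite -(csA r (fun n x k => cs x (fun i j => T m n i j k))).
  by apply: cs_ext => n s; rewrite -csA.
rewrite (csA N (fun m n s => cs s (fun i y => cs y (fun j k => T m n i j k)))).
apply: cs_ext => M s; rewrite cs_exchange; apply: cs_ext => i y.
by rewrite cs_exchange.
Qed.

(** The same regrouping for the index pattern of a * (b * c). *)
Lemma cs_five' N (T : nat -> nat -> nat -> nat -> nat -> V) :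
  cs N (fun m r => cs r (fun i s => cs s (fun n y => cs y (fun j k => T m n i j k)))) =
  cs N (fun M s => cs s (fun i y => cs y (fun j k => cs M (fun m n => T m n i j k)))).
Proof.
transitivity (cs N (fun m r => cs r (fun n s => cs s (fun i y => cs y (fun j k => T m n i j k))))).
  apply: cs_ext => m r; rewrite (csA r (fun i n y => cs y (fun j k => T m n i j k))).
  rewrite (csA r (fun n i y => cs y (fun j k => T m n i j k))).
  by apply: cs_ext => s y; rewrite csC.
rewrite (csA N (fun m n s => cs s (fun i y => cs y (fun j k => T m n i j k)))).
apply: cs_ext => M s; rewrite cs_exchange; apply: cs_ext => i y.
by rewrite cs_exchange.
Qed.

End CauchySums.

(** * Passage between arbitrary and holomorphic coefficients *)

Section Bridge.
Variable R : realType.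
Local Notation C := R[i].
Local Notation A := (holfun R).
Local Notation P := {poly A}.
Local Notation D := (@hD R).
Local Notation t := (twopii R).
Implicit Types (p q : P) (g h : GLQ) (z : uhp R).

Definition iota p : {poly (uhp R -> C)} := map_poly (\val : A -> (uhp R -> C)) p.

Lemma coef_iota p k : (iota p)`_k = p`_k.
Proof. by rewrite /iota coef_map. Qed.

Lemma iota_inj : injective iota.
Proof.
move=> p q pq; apply/polyP => k; apply: val_inj.
by have := congr1 (fun r : {poly _} => r`_k) pq; rewrite !coef_iota.
Qed.

Lemma iotaD p q : iota (p + q) = iota p + iota q. Proof. exact: rmorphD. Qed.
Lemma iotaN p : iota (- p) = - iota p. Proof. exact: rmorphN. Qed.
Lemma iotaM p q : iota (p * q) = iota p * iota q. Proof. exact: rmorphM. Qed.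
Lemma iota0 : iota 0 = 0. Proof. exact: rmorph0. Qed.

Lemma iota_sum (I : Type) (r : seq I) (F : I -> P) :
  iota (\sum_(i <- r) F i) = \sum_(i <- r) iota (F i).
Proof. exact: rmorph_sum. Qed.

Lemma iota_cst (x : C) p : iota (hcst x *: p) = cst x *: iota p.
Proof. by apply/polyP => k; rewrite coefZ !coef_iota coefZ. Qed.

Lemma slash_zero k g : slash k (0 : uhp R -> C) g = 0.
Proof. by apply/funext => z; rewrite /slash mulr0. Qed.

Lemma slashp_iota p g : slashp (iota p) g = iota (slA p g).
Proof.
apply/polyP => k; rewrite coef_iota coef_slA coef_poly coef_iota.
by case: ltnP => // /(nth_default 0); rewrite coef_iota => e; rewrite /= e slash_zero.
Qed.

Lemma val_natM k (a : A) : \val (k%:R * a) = k%:R * \val a.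
Proof. by apply/funext => z; rewrite [LHS](hfM (k%:R) a z) hfnat; congr (_ * _); elim: k => // k IH; rewrite
    !mulrS IH. Qed.

Lemma coef_Yf (f : {poly (uhp R -> C)}) k : (Yf f)`_k = k%:R * f`_k.
Proof. by rewrite coef_poly; case: ltnP => // /(nth_default 0) ->; rewrite mulr0. Qed.

Lemma Yf_iota p : Yf (iota p) = iota (Yp p).
Proof.
apply/polyP => k; rewrite coef_Yf.
transitivity (\val (k%:R * p`_k)); last by rewrite coef_iota coef_Yp.
by rewrite val_natM coef_iota.
Qed.

Lemma Xk_val k (a : A) : Xk k a = \val (D a - @hphi R * (k%:R * a)).
Proof.
apply/funext => z; transitivity ((D a - @hphi R * (k%:R * a)) z); last by [].
rewrite hfD hfN !hfM hfnat /Xk /= /phi.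
by rewrite mulrBr !mulrA.
Qed.

Lemma Xf_iota p : Xf (iota p) = iota (Xp D (@hphi R) p).
Proof.
apply/polyP => -[|k]; first by rewrite coef_iota /Xf /Xp !coefXM.
rewrite coef_iota coef_Xp /Xf coefXM coef_poly coef_iota -Xk_val.
rewrite /=; case: ltnP => // /(nth_default 0); rewrite coef_iota => e.
have -> : p`_k = 0 by apply: val_inj.
by rewrite Xk_val (derivation0 (@hD_derivation R)) !mulr0 subr0.
Qed.

(** The logarithmic derivative of a quotient is a difference, and [der_slash] in weight 2 turns that
    of eta^4 | g into [con phi g]. *)
Lemma mu_val g : mu g = \val (hmu R g).
Proof.
apply/funext => z; transitivity (hmu R g z); last by [].
rewrite /hmu /con !hfD !hfN hfM (hfnat 2) slE.
have e0 := @eta4_neq0 R; have t0 := twopii_neq0 R.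
have du := der_slash 1 (cderivP (mobius g z) (@hol_eta4 R)).
have u0 : slash 1 (@eta4 R) g z != 0.
  have d0 := ratr_det_neq0 R g; have j0 := autj_neq0 g z.
  by apply: mulf_neq0 => //; apply: mulf_neq0; rewrite ?invr_neq0// expf_neq0.
have dq := der_div (e0 z) du (cderivP z (@hol_eta4 R)).
rewrite /mu /dlog (cderivE dq) /= /phi /dlog /slash /=.
have d0 := ratr_det_neq0 R g; have j0 := autj_neq0 g z; have v0 := e0 (mobius g z); have w0 := e0 z.
rewrite (_ : (2 * 2)%N = 4%N) // (_ : (2 * 1)%N = 2%N) //.
move: (ratr (\det g)) (autj g z) t (hcj g z) (eta4 z) (eta4 (mobius g z)) d0 j0 t0 v0 w0.
move: (cderiv _ z) (cderiv _ (mobius g z)) => x y d j u c v w d0 j0 u0' v0 w0.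
by field; rewrite d0 j0 u0' v0 w0.
Qed.

Lemma modular_iota p : modular (iota p) <-> modp p.
Proof.
by split=> h k; have := h k; rewrite coef_iota => /mfP.
Qed.

Lemma modular_lift (f : {poly (uhp R -> C)}) : modular f -> exists2 p, f = iota p & modp p.
Proof.
(* The default 0 of [insubd] is never reached on the coefficients of [f], which are holomorphic. *)
move=> hf; pose i0 : (uhp R -> C) -> A := insubd (0 : A).
have i00 : i0 0 = 0 by apply: val_inj; rewrite /i0 insubdK// rpred0.
exists (map_poly i0 f).
  apply/polyP => k; rewrite coef_iota coef_map_id0// /i0 /=.
  by rewrite -[LHS](@insubdK _ _ A 0)//; case: (hf k) => h _ _; exact/asboolP.
move=> k; rewrite coef_map_id0//; apply/mfP.
have hk : f`_k \in hol (R := R) by case: (hf k) => h _ _; exact/asboolP.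
by have := hf k; rewrite -{1}[f`_k](@insubdK _ _ A 0 _ hk).
Qed.

End Bridge.

(** * The operators and brackets of the Hecke algebra in closed form *)

Section HeckeMaps.
Variables (R : realType) (Gamma : set GLQ).
Hypothesis hG : congruence_subgroup Gamma.
Local Notation C := R[i].
Local Notation A := (holfun R).
Local Notation P := {poly A}.
Local Notation D := (@hD R).
Local Notation phi := (@hphi R).
Local Notation om := (@homega R).
Local Notation opb := (opBp (@hD R) (@hcst R)).
Local Notation poc := (pochp (@hcst R)).
Local Notation co := (Gcoset Gamma).
Implicit Types (a b c : GLQ -> P) (p q : P) (g h : GLQ).

Let GSL g : Gamma g -> SL2Z g. Proof. by case: hG => + _ _ _ _; apply. Qed.
Let G1 : Gamma 1%g. Proof. by case: hG. Qed.
Let GM g h : Gamma g -> Gamma h -> Gamma (g * h)%g. Proof. by case: hG => _ _ + _ _; apply. Qed.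
Let GV g : Gamma g -> Gamma (g^-1)%g. Proof. by case: hG => _ _ _ + _; apply. Qed.

Definition hmap a : hecke_map R := fun h => iota (a h).

Lemma iota_eq0 p : (iota p == 0) = (p == 0).
Proof. by rewrite -(inj_eq (@iota_inj R)) iota0. Qed.

Lemma hecke_hmap a : heckep Gamma a -> hecke_algebra Gamma (hmap a).
Proof.
move=> ha; split=> [h|g h Gg|g h Gg|].
- exact/modular_iota/(hk_mod ha).
- by rewrite /hmap (hk_left ha).
- by rewrite /hmap (hk_right ha)// slashp_iota.
apply: finsuppS (hk_supp ha) => h /=; by rewrite /hmap iota_eq0.
Qed.

Lemma hecke_lift F : hecke_algebra Gamma F -> exists2 a, heckep Gamma a & F = hmap a.
Proof.
move=> [hm hl hr hf].
have ex h : exists p, F h = iota p /\ modp p.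
  by have [p e m] := modular_lift (hm h); exists p.
have [a ha] := choice ex.
exists a; last by apply/funext => h; case: (ha h).
split=> [h|g h Gg|g h Gg|].
- by case: (ha h).
- by apply: iota_inj; rewrite -(ha h).1 -(ha _).1 hl.
- by apply: iota_inj; rewrite -slashp_iota -(ha h).1 -(ha _).1 hr.
apply: finsuppS hf => h /=; by rewrite (ha h).1 iota_eq0.
Qed.

Lemma mul_bilinear : bilinear_slash (fun p q : P => p * q).
Proof.
by split=> [p p' q|p q q'|p q g|p q]; [rewrite mulrDl|rewrite mulrDr|rewrite slAM|exact: modpM].
Qed.

Definition cmul := conv Gamma (fun p q : P => p * q).

Lemma hecke_mul_hmap a b : heckep Gamma a -> hecke_mul Gamma (hmap a) (hmap b) = hmap (cmul a b).
Proof.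
move=> ha; apply/funext => h; rewrite /hmap /cmul /conv.
rewrite (cosum_morph hG (f := @iota R) (iota0 R) (@iotaD R) (hk_supp ha)); last first.
  by move=> r /(conv_supp mul_bilinear)[].
by apply: eq_fsbigr => c _; rewrite iotaM -slashp_iota.
Qed.

Lemma hmapB a b : hmap a - hmap b = hmap (fun h => a h - b h).
Proof. by apply/funext => h; rewrite /hmap iotaD iotaN. Qed.

Lemma hmapD a b : hmap a + hmap b = hmap (fun h => a h + b h).
Proof. by apply/funext => h; rewrite /hmap iotaD. Qed.

Lemma hscale_hmap x a : hscale x (hmap a) = hmap (fun h => hcst x *: a h).
Proof. by apply/funext => h; rewrite /hmap iota_cst. Qed.

Lemma hX_hmap a : hX (hmap a) = hmap (fun h => Xp D phi (a h)).
Proof. by apply/funext => h; rewrite /hX Xf_iota. Qed.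

Lemma hY_hmap a : hY (hmap a) = hmap (fun h => Yp (a h)).
Proof. by apply/funext => h; rewrite /hY Yf_iota. Qed.

Lemma iota_monomial (f : A) k : iota (f *: 'X^k) = \val f *: 'X^k.
Proof.
apply/polyP => i; rewrite coef_iota !coefZ !coefXn; case: eqP => _; first by rewrite !mulr1.
by rewrite !mulr0.
Qed.

Lemma hSX_hmap a : hSX (hmap a) = hmap (fun h => - Xp D (con phi h) (a h)).
Proof.
rewrite /hSX hX_hmap hY_hmap; apply/funext => h.
transitivity (- iota (Xp D phi (a h)) + (mu h *: 'X) * iota (Yp (a h))); first by [].
rewrite mu_val -['X]expr1 -iota_monomial -iotaM -iotaN -iotaD; congr iota.
by rewrite /Xp /hmu expr1 -!mul_polyC !polyCB; ring.
Qed.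

Lemma poch_hmap k m a : poch k m (hmap a) = hmap (fun h => poc k m (a h)).
Proof. by elim: m => [|m IH] //=; rewrite IH hY_hmap !hscale_hmap hmapD. Qed.

Definition aOm h : P := if h \in Gamma then om *: 'X^2 else 0.

Lemma Omega_hmap : Omega R Gamma = hmap aOm.
Proof.
apply/funext => h; rewrite /Omega /hmap /aOm; case: ifP => _; last by rewrite iota0.
by rewrite iota_monomial.
Qed.

Lemma in_Gamma_mull g h : Gamma g -> ((g * h)%g \in Gamma) = (h \in Gamma).
Proof.
move=> Gg; apply/idP/idP; rewrite !inE => Gh; last exact: GM.
by rewrite -(mulKg g h); apply: GM => //; exact: GV.
Qed.

Lemma in_Gamma_mulr g h : Gamma g -> ((h * g)%g \in Gamma) = (h \in Gamma).
Proof.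
move=> Gg; apply/idP/idP; rewrite !inE => Gh; last exact: GM.
by rewrite -(mulgK g h); apply: GM => //; exact: GV.
Qed.

Lemma aOm_supp h : aOm h != 0 -> Gamma h.
Proof. by rewrite /aOm; case: ifP; rewrite ?inE ?eqxx. Qed.

Lemma finsupp_Gamma : finsupp Gamma Gamma.
Proof.
apply: (@sub_finite_set _ _ [set co 1%g]) => // _ [h Gh <-] /=.
by rewrite -(mulg1 h) coset_mul.
Qed.

Lemma heckep_aOm : heckep Gamma aOm.
Proof.
split=> [h|g h Gg|g h Gg|].
- rewrite /aOm; case: ifP => _; last exact: modp0.
  exact: modp_monomial (@mf_omega R).
- by rewrite /aOm in_Gamma_mull.
- rewrite /aOm in_Gamma_mulr//; case: ifP => _; last by rewrite slA0.
  by rewrite slA_monomial omega_SL2Z//; exact: GSL.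
exact: finsuppS aOm_supp finsupp_Gamma.
Qed.

Lemma cosum_single (V : nmodType) (F : GLQ -> V) : linv Gamma F ->
  (forall h, F h != 0 -> Gamma h) -> cosum Gamma F = F 1%g.
Proof.
move=> lF FG; have [g Gg e] := rep_coset hG 1%g.
rewrite /cosum -(fsbig_widen [set co 1%g] (range co)).
- by rewrite fsbig_set1 e lF.
- by move=> _ ->; exists 1%g.
move=> c [[h _ <-] nc]; apply/eqP; apply: contra_notT nc => /FG Gr.
by rewrite -(coset_rep hG h) -(mulg1 (rep _)) coset_mul.
Qed.

Lemma cmul_aOm b : heckep Gamma b -> cmul aOm b = fun h => (om *: 'X^2) * b h.
Proof.
move=> hb; apply/funext => h; rewrite /cmul /conv cosum_single.
- by rewrite invg1 mulg1 slA_one /aOm mem_set.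
- exact: (conv_linv hG (fun p q => p * q) h heckep_aOm hb).
by move=> r /(conv_supp mul_bilinear)[/aOm_supp].
Qed.

(** Only the coset of h contributes, where omega gets slashed by h; multiplication on the left
    involves the coset of 1 instead and leaves omega as it is. *)
Lemma cmul_aOmr b : heckep Gamma b -> cmul b aOm = fun h => b h * (sl 2 om h *: 'X^2).
Proof.
move=> hb; apply/funext => h; rewrite /cmul /conv.
have lin := conv_linv hG (fun p q => p * q) h hb heckep_aOm.
rewrite -(cosum_reindex hG h lin) cosum_single.
- by rewrite mul1g mulgV /aOm mem_set// slA_monomial.
- by move=> g r Gg; rewrite -mulgA; exact: lin.
move=> r /(conv_supp mul_bilinear)[_ /aOm_supp].
by rewrite invgM mulVKg => /GV; rewrite invgK.
Qed.

(** [Psi] may depend on h, provided that it transforms as operators built from [con phi h] and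
    [sl 2 om h] do; the A_n require this generality. *)
Lemma heckep_op (Psi : GLQ -> P -> P) a :
  (forall h, Psi h 0 = 0) ->
  (forall g h p, Gamma g -> slA (Psi h p) g = Psi (h * g)%g (slA p g)) ->
  (forall g h p, Gamma g -> Psi (g * h)%g p = Psi h p) ->
  (forall h p, modp p -> modp (Psi h p)) ->
  heckep Gamma a -> heckep Gamma (fun h => Psi h (a h)).
Proof.
move=> P0 Ps Pl Pm ha; split=> [h|g h Gg|g h Gg|].
- exact/Pm/(hk_mod ha).
- by rewrite Pl// (hk_left ha).
- by rewrite Ps// (hk_right ha).
by apply: finsuppS (hk_supp ha) => h /=; apply: contra_neq => ->.
Qed.

Lemma additive0 (f : P -> P) : (forall p q, f (p + q) = f p + f q) -> f 0 = 0.
Proof. by move=> fD; apply: (addrI (f 0)); rewrite -fD !addr0. Qed.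

Lemma heckep_Yshift x a : heckep Gamma a -> heckep Gamma (fun h => Yp (a h) - hcst x *: a h).
Proof.
apply: (heckep_op (Psi := fun _ p => Yp p - hcst x *: p)) => // [_|g _ p _|_ p hp].
- by rewrite (additive0 (@YpD _)) scaler0 subr0.
- by rewrite slAD slAN slAZ slA_Yp.
by apply: modpD; [exact: modp_Yp|apply: modpN; exact: modpZ].
Qed.

Lemma heckep_scale x a : heckep Gamma a -> heckep Gamma (fun h => hcst x *: a h).
Proof.
apply: (heckep_op (Psi := fun _ p => hcst x *: p)) => [_|g _ p _|g _ p _|_ p hp].
- exact: scaler0.
- by rewrite slAZ.
- by [].
exact: modpZ.
Qed.

Lemma heckep_poch k m a : heckep Gamma a -> heckep Gamma (fun h => poc k m (a h)).
Proof.
apply: (heckep_op (Psi := fun _ p => poc k m p)) => // [_|g _ p _|_ p hp].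
- exact: (additive0 (fun p q => pochpD _ k m p q)).
- exact: slA_pochp.
exact: modp_pochp.
Qed.

Lemma heckep_opB n a : heckep Gamma a -> heckep Gamma (fun h => opb phi om n (a h)).
Proof.
apply: (heckep_op (Psi := fun _ p => opb phi om n p)) => // [_|g _ p Gg|_ p hp].
- exact: (additive0 (fun p q => opBpD (@hD_derivation R) _ phi om n p q)).
- by rewrite slA_opBp con_SL2Z ?omega_SL2Z//; exact: GSL.
exact: modp_opBp.
Qed.

(** The component of A_n at h: up to sign, B_n for the pair (phi, omega) transported by h. *)
Definition opt n h p := (-1) ^+ n *: opb (con phi h) (sl 2 om h) n p.

Lemma heckep_opt n a : heckep Gamma a -> heckep Gamma (fun h => opt n h (a h)).
Proof.
apply: (heckep_op (Psi := opt n)) => [h|g h p _|g h p Gg|h p hp].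
- by rewrite /opt (additive0 (fun p q => opBpD (@hD_derivation R) _ _ _ n p q)) scaler0.
- by rewrite /opt slA_sign slA_opBp conM sl_mul.
- by rewrite /opt -(conM phi g h) -(sl_mul 2 om g h) (con_SL2Z R (GSL Gg)) (omega_SL2Z R (GSL Gg)).
(* The operator at h is the one for (phi, omega) conjugated by the slash with h, and modular forms
   of all levels are stable under both. *)
rewrite /opt -(slA_one p) -(mulVg h) -slA_mul -slA_opBp.
by apply: modp_sign; apply: modp_slA; apply: modp_opBp; exact: modp_slA.
Qed.

Lemma opB_hmap n a : heckep Gamma a ->
  opB Gamma n (hmap a) = hmap (fun h => opb phi om n (a h)).
Proof.
move=> ha; pose Q n := opB Gamma n (hmap a) = hmap (fun h => opb phi om n (a h)).
suff [] : Q n /\ Q n.+1 by [].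
elim: n => [|n [IH1 IH2]].
  split=> //; rewrite /Q [LHS]/= subr0 hX_hmap; congr hmap; apply/funext => h.
  by rewrite [RHS]/= subr0.
split=> //; rewrite /Q.
rewrite -[LHS]/(hX (opB Gamma n.+1 (hmap a)) - hscale n.+1%:R (hecke_mul Gamma (Omega R Gamma)
  (hY (opB Gamma n (hmap a)) - hscale (n%:R / 2) (opB Gamma n (hmap a))))).
rewrite IH1 IH2 hX_hmap hY_hmap hscale_hmap hmapB Omega_hmap hecke_mul_hmap; last exact: heckep_aOm.
rewrite cmul_aOm ?hscale_hmap ?hmapB//.
exact/heckep_Yshift/heckep_opB.
Qed.

Lemma Xp_sign f n p : Xp D f ((-1) ^+ n *: p) = (-1) ^+ n *: Xp D f p.
Proof.
rewrite -signr_odd; case: odd; rewrite ?expr0 ?scale1r// expr1 !scaleN1r.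
have XD := XpD (@hD_derivation R) f.
by apply: (addrI (Xp D f p)); rewrite -XD !subrr (additive0 XD).
Qed.

Lemma Yp_sign n p : Yp ((-1) ^+ n *: p) = (-1) ^+ n *: Yp p.
Proof. by rewrite /Yp derivZ scalerAr. Qed.

Lemma opA_hmap n a : heckep Gamma a ->
  opA Gamma n (hmap a) = hmap (fun h => opt n h (a h)).
Proof.
move=> ha; pose Q n := opA Gamma n (hmap a) = hmap (fun h => opt n h (a h)).
suff [] : Q n /\ Q n.+1 by [].
elim: n => [|n [IH1 IH2]].
  split; rewrite /Q /opt.
    by congr hmap; apply/funext => h; rewrite expr0 scale1r.
  rewrite [LHS]/= subr0 hSX_hmap; congr hmap; apply/funext => h.
  by rewrite expr1 scaleN1r [in RHS]/= subr0.
split=> //; rewrite /Q.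
rewrite -[LHS]/(hSX (opA Gamma n.+1 (hmap a)) - hscale n.+1%:R (hecke_mul Gamma
  (hY (opA Gamma n (hmap a)) - hscale (n%:R / 2) (opA Gamma n (hmap a))) (Omega R Gamma))).
rewrite IH1 IH2 hSX_hmap hY_hmap hscale_hmap hmapB Omega_hmap.
have hd := heckep_Yshift (n%:R / 2) (heckep_opt n ha).
rewrite hecke_mul_hmap// cmul_aOmr// hscale_hmap hmapB; congr hmap; apply/funext => h.
rewrite /opt Xp_sign Yp_sign -[opb _ _ n.+2 _]/(Xp D (con phi h) (opb (con phi h) (sl 2 om h) n.+1 (a h)) -
  hcst n.+1%:R *: ((sl 2 om h *: 'X^2) * (Yp (opb (con phi h) (sl 2 om h) n (a h)) - hcst (n%:R / 2) *: opb
      (con phi h) (sl 2 om h) n (a h)))).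
move: (Xp D (con phi h) _) => x; move: (Yp _) => y.
move: (opb (con phi h) (sl 2 om h) n (a h)) => u; move: (sl 2 om h) => o.
move: (hcst n.+1%:R) (hcst (n%:R / 2)) => c1 c2.
rewrite !exprS -!mul_polyC !polyCM !polyCN; ring.
Qed.

Lemma RC_hmap n a b : heckep Gamma a -> heckep Gamma b ->
  RC Gamma n (hmap a) (hmap b) = hmap (arc Gamma n a b).
Proof.
move=> ha hb; apply/funext => h.
pose e (k : 'I_n.+1) h := hcst (k`!%:R)^-1 *: opt k h (poc k (n - k) (a h)).
pose f (k : 'I_n.+1) h := hcst ((n - k)`!%:R)^-1 *: opb phi om (n - k) (poc (n - k) k (b h)).
have he k : heckep Gamma (e k) by apply: heckep_scale; apply: heckep_opt; exact: heckep_poch.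
have hf k : heckep Gamma (f k) by apply: heckep_scale; apply: heckep_opB; exact: heckep_poch.
rewrite /RC fct_sumE.
transitivity (\sum_(k < n.+1) iota (cmul (e k) (f k) h)).
  apply: eq_bigr => k _; rewrite !poch_hmap opA_hmap; last exact: heckep_poch.
  rewrite opB_hmap; last exact: heckep_poch.
  by rewrite !hscale_hmap hecke_mul_hmap//; exact: he.
rewrite -iota_sum; congr iota; rewrite /cmul /conv.
rewrite -(cosum_sum hG (P := [set h | a h != 0])); last 2 first.
- exact: hk_supp ha.
- move=> k r /(conv_supp mul_bilinear)[+ _]; apply: contra_neq => e0.
  rewrite /e e0 (additive0 (fun p q => pochpD _ k (n - k) p q)) /opt.
  by rewrite (additive0 (fun p q => opBpD (@hD_derivation R) _ _ _ k p q)) !scaler0.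
apply: cosum_ext => r.
(* Slashing by r gives the right half the transported pair that the left half already has, so the
   term is a genuine bracket, and its pair may be changed back to (phi, omega). *)
rewrite (rc_indep n _ _ (@hphi_adapted R) (adapted_con r (@hphi_adapted R))).
by apply: eq_bigr => k _; rewrite /f slAZ slA_opBp slA_pochp.
Qed.

End HeckeMaps.

(** * Associativity of the star product on power series *)

Section StarProduct.
Variables (R : realType) (Gamma : set GLQ).
Hypothesis hG : congruence_subgroup Gamma.
Local Notation P := {poly holfun R}.
Implicit Types (a b c : GLQ -> P) (h : GLQ).

Lemma heckep0 : heckep Gamma (fun _ => 0 : P).
Proof.
split=> [h|//|g h _|]; [exact: modp0|by rewrite slA0|].
by apply: (@sub_finite_set _ _ set0) => [x [h /=]|//]; rewrite eqxx.
Qed.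

Lemma heckepD a b : heckep Gamma a -> heckep Gamma b -> heckep Gamma (fun h => a h + b h).
Proof.
move=> ha hb; split=> [h|g h Gg|g h Gg|].
- by apply: modpD; [exact: hk_mod ha h|exact: hk_mod hb h].
- by rewrite (hk_left ha)// (hk_left hb).
- by rewrite (hk_right ha)// (hk_right hb)// slAD.
have : finsupp Gamma ([set h | a h != 0] `|` [set h | b h != 0]).
  by rewrite /finsupp image_setU finite_setU; split; [exact: hk_supp ha|exact: hk_supp hb].
apply: finsuppS => h /=; rewrite /setU/=; have [->|] := eqVneq (a h) 0; last by left.
by rewrite add0r; right.
Qed.

Lemma heckep_sum n (a : nat -> GLQ -> P) : (forall i, heckep Gamma (a i)) ->
  heckep Gamma (fun h => \sum_(i < n) a i h).
Proof.
move=> ha; elim: n => [|n IH].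
  by rewrite (_ : (fun _ => _) = fun _ => 0); [exact: heckep0|apply/funext => h; rewrite big_ord0].
rewrite (_ : (fun _ => _) = fun h => (\sum_(i < n) a i h) + a n h); first exact: heckepD.
by apply/funext => h; rewrite big_ord_recr.
Qed.

Lemma arc_suml m n (a : nat -> GLQ -> P) b h : (forall i, heckep Gamma (a i)) ->
  arc Gamma m (fun h => \sum_(i < n) a i h) b h = \sum_(i < n) arc Gamma m (a i) b h.
Proof.
move=> ha; rewrite /arc /conv; have hM := rc_bilinear R m.
have E (r : GLQ) : rc (@hphi R) (@homega R) m (\sum_(i < n) a i r) (slA (b (h * r^-1)%g) r) =
    \sum_(i < n) rc (@hphi R) (@homega R) m (a i r) (slA (b (h * r^-1)%g) r).
  by apply: (big_morph _ (fun p q => bs_Dl hM p q _)); exact: bs_0l hM.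
rewrite (cosum_ext _ E).
have fin : finsupp Gamma (\big[setU/set0]_(i < n) [set h | a i h != 0]).
  elim: n {E} => [|n IH]; first by rewrite big_ord0 /finsupp image_set0.
  by rewrite big_ord_recr /finsupp image_setU finite_setU; split=> //; exact: hk_supp (ha n).
rewrite (cosum_sum hG fin)// => i r /(conv_supp hM)[air _].
by rewrite (bigD1 i)//=; left.
Qed.

Lemma arc_sumr m n a (b : nat -> GLQ -> P) h : heckep Gamma a ->
  arc Gamma m a (fun h => \sum_(i < n) b i h) h = \sum_(i < n) arc Gamma m a (b i) h.
Proof.
move=> ha; rewrite /arc /conv; have hM := rc_bilinear R m.
rewrite -(cosum_sum hG (hk_supp ha)); last by move=> i r /(conv_supp hM)[].
apply: cosum_ext => r; rewrite slA_sum.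
by apply: (big_morph _ (bs_Dr hM _)); exact: bs_0r hM.
Qed.

Definition astar (a b : nat -> GLQ -> P) (N : nat) h : P :=
  cs N (fun n s => cs s (fun i j => arc Gamma n (a i) (b j) h)).

Lemma heckep_astar (a b : nat -> GLQ -> P) N :
  (forall i, heckep Gamma (a i)) -> (forall i, heckep Gamma (b i)) -> heckep Gamma (astar a b N).
Proof.
move=> ha hb.
apply: (@heckep_sum _ (fun n h => cs (N - n) (fun i j => arc Gamma n (a i) (b j) h))) => n.
apply: (@heckep_sum _ (fun i h => arc Gamma n (a i) (b (N - n - i)%N) h)) => i.
exact: heckep_arc.
Qed.

Lemma astar_assoc (a b c : nat -> GLQ -> P) N h :
  (forall i, heckep Gamma (a i)) -> (forall i, heckep Gamma (b i)) ->
  (forall i, heckep Gamma (c i)) ->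
  astar (astar a b) c N h = astar a (astar b c) N h.
Proof.
move=> ha hb hc.
have arcl m s k : arc Gamma m (astar a b s) (c k) h =
    cs s (fun n x => cs x (fun i j => arc Gamma m (arc Gamma n (a i) (b j)) (c k) h)).
  rewrite (arc_suml m s.+1 (a := fun n h => cs (s - n) (fun i j => arc Gamma n (a i) (b j) h))); last first.
    move=> n; apply: (@heckep_sum _ (fun i h => arc Gamma n (a i) (b (s - n - i)%N) h)) => i.
    exact: heckep_arc.
  apply: eq_bigr => n _.
  rewrite (arc_suml m _ (a := fun i h => arc Gamma n (a i) (b (s - n - i)%N) h))// => i.
  exact: heckep_arc.
have arcr m i s : arc Gamma m (a i) (astar b c s) h =
    cs s (fun n y => cs y (fun j k => arc Gamma m (a i) (arc Gamma n (b j) (c k)) h)).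
  rewrite (arc_sumr m s.+1 (fun n h => cs (s - n) (fun j k => arc Gamma n (b j) (c k) h)))//.
  apply: eq_bigr => n _.
  by rewrite (arc_sumr m _ (fun j h => arc Gamma n (b j) (c (s - n - j)%N) h)).
transitivity (cs N (fun m r => cs r (fun s k => cs s (fun n x => cs x (fun i j =>
    arc Gamma m (arc Gamma n (a i) (b j)) (c k) h))))).
  by apply: cs_ext => m r; apply: cs_ext => s k; exact: arcl.
rewrite (cs_five N (fun m n i j k => arc Gamma m (arc Gamma n (a i) (b j)) (c k) h)).
transitivity (cs N (fun m r => cs r (fun i s => cs s (fun n y => cs y (fun j k =>
    arc Gamma m (a i) (arc Gamma n (b j) (c k)) h))))); last first.
  by apply: cs_ext => m r; apply: cs_ext => i s; rewrite arcr.
rewrite (cs_five' N (fun m n i j k => arc Gamma m (a i) (arc Gamma n (b j) (c k)) h)).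
apply: cs_ext => M s; apply: cs_ext => i y; apply: cs_ext => j k.
(* The sums are indexed by the order of the outer bracket, [arc_assoc] by that of the inner one. *)
by rewrite csC [RHS]csC; exact: arc_assoc.
Qed.

Lemma star_hmap (a b : nat -> GLQ -> P) :
  (forall i, heckep Gamma (a i)) -> (forall i, heckep Gamma (b i)) ->
  star Gamma (fun i => hmap (a i)) (fun i => hmap (b i)) = fun N => hmap (astar a b N).
Proof.
move=> ha hb; apply/funext => N; apply/funext => h.
rewrite /star /hmap /astar /cs iota_sum fct_sumE; apply: eq_bigr => n _.
rewrite iota_sum fct_sumE; apply: eq_bigr => i _.
by rewrite RC_hmap.
Qed.

Lemma hecke_lift_seq (F : nat -> hecke_map R) : (forall i, hecke_algebra Gamma (F i)) ->
  exists2 a : nat -> GLQ -> P, forall i, heckep Gamma (a i) & F = fun i => hmap (a i).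
Proof.
move=> hF.
have ex i : exists a, heckep Gamma a /\ F i = hmap a.
  by have [a ha e] := hecke_lift (hF i); exists a.
have [a ha] := choice ex.
by exists a => [i|]; [case: (ha i)|apply/funext => i; case: (ha i)].
Qed.

End StarProduct.

Theorem corollary9 (R : realType) (Gamma : set GLQ)
    (Gamma_congruence : congruence_subgroup Gamma) :
  [/\ (* the brackets are defined on A(Gamma) *)
      forall (n : nat) (a b : hecke_map R),
        hecke_algebra Gamma a -> hecke_algebra Gamma b ->
        hecke_algebra Gamma (RC Gamma n a b),
      (* *_t deforms the product of A(Gamma) *)
      forall a b : hecke_map R,
        hecke_algebra Gamma a -> hecke_algebra Gamma b ->
        RC Gamma 0 a b = hecke_mul Gamma a b
    & (* *_t is associative on A(Gamma)[[t]] *)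
      forall a b c : nat -> hecke_map R,
        (forall i, hecke_algebra Gamma (a i)) ->
        (forall i, hecke_algebra Gamma (b i)) ->
        (forall i, hecke_algebra Gamma (c i)) ->
        star Gamma (star Gamma a b) c = star Gamma a (star Gamma b c)].
Proof.
have hG := Gamma_congruence; split=> [n a b|a b _ _|a b c].
- move=> /hecke_lift[{}a ha ->] /hecke_lift[{}b hb ->].
  by rewrite RC_hmap//; apply: hecke_hmap; exact: heckep_arc.
- have h1 (F : hecke_map R) : hscale (0`!%:R)^-1 F = F.
    by apply/funext => h; rewrite /hscale fact0 invr1 scale1r.
  by rewrite /RC big_ord1 /= !h1.
move=> /hecke_lift_seq[{}a ha ->] /hecke_lift_seq[{}b hb ->] /hecke_lift_seq[{}c hc ->].
have hab i := heckep_astar hG i ha hb; have hbc i := heckep_astar hG i hb hc.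
rewrite !star_hmap//; apply/funext => N; apply/funext => h.
by rewrite /hmap astar_assoc.
Qed.
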